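(* Let $N\ge2$, $\Omega\subset\mathbb{R}^N$ bounded open, $T>0$, $Q=(0,T)\times\Omega$, $p>\frac{2N+1}{N+1}$, let $a$ satisfy the structure assumptions in the context, and let $u_0\in L^1(\Omega)$. Let $\mu\in M(Q)$, and suppose that there exists $g\in L^p(0,T;W^{1,p}_0(\Omega))\cap L^\infty(Q)$ such that $\mu$ can be decomposed as $$\mu=\mu_0+\mu_s=f-\mathrm{div}(G)+g_t+\mu_s^+-\mu_s^-$$ for some $f\in L^1(Q)$ and $G\in(L^{p'}(Q))^N$ (so that $\mu_0=f-\mathrm{div}(G)+g_t$). Let $u$ be the renormalized solution (in the sense defined in the context) of $$u_t-\mathrm{div}(a(t,x,\nabla u))=\mu \text{ in }(0,T)\times\Omega,\qquad u=0\text{ on }(0,T)\times\partial\Omega,\qquad u(0)=u_0\text{ in }\Omega.$$ Then, if $u\ge0$, we have $\mu_s\ge0$.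
   Context: Assumptions on $a$: $p'=p/(p-1)$; $a:Q\times\mathbb{R}^N\to\mathbb{R}^N$ is Carathéodory and for a.e. $(t,x)\in Q$ and all $\xi\neq\eta$ in $\mathbb{R}^N$: $a(t,x,\xi)\cdot\xi\ge\alpha|\xi|^p$, $|a(t,x,\xi)|\le\beta[b(t,x)+|\xi|^{p-1}]$, $(a(t,x,\xi)-a(t,x,\eta))\cdot(\xi-\eta)>0$, with constants $\alpha,\beta>0$ and $0\le b\in L^{p'}(Q)$. Parabolic capacity. Let $V=W^{1,p}_0(\Omega)\cap L^2(\Omega)$ with norm $\|\cdot\|_{W^{1,p}_0(\Omega)}+\|\cdot\|_{L^2(\Omega)}$, and $W=\{u\in L^p(0,T;V):u_t\in L^{p'}(0,T;V')\}$ with norm $\|u\|_W=\|u\|_{L^p(0,T;V)}+\|u_t\|_{L^{p'}(0,T;V')}$. For $U\subseteq Q$ open, $\mathrm{cap}_p(U)=\inf\{\|u\|_W:u\in W,\ u\ge\chi_U\text{ a.e. in }Q\}$ ($\inf\emptyset=+\infty$); for a Borel set $B\subseteq Q$, $\mathrm{cap}_p(B)=\inf\{\mathrm{cap}_p(U):U\text{ open in }Q,\ B\subseteq U\}$. Decomposition of measures. $M(Q)$ is the set of Radon measures with bounded variation on $Q$; $M_0(Q)$ is the subset of those vanishing on all sets of zero $p$-capacity. Every $\mu\in M(Q)$ splits uniquely as $\mu=\mu_0+\mu_s$ with $\mu_0\in M_0(Q)$ and $\mu_s=\mu_s^+-\mu_s^-$ concentrated on a set of zero $p$-capacity, where $\mu_s^+$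 and $\mu_s^-$ are the positive and negative parts of $\mu_s$. A decomposition of $\mu_0$ is a triple $(f,G,g)$ with $f\in L^1(Q)$, $G\in(L^{p'}(Q))^N$, $g\in L^p(0,T;V)$, such that $\int_Q\varphi\,d\mu_0=\int_Q f\varphi\,dxdt+\int_Q G\cdot\nabla\varphi\,dxdt-\int_0^T\langle\varphi_t,g\rangle\,dt$ for all $\varphi\in C_c^\infty([0,T]\times\Omega)$; every $\mu_0\in M_0(Q)$ admits such a decomposition, which is not unique. Given a decomposition, put $\hat\mu_0=f-\mathrm{div}(G)$ and, for $w\in L^p(0,T;W^{1,p}_0(\Omega))\cap L^\infty(Q)$, $\int_Q w\,d\hat\mu_0:=\int_Q fw\,dxdt+\int_Q G\cdot\nabla w\,dxdt$. Renormalized solution. Let $T_k(s)=\max(-k,\min(k,s))$. A measurable function $u$ is a renormalized solution of the problem if there exists a decomposition $(f,G,g)$ of $\mu_0$ such that, with $v=u-g$: $v\in L^q(0,T;W^{1,q}_0(\Omega))\cap L^\infty(0,T;L^1(\Omega))$ for every $q<p-\frac{N}{N+1}$; $T_k(v)\in L^p(0,T;W^{1,p}_0(\Omega))$ for every $k>0$; for every $S\in W^{2,\infty}(\mathbb{R})$ such that $S'$ has compact support and $S(0)=0$, $$-\int_\Omega S(u_0)\varphi(0)\,dx-\int_0^T\langle\varphi_t,S(v)\rangle\,dt+\int_Q S'(v)a(t,x,\nabla u)\cdot\nabla\varphi\,dxdt+\int_Q S''(v)a(t,x,\nabla u)\cdot\nabla v\,\varphi\,dxdt=\int_Q S'(v)\varphi\,d\hat\mu_0$$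 for every $\varphi\in L^p(0,T;W^{1,p}_0(\Omega))\cap L^\infty(Q)$ with $\varphi_t\in L^{p'}(0,T;W^{-1,p'}(\Omega))$ and $\varphi(T,x)=0$; and for every $\psi\in C(\overline Q)$, $$\lim_{n\to\infty}\frac1n\int_{\{n\le v<2n\}}a(t,x,\nabla u)\cdot\nabla v\,\psi\,dxdt=\int_Q\psi\,d\mu_s^+,\qquad \lim_{n\to\infty}\frac1n\int_{\{-2n<v\le -n\}}a(t,x,\nabla u)\cdot\nabla v\,\psi\,dxdt=\int_Q\psi\,d\mu_s^-.$$ *)

(* Defs.v *)
From HB Require Import structures.
From mathcomp Require Import all_boot all_order all_algebra.
From mathcomp Require Import all_classical all_reals all_analysis.

Set Implicit Arguments.
Unset Strict Implicit.
Unset Printing Implicit Defensive.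
Import Order.TTheory GRing.Theory Num.Theory.
Import numFieldNormedType.Exports.

Local Open Scope classical_set_scope.
Local Open Scope ring_scope.

Fact rV_display : measure_display.
Proof. exact: default_measure_display. Qed.

Section measurable_rV.
Context {R : realType} (n : nat).

Let coord (i : 'I_n) (x : 'rV[R]_n) : R := x ord0 i.

Let rV_set0 : g_sigma_preimage coord set0.
Proof. exact: sigma_algebra0. Qed.

Let rV_setC A : g_sigma_preimage coord A -> g_sigma_preimage coord (~` A).
Proof. exact: sigma_algebraC. Qed.

Let rV_bigcup (F : _^nat) : (forall i, g_sigma_preimage coord (F i)) ->
  g_sigma_preimage coord (\bigcup_i (F i)).
Proof. exact: sigma_algebra_bigcup. Qed.

(* The sigma-algebra generated by the coordinates, i.e. the Borel one. *)
HB.instance Definition _ := @isMeasurable.Build rV_display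
  'rV[R]_n (g_sigma_preimage coord) rV_set0 rV_setC rV_bigcup.

Lemma measurable_coord (i : 'I_n) :
  measurable_fun [set: 'rV[R]_n] (fun x : 'rV[R]_n => x ord0 i).
Proof.
move=> _ B mB; rewrite setTI; apply: sub_sigma_algebra.
rewrite -bigcup_seq/=; exists i => /=; first by rewrite mem_index_enum.
by exists B => //; rewrite setTI.
Qed.

Lemma measurable_fun_rV d (T : measurableType d) (f : T -> 'rV[R]_n) :
  (forall i, measurable_fun [set: T] (fun t => f t ord0 i)) ->
  measurable_fun [set: T] f.
Proof.
move=> mf.
have H : <<s \big[setU/set0]_(i < n) preimage_set_system setT (coord i)
    measurable >> `<=` [set B | measurable (f @^-1` B)].
  apply: smallest_sub.
    split=> [|A mA|F mF].
    - by rewrite /= preimage_set0.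
    - by rewrite /= setTD preimage_setC; apply: measurableC; exact: mA.
    - by rewrite /= preimage_bigcup; apply: bigcup_measurable => i _; exact: mF.
  rewrite -bigcup_seq; apply: bigcup_sub => i _ A [B mB <-].
  by have := mf i measurableT _ mB; rewrite !setTI.
by move=> _ B mB; rewrite setTI; exact: H.
Qed.

End measurable_rV.

Section lebesgue_rV.
Context {R : realType}.

(* [lebesgue_measure], seen as a measure on [R] itself rather than on its
   alias [measurableTypeR R]. *)
Definition lebesgueR : set R -> \bar R := @lebesgue_measure R.

HB.instance Definition _ := isMeasure.Build _ R R lebesgueR
  (measure0 lebesgue_measure) (@measure_ge0 _ _ _ lebesgue_measure)
  (@measure_semi_sigma_additive _ _ _ lebesgue_measure).
HB.instance Definition _ := Measure_isSigmaFinite.Build _ R R lebesgueR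
  (@sigma_finiteT _ _ _ lebesgue_measure).

Definition cons_rV n (z : R * 'rV[R]_n) : 'rV[R]_n.+1 :=
  \row_i if unlift ord0 i is Some j then z.2 ord0 j else z.1.

Definition uncons_rV n (x : 'rV[R]_n.+1) : R * 'rV[R]_n :=
  (x ord0 ord0, \row_i x ord0 (lift ord0 i)).

Lemma cons_rVK n : cancel (@cons_rV n) (@uncons_rV n).
Proof.
case=> t x; rewrite /uncons_rV /cons_rV !mxE unlift_none/=; congr pair.
by apply/rowP => i; rewrite !mxE liftK.
Qed.

Lemma uncons_rVK n : cancel (@uncons_rV n) (@cons_rV n).
Proof.
by move=> x; apply/rowP => i; rewrite mxE; case: unliftP => [j|] -> /=;
  rewrite ?mxE.
Qed.

Lemma measurable_cons_rV n : measurable_fun setT (@cons_rV n).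
Proof.
apply: measurable_fun_rV => i.
under eq_fun do rewrite mxE.
case: unliftP => [j|] _; last exact: measurable_fst.
exact: measurableT_comp (measurable_coord j) measurable_snd.
Qed.

Lemma measurable_uncons_rV n : measurable_fun setT (@uncons_rV n).
Proof.
apply/measurable_fun_pairP; split; first exact: measurable_coord.
apply: measurable_fun_rV => i; rewrite /uncons_rV/comp/=.
under eq_fun do rewrite mxE.
exact: measurable_coord.
Qed.

(* [\x] has no usable sigma-finiteness instance in the library when the two
   factors are only sigma-finite. *)
Section lebesgue_prod.
Context n (m : {sigma_finite_measure set 'rV[R]_n -> \bar R}).

Definition lebesgue_prod : set (R * 'rV[R]_n) -> \bar R := (lebesgueR \x m)%E.

HB.instance Definition _ := Measure.copy lebesgue_prod (lebesgueR \x m)%E.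

Let prod_sigma_finite : sigma_finite setT lebesgue_prod.
Proof.
have /sigma_finiteP[F [TF ndF Foo]] := sigma_finiteT lebesgueR.
have /sigma_finiteP[G [TG ndG Goo]] := sigma_finiteT m.
exists (fun k => F k `*` G k).
  rewrite -setXTT TF TG predeqE => -[x y]; split.
    move=> [/= [i _ Fix] [k _ Gky]]; exists (maxn i k) => //; split.
    - by move: x Fix; exact/subsetPset/ndF/leq_maxl.
    - by move: y Gky; exact/subsetPset/ndG/leq_maxr.
  by move=> [i _ []/= ? ?]; split; exists i.
move=> k; have [? ?] := Foo k; have [? ?] := Goo k.
split; first exact: measurableX.
by rewrite /lebesgue_prod product_measure1E// lte_mul_pinfty// ge0_fin_numE.
Qed.

HB.instance Definition _ := Measure_isSigmaFinite.Build _ _ _ lebesgue_prod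
  prod_sigma_finite.

End lebesgue_prod.

Section lebesgue_cons.
Context n (m : {sigma_finite_measure set 'rV[R]_n -> \bar R}).

Definition lebesgue_cons : set 'rV[R]_n.+1 -> \bar R :=
  pushforward (lebesgue_prod m) (@cons_rV n).

Let cons0 : lebesgue_cons set0 = 0%E.
Proof. by rewrite /lebesgue_cons /pushforward preimage_set0 measure0. Qed.

Let cons_ge0 A : (0 <= lebesgue_cons A)%E.
Proof. by rewrite /lebesgue_cons /pushforward measure_ge0. Qed.

Let cons_sigma_additive : semi_sigma_additive lebesgue_cons.
Proof.
have mp A : measurable A -> measurable (@cons_rV n @^-1` A).
  by move=> mA; rewrite -[X in measurable X]setTI; exact: measurable_cons_rV.
move=> F mF tF mUF; rewrite /lebesgue_cons /pushforward preimage_bigcup.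
apply: measure_semi_sigma_additive => [i| |].
- exact: mp.
- apply/trivIsetP => i j _ _ ij; rewrite -preimage_setI.
  by move/trivIsetP : tF => /(_ _ _ _ _ ij) ->//; rewrite preimage_set0.
- by rewrite -preimage_bigcup; exact: mp.
Qed.

HB.instance Definition _ := isMeasure.Build _ _ _ lebesgue_cons
  cons0 cons_ge0 cons_sigma_additive.

Let cons_sigma_finite : sigma_finite setT lebesgue_cons.
Proof.
have [F FT mF] := sigma_finiteT (lebesgue_prod m).
exists (fun i => @uncons_rV n @^-1` F i).
  by rewrite -preimage_bigcup -FT preimage_setT.
move=> i; have [mFi Foo] := mF i; split.
  by rewrite -[X in measurable X]setTI; exact: measurable_uncons_rV.
by rewrite /lebesgue_cons /pushforward -comp_preimage
  (_ : _ \o _ = id) //; apply/funext => z; exact: cons_rVK.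
Qed.

HB.instance Definition _ := Measure_isSigmaFinite.Build _ _ _ lebesgue_cons
  cons_sigma_finite.

End lebesgue_cons.

Fixpoint lebesgue_rV n : {sigma_finite_measure set 'rV[R]_n -> \bar R} :=
  if n is m.+1 then lebesgue_cons (lebesgue_rV m) else \d_(0 : 'rV[R]_0).

End lebesgue_rV.

Section signed_measures.
Context d (E : measurableType d) (R : realType).
Implicit Types nu : {charge set E -> \bar R}.

Definition hahn_pos nu : set E := sval (cid (Hahn_decomposition nu)).
Definition hahn_neg nu : set E :=
  sval (cid (svalP (cid (Hahn_decomposition nu)))).
Definition hahn_pos_neg nu : hahn_decomposition nu (hahn_pos nu) (hahn_neg nu) :=
  svalP (cid (svalP (cid (Hahn_decomposition nu)))).

(* The positive and negative parts nu^+ and nu^- of nu do not depend on the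
   Hahn decomposition that is chosen. *)
Definition pos_part nu : {measure set E -> \bar R} :=
  jordan_pos (hahn_pos_neg nu).
Definition neg_part nu : {measure set E -> \bar R} :=
  jordan_neg (hahn_pos_neg nu).

Definition charge_int nu (D : set E) (f : E -> R) : R :=
  \int[pos_part nu]_(z in D) f z - \int[neg_part nu]_(z in D) f z.

Definition concentrated nu (D : set E) :=
  forall A, measurable A -> A `&` D = set0 -> nu A = 0%E.

End signed_measures.

Section lebesgue_spaces.
Context d (E : measurableType d) (R : realType).
Variables (mu : {measure set E -> \bar R}) (D : set E) (q : \bar R).

Definition Lq_norm (f : E -> R) : \bar R := 'N[mu]_q[(EFin \o f) \_ D]%E.

Definition Lq : set (E -> R) :=
  [set f | measurable_fun D f /\ (Lq_norm f < +oo)%E].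

End lebesgue_spaces.

Section test_functions.
Context (R : realType) (E : normedModType R).

Fixpoint Ck k (f : E -> R) : Prop :=
  continuous f /\
  if k is k'.+1 then
    (forall x v, derivable f x v) /\ (forall v, Ck k' ('D_v f))
  else True.

Definition test_function (D : set E) (f : E -> R) :=
  [/\ forall k, Ck k f, compact (closure [set x | f x != 0])
    & closure [set x | f x != 0] `<=` D].

End test_functions.

(* A space X of (representatives of) elements of a vector space E, with its
   norm. In what follows E consists of functions, and two functions that are
   equal a.e. represent the same element of X. *)
Record nspace (R : realType) (E : lmodType R) := NSpace {
  carrier :> E -> Prop;
  nnorm : E -> \bar R }.

Section normed_spaces.
Context (R : realType) (E : lmodType R).
Implicit Types X Y : nspace E.

Definition interspace X Y : nspace E :=
  NSpace (fun x => X x /\ Y x) (fun x => nnorm X x + nnorm Y x)%E.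

Definition dual_space X : nspace (E -> R) :=
  NSpace
    [set h | (forall a x y, X x -> X y -> h (a *: x + y) = a * h x + h y) /\
      exists C : R, forall x, X x -> (`|h x|%:E <= C%:E * nnorm X x)%E]
    (fun h => ereal_sup [set `|h x|%:E | x in [set x | X x /\ (nnorm X x <= 1)%E]]).

Definition simple_curve X (s : R -> E) :=
  exists n (A : 'I_n -> set R) (x : 'I_n -> E),
    [/\ forall i, measurable (A i), forall i, X (x i)
      & s = fun t => \sum_(i < n) (\1_(A i) t : R) *: x i].

Definition bochner_norm X (T : R) (q : \bar R) (u : R -> E) : \bar R :=
  'N[@lebesgueR R]_q[(fun t => nnorm X (u t)) \_ ([set` `]0, T[%R] : set R)]%E.

(* L^q(0, T; X): the curves that are a.e. limits, in X, of simple ones and have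
   a finite norm. *)
Definition bochner X (T : R) (q : \bar R) : set (R -> E) :=
  [set u | (exists s : nat -> R -> E,
      (forall k, simple_curve X (s k)) /\
      {ae @lebesgueR R, forall t, 0 < t < T ->
        X (u t) /\ (fun k => nnorm X (u t - s k t)) @ \oo --> 0%E}) /\
    (bochner_norm X T q u < +oo)%E].

End normed_spaces.

Section euclidean.
Context (R : realType) (N : nat).
Implicit Types x y : 'rV[R]_N.

Definition dotp x y : R := \sum_(i < N) x ord0 i * y ord0 i.
(* the Euclidean norm; the norm of the library on 'rV is the max norm *)
Definition enorm x : R := Num.sqrt (dotp x x).

End euclidean.

Section sobolev.
Context (R : realType) (N : nat).
Variable Om : set 'rV[R]_N.
Local Notation dx := (@lebesgue_rV R N).
Local Notation e_ i := (delta_mx ord0 i : 'rV[R]_N).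
Implicit Types w : 'rV[R]_N -> R.

Definition loc_integrable w :=
  measurable_fun Om w /\
  forall K, compact K -> K `<=` Om -> (\int[dx]_(x in K) `|w x|%:E < +oo)%E.

Definition is_grad w (F : 'rV[R]_N -> 'rV[R]_N) :=
  [/\ loc_integrable w, forall i, loc_integrable (fun x => F x ord0 i)
    & forall phi, test_function Om phi -> forall i,
      \int[dx]_(x in Om) (w x * 'D_(e_ i) phi x) =
      - (\int[dx]_(x in Om) (F x ord0 i * phi x))].

(* the weak gradient of w in Om, when there is one *)
Definition grad w : 'rV[R]_N -> 'rV[R]_N := xget (fun=> 0) [set F | is_grad w F].

Definition Lq_space (q : \bar R) : nspace ('rV[R]_N -> R) :=
  NSpace (Lq dx Om q) (Lq_norm dx Om q).

Definition W1_norm (q : R) w : \bar R :=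
  (Lq_norm dx Om q%:E w + Lq_norm dx Om q%:E (fun x => enorm (grad w x)))%E.

Definition W1 (q : R) : set ('rV[R]_N -> R) :=
  [set w | [/\ Lq dx Om q%:E w, exists F, is_grad w F
             & forall i, Lq dx Om q%:E (fun x => grad w x ord0 i)]].

(* The carrier is the closure of the test functions in W^{1,q}(Om). *)
Definition W10 (q : R) : nspace ('rV[R]_N -> R) :=
  NSpace
    [set w | W1 q w /\ exists phi : nat -> 'rV[R]_N -> R,
      (forall k, test_function Om (phi k)) /\
      (fun k => W1_norm q (w - phi k)) @ \oo --> 0%E]
    (W1_norm q).

Definition Vspace (p : R) : nspace ('rV[R]_N -> R) :=
  interspace (W10 p) (Lq_space 2%:E).

End sobolev.

Section parabolic.
Context (R : realType) (N : nat).
Variables (Om : set 'rV[R]_N) (T p : R).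
Local Notation space := 'rV[R]_N.
Local Notation dx := (@lebesgue_rV R N).
Local Notation dt := (@lebesgueR R).
Local Notation dtx := (@lebesgue_prod R N dx).
Local Notation pt := (1, 0 : space).
Local Notation px i := (0 : R, delta_mx ord0 i : space).
Implicit Types (u v w phi psi : R * space -> R) (h : R -> (space -> R) -> R).

Definition cylinder : set (R * space) := `]0, T[ `*` Om.
Local Notation Q := cylinder.

Definition conjugate : R := p / (p - 1).
Local Notation p' := conjugate.

(* u as a curve t |-> u(t, .) *)
Definition curve u : R -> space -> R := fun t x => u (t, x).

Definition loc_integrableQ u :=
  measurable_fun Q u /\
  forall K, compact K -> K `<=` Q -> (\int[dtx]_(z in K) `|u z|%:E < +oo)%E.

Definition is_xgrad u (F : R * space -> space) :=
  [/\ loc_integrableQ u, forall i, loc_integrableQ (fun z => F z ord0 i)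
    & forall phi, test_function Q phi -> forall i,
      \int[dtx]_(z in Q) (u z * 'D_(px i) phi z) =
      - (\int[dtx]_(z in Q) (F z ord0 i * phi z))].

(* the weak gradient of u in Q with respect to x, when there is one *)
Definition xgrad u : R * space -> space := xget (fun=> 0) [set F | is_xgrad u F].

(* u_t = h in the sense of distributions on Q *)
Definition time_derivative u h :=
  forall phi, test_function Q phi ->
    \int[dtx]_(z in Q) (u z * 'D_pt phi z) =
    - (\int[dt]_(t in `]0, T[) h t (curve phi t)).

Definition in_LpX (X : nspace (space -> R)) (q : \bar R) u :=
  measurable_fun Q u /\ bochner X T q (curve u).

(* u belongs to W and u_t = h *)
Definition in_W u h :=
  [/\ in_LpX (Vspace Om p) p%:E u, bochner (dual_space (Vspace Om p)) T p'%:E h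
    & time_derivative u h].

Definition W_norm u h : \bar R :=
  (bochner_norm (Vspace Om p) T p%:E (curve u) +
   bochner_norm (dual_space (Vspace Om p)) T p'%:E h)%E.

Definition cap_open (U : set (R * space)) : \bar R :=
  ereal_inf [set c | exists u h, [/\ in_W u h,
    {ae dtx, forall z, Q z -> (\1_U z : R) <= u z} & c = W_norm u h]].

Definition cap (B : set (R * space)) : \bar R :=
  ereal_inf [set cap_open U | U in [set U | [/\ open U, B `<=` U & U `<=` Q]]].

Implicit Types nu mu : {charge set (R * space)%type -> \bar R}.

(* An element of M(Q) is a finite signed Borel measure on R x R^N that is
   concentrated on Q; on an open set, these are the Radon measures of bounded
   variation. *)
Definition in_MQ mu := concentrated mu Q.

Definition in_M0Q mu := in_MQ mu /\
  forall B, measurable B -> B `<=` Q -> cap B = 0%E -> mu B = 0%E.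

Definition cap_singular mu :=
  exists E, [/\ measurable E, E `<=` Q, cap E = 0%E & concentrated mu E].

Definition cap_decomposition mu mu0 mus :=
  [/\ in_MQ mu, in_M0Q mu0, cap_singular mus
    & forall A, measurable A -> mu A = (mu0 A + mus A)%E].

(* f - div G + g_t = mu0. The functions in C_c^oo([0, T] x Om) are the
   restrictions of those in C_c^oo(R x Om). *)
Definition represents mu0 (f : R * space -> R) (G : R * space -> space)
    (g : R * space -> R) :=
  forall phi, test_function (setT `*` Om) phi ->
    charge_int mu0 Q phi =
    \int[dtx]_(z in Q) (f z * phi z)
    + \int[dtx]_(z in Q) dotp (G z) (\row_i 'D_(px i) phi z)
    - \int[dtx]_(z in Q) ('D_pt phi z * g z).

Definition in_Lq_vec (q : \bar R) (G : R * space -> space) :=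
  forall i, Lq dtx Q q (fun z => G z ord0 i).

Definition decomposition mu0 f G g :=
  [/\ Lq dtx Q 1%:E f, in_Lq_vec p'%:E G, in_LpX (Vspace Om p) p%:E g
    & represents mu0 f G g].

(* the integral of w against f - div G *)
Definition hat_int (f : R * space -> R) (G : R * space -> space) w : R :=
  \int[dtx]_(z in Q) (f z * w z) + \int[dtx]_(z in Q) dotp (G z) (xgrad w z).

Definition structure_assumptions (a : R * space -> space -> space)
    (alpha beta : R) (b : R * space -> R) :=
  [/\ forall xi, measurable_fun Q (a ^~ xi),
      {ae dtx, forall z, Q z -> continuous (a z)},
      0 < alpha /\ 0 < beta, Lq dtx Q p'%:E b
    & {ae dtx, forall z, Q z -> 0 <= b z /\
        forall xi eta, xi != eta ->
        [/\ alpha * enorm xi `^ p <= dotp (a z xi) xi,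
            enorm (a z xi) <= beta * (b z + enorm xi `^ (p - 1))
          & 0 < dotp (a z xi - a z eta) (xi - eta)]}].

Definition trunc (k s : R) : R := Num.max (- k) (Num.min k s).

(* S, with its first derivative S1 and its second derivative S2, is in
   W^{2,oo}(R); S and S1 are the continuous representatives. *)
Definition in_W2oo (S S1 S2 : R -> R) :=
  [/\ continuous S, continuous S1,
      [/\ Lq dt setT +oo%E S, Lq dt setT +oo%E S1 & Lq dt setT +oo%E S2],
      forall eta : R -> R, test_function setT eta ->
        \int[dt]_x (S x * 'D_1 eta x) = - (\int[dt]_x (S1 x * eta x))
    & forall eta : R -> R, test_function setT eta ->
        \int[dt]_x (S1 x * 'D_1 eta x) = - (\int[dt]_x (S2 x * eta x))].

(* phi is in L^p(0,T;W^{1,p}_0(Om)) and in L^oo(Q), its derivative phi_t = h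
   is in L^p'(0,T;W^{-1,p'}(Om)), and phi(T) = 0. Such a function has a
   representative in C([0,T];L^2(Om)), which gives a meaning to phi(0) and
   phi(T); phi stands for that representative. *)
Definition renormalized_test phi h :=
  [/\ in_LpX (W10 Om p) p%:E phi, Lq dtx Q +oo%E phi,
      bochner (dual_space (W10 Om p)) T p'%:E h, time_derivative phi h
    & (forall t, 0 <= t <= T -> Lq_space Om 2%:E (curve phi t) /\
         (fun s => nnorm (Lq_space Om 2%:E) (curve phi s - curve phi t))
           @ within `[0, T] (nbhs t) --> 0%E) /\
      {ae dx, forall x, Om x -> phi (T, x) = 0}].

Definition renormalized_equation (a : R * space -> space -> space)
    (u0 : space -> R) f G u v :=
  forall S S1 S2 : R -> R, in_W2oo S S1 S2 ->
    compact (closure [set s | S1 s != 0]) -> S 0 = 0 ->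
  forall phi h, renormalized_test phi h ->
    - (\int[dx]_(x in Om) (S (u0 x) * phi (0, x)))
    - \int[dt]_(t in `]0, T[) h t (S \o curve v t)
    + \int[dtx]_(z in Q) (S1 (v z) * dotp (a z (xgrad u z)) (xgrad phi z))
    + \int[dtx]_(z in Q)
        (S2 (v z) * dotp (a z (xgrad u z)) (xgrad v z) * phi z)
    = hat_int f G (fun z => S1 (v z) * phi z).

(* (1/n) times the integral of a(t,x,grad u).grad v psi over {v in I} *)
Definition energy_mean (a : R * space -> space -> space) u v psi
    (n : nat) (I : set R) : R :=
  n%:R^-1 * \int[dtx]_(z in Q `&` v @^-1` I)
    (dotp (a z (xgrad u z)) (xgrad v z) * psi z).

(* u is a renormalized solution of u_t - div a(t,x,grad u) = mu0 + mus with
   initial datum u0 *)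
Definition renormalized_solution (a : R * space -> space -> space)
    (u0 : space -> R) mu0 mus u :=
  measurable_fun Q u /\
  exists f G g, decomposition mu0 f G g /\ let v := u - g in
  [/\ forall q : R, 1 <= q -> q < p - N%:R / (N%:R + 1) ->
        in_LpX (W10 Om q) q%:E v /\ in_LpX (Lq_space Om 1%:E) +oo%E v,
      forall k : R, 0 < k -> in_LpX (W10 Om p) p%:E (trunc k \o v),
      renormalized_equation a u0 f G u v
    & forall psi, {within closure Q, continuous psi} ->
        ((fun n => energy_mean a u v psi n `[n%:R, (2 * n)%:R[) @ \oo -->
           \int[pos_part mus]_(z in Q) psi z) /\
        ((fun n => energy_mean a u v psi n `]- (2 * n)%:R, - n%:R]) @ \oo -->
           \int[neg_part mus]_(z in Q) psi z)].

End parabolic.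

(* Main.v *)
Require Import Defs.
From mathcomp Require Import all_boot all_order all_algebra.
From mathcomp Require Import all_classical all_reals all_analysis.
From mathcomp Require Import measurable_realfun simple_functions lebesgue_integral_definition.
From mathcomp Require Import ring lra zify.
Set Implicit Arguments.
Unset Strict Implicit.
Unset Printing Implicit Defensive.
Import Order.TTheory GRing.Theory Num.Theory.
Import numFieldNormedType.Exports HBNNSimple.
Local Open Scope classical_set_scope.
Local Open Scope ring_scope.

(** Let (f', G', g') be the decomposition of mu0 that comes with the renormalized
    solution u, let v = u - g', and let w = g' - g, where g is the bounded
    function of the hypotheses. The negative part of mus is the limit of the
    energies m^-1 times the integral of a(t,x,grad u).grad v phi over the ring
    {m <= -v < 2m}, and the claim is that this limit is at most 0 for every
    nonnegative test function phi.

    The idea is that v cannot be very negative unless w is large: as u >= 0 and g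
    is bounded, v + w = u - g >= -C0. Moreover w solves a linear equation: both
    triples represent mu0, so that w_t = F - div H with F = f - f' in L^1 and
    H = G - G' in L^p'. The renormalized equation is therefore tested with
    chi = phi b(w / M), where b is a smooth bump function with b(0) = 1, and with
    the function S = [ren m L] for L = 2^J m and M = L / 4. Its second
    derivative is a tent of height 1/m over {m/2 < -s < 5m/2}, minus a tent of
    height 1/L over {L/2 < -s < 5L/2}, which is there to give S' a compact
    support. On the second ring w >= L/2 - C0 >= M, so that chi vanishes: only
    the energy in the first ring survives, with a sign, on the left-hand side.

    It remains to see that all other terms are small
    ([renormalized_estimate]). The terms without gradients are integrals of L^1
    functions over {m/2 < -v}, and vanish as m grows. The terms with two gradients
    are products of a function whose p-th or p'-th power is controlled by the
    energy density e with a function that is bounded in the conjugate Lebesgue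
    space. By Young's inequality they are at most tau e + Ct (an L^1 function),
    over one of the rings and divided by m or M. The energy in {m/2 < -v < 5L/2}
    is O(L) because the means of the energy over dyadic rings converge
    ([energy_ring]); so the contribution of e is O(tau), and the other one is
    O(Ct / m). Letting J, then m tend to infinity, and then tau to 0, gives the
    claim ([energy_limit_le0]).

    The function w has no strong derivatives, so chi is built from its
    mollifications. Only two facts on these are used: they converge in L^1, and
    their gradients are bounded in L^p on compact sets. The latter, as well as
    the integrability of all weak gradients at hand, is obtained by duality: a
    function of L^q(0,T;W^{1,q}_0) pairs with the derivatives of a test function
    Psi at most as C plus the integral of |Psi| ^ q' ([LpX_bound]), and a locally
    integrable function that acts on test functions in this way is in L^q
    ([dual_Lq]). *)

(** * Integration of real-valued functions *)

(** The integral of a nonnegative function is a supremum over simple functions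
    below it, which makes it monotone without any measurability. *)
Lemma le_lower_integral0 d (T : measurableType d) (R : realType)
    (mu : {measure set T -> \bar R}) (f g : T -> \bar R) :
  (forall x, 0 <= f x)%E -> (forall x, f x <= g x)%E ->
  (\int[mu]_x f x <= \int[mu]_x g x)%E.
Proof.
move=> f0 fg; have g0 x : (0 <= g x)%E by exact: le_trans (f0 _) (fg _).
rewrite !ge0_integralTE//; apply: le_ereal_sup => _ /= [h hf <-]; exists h => // x.
by apply: le_trans (hf x) _.
Qed.

Section integration.
Context d (T : measurableType d) (R : realType).
Variables (mu : {measure set T -> \bar R}) (D : set T).
Hypothesis mD : measurable D.
Implicit Types f g h : T -> R.

Local Notation L1 f := (mu.-integrable D (EFin \o f)).

Lemma L1_measurable f : L1 f -> measurable_fun D f.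
Proof. by move=> /integrableP[/measurable_EFinP]. Qed.

Lemma L1_dom f g : measurable_fun D f -> L1 g ->
  (forall x, D x -> `|f x| <= g x) -> L1 f.
Proof.
move=> mf ig fg; apply: le_integrable ig => //.
  exact/measurable_EFinP.
move=> x Dx; rewrite /= lee_fin (le_trans (fg _ Dx))//.
by rewrite ler_norm.
Qed.

Lemma L1D f g : L1 f -> L1 g -> L1 (fun x => f x + g x).
Proof.
move=> If Ig; rewrite (_ : _ \o _ = (EFin \o f) \+ (EFin \o g))%E.
  exact: integrableD.
by apply/funext => x.
Qed.

Lemma L1B f g : L1 f -> L1 g -> L1 (fun x => f x - g x).
Proof.
move=> If Ig; rewrite (_ : _ \o _ = (EFin \o f) \- (EFin \o g))%E.
  exact: integrableB.
by apply/funext => x.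
Qed.

Lemma L1Zl f (c : R) : L1 f -> L1 (fun x => c * f x).
Proof.
move=> If; rewrite (_ : _ \o _ = (fun x => c%:E * (EFin \o f) x))%E.
  exact: integrableZl.
by apply/funext => x.
Qed.

Lemma L1norm f : L1 f -> L1 (fun x => `|f x|).
Proof. by move=> If; exact: integrable_norm. Qed.

Lemma L1_sum I (s : seq I) (F : I -> T -> R) : (forall i, L1 (F i)) ->
  L1 (fun x => \sum_(i <- s) F i x).
Proof.
move=> h; elim: s => [|i s IH].
  by under eq_fun do rewrite big_nil; exact: integrable0.
by under eq_fun do rewrite big_cons; exact: L1D.
Qed.

Lemma L1_indic (A : set T) : measurable A -> (mu A < +oo)%E -> L1 (\1_A : T -> R).
Proof.
move=> mA Af; apply/integrableP; split.
  by apply/measurable_EFinP; apply: measurable_funTS; exact: measurable_indic.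
under eq_integral do rewrite /= ger0_norm//.
rewrite integral_indic//; apply: le_lt_trans Af; apply: le_measure; rewrite ?inE//.
exact: measurableI.
Qed.

Lemma L1_eq f g : (forall x, D x -> f x = g x) -> L1 f -> L1 g.
Proof.
move=> fg; apply: eq_integrable => // x /set_mem Dx.
by rewrite /= fg.
Qed.

Lemma L1M_bounded f g (c : R) : measurable_fun D f ->
  (forall x, D x -> `|f x| <= c) -> L1 g -> L1 (fun x => f x * g x).
Proof.
move=> mf fc ig; apply: (@L1_dom _ (fun x => c * `|g x|)).
- by apply: measurable_funM => //; exact: L1_measurable ig.
- exact/L1Zl/L1norm.
- by move=> x Dx; rewrite normrM ler_wpM2r// fc.
Qed.

Lemma Rintegral_sum I (s : seq I) (F : I -> T -> R) : (forall i, L1 (F i)) ->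
  \int[mu]_(x in D) (\sum_(i <- s) F i x) =
  \sum_(i <- s) \int[mu]_(x in D) F i x.
Proof.
move=> h; elim: s => [|i s IH].
  rewrite big_nil; under eq_Rintegral do rewrite big_nil.
  by rewrite Rintegral_cst// mul0r.
rewrite big_cons -IH -RintegralD//; last exact: L1_sum.
by under eq_Rintegral do rewrite big_cons.
Qed.

Lemma Rintegral_eq f g : (forall x, D x -> f x = g x) ->
  \int[mu]_(x in D) f x = \int[mu]_(x in D) g x.
Proof. by move=> fg; apply: eq_Rintegral => x /set_mem /fg. Qed.

Lemma RintegralN f : L1 f -> \int[mu]_(x in D) - f x = - \int[mu]_(x in D) f x.
Proof.
by move=> If; under eq_Rintegral do rewrite -mulN1r; rewrite RintegralZl// mulN1r.
Qed.

Lemma Rintegral_abs_le f g : measurable_fun D f -> L1 g ->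
  (forall x, D x -> `|f x| <= g x) ->
  `|\int[mu]_(x in D) f x| <= \int[mu]_(x in D) g x.
Proof.
move=> mf ig fg; have If := L1_dom mf ig fg.
by apply: le_trans (le_normr_Rintegral mD If) _; apply: le_Rintegral => //; exact: L1norm.
Qed.

Lemma le_lower_integral (f g : T -> \bar R) :
  (forall x, D x -> 0 <= f x)%E -> (forall x, D x -> f x <= g x)%E ->
  (\int[mu]_(x in D) f x <= \int[mu]_(x in D) g x)%E.
Proof.
move=> f0 fg; have g0 x : D x -> (0 <= g x)%E by move=> Dx; exact: le_trans (f0 _ Dx) (fg _ Dx).
rewrite !ge0_integralE//; apply: le_ereal_sup => _ /= [h hf <-]; exists h => // x.
apply: le_trans (hf x) _; rewrite /patch; case: ifPn => // /set_mem; exact: fg.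
Qed.

Lemma integral_ge0_ae_eq (f g : T -> \bar R) : (forall x, D x -> 0 <= f x)%E ->
  (forall x, D x -> 0 <= g x)%E ->
  {ae mu, forall x, D x -> f x = g x} ->
  (\int[mu]_(x in D) f x = \int[mu]_(x in D) g x)%E.
Proof.
suff H (f' g' : T -> \bar R) : (forall x, D x -> 0 <= f' x)%E ->
  (forall x, D x -> 0 <= g' x)%E ->
  {ae mu, forall x, D x -> f' x = g' x} ->
  (\int[mu]_(x in D) f' x <= \int[mu]_(x in D) g' x)%E.
  move=> f0 g0 fg; apply/eqP; rewrite eq_le !H//.
  by apply: filterS fg => x h Dx; rewrite h.
move=> {}f0 {}g0 [N [mN N0 hN]].
rewrite (ge0_integralE mu f0); apply: ge_ereal_sup => _ /= [h hf <-].
rewrite -(@integralT_nnsfun _ _ _ mu h).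
rewrite (@ge0_negligible_integral _ _ _ mu setT N)//; first last.
- by move=> x _; rewrite lee_fin fun_ge0.
- exact/measurable_EFinP.
rewrite setTD integral_mkcond.
pose h1 := mul_nnsfun h (indic_nnsfun R (measurableC mN)).
rewrite (_ : _ \_ _ = EFin \o h1); last first.
  apply/funext => x; rewrite /h1 /patch /comp/= mindicE.
  by case: (x \in _); rewrite ?mulr1 ?mulr0.
rewrite (@integralT_nnsfun _ _ _ mu h1) (ge0_integralE mu g0).
apply: ereal_sup_ubound; exists h1 => // x /=.
have gD0 : (0 <= (g' \_ D) x)%E.
  by rewrite /patch; case: ifPn => [/set_mem|_]; [exact: g0|].
rewrite mindicE; case: (boolP (x \in ~` N)) => [/set_mem Nx|_]; last by rewrite mulr0.
rewrite mulr1; apply: le_trans (hf x) _.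
rewrite /patch; case: ifPn => // /set_mem Dx.
suff -> : f' x = g' x by [].
by apply: contrapT => fgx; apply: Nx; apply: hN => /(_ Dx).
Qed.

Lemma Rintegral_ae_eq (f g : T -> R) :
  {ae mu, forall x, D x -> f x = g x} ->
  \int[mu]_(x in D) f x = \int[mu]_(x in D) g x.
Proof.
move=> fg; rewrite /Rintegral integralE [in RHS]integralE; congr (fine (_ - _)%E).
  apply: integral_ge0_ae_eq; [by move=> *; exact: funepos_ge0|by move=> *; exact: funepos_ge0|].
  by apply: filterS fg => x h Dx; rewrite !funeposE h.
apply: integral_ge0_ae_eq; [by move=> *; exact: funeneg_ge0|by move=> *; exact: funeneg_ge0|].
by apply: filterS fg => x h Dx; rewrite !funenegE h.
Qed.

Lemma DCT_R (f_ : nat -> T -> R) (f g : T -> R) :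
  (forall n, measurable_fun D (f_ n)) ->
  (forall x, D x -> f_ ^~ x @ \oo --> f x) ->
  L1 g -> (forall n x, D x -> `|f_ n x| <= g x) ->
  (fun n => \int[mu]_(x in D) f_ n x) @ \oo --> \int[mu]_(x in D) f x.
Proof.
move=> mf ff Ig fg.
have mff : measurable_fun D f by apply: (measurable_fun_cvg mf).
have := @dominated_convergence _ _ _ mu D mD (fun n => EFin \o f_ n) (EFin \o f) (EFin \o g).
case.
- by move=> n; exact/measurable_EFinP.
- exact/measurable_EFinP.
- apply: aeW => x Dx; apply/fine_cvgP; split; first exact: nearW.
  exact: ff.
- exact: Ig.
- by apply: aeW => x n Dx; rewrite /= lee_fin fg.
move=> If _ cv.
rewrite /Rintegral; apply: fine_cvg; rewrite fineK; first exact: cv.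
exact: integrable_fin_num.
Qed.

Lemma measurable_indb (b : T -> bool) : measurable_fun D b ->
  measurable_fun D (fun x => (b x)%:R : R).
Proof.
move=> mb; rewrite (_ : (fun _ => _) = (fun x => if b x then 1 else 0 : R)).
  by apply: measurable_fun_if => //; exact: measurable_cst.
by apply/funext => x; case: (b x).
Qed.

(** By dominated convergence: each point lies in finitely many of the sets only. *)
Lemma L1_tail (f : T -> R) (b : nat -> T -> bool) : L1 f ->
  (forall n, measurable_fun D (b n)) ->
  (forall x, D x -> \forall n \near \oo, ~~ b n x) ->
  (fun n => \int[mu]_(x in D) (`|f x| * (b n x)%:R)) @ \oo --> 0.
Proof.
move=> If mb hb.
have -> : (0 : R) = \int[mu]_(x in D) (cst 0 x) by rewrite Rintegral_cst// mul0r.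
apply: (@DCT_R _ _ (fun x => `|f x|)).
- move=> n; apply: measurable_funM; last exact: measurable_indb.
  exact: L1_measurable (L1norm If).
- move=> x Dx; apply: cvg_near_cst; near=> n.
  by rewrite (_ : b n x = false) ?mulr0//; apply/negbTE; near: n; exact: hb.
- exact: L1norm.
- by move=> n x _; case: (b n x); rewrite ?mulr1 ?mulr0 ?normr0 ?normr_id.
Unshelve. all: by end_near. Qed.

(** The functions h k are bounded and tend to 0 in measure. This is done without
    subsequences, by cutting g at a high level: the bounded part of g is
    controlled by r k, the rest is small in L^1. *)
Lemma cvg_int_min (h r : nat -> T -> R) (c C : R) (g : T -> R) :
  (forall k, measurable_fun D (h k)) ->
  (forall k x, D x -> `|h k x| <= c) -> (forall k x, D x -> `|h k x| <= C * r k x) ->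
  (forall k, L1 (r k)) -> (fun k => \int[mu]_(x in D) r k x) @ \oo --> 0 ->
  0 <= C -> L1 g ->
  (fun k => \int[mu]_(x in D) (h k x * g x)) @ \oo --> 0.
Proof.
move=> mh hc hC Ir r0 C0 Ig.
have c0 k x : D x -> 0 <= C * r k x by move=> Dx; apply: le_trans (hC k x Dx).
have mg := L1_measurable Ig.
have mgb n : measurable_fun D (fun x => n%:R < `|g x|).
  by apply: measurable_fun_ltr => //; exact: measurableT_comp.
have tl := @L1_tail g (fun n x => n%:R < `|g x|) Ig mgb.
have {}tl : (fun n : nat => \int[mu]_(x in D) (`|g x| * ((n%:R < `|g x|)%R)%:R)) @ \oo --> 0.
  apply: tl => x Dx; near=> n; rewrite -leNgt.
  by near: n; exact: nbhs_infty_ger.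
apply/cvgrPdist_le => /= e e0.
have [n hn] : exists n : nat, (`|c| + 1) * \int[mu]_(x in D) (`|g x| * ((n%:R < `|g x|)%R)%:R) <= e / 2.
  have e1 : 0 < e / 2 / (`|c| + 1) by rewrite !divr_gt0// ltr_wpDl.
  have /cvgrPdist_le/(_ _ e1)[n _ hn] := tl.
  exists n; have /= := hn n (leqnn n); rewrite sub0r normrN => /(le_trans (ler_norm _)).
  by rewrite ler_pdivlMr 1?mulrC// ltr_wpDl.
have e2 : 0 < e / 2 / (n%:R * C + 1) by rewrite !divr_gt0// ltr_wpDl// mulr_ge0.
have /cvgrPdist_le/(_ _ e2) := r0; apply: filterS => k.
rewrite !sub0r !normrN => /(le_trans (ler_norm _)) hk.
have I1 : L1 (fun x => n%:R * C * r k x) by exact: L1Zl.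
have I2 : L1 (fun x => (`|c| + 1) * (`|g x| * ((n%:R < `|g x|)%R)%:R)).
  apply: L1Zl; under eq_fun do rewrite mulrC.
  apply: (@L1M_bounded _ _ 1); [exact: measurable_indb| |exact: L1norm].
  by move=> x _; case: (_ < _); rewrite ?normr1 ?normr0.
apply: (@le_trans _ _ (\int[mu]_(x in D) (n%:R * C * r k x + (`|c| + 1) * (`|g x| * ((n%:R < `|g x|)%R)%:R)))).
  apply: Rintegral_abs_le.
  - by apply: measurable_funM.
  - exact: L1D.
  - move=> x Dx; rewrite normrM; case: ltP => [ng|gn]; rewrite ?mulr1 ?mulr0 ?addr0.
      rewrite -[leLHS]add0r lerD//.
        by rewrite -mulrA mulr_ge0// c0.
      by rewrite ler_wpM2r// (le_trans (hc _ _ Dx))// (le_trans (ler_norm c))// lerDl.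
    by rewrite mulrC -mulrA ler_pM// hC.
have I3 : L1 (fun x => `|g x| * ((n%:R < `|g x|)%R)%:R).
  apply: L1_eq (L1Zl (`|c| + 1)^-1 I2) => x _.
  by rewrite mulKf// gt_eqF// ltr_wpDl.
rewrite RintegralD// (RintegralZl _ mD (Ir k)) (RintegralZl _ mD I3).
rewrite [leRHS](splitr e) lerD//.
apply: (@le_trans _ _ ((n%:R * C + 1) * (e / 2 / (n%:R * C + 1)))); last first.
  by rewrite mulrCA mulfV ?mulr1// gt_eqF// ltr_wpDl// mulr_ge0.
have [i0|i0] := lerP 0 (\int[mu]_(x in D) r k x).
  by rewrite ler_pM// ?mulr_ge0// lerDl.
apply: (@le_trans _ _ 0); first by rewrite mulr_ge0_le0// ?mulr_ge0// ltW.
by rewrite mulr_ge0// ?(ltW e2)// addr_ge0// mulr_ge0.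
Unshelve. all: by end_near. Qed.
Lemma measurable_powR_comp (f : T -> R) r : measurable_fun D f ->
  measurable_fun D (fun x => f x `^ r).
Proof. by apply: (measurableT_comp (f := fun x : R => x `^ r)); exact: measurable_powR. Qed.

Lemma Rintegral_le_sub (K : set T) f : measurable K -> K `<=` D -> L1 f ->
  (forall x, D x -> 0 <= f x) -> \int[mu]_(x in K) f x <= \int[mu]_(x in D) f x.
Proof.
move=> mK KD If f0; have IK := integrableS mD mK KD If.
rewrite -lee_fin /Rintegral !fineK ?integrable_fin_num//.
by apply: ge0_subset_integral => //; exact/measurable_EFinP/L1_measurable.
Qed.

End integration.

(** * Lebesgue measure on R x R^n *)

Section rV_measure.
Context {R : realType}.
Local Notation dx n := (@lebesgue_rV R n).
Local Notation dtx n := (@lebesgue_prod R n (dx n)).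

Lemma lebesgueR_itv (c : R) : 0 < c ->
  @lebesgueR R [set t | `|t| < c] = (2 * c)%:E.
Proof.
move=> c0; rewrite (_ : [set t | _] = `]-c, c[%classic); last first.
  by apply/seteqP; split => t /=; rewrite in_itv/= ltr_norml.
rewrite /lebesgueR lebesgue_measure_itv/= lte_fin ifT; last by rewrite gtrN.
by rewrite -EFinD opprK mulr_natl mulr2n.
Qed.

Definition cube n (c : R) : set 'rV[R]_n := [set x | forall i, `|x ord0 i| < c].

Arguments cube : clear implicits.

Lemma measurable_cube n (c : R) : measurable (cube n c).
Proof.
rewrite (_ : cube n c = \bigcap_(i in [set: 'I_n]) [set x : 'rV[R]_n | `|x ord0 i| < c]).
  apply: fin_bigcap_measurable => // i _.
  have := @measurable_coord R n i measurableT `]-c, c[%classic (measurable_itv _).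
  rewrite setTI (_ : _ @^-1` _ = [set x : 'rV[R]_n | `|x ord0 i| < c])//.
  by apply/seteqP; split => t /=; rewrite in_itv/= ltr_norml.
by apply/seteqP; split => x /= h i => [_|]; exact: h.
Qed.

Lemma lebesgue_rV_cube n (c : R) : 0 < c ->
  dx n (cube n c) = ((2 * c) ^+ n)%:E.
Proof.
move=> c0; elim: n => [|n IH].
  by rewrite expr0 /= diracE mem_set//= => -[].
have -> : dx n.+1 (cube n.+1 c) = dtx n (@cons_rV R n @^-1` cube n.+1 c) by [].
have -> : @cons_rV R n @^-1` cube n.+1 c = [set t | `|t| < c] `*` cube n c.
  apply/seteqP; split => -[t x] /= h.
    split; first by have := h ord0; rewrite /cons_rV mxE unlift_none.
    by move=> i; have := h (lift ord0 i); rewrite /cons_rV mxE liftK.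
  move=> i; rewrite /cons_rV mxE; case: unliftP => [j|] _; [exact: h.2|exact: h.1].
rewrite /lebesgue_prod product_measure1E//; last 2 first.
- rewrite (_ : [set t | _] = `]-c, c[%classic); first exact: measurable_itv.
  by apply/seteqP; split => t /=; rewrite in_itv/= ltr_norml.
- exact: measurable_cube.
by rewrite [X in (X * _)%E]lebesgueR_itv// [X in (_ * X)%E]IH -EFinM exprS.
Qed.

Lemma integral_lebesgue_prod n (f : R * 'rV[R]_n -> \bar R) :
  measurable_fun setT f -> (forall z, 0 <= f z)%E ->
  (\int[dtx n]_z f z = \int[@lebesgueR R]_t \int[dx n]_x f (t, x))%E.
Proof. by move=> mf f0; exact: fubini_tonelli1. Qed.

Lemma integral_lebesgue_rVS n (f : 'rV[R]_n.+1 -> \bar R) :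
  measurable_fun setT f -> (forall z, 0 <= f z)%E ->
  (\int[dx n.+1]_z f z = \int[dtx n]_z f (cons_rV z))%E.
Proof.
move=> mf f0.
have := @ge0_integral_pushforward _ _ _ _ R _ (@measurable_cons_rV R n) (dtx n) setT f.
by rewrite preimage_setT => <- //.
Qed.

Lemma lebesgueR_shift (s : R) (A : set R) : measurable A ->
  lebesgueR ((fun t => t + s) @^-1` A) = lebesgueR A.
Proof.
move=> mA.
have mshift : measurable_fun setT (fun t : measurableTypeR R => t + s : measurableTypeR R).
  exact: measurable_funD.
have /= := @lebesgue_measure_unique R
  (pushforward lebesgue_measure (fun t : measurableTypeR R => t + s : measurableTypeR R)).
move=> /(_ mshift).
move=> H; apply/esym; apply: H => // _ [[a b]] _ <-.
rewrite /pushforward /= (_ : _ @^-1` _ = `]a - s, b - s]%classic); last first.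
  by apply/seteqP; split => x /=; rewrite !in_itv/= ltrBlDr lerBrDr.
rewrite !lebesgue_measure_itv/= !lte_fin ltrD2r.
by case: ifP => // _; rewrite -!EFinD; congr (_%:E); ring.
Qed.

Lemma integral_lebesgueR_shift (f : R -> \bar R) (s : R) :
  measurable_fun setT f -> (forall z, 0 <= f z)%E ->
  (\int[@lebesgueR R]_t f (t + s)%R = \int[@lebesgueR R]_t f t)%E.
Proof.
move=> mf f0.
have mshift : measurable_fun setT (fun t : R => t + s) by exact: measurable_funD.
have := @ge0_integral_pushforward _ _ _ _ R _ mshift (@lebesgueR R) setT f.
rewrite preimage_setT => <- //.
by apply: eq_measure_integral => //= A mA _; exact: lebesgueR_shift.
Qed.

Lemma measurable_shift_rV n (y : 'rV[R]_n) :
  measurable_fun setT (fun x : 'rV[R]_n => x + y).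
Proof.
apply: measurable_fun_rV => i; under eq_fun do rewrite mxE.
by apply: measurable_funD => //; exact: measurable_coord.
Qed.

Lemma integral_rV_shift n (f : 'rV[R]_n -> \bar R) (y : 'rV[R]_n) :
  measurable_fun setT f -> (forall z, 0 <= f z)%E ->
  (\int[dx n]_x f (x + y)%R = \int[dx n]_x f x)%E.
Proof.
elim: n f y => [|n IH] f y mf f0.
  have e (x : 'rV[R]_0) : x + y = x by apply/rowP => -[].
  by apply: eq_integral => x _; rewrite e.
have mfc : measurable_fun setT (f \o @cons_rV R n).
  by apply: measurableT_comp => //; exact: measurable_cons_rV.
have mfs : measurable_fun setT (fun x : 'rV[R]_n.+1 => f (x + y)).
  by apply: (measurableT_comp mf); exact: measurable_shift_rV.
rewrite !integral_lebesgue_rVS//.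
pose s := (uncons_rV y).1; pose y' := (uncons_rV y).2.
have e (z : R * 'rV[R]_n) : cons_rV z + y = cons_rV (z.1 + s, z.2 + y').
  apply/rowP => i; rewrite !mxE; case: unliftP => [j|] ->; rewrite ?mxE//.
under eq_integral do rewrite e.
have mfcs : measurable_fun setT (fun z : R * 'rV[R]_n => f (cons_rV (z.1 + s, z.2 + y'))).
  apply: (measurableT_comp mfc); apply: measurable_fun_pair.
    by apply: measurable_funD => //; exact: measurable_fst.
  by apply: (measurableT_comp (@measurable_shift_rV _ _)); exact: measurable_snd.
have mt (t : R) : measurable_fun setT (fun x => f (cons_rV (t, x))).
  by apply: (measurableT_comp mfc) => /=; exact: measurable_fun_pair.
rewrite (integral_lebesgue_prod mfcs (fun z => f0 _)) (integral_lebesgue_prod mfc (fun z => f0 _)).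
rewrite -(integral_lebesgueR_shift s (f := fun t => \int[dx n]_x f (cons_rV (t, x)))%E).
- by apply: eq_integral => t _ /=; rewrite (IH (fun x => f (cons_rV (t + s, x)))).
- exact: (measurable_fun_fubini_tonelli_F (m2 := dx n) _ mfc (fun z => f0 _)).
- by move=> t; exact: integral_ge0.
Qed.

Local Notation E n := (R * 'rV[R]_n)%type.

Lemma measurable_shift_E n (y : E n) : measurable_fun setT (fun z : E n => z + y).
Proof.
apply: measurable_fun_pair.
  by apply: measurable_funD => //; exact: measurable_fst.
by apply: (measurableT_comp (@measurable_shift_rV _ _)); exact: measurable_snd.
Qed.

Lemma integral_E_shift n (f : E n -> \bar R) (y : E n) :
  measurable_fun setT f -> (forall z, 0 <= f z)%E ->
  (\int[dtx n]_z f (z + y)%R = \int[dtx n]_z f z)%E.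
Proof.
move=> mf f0.
have mfs : measurable_fun setT (fun x : E n => f (x + y)).
  by apply: (measurableT_comp mf); exact: measurable_shift_E.
have mt (t : R) : measurable_fun setT (fun x => f (t, x)).
  by apply: (measurableT_comp mf) => /=; exact: measurable_fun_pair.
rewrite (integral_lebesgue_prod mfs (fun z => f0 _)) (integral_lebesgue_prod mf f0).
rewrite -(integral_lebesgueR_shift y.1 (f := fun t => \int[dx n]_x f (t, x))%E).
- by apply: eq_integral => t _ /=; rewrite -(integral_rV_shift y.2 (f := fun x => f (t + y.1, x))).
- exact: (measurable_fun_fubini_tonelli_F (m2 := dx n) _ mf f0).
- by move=> t; exact: integral_ge0.
Qed.

Lemma Rintegral_E_shift n (f : E n -> R) (y : E n) : measurable_fun setT f ->
  \int[dtx n]_z f (z + y) = \int[dtx n]_z f z.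
Proof.
move=> /measurable_EFinP mf; rewrite /Rintegral integralE [in RHS]integralE; congr (fine (_ - _)%E).
  rewrite -[RHS](integral_E_shift y); last by move=> z; exact: funepos_ge0.
    by apply: eq_integral => z _; rewrite !funeposE.
  exact: measurable_funepos mf.
rewrite -[RHS](integral_E_shift y); last by move=> z; exact: funeneg_ge0.
  by apply: eq_integral => z _; rewrite !funenegE.
exact: measurable_funeneg mf.
Qed.

Definition rat_pt n (q : rat * 'rV[rat]_n) : E n := (ratr q.1, \row_i ratr (q.2 ord0 i)).

Lemma rat_pt_dense n (z : E n) (e : R) : 0 < e -> exists q, ball (rat_pt q) e z.
Proof.
move=> e0.
have H (x : R) : exists q : rat, `|ratr q - x| < e.
  have [q] : exists q : rat, ratr q \in `]x - e, x + e[.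
    by apply: rat_in_itvoo; rewrite ltrD2l gtrN.
  by rewrite in_itv/= => qx; exists q; rewrite ltr_distl.
have [q hq] := choice H.
exists (q z.1, \row_i q (z.2 ord0 i)); split => /=.
  by rewrite /ball/= hq.
by split => // i j; rewrite !mxE /ball/= (ord1 i) hq.
Qed.

Lemma E_ballP n (y z : E n) (e : R) : 0 < e ->
  ball y e z <-> `|z.1 - y.1| < e /\ cube n e (z.2 - y.2).
Proof.
move=> e0; split.
  move=> [/= h1 h2]; split; first by rewrite distrC.
  by move=> i; have := h2.2 ord0 i; rewrite !mxE /ball/= distrC.
move=> [h1 h2]; split; first by rewrite /ball/= distrC.
by split => // i j; have := h2 j; rewrite (ord1 i) /ball/= !mxE distrC.
Qed.

Lemma measurable_E_ball n (y : E n) (e : R) : 0 < e -> measurable (ball y e : set (E n)).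
Proof.
move=> e0; have -> : ball y e = (fun z : E n => z + (- y)) @^-1` ([set t | `|t| < e] `*` cube n e).
  by apply/seteqP; split => z; rewrite E_ballP.
rewrite -[X in measurable X]setTI; apply: measurable_shift_E => //.
apply: measurableX; last exact: measurable_cube.
rewrite (_ : [set t | _] = `]-e, e[%classic); first exact: measurable_itv.
by apply/seteqP; split => t /=; rewrite in_itv/= ltr_norml.
Qed.

(** As in Lindelof's theorem, countably many balls with rational centres and
    radii suffice. *)
Lemma bigcup_ball_cover n (A : set (E n)) (P : set (E n) -> Prop) :
  (forall z, A z -> exists2 r, 0 < r & forall B, B `<=` ball z r -> P B) ->
  exists B : nat -> set (E n), A `<=` \bigcup_k B k /\
    forall k, B k = set0 \/ exists y e, [/\ 0 < e, B k = ball y e & P (B k)].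
Proof.
move=> hA.
have [pk [upk pkK]] : exists pk, exists upk : nat -> option (rat * 'rV[rat]_n * nat), pcancel pk upk.
  by exists pickle, unpickle; exact: pickleK.
pose b (c : rat * 'rV[rat]_n * nat) : set (E n) := ball (rat_pt c.1) (c.2.+1%:R^-1).
pose B k := if upk k is Some c then if `[< P (b c) >] then b c else set0 else set0.
have e0 m : 0 < m.+1%:R^-1 :> R by [].
exists B; split; last first.
  move=> k; rewrite /B; case: (upk k) => [c|]; last by left.
  by case: asboolP => h; [right; exists (rat_pt c.1), (c.2.+1%:R^-1)|left].
move=> z /hA[r r0 hr].
have [m hm] : exists m, m.+1%:R^-1 < r / 2.
  have := @ltr_add_invr R 0 (r / 2); rewrite divr_gt0// => /(_ isT)[m]; rewrite add0r => h.
  by exists m.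
have [q hq] := rat_pt_dense z (e0 m).
exists (pk (q, m)); first exact: I.
rewrite /B pkK; case: asboolP; first by move=> _; exact: hq.
case; apply: hr => y hy.
apply: (@le_ball _ _ _ (r / 2 + r / 2)); first by rewrite -splitr.
apply: (@ball_triangle _ _ (rat_pt q)).
  by apply: ball_sym; apply: le_ball hq; exact: ltW.
by apply: le_ball hy; exact: ltW.
Qed.

(** The sigma-algebra is generated by the coordinates, and the balls of the
    product are boxes. *)
Lemma open_measurable_E n (A : set (E n)) : open A -> measurable A.
Proof.
move=> oA; have [z Az|B [AB hB]] := @bigcup_ball_cover _ A (fun B => B `<=` A).
  have /nbhs_ballP[r /= r0 hr] := open_nbhs_nbhs (conj oA Az).
  by exists r => // B hB; exact: subset_trans hr.
have -> : A = \bigcup_k B k.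
  apply/seteqP; split => // z [k _]; case: (hB k) => [->//|[y [e [_ _ h]]]].
  exact: h.
apply: bigcup_measurable => k _.
by have [->//|[y [e [e0 -> _]]]] := hB k; exact: measurable_E_ball.
Qed.

(** A set that is locally null is null, by separability; no finiteness of the
    measure is involved. *)
Lemma null_cover_E n (m : {measure set (E n) -> \bar R}) (A : set (E n)) :
  measurable A ->
  (forall y, A y -> exists2 e, 0 < e & (m (ball y e) = 0)%E) -> (m A = 0)%E.
Proof.
move=> mA hA.
have [y Ay|B [AB hB]] := @bigcup_ball_cover _ A (fun B => measurable B -> (m B = 0)%E).
  have [r r0 hr] := hA _ Ay; exists r => // B hB mB.
  by apply: (subset_measure0 mB _ hB hr); exact: measurable_E_ball.
have mB k : measurable (B k).
  by have [->//|[y [e [e0 -> _]]]] := hB k; exact: measurable_E_ball.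
apply: (@subset_measure0 _ _ _ m A (\bigcup_k B k)) => //; first exact: bigcup_measurable.
apply/negligibleP; first exact: bigcup_measurable.
apply: negligible_bigcup => k; apply/negligibleP => //.
by have [->|[y [e [e0 _ /(_ (mB k))]]]] := hB k; rewrite ?measure0.
Qed.

Lemma closed_measurable_E n (A : set (E n)) : closed A -> measurable A.
Proof.
move=> cA; rewrite -[A]setCK; apply: measurableC.
by apply: open_measurable_E; rewrite openC.
Qed.

Lemma continuous_measurable_E n (f : E n -> R) : continuous f -> measurable_fun setT f.
Proof.
move=> cf mT; apply: (measurability _ (RGenOInfty.measurableE R)) => //.
move=> _ [_ [x ->] <-]; rewrite setTI; apply: open_measurable_E.
exact: open_comp.
Qed.

Lemma measurable_slice n (A : set (E n)) t : measurable A -> measurable [set x | A (t, x)].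
Proof.
move=> mA; have := @measurable_xsection _ _ _ _ A t mA.
by rewrite xsectionE.
Qed.

Lemma open_measurable_rV n (A : set 'rV[R]_n) : open A -> measurable A.
Proof.
move=> oA; have h : open ([set z : E n | A z.2]).
  by apply: open_comp => //; move=> z _; exact: cvg_snd.
exact: (@measurable_slice _ _ 0 (open_measurable_E h)).
Qed.

Lemma bounded_finite n (A : set (E n)) : measurable A -> bounded_set A -> (dtx n A < +oo)%E.
Proof.
move=> mA [M [_ /(_ (`|M| + 1))]] => /(_ _)/= hM.
have {}hM : forall z, A z -> `|z| <= `|M| + 1.
  by apply: hM; rewrite (le_lt_trans (ler_norm _))// ltrDl.
have c0 : 0 < `|M| + 2 by rewrite ltr_wpDl.
have sA : A `<=` ball (0 : E n) (`|M| + 2).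
  move=> z /hM hz; rewrite -ball_normE /ball_/= sub0r normrN.
  by rewrite (le_lt_trans hz)// ltrD2l ltr1n.
apply: (@le_lt_trans _ _ (dtx n (ball (0 : E n) (`|M| + 2)))).
  by apply: le_measure => //; rewrite inE//; exact: measurable_E_ball.
rewrite (_ : ball _ _ = [set t | `|t| < `|M| + 2] `*` cube n (`|M| + 2)); last first.
  by apply/seteqP; split => z; rewrite E_ballP// !subr0.
rewrite /lebesgue_prod product_measure1E//; last 2 first.
- rewrite (_ : [set t | _] = `](-(`|M| + 2)), (`|M| + 2)[%classic); first exact: measurable_itv.
  by apply/seteqP; split => t /=; rewrite in_itv/= ltr_norml.
- exact: measurable_cube.
by rewrite [X in (X * _)%E]lebesgueR_itv// [X in (_ * X)%E]lebesgue_rV_cube// -EFinM ltry.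
Qed.

Lemma ball_pos n (e : R) : 0 < e -> (0 < dtx n (ball (0%R : E n) e))%E.
Proof.
move=> e0; rewrite (_ : ball _ _ = [set t | `|t| < e] `*` cube n e); last first.
  by apply/seteqP; split => z; rewrite E_ballP// !subr0.
rewrite /lebesgue_prod product_measure1E//; last 2 first.
- rewrite (_ : [set t | _] = `]-e, e[%classic); first exact: measurable_itv.
  by apply/seteqP; split => t /=; rewrite in_itv/= ltr_norml.
- exact: measurable_cube.
rewrite [X in (X * _)%E]lebesgueR_itv// [X in (_ * X)%E]lebesgue_rV_cube// -EFinM lte_fin.
by rewrite mulr_gt0// ?exprn_gt0// mulr_gt0.
Qed.

End rV_measure.

(** * Smooth functions *)

Section smooth_calculus.
Context {R : realType} {V : normedModType R}.
Implicit Types (f g : V -> R) (v x : V).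

Definition smooth f := forall k, Ck k f.

(** It makes the calculus of functions of one real variable available for
    directional derivatives. *)
Lemma derive_line f x v : (derivable f x v <-> derivable (fun s : R => f (s *: v + x)) 0 1) /\
  'D_v f x = derive1 (fun s : R => f (s *: v + x)) 0.
Proof.
rewrite derive1E /derivable /derive.
have -> : (fun h : R => h^-1 *: (((fun s : R => f (s *: v + x)) \o shift 0) (h *: (1 : R)) - f (0 *: v + x)))
  = (fun h : R => h^-1 *: ((f \o shift x) (h *: v) - f x)).
  by apply/funext => h /=; rewrite addr0 scale0r add0r [h *: 1]mulr1.
by [].
Qed.

Lemma is_derive_line f x v (s : R) : derivable f (s *: v + x) v ->
  is_derive s (1 : R) (fun s : R => f (s *: v + x)) ('D_v f (s *: v + x)).
Proof.
rewrite /derivable => df.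
have e : (fun h : R => h^-1 *: (((fun s : R => f (s *: v + x)) \o shift s) (h *: (1 : R)) - f (s *: v + x)))
  = (fun h : R => h^-1 *: ((f \o shift (s *: v + x)) (h *: v) - f (s *: v + x))).
  by apply/funext => h /=; rewrite [h *: 1]mulr1 scalerDl addrA.
by split; rewrite /derivable /derive e.
Qed.

Lemma derivable_comp1 (h : R -> R) f x v :
  derivable h (f x) 1 -> derivable f x v ->
  derivable (h \o f) x v /\ 'D_v (h \o f) x = derive1 h (f x) * 'D_v f x.
Proof.
move=> dh df.
have [l1 e1] := derive_line f x v; have [l2 e2] := derive_line (h \o f) x v.
set phi := (fun s : R => f (s *: v + x)) in l1 e1.
have phi0 : phi 0 = f x by rewrite /phi scale0r add0r.
have dphi := l1.1 df.
have dh' : derivable h (phi 0) 1 by rewrite phi0.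
split.
  apply/l2; apply/derivable1_diffP.
  by apply: (@differentiable_comp _ _ _ _ phi h); apply/derivable1_diffP.
rewrite e2 e1 -phi0; rewrite (_ : (fun s : R => _) = h \o phi)//.
by rewrite derive1_comp.
Qed.

Lemma Ck_continuous k f : Ck k f -> continuous f.
Proof. by case: k => [|k] []. Qed.

Lemma CkSP k f : Ck k.+1 f <->
  [/\ continuous f, forall x v, derivable f x v & forall v, Ck k ('D_v f)].
Proof. by split=> [[? []]|[]]. Qed.

Lemma CkW k f : Ck k.+1 f -> Ck k f.
Proof.
elim: k f => [|k IH] f [cf [df hf]]; split => //.
by split => // v; apply: IH; exact: hf.
Qed.

Lemma Ck_cst k (c : R) : Ck k (cst c : V -> R).
Proof.
elim: k c => [|k IH] c; split => //; try exact: cst_continuous.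
split; first by move=> x v; exact: derivable_cst.
move=> v; rewrite (_ : 'D_v (cst c) = cst 0); first exact: IH.
by apply/funext => x; rewrite derive_cst.
Qed.

Lemma CkD k f g : Ck k f -> Ck k g -> Ck k (fun x => f x + g x).
Proof.
elim: k f g => [|k IH] f g.
  by move=> [cf _] [cg _]; split => // x; apply: cvgD; [exact: cf|exact: cg].
move=> /CkSP[cf df hf] /CkSP[cg dg hg]; apply/CkSP; split.
- by move=> x; apply: cvgD; [exact: cf|exact: cg].
- by move=> x v; exact: derivableD.
- move=> v; have -> : 'D_v (fun x => f x + g x) = fun x => 'D_v f x + 'D_v g x.
    by apply/funext => x; rewrite -deriveD.
  exact: (IH _ _ (hf v) (hg v)).
Qed.

Lemma CkM k f g : Ck k f -> Ck k g -> Ck k (fun x => f x * g x).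
Proof.
elim: k f g => [|k IH] f g.
  by move=> [cf _] [cg _]; split => // x; apply: cvgM; [exact: cf|exact: cg].
move=> hf0 hg0; have /CkSP[cf df hf] := hf0; have /CkSP[cg dg hg] := hg0.
apply/CkSP; split.
- by move=> x; apply: cvgM; [exact: cf|exact: cg].
- by move=> x v; exact: derivableM.
- move=> v; have -> : 'D_v (fun x => f x * g x) = fun x => f x * 'D_v g x + g x * 'D_v f x.
    by apply/funext => x; rewrite -[LHS]/('D_v (f * g) x) deriveM.
  exact: (CkD (IH _ _ (CkW hf0) (hg v)) (IH _ _ (CkW hg0) (hf v))).
Qed.

(** By induction on k with the chain rule; the derivative of h is again of class
    C^(k-1) on the line. *)
Lemma Ck_comp k (h : R -> R) f : Ck k h -> Ck k f -> Ck k (h \o f).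
Proof.
elim: k h f => [|k IH] h f.
  by move=> [ch _] [cf _]; split => // x; apply: continuous_comp; [exact: cf|exact: ch].
move=> hh0 hf0.
have [ch [dh _]] := hh0; have [cf [df _]] := hf0.
have hf v : Ck k ('D_v f) by have [_ [_ ]] := hf0; exact.
have hh : Ck k ('D_1 h) by have [_ [_ ]] := hh0; exact.
split; first by move=> x; apply: continuous_comp; [exact: cf|exact: ch].
split; first by move=> x v; exact: (derivable_comp1 (dh _ _) (df _ _)).1.
move=> v; have -> : 'D_v (h \o f) = fun x => ('D_1 h \o f) x * 'D_v f x.
  by apply/funext => x; rewrite (derivable_comp1 (dh _ _) (df _ _)).2 /= derive1E.
exact: (CkM (IH _ _ hh (CkW hf0)) (hf v)).
Qed.

Lemma Ck_linear k (l : V -> R) : continuous l ->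
  (forall (a : R) x y, l (a *: x + y) = a * l x + l y) -> Ck k l.
Proof.
move=> cl ll.
have dl x v : (fun h : R => h^-1 *: ((l \o shift x) (h *: v) - l x)) @ 0^' --> l v.
  apply: cvg_near_cst; near=> h.
  rewrite /= ll addrK [_ *: _]mulrA mulVf ?mul1r//.
  by near: h; exact: nbhs_dnbhs_neq.
case: k => [|k]; split => //; split.
  by move=> x v; apply/cvg_ex; exists (l v); exact: dl.
move=> v; rewrite (_ : 'D_v l = cst (l v)); first exact: Ck_cst.
by apply/funext => x; apply/cvg_lim => //; exact: dl.
Unshelve. all: by end_near. Qed.

Lemma smooth_continuous f : smooth f -> continuous f.
Proof. by move=> /(_ 0%N) []. Qed.
Lemma smooth_derivable f x v : smooth f -> derivable f x v.
Proof. by move=> /(_ 1%N) [_ []]. Qed.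
Lemma smooth_derive f v : smooth f -> smooth ('D_v f).
Proof. by move=> hf k; have [_ [_ ]] := hf k.+1; exact. Qed.
Lemma smoothD f g : smooth f -> smooth g -> smooth (fun x => f x + g x).
Proof. by move=> hf hg k; exact: CkD. Qed.
Lemma smoothM f g : smooth f -> smooth g -> smooth (fun x => f x * g x).
Proof. by move=> hf hg k; exact: CkM. Qed.
Lemma smooth_comp (h : R -> R) f : (forall k, Ck k h) -> smooth f -> smooth (h \o f).
Proof. by move=> hf hg k; exact: Ck_comp. Qed.
Lemma smooth_cst c : smooth (cst c).
Proof. by move=> k; exact: Ck_cst. Qed.

Lemma smooth_prod (I : Type) (s : seq I) (F : I -> V -> R) :
  (forall i, smooth (F i)) -> smooth (fun x => \prod_(i <- s) F i x).
Proof.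
move=> h; elim: s => [|i s IH].
  by under eq_fun do rewrite big_nil; exact: smooth_cst.
by under eq_fun do rewrite big_cons; exact: smoothM.
Qed.

Lemma derive_smoothM f g x v : smooth f -> smooth g ->
  'D_v (fun x => f x * g x) x = f x * 'D_v g x + g x * 'D_v f x.
Proof.
move=> hf hg; rewrite -[LHS]/('D_v (f * g) x) deriveM//; exact: smooth_derivable.
Qed.

Lemma derive_smooth_comp (h : R -> R) f x v : (forall k, Ck k h) -> smooth f ->
  'D_v (h \o f) x = 'D_1 h (f x) * 'D_v f x.
Proof.
move=> hh hf; rewrite (derivable_comp1 _ _).2 ?derive1E//; last exact: smooth_derivable.
by have [_ []] := hh 1%N.
Qed.

(** The complement of K is open, so that f vanishes near each of its points. *)
Lemma derive_out (K : set V) f : closed K -> (forall x, ~ K x -> f x = 0) ->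
  forall v x, ~ K x -> 'D_v f x = 0.
Proof.
move=> cK f0 v x Kx; apply/cvg_lim => //; apply: cvg_near_cst.
have oK : open (~` K) by rewrite openC.
have nK : nbhs x (~` K) by exact: open_nbhs_nbhs.
have : \forall h \near (0 : R), (~` K) (h *: v + x).
  have c : (fun h : R => h *: v + x) @ (0 : R) --> x.
    rewrite -[X in _ --> X]add0r -(scale0r v); apply: cvgD; last exact: cvg_cst.
    by apply: cvgZr_tmp => //; exact: cvg_id.
  exact: c.
move=> nh; near=> h; rewrite /= (f0 x Kx) f0 ?subr0 ?scaler0//.
by near: h; exact: nbhs_dnbhs.
Unshelve. all: by end_near. Qed.

End smooth_calculus.

(** * A bump function *)

Section bump.
Context {R : realType}.
Implicit Types (P : {poly R}) (x : R).

(** The functions P(1/x) exp(-1/x), continued by 0: they are stable under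
    differentiation, which makes them smooth. *)
Definition flat P x : R := if 0 < x then P.[x^-1] * expR (- x^-1) else 0.

Lemma horner_growth P : exists C : R, 0 <= C /\ forall y, 1 <= y -> `|P.[y]| <= C * y ^+ size P.
Proof.
exists (\sum_(i < size P) `|P`_i|); split; first exact: sumr_ge0.
move=> y y1; rewrite horner_coef mulr_suml; apply: le_trans (ler_norm_sum _ _ _) _.
apply: ler_sum => i _; rewrite normrM ler_wpM2l// normrX ger0_norm ?(le_trans _ y1)//.
by apply: ler_weXn2l => //; exact: ltnW.
Qed.

(** The exponential beats every polynomial in 1/x; the quadratic bound gives the
    derivative at 0. *)
Lemma flat_small P : exists C : R, 0 <= C /\ forall x, x <= 1 -> `|flat P x| <= C * x ^+ 2.
Proof.
have [C [C0 hC]] := horner_growth P.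
pose n := (size P).+2.
exists (C * n`!%:R); split; first by rewrite mulr_ge0.
move=> x x1; rewrite /flat; case: ltP => x0; last by rewrite normr0 mulr_ge0 ?sqr_ge0// mulr_ge0.
have y1 : 1 <= x^-1 by rewrite invf_ge1.
have y0 : 0 < x^-1 by rewrite invr_gt0.
rewrite normrM (ger0_norm (expR_ge0 _)).
apply: (@le_trans _ _ (C * (x^-1) ^+ size P * (n`!%:R / (x^-1) ^+ n))).
  apply: ler_pM; [by []|exact: expR_ge0|exact: hC|].
  have q0 : 0 < n`!%:R / x^-1 ^+ n.
    by rewrite divr_gt0// ?exprn_gt0// ltr0n fact_gt0.
  rewrite expRN -[leRHS]invrK lef_pV2 ?posrE ?expR_gt0 ?invr_gt0//.
  rewrite invf_div; apply: le_trans (expR_ge1Dxn (size P).+1 (ltW y0)).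
  by rewrite lerDr.
rewrite -!mulrA ler_wpM2l// mulrCA ler_wpM2l// /n -addn2 exprD invfM mulrA mulfV ?mul1r.
  by rewrite exprVn invrK.
by rewrite expf_neq0// gt_eqF.
Qed.

Lemma is_derive_flat P x : is_derive x 1 (flat P) (flat ('X^2 * (P - P^`())) x).
Proof.
have [x0|x0|->] := ltgtP x 0.
- rewrite {2}/flat ltNge (ltW x0)/=.
  apply: (@near_eq_is_derive _ _ _ (cst 0)).
  near=> y; rewrite /flat ltNge ifF//; apply/negbTE; rewrite negbK ltW//.
  by near: y; exact: lt_nbhsl.
- rewrite {2}/flat x0.
  apply: (@near_eq_is_derive R R R (fun y : R => P.[y^-1] * expR (- y^-1))).
    near=> y; rewrite /flat ifT//.
    by near: y; exact: lt_nbhsr.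
  have xn0 : x != 0 by rewrite gt_eqF.
  have d1 : is_derive x 1 (fun y : R => y^-1) (- x ^- 2).
    have := @is_deriveV _ id x 1 1 xn0 (is_derive_id _ _).
    by rewrite scaler1.
  have d2 : is_derive x 1 (fun y : R => P.[y^-1]) (P^`().[x^-1] * (- x ^- 2)).
    have d0 : is_derive (x^-1) 1 (horner P) P^`().[x^-1] by exact: is_derive_poly.
    exact: (@is_derive1_comp _ (horner P) _ x _ _ d0 d1).
  have d3 : is_derive x 1 (fun y : R => expR (- y^-1)) (expR (- x^-1) * x ^- 2).
    have d3 : is_derive x 1 (fun y : R => - y^-1) (x ^- 2) by rewrite -[x ^- 2]opprK; exact: is_deriveN.
    exact: (@is_derive1_comp _ expR _ x _ _ _ d3).
  apply: is_derive_eq.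
  rewrite hornerM hornerXn !hornerE exprVn /GRing.scale/=; ring.
- rewrite {2}/flat ltxx.
  have [C [C0 hC]] := flat_small P.
  have h : (fun h : R => h^-1 *: ((flat P \o shift 0) (h *: (1 : R)) - flat P 0)) @ 0^' --> (0 : R).
    apply/cvgrPdist_le => /= e e0; near=> h.
    rewrite sub0r normrN addr0 [h *: 1]mulr1 {2}/flat ltxx subr0 [_ *: _]mulrC.
    have h0 : h != 0 by near: h; exact: nbhs_dnbhs_neq.
    rewrite normrM normfV ler_pdivrMr ?normr_gt0//.
    have h1 : `|h| <= 1.
      by near: h; exact: dnbhs0_le.
    have h2 : `|h| <= e / (C + 1).
      by near: h; apply: dnbhs0_le; rewrite divr_gt0// ltr_wpDl.
    apply: le_trans (hC _ (le_trans (ler_norm h) h1)) _.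
    have -> : h ^+ 2 = `|h| * `|h| by rewrite -normrM -expr2 ger0_norm ?sqr_ge0.
    rewrite mulrA ler_wpM2r//.
    apply: (@le_trans _ _ ((C + 1) * (e / (C + 1)))).
      by apply: ler_pM => //; rewrite lerDl.
    by rewrite mulrCA mulfV ?mulr1// gt_eqF// ltr_wpDl.
  split; first by apply/cvg_ex; exists 0.
  by apply/cvg_lim.
Unshelve. all: by end_near. Qed.

Lemma flat_Ck k P : Ck k (flat P).
Proof.
elim: k P => [|k IH] P.
  split => // x; have [d _] := is_derive_flat P x.
  by apply: differentiable_continuous; apply/derivable1_diffP.
apply/CkSP; split.
- move=> x; have [d _] := is_derive_flat P x.
  by apply: differentiable_continuous; apply/derivable1_diffP.
- move=> x v; have [d _] := is_derive_flat P x.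
  by apply: diff_derivable; apply/derivable1_diffP.
- move=> v; rewrite (_ : 'D_v (flat P) = fun x => cst v x * flat ('X^2 * (P - P^`())) x).
    exact: CkM (Ck_cst _ _) (IH _).
  apply/funext => x; have [d e] := is_derive_flat P x.
  have df : differentiable (flat P) x by apply/derivable1_diffP.
  rewrite deriveE// -[v]mulr1 [v * 1]/(v *: 1) linearZ/= -deriveE// e.
  by rewrite mulr1.
Qed.

(** One factor for each endpoint of [-1, 1], normalized by the value at 0. *)
Definition bump x : R := flat 1 (1 - x) * flat 1 (1 + x) / flat 1 1 ^+ 2.

Lemma bump_Ck k : Ck k bump.
Proof.
have Ck_id j : Ck j (id : R -> R) by apply: Ck_linear => // x; exact: cvg_id.
rewrite /bump; apply: CkM; last exact: Ck_cst.
apply: CkM; apply: (@Ck_comp _ _ k (flat 1)); try exact: flat_Ck.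
  have -> : (fun x : R => 1 - x) = (fun x => cst 1 x + cst (-1) x * id x).
    by apply/funext => x /=; rewrite mulN1r.
  apply: CkD; first exact: Ck_cst.
  by apply: CkM => //; exact: Ck_cst.
by apply: CkD => //; exact: Ck_cst.
Qed.

Lemma flat1_gt0 x : 0 < x -> 0 < flat 1 x.
Proof. by move=> x0; rewrite /flat x0 hornerC mul1r expR_gt0. Qed.

Lemma flat1_le0 x : x <= 0 -> flat 1 x = 0.
Proof. by move=> x0; rewrite /flat ltNge x0. Qed.

Lemma bump_gt0 x : `|x| < 1 -> 0 < bump x.
Proof.
rewrite ltr_norml => /andP[x1 x2]; rewrite /bump divr_gt0 ?exprn_gt0 ?mulr_gt0 ?flat1_gt0//.
  by rewrite subr_gt0.
by rewrite -ltrBlDl sub0r.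
Qed.

Lemma bump_out x : 1 <= `|x| -> bump x = 0.
Proof.
rewrite ler_normr => /orP[x1|x1]; rewrite /bump.
  by rewrite (@flat1_le0 (1 - x)) ?mul0r// subr_le0.
by rewrite (@flat1_le0 (1 + x)) ?mulr0 ?mul0r// -lerBrDl sub0r lerNr.
Qed.

Lemma bump_ge0 x : 0 <= bump x.
Proof. by have [/bump_gt0/ltW//|/bump_out->] := ltP `|x| 1. Qed.

Lemma bump_even x : bump (- x) = bump x.
Proof. by rewrite /bump opprK [X in X / _]mulrC. Qed.

Lemma bump0 : bump 0 = 1.
Proof.
by rewrite /bump subr0 addr0 -expr2 mulfV// expf_neq0// gt_eqF// flat1_gt0.
Qed.

End bump.

(** * Compactly supported functions and mollifiers *)

Section compact_support.
Context {R : realType} {V : normedModType R}.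
Implicit Types (f g : V -> R) (K D : set V).

Definition supp_in K f := forall z, ~ K z -> f z = 0.

Lemma test_intro K D f : smooth f -> compact K -> supp_in K f -> K `<=` D ->
  test_function D f.
Proof.
move=> sf cK fK KD.
have clK : closed K by apply: compact_closed => //; exact: norm_hausdorff.
have sub : closure [set x | f x != 0] `<=` K.
  rewrite [X in _ `<=` X](closure_id K).1//; apply: closure_subset => x /=.
  by apply: contraNP => /fK ->.
split=> //; last exact: subset_trans KD.
by apply: subclosed_compact cK sub; exact: closed_closure.
Qed.

Lemma test_elim D f : test_function D f ->
  exists K, [/\ smooth f, compact K, supp_in K f & K `<=` D].
Proof.
move=> [sf cK KD]; exists (closure [set x | f x != 0]); split => // z zK.
by apply: contrapT => /eqP fz; apply: zK; exact: subset_closure.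
Qed.

Lemma supp_in_derive K f v : compact K -> supp_in K f -> supp_in K ('D_v f).
Proof.
move=> cK fK z zK; apply: (@derive_out _ _ K) => //.
by apply: compact_closed => //; exact: norm_hausdorff.
Qed.

Lemma supp_in_bounded K f : continuous f -> compact K -> supp_in K f ->
  exists2 C, 0 <= C & forall z, `|f z| <= C.
Proof.
move=> cf cK fK.
have /compact_bounded[M [_ /(_ (`|M| + 1))]] : compact (f @` K).
  by apply: continuous_compact => //; exact: continuous_subspaceT.
move=> /(_ _)/= hM; exists (`|M| + 1) => [|z]; first by rewrite addr_ge0.
have [Kz|nK] := pselect (K z); last by rewrite fK// normr0 addr_ge0.
apply: hM; last by exists z.
by rewrite (le_lt_trans (ler_norm _))// ltrDl.
Qed.

Lemma supp_in_unif K f : continuous f -> compact K -> supp_in K f ->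
  forall e, 0 < e -> exists2 r, 0 < r & forall y z, `|y - z| < r -> `|f y - f z| <= e.
Proof.
move=> cf cK fK e e0.
have /compact_near_coveringP H := cK.
have {}H : \forall r \near (0 : R)^'+, K `<=` [set x | forall y, `|y - x| < r -> `|f y - f x| <= e].
  apply: (H _ _ (fun r x => forall y, `|y - x| < r -> `|f y - f x| <= e)) => x Kx.
  have e20 : 0 < e / 2 by rewrite divr_gt0.
  have /cvgrPdist_le/(_ _ e20)/nbhs_ballP[d /= d0 hd] := cf x.
  exists (ball x (d / 2), [set r | 0 < r < d / 2]) => /=.
    split; first by apply: nbhsx_ballx; rewrite divr_gt0.
    by near=> r; apply/andP; split; near: r; [exact: nbhs_right_gt|apply: nbhs_right_lt; rewrite divr_gt0].
  move=> [x' r] /= [hx' /andP[r0 rd]] y yx'.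
  have h1 := hd x'; have h2 := hd y.
  rewrite (le_trans (ler_distD (f x) _ _))// (splitr e) lerD//.
    rewrite distrC; apply: h2; rewrite -ball_normE /ball_/=.
    rewrite (le_lt_trans (ler_distD x' _ _))// (splitr d) ltrD//.
      by move: hx'; rewrite -ball_normE.
    by rewrite distrC (lt_trans yx').
  apply: h1; apply: le_ball hx'; rewrite ler_pdivrMr// ler_pMr// ler1n//.
near (0 : R)^'+ => r.
have r0 : 0 < r by near: r; exact: nbhs_right_gt.
have hr : K `<=` [set x | forall y, `|y - x| < r -> `|f y - f x| <= e] by near: r.
exists r => // y z yz.
have [Kz|nKz] := pselect (K z); first exact: hr.
have [Ky|nKy] := pselect (K y).
  by rewrite distrC; apply: hr => //; rewrite distrC.
by rewrite !fK// subrr normr0 ltW.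
Unshelve. all: by end_near. Qed.

Lemma compact_margin K D : compact K -> open D -> K `<=` D ->
  exists2 r, 0 < r & forall z y, K z -> `|y - z| < r -> D y.
Proof.
move=> cK oD KD.
have /compact_near_coveringP H := cK.
have {}H : \forall r \near (0 : R)^'+, K `<=` [set x | forall y, `|y - x| < r -> D y].
  apply: (H _ _ (fun r x => forall y, `|y - x| < r -> D y)) => x Kx.
  have /nbhs_ballP[d /= d0 hd] := open_nbhs_nbhs (conj oD (KD _ Kx)).
  exists (ball x (d / 2), [set r | 0 < r < d / 2]) => /=.
    split; first by apply: nbhsx_ballx; rewrite divr_gt0.
    by near=> r; apply/andP; split; near: r; [exact: nbhs_right_gt|apply: nbhs_right_lt; rewrite divr_gt0].
  move=> [x' r] /= [hx' /andP[r0 rd]] y yx'; apply: hd.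
  rewrite -ball_normE /ball_/=.
  rewrite (le_lt_trans (ler_distD x' _ _))// (splitr d) ltrD//.
    by move: hx'; rewrite -ball_normE.
  by rewrite distrC (lt_trans yx').
near (0 : R)^'+ => r.
exists r; first by near: r; exact: nbhs_right_gt.
have hr : K `<=` [set x | forall y, `|y - x| < r -> D y] by near: r.
by move=> z y Kz; exact: hr.
Unshelve. all: by end_near. Qed.

Lemma compact_add K L : compact K -> compact L -> compact [set z | exists2 x, K x & L (z - x)].
Proof.
move=> cK cL.
have -> : [set z | exists2 x, K x & L (z - x)] = (fun p : V * V => p.1 + p.2) @` (K `*` L).
  apply/seteqP; split => [z [x Kx Lz]|z [[x y] [/= Kx Ly] <-]].
    by exists (x, z - x) => //=; rewrite addrC subrK.
  by exists x => //; rewrite addrC addKr.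
apply: continuous_compact; last exact: compact_setX.
by apply: continuous_subspaceT => p; exact: add_continuous.
Qed.

End compact_support.

Section kernel.
Context {R : realType} (n : nat).
Local Notation dx := (@lebesgue_rV R n).
Local Notation dtx := (@lebesgue_prod R n dx).
Local Notation E := (R * 'rV[R]_n)%type.
Implicit Types (e : R) (z : E).

Definition ecoord (i : 'I_n) z : R := z.2 ord0 i.

Lemma smooth_fst : smooth (fun z : E => z.1).
Proof. by move=> k; apply: Ck_linear => // z; exact: cvg_fst. Qed.

Lemma coord_continuous_rV (i : 'I_n) : continuous (fun x : 'rV[R]_n => x ord0 i).
Proof. by move=> x; exact: coord_continuous. Qed.

Lemma smooth_ecoord i : smooth (ecoord i).
Proof.
move=> k; apply: Ck_linear; last by move=> a x y; rewrite /ecoord/= !mxE.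
move=> z; apply: (@continuous_comp _ _ _ snd (fun x : 'rV[R]_n => x ord0 i)).
  exact: cvg_snd.
exact: coord_continuous_rV.
Qed.

Definition cbox e : set E := [set z | `|z.1| <= e /\ forall i, `|ecoord i z| <= e].

Lemma cbox_compact e : compact (cbox e).
Proof.
have -> : cbox e = `[- e, e]%classic `*` [set x : 'rV[R]_n | forall i, `[- e, e]%classic (x ord0 i)].
  apply/seteqP; split => -[t x] /=.
    by move=> [h1 h2]; split=> [|i]; rewrite in_itv/= -ler_norml//; exact: h2.
  by rewrite in_itv/= -ler_norml => -[h1 h2]; split => // i; have := h2 i; rewrite /= in_itv/= -ler_norml.
apply: compact_setX; first exact: segment_compact.
exact: (@rV_compact _ _ (fun=> `[- e, e]%classic) (fun=> @segment_compact _ _ _)).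
Qed.

Definition kern e z : R := bump (z.1 / e) * \prod_(i < n) bump (ecoord i z / e).

Lemma kern_smooth e : smooth (kern e).
Proof.
have sc (l : E -> R) : smooth l -> smooth (fun z => bump (l z / e)).
  move=> sl; apply: (@smooth_comp _ _ bump (fun z => l z / e)); first exact: bump_Ck.
  by apply: smoothM => //; exact: smooth_cst.
apply: smoothM; first by apply: sc; exact: smooth_fst.
by apply: smooth_prod => i; apply: sc; exact: smooth_ecoord.
Qed.

Lemma kern_ge0 e z : 0 <= kern e z.
Proof. by rewrite mulr_ge0 ?bump_ge0// prodr_ge0// => i _; exact: bump_ge0. Qed.

Lemma kern_even e z : kern e (- z) = kern e z.
Proof.
rewrite /kern /= mulNr bump_even; congr (_ * _); apply: eq_bigr => i _.
by rewrite /ecoord/= mxE mulNr bump_even.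
Qed.

Lemma kern_supp e : 0 < e -> forall z, ~ ball (0 : E) e z -> kern e z = 0.
Proof.
move=> e0 z; rewrite E_ballP// !subr0 => /not_andP h.
have b (x : R) : ~ `|x| < e -> bump (x / e) = 0.
  move=> /negP; rewrite -leNgt => xe; apply: bump_out.
  by rewrite normrM normfV (gtr0_norm e0) ler_pdivlMr// mul1r.
rewrite /kern; case: h => [/b -> |/existsNP[i /b hi]]; first by rewrite mul0r.
by rewrite (bigD1 i)//= /ecoord hi mul0r mulr0.
Qed.

Lemma kern_gt0 e z : 0 < e -> ball (0 : E) e z -> 0 < kern e z.
Proof.
move=> e0; rewrite E_ballP// !subr0 => -[h1 h2].
have b (x : R) : `|x| < e -> 0 < bump (x / e).
  by move=> xe; apply: bump_gt0; rewrite normrM normfV (gtr0_norm e0) ltr_pdivrMr// mul1r.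
by rewrite mulr_gt0 ?b// prodr_gt0// => i _; rewrite b//; exact: h2.
Qed.

Lemma ball_cbox e : 0 < e -> ball (0 : E) e `<=` cbox e.
Proof.
move=> e0 z; rewrite E_ballP// !subr0 => -[h1 h2]; split; first exact: ltW.
by move=> i; exact/ltW/h2.
Qed.

Lemma kern_supp_in e : 0 < e -> supp_in (cbox e) (kern e).
Proof. by move=> e0 z zb; apply: kern_supp => // /(ball_cbox e0). Qed.

Lemma compact_measurable (K : set E) : compact K -> measurable K.
Proof.
by move=> cK; apply: closed_measurable_E; apply: compact_closed => //; exact: norm_hausdorff.
Qed.

Lemma compact_finite (K : set E) : compact K -> (dtx K < +oo)%E.
Proof. by move=> cK; apply: bounded_finite; [exact: compact_measurable|exact: compact_bounded]. Qed.

Lemma supp_in_integrable (K : set E) (f : E -> R) (C : R) : measurable K ->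
  (dtx K < +oo)%E -> measurable_fun setT f -> supp_in K f ->
  (forall z, `|f z| <= C) -> dtx.-integrable setT (EFin \o f).
Proof.
move=> mK Kf mf fK fC; apply: (@L1_dom _ _ _ _ _ measurableT _ (fun z => C * \1_K z)) => //.
  by apply: L1Zl => //; exact: L1_indic.
move=> z _; rewrite indicE; case: (boolP (z \in K)) => zK; first by rewrite mulr1.
by rewrite fK ?normr0 ?mulr0// => /mem_set; exact/negP.
Qed.

Lemma supp_in_integrable_cts (K : set E) (f : E -> R) : compact K -> continuous f ->
  supp_in K f -> dtx.-integrable setT (EFin \o f).
Proof.
move=> cK cf fK; have [C C0 hC] := supp_in_bounded cf cK fK.
apply: (@supp_in_integrable K _ C) => //; [exact: compact_measurable|exact: compact_finite|].
exact: continuous_measurable_E.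
Qed.

Lemma kern_int_gt0 e : 0 < e -> 0 < \int[dtx]_z kern e z.
Proof.
move=> e0; rewrite lt_neqAle Rintegral_ge0 ?andbT; last by move=> z _; exact: kern_ge0.
apply/eqP => /esym h.
have Ik := supp_in_integrable_cts (@cbox_compact e) (smooth_continuous (@kern_smooth e)) (kern_supp_in e0).
have h' : (\int[dtx]_z `|(EFin \o kern e) z| = 0)%E.
  rewrite -[LHS]fineK.
    congr EFin; rewrite -[RHS]h /Rintegral; congr fine; apply: eq_integral => z _.
    by rewrite /= ger0_norm// kern_ge0.
  by case/integrableP : Ik => _ Ik; rewrite ge0_fin_numE//; exact: integral_ge0.
have mk : measurable_fun setT (EFin \o kern e).
  by apply/measurable_EFinP; apply: continuous_measurable_E; apply: smooth_continuous; exact: kern_smooth.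
have [N [mN N0 hN]] := (ae_eq_integral_abs dtx measurableT mk).1 h'.
have := @ball_pos R n e e0.
rewrite (@subset_measure0 _ _ _ dtx _ N) ?ltxx//; first exact: measurable_E_ball.
move=> z zb; apply: hN => /(_ I)/= /eqP; rewrite eqe.
by rewrite gt_eqF// kern_gt0.
Qed.

Lemma smooth_measurable (D : set E) (f : E -> R) : smooth f -> measurable_fun D f.
Proof.
by move=> sf; apply: measurable_funTS; apply: continuous_measurable_E; exact: smooth_continuous.
Qed.

Definition rho e z : R := (\int[dtx]_y kern e y)^-1 * kern e z.

Lemma rho_smooth e : smooth (rho e).
Proof. by apply: smoothM; [exact: smooth_cst|exact: kern_smooth]. Qed.

Lemma rho_ge0 e z : 0 <= rho e z.
Proof.
by rewrite mulr_ge0 ?kern_ge0// invr_ge0 Rintegral_ge0// => y _; exact: kern_ge0.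
Qed.

Lemma rho_even e z : rho e (- z) = rho e z.
Proof. by rewrite /rho kern_even. Qed.

Lemma rho_supp e : 0 < e -> forall z, ~ ball (0 : E) e z -> rho e z = 0.
Proof. by move=> e0 z /(kern_supp e0) h; rewrite /rho h mulr0. Qed.

Lemma rho_supp_in e : 0 < e -> supp_in (cbox e) (rho e).
Proof. by move=> e0 z zb; apply: rho_supp => // /(ball_cbox e0). Qed.

Lemma rho_gt0 e z : 0 < e -> ball (0 : E) e z -> 0 < rho e z.
Proof. by move=> e0 b; rewrite mulr_gt0 ?kern_gt0// invr_gt0 kern_int_gt0. Qed.

Lemma rho_integrable e : 0 < e -> dtx.-integrable setT (EFin \o rho e).
Proof.
move=> e0; exact: (supp_in_integrable_cts (@cbox_compact e) (smooth_continuous (@rho_smooth e)) (rho_supp_in e0)).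
Qed.

Lemma rho_int1 e : 0 < e -> \int[dtx]_z rho e z = 1.
Proof.
move=> e0; rewrite /rho RintegralZl//; first by rewrite mulVf// gt_eqF// kern_int_gt0.
exact: (supp_in_integrable_cts (@cbox_compact e) (smooth_continuous (@kern_smooth e)) (kern_supp_in e0)).
Qed.

End kernel.

(** * Convolution and integration by parts *)

Section convolution.
Context {R : realType} (n : nat).
Local Notation dx := (@lebesgue_rV R n).
Local Notation dtx := (@lebesgue_prod R n dx).
Local Notation E := (R * 'rV[R]_n)%type.
Implicit Types (r f : E -> R) (K : set E) (z v : E).

Definition conv r f z : R := \int[dtx]_y (r (z - y) * f y).

Definition csmooth r := smooth r /\ exists2 K, compact K & supp_in K r.

Lemma csmooth_derive r v : csmooth r -> csmooth ('D_v r).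
Proof.
move=> [sr [K cK rK]]; split; first exact: smooth_derive.
by exists K => //; exact: supp_in_derive.
Qed.

Lemma measurable_subl r z : continuous r -> measurable_fun setT (fun y : E => r (z - y)).
Proof.
move=> cr; apply: continuous_measurable_E => y.
apply: (@continuous_comp _ _ _ (fun y : E => z - y) r); last exact: cr.
by apply: cvgB; [exact: cvg_cst|exact: cvg_id].
Qed.

Lemma csmooth_bounded r : csmooth r -> exists2 C, 0 <= C & forall z, `|r z| <= C.
Proof.
by move=> [sr [K cK rK]]; exact: supp_in_bounded (smooth_continuous sr) cK rK.
Qed.

Lemma conv_integrable r f z : csmooth r -> dtx.-integrable setT (EFin \o f) ->
  dtx.-integrable setT (EFin \o (fun y => r (z - y) * f y)).
Proof.
move=> hr If; have [C C0 hC] := csmooth_bounded hr.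
apply: (L1M_bounded measurableT (c := C)) => //.
exact: measurable_subl (smooth_continuous hr.1).
Qed.

Lemma conv_continuous r f : csmooth r -> dtx.-integrable setT (EFin \o f) ->
  continuous (conv r f).
Proof.
move=> hr If z; have [sr [K cK rK]] := hr.
apply/cvgrPdist_le => /= e e0.
pose c := \int[dtx]_y `|f y| + 1.
have c0 : 0 < c by rewrite ltr_wpDl// Rintegral_ge0.
have ec : 0 < e / c by rewrite divr_gt0.
have [d d0 hd] := supp_in_unif (smooth_continuous sr) cK rK ec.
apply: filterS (nbhsx_ballx z d d0) => y; rewrite -ball_normE /ball_/= => zy.
rewrite /conv -RintegralB//; [|exact: conv_integrable..].
apply: (@le_trans _ _ (\int[dtx]_x (e / c * `|f x|))).
  apply: Rintegral_abs_le => //.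
  - by apply: L1_measurable; apply: L1B => //; exact: conv_integrable.
  - by apply: L1Zl => //; exact: L1norm.
  - move=> x _; rewrite -mulrBl normrM ler_wpM2r// hd//.
    by rewrite opprB addrA subrK.
rewrite RintegralZl//; last exact: L1norm.
rewrite -mulrA ler_piMr ?(ltW e0)// mulrC ler_pdivrMr// mul1r /c lerDl//.
Qed.

(** Differentiation under the integral; the derivatives of r are bounded, and f
    is integrable. *)
Lemma conv_derive r f v z : csmooth r -> dtx.-integrable setT (EFin \o f) ->
  derivable (conv r f) z v /\ 'D_v (conv r f) z = conv ('D_v r) f z.
Proof.
move=> hr If; have hdr := csmooth_derive v hr.
have [C C0 hC] := csmooth_bounded hdr.
pose F (s : R) (y : E) := r (s *: v + z - y) * f y.
have dF (s : R) y : is_derive s (1 : R) (F ^~ y) ('D_v r (s *: v + z - y) * f y).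
  have e1 : F ^~ y = f y \*: (fun s : R => r (s *: v + (z - y))).
    by apply/funext => h; rewrite /F /= mulrC addrA.
  rewrite e1; have := @is_derive_line _ _ r (z - y) v s (@smooth_derivable _ _ _ _ _ hr.1).
  by move=> /(is_deriveZ (f y))/is_derive_eq; apply; rewrite [_ *: _]mulrC addrA.
have I0 : (`]-1, 1[ : set R)%classic 0 by rewrite /= in_itv/= oppr_lt0 ltr01.
have intF s : (`]-1, 1[ : set R)%classic s -> dtx.-integrable setT (EFin \o F s).
  by move=> _; exact: conv_integrable.
have derF s y : (`]-1, 1[ : set R)%classic s -> setT y -> derivable (F ^~ y) s 1.
  by move=> _ _; have [] := dF s y.
have G0 y : 0 <= C * `|f y| by rewrite mulr_ge0.
have IG : dtx.-integrable setT (EFin \o (fun y => C * `|f y|)).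
  by apply: L1Zl => //; exact: L1norm.
have Gub s y : (`]-1, 1[ : set R)%classic s -> setT y -> `|partial1of2 F s y| <= C * `|f y|.
  move=> _ _; rewrite partial1of2E; have [_ ->] := dF s y.
  by rewrite normrM ler_wpM2r.
have dU := derivable_under_integral measurableT I0 intF derF G0 IG Gub.
have eU := differentiation_under_integral measurableT I0 intF derF G0 IG Gub.
have [l1 e1] := derive_line (conv r f) z v.
split; first exact/l1.
rewrite e1 [LHS]eU; apply: eq_Rintegral => y _.
by rewrite partial1of2E; have [_ ->] := dF 0 y; rewrite scale0r add0r.
Qed.

Lemma conv_smooth r f : csmooth r -> dtx.-integrable setT (EFin \o f) -> smooth (conv r f).
Proof.
move=> hr If k; elim: k r hr => [|k IH] r hr.
  by split => //; exact: conv_continuous.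
apply/CkSP; split; first exact: conv_continuous.
  by move=> z v; exact: (conv_derive v z hr If).1.
move=> v; rewrite (_ : 'D_v _ = conv ('D_v r) f).
  by apply: IH; exact: csmooth_derive.
by apply/funext => z; exact: (conv_derive v z hr If).2.
Qed.

End convolution.

Section integration_by_parts.
Context {R : realType} (n : nat).
Local Notation dx := (@lebesgue_rV R n).
Local Notation dtx := (@lebesgue_prod R n dx).
Local Notation E := (R * 'rV[R]_n)%type.
Implicit Types (f g : E -> R) (K : set E) (z v : E).

Lemma csmooth_integrable f : csmooth f -> dtx.-integrable setT (EFin \o f).
Proof. by move=> [sf [K cK fK]]; exact: supp_in_integrable_cts cK (smooth_continuous sf) fK. Qed.

Lemma csmoothMl f g : smooth f -> csmooth g -> csmooth (fun z => f z * g z).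
Proof.
move=> sf [sg [K cK gK]]; split; first exact: smoothM.
by exists K => // z zK; rewrite gK ?mulr0.
Qed.

Lemma csmoothMr f g : csmooth f -> smooth g -> csmooth (fun z => f z * g z).
Proof.
move=> [sg [K cK gK]] sf; split; first exact: smoothM.
by exists K => // z zK; rewrite gK ?mul0r.
Qed.

(** Differentiate the integral of a translate of f, which is constant. *)
Lemma Rintegral_derive0_C1 f v K (C : R) : continuous f -> (forall z, derivable f z v) ->
  (forall z, `|'D_v f z| <= C) -> compact K -> supp_in K f ->
  \int[dtx]_z 'D_v f z = 0.
Proof.
move=> cf df hC cK fK; have C0 : 0 <= C by apply: le_trans (hC 0).
pose L : set E := (fun s : R => - (s *: v)) @` `[-1, 1]%classic.
have cL : compact L.
  apply: continuous_compact; last exact: segment_compact.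
  apply: continuous_subspaceT => s; apply: cvgN.
  by apply: cvgZr_tmp; exact: cvg_id.
have cK' := compact_add cK cL.
set K' := [set z | exists2 x, K x & L (z - x)] in cK'.
have hK' (s : R) z : s \in `]-1, 1[ -> ~ K' z -> ~ K (s *: v + z).
  move=> s1 zK' Ksz; apply: zK'; exists (s *: v + z) => //; exists s => /=.
    by apply: subset_itvW s1.
  by rewrite opprD addrCA subrr addr0.
have cs (s : R) : continuous (fun z : E => s *: v + z).
  by move=> z; apply: cvgD; [exact: cvg_cst|exact: cvg_id].
pose F (s : R) z := f (s *: v + z).
have I0 : (`]-1, 1[ : set R)%classic 0 by rewrite /= in_itv/= oppr_lt0 ltr01.
have intF s : (`]-1, 1[ : set R)%classic s -> dtx.-integrable setT (EFin \o F s).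
  move=> s1; apply: (supp_in_integrable_cts cK').
    by move=> z; apply: (@continuous_comp _ _ _ (fun z : E => s *: v + z) f); [exact: cs|exact: cf].
  by move=> z zK'; apply: fK; exact: hK'.
have dF (s : R) z : is_derive s (1 : R) (F ^~ z) ('D_v f (s *: v + z)).
  exact: is_derive_line.
have derF s z : (`]-1, 1[ : set R)%classic s -> setT z -> derivable (F ^~ z) s 1.
  by move=> _ _; have [] := dF s z.
have G0 z : 0 <= C * \1_K' z by rewrite mulr_ge0.
have IG : dtx.-integrable setT (EFin \o (fun z => C * \1_K' z)).
  by apply: L1Zl => //; apply: L1_indic => //; [exact: compact_measurable|exact: compact_finite].
have Gub s z : (`]-1, 1[ : set R)%classic s -> setT z -> `|partial1of2 F s z| <= C * \1_K' z.
  move=> s1 _; rewrite partial1of2E; have [_ ->] := dF s z.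
  rewrite indicE; case: (boolP (z \in K')) => zK; first by rewrite mulr1.
  have h : ~ K (s *: v + z) by apply: hK' => // /mem_set; exact/negP.
  by rewrite (supp_in_derive v cK fK h) normr0 mulr0.
have eU := differentiation_under_integral measurableT I0 intF derF G0 IG Gub.
have Fc : (fun s => \int[dtx]_z F s z) = cst (\int[dtx]_z f z).
  apply/funext => s; rewrite /F /=.
  under eq_Rintegral do rewrite addrC.
  by rewrite (Rintegral_E_shift (s *: v))//; exact: continuous_measurable_E.
rewrite Fc derive1_cst in eU; rewrite [RHS]eU.
apply: eq_Rintegral => z _; rewrite partial1of2E; have [_ ->] := dF 0 z.
by rewrite scale0r add0r.
Qed.

Lemma Rintegral_derive0 f v : csmooth f -> \int[dtx]_z 'D_v f z = 0.
Proof.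
move=> hf; have [sf [K cK fK]] := hf.
have [C _ hC] := csmooth_bounded (csmooth_derive v hf).
apply: (Rintegral_derive0_C1 (smooth_continuous sf) _ hC cK fK) => z.
exact: smooth_derivable.
Qed.

Lemma Rintegral_by_parts f g v : smooth f -> csmooth g ->
  \int[dtx]_z (f z * 'D_v g z) = - \int[dtx]_z (g z * 'D_v f z).
Proof.
move=> sf hg; have hfg := csmoothMl sf hg.
have /esym := Rintegral_derive0 v hfg.
rewrite (_ : \int[dtx]_z _ = \int[dtx]_z (f z * 'D_v g z + g z * 'D_v f z)); last first.
  by apply: eq_Rintegral => z _; rewrite derive_smoothM//; exact: hg.1.
rewrite RintegralD//.
- by move/eqP; rewrite eq_sym addr_eq0 => /eqP.
- by apply: csmooth_integrable; apply: csmoothMl => //; exact: csmooth_derive.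
- by apply: csmooth_integrable; apply: csmoothMr => //; exact: smooth_derive.
Qed.

End integration_by_parts.

(** * Mollification in Lebesgue spaces *)

Section mollification.
Context {R : realType} (n : nat).
Local Notation dx := (@lebesgue_rV R n).
Local Notation dtx := (@lebesgue_prod R n dx).
Local Notation E := (R * 'rV[R]_n)%type.
Local Notation L1 f := (dtx.-integrable setT (EFin \o f)).
Implicit Types (f g h : E -> R) (e : R) (K : set E) (z v : E).

Lemma rho_csmooth e : 0 < e -> csmooth (@rho R n e).
Proof. by move=> e0; split; [exact: rho_smooth|exists (cbox e); [exact: cbox_compact|exact: rho_supp_in]]. Qed.

Lemma measurable_sub_E : measurable_fun setT (fun p : E * E => p.1 - p.2).
Proof.
apply: measurable_fun_pair.
  apply: measurable_funB; apply: (measurableT_comp measurable_fst).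
    exact: measurable_fst.
  exact: measurable_snd.
apply: measurable_fun_rV => i; under eq_fun do rewrite !mxE.
by apply: measurable_funB; apply: (measurableT_comp (measurable_coord i));
  apply: (measurableT_comp measurable_snd); [exact: measurable_fst|exact: measurable_snd].
Qed.

(** Tonelli's theorem and translation invariance. *)
Lemma conv_mass e h : 0 < e -> L1 h -> (forall z, 0 <= h z) ->
  L1 (conv (rho e) h) /\ \int[dtx]_z conv (rho e) h z = \int[dtx]_z h z.
Proof.
move=> e0 Ih h0.
have mrho : measurable_fun setT (@rho R n e).
  by apply: continuous_measurable_E; apply: smooth_continuous; exact: rho_smooth.
have mh := L1_measurable Ih.
pose P (p : E * E) : \bar R := (rho e (p.1 - p.2) * h p.2)%:E.
have mP : measurable_fun setT P.
  apply/measurable_EFinP; apply: measurable_funM.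
    exact: (measurableT_comp mrho measurable_sub_E).
  exact: (measurableT_comp mh measurable_snd).
have P0 p : (0 <= P p)%E by rewrite lee_fin mulr_ge0// rho_ge0.
have T1 := fubini_tonelli (m1 := dtx) (m2 := dtx) _ mP P0.
have eL z : (\int[dtx]_y P (z, y) = (conv (rho e) h z)%:E)%E.
  rewrite /conv /Rintegral fineK//; apply: integrable_fin_num => //.
  exact: (conv_integrable z (rho_csmooth e0) Ih).
have eR y : (\int[dtx]_z P (z, y) = (h y)%:E)%E.
  rewrite /P /=.
  under eq_integral do rewrite EFinM.
  rewrite ge0_integralZr//=; last 3 first.
  - apply/measurable_EFinP; apply: (measurableT_comp mrho); exact: measurable_shift_E.
  - by move=> z _; rewrite lee_fin rho_ge0.
  - by rewrite lee_fin.
  rewrite (integral_E_shift (- y) (f := EFin \o rho e)); last 2 first.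
  - exact/measurable_EFinP.
  - by move=> z; rewrite lee_fin rho_ge0.
  rewrite -[X in (X * _)%E]fineK.
    by rewrite [fine _](rho_int1 n e0) mul1e.
  by apply: integrable_fin_num => //; exact: rho_integrable.
have T2 : (\int[dtx]_z (conv (rho e) h z)%:E = \int[dtx]_y (h y)%:E)%E.
  under eq_integral do rewrite -eL.
  by rewrite T1; apply: eq_integral => y _; exact: eR.
split; last by rewrite /Rintegral T2.
apply/integrableP; split.
  apply/measurable_EFinP; apply: continuous_measurable_E.
  exact: conv_continuous (rho_csmooth e0) Ih.
have [_ hlt] := integrableP _ _ _ Ih.
under eq_integral => z _.
  rewrite gee0_abs; last by rewrite lee_fin Rintegral_ge0// => y _; rewrite mulr_ge0// rho_ge0.
  over.
rewrite T2; apply: le_lt_trans hlt; rewrite le_eqVlt; apply/orP; left; apply/eqP.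
by apply: eq_integral => z _; rewrite gee0_abs// lee_fin.
Qed.

Lemma conv_abs e f z : 0 < e -> L1 f -> `|conv (rho e) f z| <= conv (rho e) (fun y => `|f y|) z.
Proof.
move=> e0 If; have I2 := conv_integrable z (rho_csmooth e0) If.
apply: Rintegral_abs_le => //; first exact: L1_measurable I2.
  by apply: conv_integrable (rho_csmooth e0) _; exact: L1norm.
by move=> y _; rewrite normrM (ger0_norm (rho_ge0 _ _)).
Qed.

(** The graph of a ^ q lies above its tangent at y; this is Young's inequality,
    rearranged. *)
Lemma powR_tangent (q a y : R) : 1 < q -> 0 <= a -> 0 <= y ->
  q * y `^ (q - 1) * a - (q - 1) * y `^ q <= a `^ q.
Proof.
move=> q1 a0 y0; have q0 : 0 < q by rewrite (lt_trans _ q1).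
have p0 : 0 < q / (q - 1) by rewrite divr_gt0// subr_gt0.
have := @conjugate_powR R a (y `^ (q - 1)) q (q / (q - 1)) a0 (powR_ge0 _ _) q0 p0.
have -> : q^-1 + (q / (q - 1))^-1 = 1 by field; rewrite subr_eq0 !gt_eqF.
move=> /(_ erefl).
rewrite -powRrM mulrCA mulfV ?mulr1; last by rewrite subr_eq0 gt_eqF.
rewrite -(ler_pM2l q0) => h; rewrite lerBlDr (_ : q * _ * a = q * (a * y `^ (q - 1))); last by ring.
apply: le_trans h _; rewrite le_eqVlt; apply/orP; left; apply/eqP.
by field; rewrite subr_eq0 !gt_eqF.
Qed.

Lemma rho_shift e z : 0 < e ->
  L1 (fun y => rho e (z - y)) /\ \int[dtx]_y rho e (z - y) = 1.
Proof.
move=> e0; have E1 : (fun y => rho e (z - y)) = (fun y => rho e (y + - z)).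
  by apply/funext => y; rewrite -rho_even opprB.
have mrho : measurable_fun setT (@rho R n e).
  by apply: continuous_measurable_E; apply: smooth_continuous; exact: rho_smooth.
rewrite E1; split; last first.
  by rewrite (Rintegral_E_shift (- z)) ?(rho_int1 n e0).
apply/integrableP; split.
  by apply/measurable_EFinP; apply: (measurableT_comp mrho); exact: measurable_shift_E.
have [_] := integrableP _ _ _ (@rho_integrable R n e e0).
rewrite -(integral_E_shift (- z) (f := fun z => `|(EFin \o rho e) z|%E))//.
by apply: measurableT_comp => //; exact/measurable_EFinP.
Qed.

(** Jensen's inequality for the probability density of the kernel: integrate the
    tangent inequality at the value of the convolution. *)
Lemma conv_jensen (q : R) e f z : 1 < q -> 0 < e -> L1 f -> L1 (fun y => `|f y| `^ q) ->
  `|conv (rho e) f z| `^ q <= conv (rho e) (fun y => `|f y| `^ q) z.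
Proof.
move=> q1 e0 If Ifq; set y := conv (rho e) (fun y => `|f y|) z.
have y0 : 0 <= y by apply: Rintegral_ge0 => x _; rewrite mulr_ge0// rho_ge0.
have q0 : 0 <= q by rewrite ltW// (lt_trans _ q1).
apply: (@le_trans _ _ (y `^ q)).
  by apply: ge0_ler_powR => //; rewrite ?nnegrE//; exact: conv_abs.
have I1 := conv_integrable z (rho_csmooth e0) (L1norm If).
have I2 := conv_integrable z (rho_csmooth e0) Ifq.
have [I3 i3] := rho_shift z e0.
apply: (@le_trans _ _ (\int[dtx]_x (q * y `^ (q - 1) * (rho e (z - x) * `|f x|) - (q - 1) * y `^ q * rho e (z - x)))).
  rewrite RintegralB//; last 2 first.
  - exact: L1Zl.
  - exact: L1Zl.
  rewrite (RintegralZl _ measurableT I1) (RintegralZl _ measurableT I3) i3 mulr1 -[X in q * _ * X]/y.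
  rewrite -(mulr_powRB1 y0 (lt_trans ltr01 q1)).
  by rewrite le_eqVlt; apply/orP; left; apply/eqP; ring.
apply: le_Rintegral => //.
  by apply: L1B => //; exact: L1Zl.
move=> x _; rewrite mulrCA [X in _ - X]mulrC -mulrBr ler_wpM2l ?rho_ge0//.
exact: powR_tangent.
Qed.

Lemma conv_Lq (q : R) e f : 1 < q -> 0 < e -> L1 f -> L1 (fun y => `|f y| `^ q) ->
  L1 (fun z => `|conv (rho e) f z| `^ q) /\
  \int[dtx]_z (`|conv (rho e) f z| `^ q) <= \int[dtx]_z (`|f z| `^ q).
Proof.
move=> q1 e0 If Ifq.
have [I1 i1] := conv_mass e0 Ifq (fun z => powR_ge0 _ _).
have mc : measurable_fun setT (fun z => `|conv (rho e) f z| `^ q).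
  apply: measurable_powR_comp.
  apply: measurableT_comp => //; apply: continuous_measurable_E.
  exact: conv_continuous (rho_csmooth e0) If.
have I2 : L1 (fun z => `|conv (rho e) f z| `^ q).
  apply: (L1_dom measurableT mc I1) => z _.
  by rewrite ger0_norm ?powR_ge0//; exact: conv_jensen.
split => //; rewrite -i1; apply: le_Rintegral => // z _; exact: conv_jensen.
Qed.

Lemma conv_L1 e f : 0 < e -> L1 f -> L1 (conv (rho e) f) /\
  \int[dtx]_z `|conv (rho e) f z| <= \int[dtx]_z `|f z|.
Proof.
move=> e0 If.
have [I1 i1] := conv_mass e0 (L1norm If) (fun z => normr_ge0 _).
have mc : measurable_fun setT (conv (rho e) f).
  by apply: continuous_measurable_E; exact: conv_continuous (rho_csmooth e0) If.
have I2 : L1 (conv (rho e) f).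
  by apply: (L1_dom measurableT mc I1) => z _; exact: conv_abs.
split => //; rewrite -i1; apply: le_Rintegral => //; first exact: L1norm.
by move=> z _; exact: conv_abs.
Qed.

Lemma conv_le e f (C : R) z : 0 < e -> L1 f -> (forall y, `|f y| <= C) ->
  `|conv (rho e) f z| <= C.
Proof.
move=> e0 If fC; have [I3 i3] := rho_shift z e0.
rewrite -[C]mulr1 -i3 -RintegralZl//; apply: Rintegral_abs_le => //.
- exact: L1_measurable (conv_integrable z (rho_csmooth e0) If).
- exact: L1Zl.
- by move=> y _; rewrite normrM (ger0_norm (rho_ge0 _ _)) mulrC ler_wpM2r ?rho_ge0.
Qed.

Lemma conv_supp e f K : 0 < e -> supp_in K f ->
  supp_in [set z | exists2 x, K x & cbox e (z - x)] (conv (rho e) f).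
Proof.
move=> e0 fK z zK.
transitivity (\int[dtx]_y (0 : R)); last by rewrite Rintegral_cst// mul0r.
apply: eq_Rintegral => y _.
have [Ky|nK] := pselect (K y); last by rewrite fK// mulr0.
rewrite (@rho_supp_in _ _ e e0 (z - y)) ?mul0r// => b; apply: zK.
by exists y.
Qed.

End mollification.

Import HBSimple.

Section density.
Context {R : realType} (n : nat).
Local Notation dx := (@lebesgue_rV R n).
Local Notation dtx := (@lebesgue_prod R n dx).
Local Notation E := (R * 'rV[R]_n)%type.
Variable D : set E.
Hypotheses (mD : measurable D) (finD : (dtx D < +oo)%E).
Local Notation L1 f := (dtx.-integrable D (EFin \o f)).
Implicit Types (f g psi : E -> R) (A : set E).

Definition bunif psi := (exists C, forall z, `|psi z| <= C) /\
  forall e, 0 < e -> exists2 r, 0 < r & forall y z : E, `|y - z| < r -> `|psi y - psi z| <= e.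

Lemma bunif_continuous psi : bunif psi -> continuous psi.
Proof.
move=> [_ h] z; apply/cvgrPdist_le => e /h[r r0 hr].
by apply: filterS (nbhsx_ballx z r r0) => y; rewrite -ball_normE => /hr.
Qed.

Lemma bunif_measurable psi : bunif psi -> measurable_fun setT psi.
Proof. by move=> /bunif_continuous; exact: continuous_measurable_E. Qed.

Lemma bunifD f g : bunif f -> bunif g -> bunif (fun z => f z + g z).
Proof.
move=> [[C hC] uf] [[C' hC'] ug]; split.
  by exists (C + C') => z; rewrite (le_trans (ler_normD _ _))// lerD.
move=> e e0; have e20 : 0 < e / 2 by rewrite divr_gt0.
have [r r0 hr] := uf _ e20; have [s s0 hs] := ug _ e20.
exists (Num.min r s); first by rewrite lt_min r0.
move=> y z; rewrite lt_min => /andP[/hr h1 /hs h2].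
by rewrite opprD addrACA (le_trans (ler_normD _ _))// (splitr e) lerD.
Qed.

Lemma bunifM f g : bunif f -> bunif g -> bunif (fun z => f z * g z).
Proof.
move=> [[C hC] uf] [[C' hC'] ug].
have c0 : 0 <= C by apply: le_trans (hC 0).
have c0' : 0 <= C' by apply: le_trans (hC' 0).
split; first by exists (C * C') => z; rewrite normrM ler_pM.
move=> e e0; have e20 : 0 < e / 2 by rewrite divr_gt0.
have e1 : 0 < e / 2 / (C' + 1) by rewrite divr_gt0// ltr_wpDl.
have e2 : 0 < e / 2 / (C + 1) by rewrite divr_gt0// ltr_wpDl.
have [r r0 hr] := uf _ e1; have [s s0 hs] := ug _ e2.
exists (Num.min r s); first by rewrite lt_min r0.
move=> y z; rewrite lt_min => /andP[/hr h1 /hs h2].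
have -> : f y * g y - f z * g z = (f y - f z) * g y + f z * (g y - g z) by ring.
rewrite (le_trans (ler_normD _ _))// !normrM (splitr e) lerD//.
  apply: (@le_trans _ _ (e / 2 / (C' + 1) * (C' + 1))); last by rewrite mulfVK// gt_eqF// ltr_wpDl.
  by rewrite ler_pM// (le_trans (hC' _))// lerDl.
apply: (@le_trans _ _ ((C + 1) * (e / 2 / (C + 1)))); last by rewrite mulrC mulfVK// gt_eqF// ltr_wpDl.
by rewrite ler_pM// (le_trans (hC _))// lerDl.
Qed.

Lemma bunif_cst c : bunif (cst c).
Proof.
split; first by exists `|c|.
by move=> e e0; exists 1 => // y z _; rewrite subrr normr0 ltW.
Qed.

Lemma bunif_L1 psi : bunif psi -> L1 psi.
Proof.
move=> h; have [[C hC] _] := h.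
apply: (@L1_dom _ _ _ _ _ mD _ (fun z => C * \1_D z)) => //.
- by apply: measurable_funTS; exact: bunif_measurable.
- by apply: L1Zl => //; exact: L1_indic.
- by move=> z Dz; rewrite indicE mem_set// mulr1.
Qed.

Lemma indic_L1 A : measurable A -> L1 (\1_A : E -> R).
Proof.
move=> mA; apply: (L1_dom (g := fun z => cst 1 z) mD).
- exact: measurable_funTS (measurable_indic mA).
- exact: bunif_L1 (bunif_cst 1).
- by move=> z _; rewrite indicE; case: (_ \in _); rewrite /= ?normr1 ?normr0.
Qed.

(** Approximation in the mean by bounded uniformly continuous functions. Uniform
    continuity, rather than compact support, is what is stable under the
    operations below. *)
Definition approx f := L1 f /\ forall e, 0 < e -> exists2 psi, bunif psi &
  \int[dtx]_(z in D) `|f z - psi z| <= e.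

Lemma approx_lim f : L1 f ->
  (forall e, 0 < e -> exists2 g, approx g & \int[dtx]_(z in D) `|f z - g z| <= e) -> approx f.
Proof.
move=> If h; split => // e e0; have e20 : 0 < e / 2 by rewrite divr_gt0.
have [g [Ig ag] hg] := h _ e20; have [psi up hp] := ag _ e20.
have Ip := bunif_L1 up.
exists psi => //; rewrite (splitr e); apply: le_trans (lerD hg hp).
rewrite -RintegralD//; [|exact/L1norm/L1B|exact/L1norm/L1B].
apply: le_Rintegral => //; first exact/L1norm/L1B.
  by apply: L1D => //; exact/L1norm/L1B.
by move=> z _; exact: ler_distD.
Qed.

Lemma approx_bunif f : bunif f -> approx f.
Proof.
move=> uf; split; first exact: bunif_L1.
move=> e e0; exists f => //; under eq_Rintegral do rewrite subrr normr0.
by rewrite Rintegral_cst// mul0r ltW.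
Qed.

Lemma approx_cvg f (f_ : nat -> E -> R) (C : R) : (forall k, approx (f_ k)) ->
  (forall z, D z -> f_ ^~ z @ \oo --> f z) -> (forall k z, D z -> `|f_ k z| <= C) ->
  L1 f -> approx f.
Proof.
move=> af ff fC If; apply: approx_lim => // e e0.
have Ic : L1 (fun z => `|f z| + C).
  by apply: L1D; [by []|exact: L1norm|]; apply: bunif_L1; exact: bunif_cst.
have mf k : measurable_fun D (f_ k) by exact: L1_measurable (af k).1.
have mff := L1_measurable If.
have : (fun k => \int[dtx]_(z in D) `|f z - f_ k z|) @ \oo --> \int[dtx]_(z in D) (0 : R).
  apply: (DCT_R mD (g := fun z => `|f z| + C)) => //.
  - by move=> k; apply: measurableT_comp => //; exact: measurable_funB.
  - move=> z Dz; rewrite -[X in _ --> X](normr0 R) -(subrr (f z)).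
    by apply: cvg_norm; apply: cvgB; [exact: cvg_cst|exact: ff].
  - move=> k z Dz; rewrite normr_id (le_trans (ler_normB _ _))// lerD2l.
    exact: fC.
rewrite Rintegral_cst// mul0r => /cvgrPdist_le/(_ _ e0)[k _ hk].
exists (f_ k) => //; have := hk k (leqnn k); rewrite sub0r normrN.
exact: le_trans (ler_norm _).
Qed.

Lemma approxD f g : approx f -> approx g -> approx (fun z => f z + g z).
Proof.
move=> [If af] [Ig ag]; split; first exact: L1D.
move=> e e0; have e20 : 0 < e / 2 by rewrite divr_gt0.
have [p up hp] := af _ e20; have [q uq hq] := ag _ e20.
have Ip := bunif_L1 up; have Iq := bunif_L1 uq.
exists (fun z => p z + q z); first exact: bunifD.
rewrite (splitr e); apply: le_trans (lerD hp hq).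
rewrite -RintegralD//; [|exact/L1norm/L1B|exact/L1norm/L1B].
apply: le_Rintegral => //.
- by apply/L1norm/L1B => //; exact: L1D.
- by apply: L1D => //; exact/L1norm/L1B.
- by move=> z _; rewrite opprD addrACA ler_normD.
Qed.

Lemma approxMb f g (C : R) : approx f -> approx g -> (forall z, D z -> `|g z| <= C) ->
  approx (fun z => f z * g z).
Proof.
move=> [If af] [Ig ag] gC.
have If' : L1 (fun z => f z * g z).
  by under eq_fun do rewrite mulrC; apply: (L1M_bounded mD (c := C)) => //; exact: L1_measurable Ig.
split => // e e0; have e20 : 0 < e / 2 by rewrite divr_gt0.
have e1 : 0 < e / 2 / (`|C| + 1) by rewrite divr_gt0// ltr_wpDl.
have [p up hp] := af _ e1.
have [[C' hC'] _] := up.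
have c0' : 0 <= C' by apply: le_trans (hC' 0).
have e2 : 0 < e / 2 / (C' + 1) by rewrite divr_gt0// ltr_wpDl.
have [q uq hq] := ag _ e2.
have Ip := bunif_L1 up; have Iq := bunif_L1 uq.
exists (fun z => p z * q z); first exact: bunifM.
have I1 : L1 (fun z => (`|C| + 1) * `|f z - p z|) by apply: L1Zl => //; exact/L1norm/L1B.
have I2 : L1 (fun z => (C' + 1) * `|g z - q z|) by apply: L1Zl => //; exact/L1norm/L1B.
apply: (@le_trans _ _ (\int[dtx]_(z in D) ((`|C| + 1) * `|f z - p z| + (C' + 1) * `|g z - q z|))).
  apply: le_Rintegral => //.
  - by apply/L1norm/L1B => //; apply: bunif_L1; exact: bunifM.
  - exact: L1D.
  - move=> z Dz; have -> : f z * g z - p z * q z = g z * (f z - p z) + p z * (g z - q z) by ring.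
    rewrite (le_trans (ler_normD _ _))// !normrM lerD// ler_wpM2r//.
      by rewrite (le_trans (gC _ Dz))// (le_trans (ler_norm _))// lerDl.
    by rewrite (le_trans (hC' _))// lerDl.
rewrite RintegralD// !RintegralZl//; [|exact/L1norm/L1B|exact/L1norm/L1B].
rewrite (splitr e) lerD//.
  by rewrite mulrC -ler_pdivlMr// ltr_wpDl.
by rewrite mulrC -ler_pdivlMr// ltr_wpDl.
Qed.

Definition approx_set A := measurable A /\ approx (\1_A : E -> R).

Lemma approx_setT : approx_set setT.
Proof. by split => //; rewrite indicT; apply: approx_bunif; exact: bunif_cst. Qed.

Lemma approx_setC A : approx_set A -> approx_set (~` A).
Proof.
move=> [mA aA]; split; first exact: measurableC.
rewrite (_ : \1_(~` A) = (fun z => cst 1 z + cst (-1) z * \1_A z)); last first.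
  apply/funext => z; rewrite !indicE /= in_setC; case: (z \in A) => /=; ring.
apply: approxD; first by apply: approx_bunif; exact: bunif_cst.
apply: (@approxMb _ _ 1) => //; first by apply: approx_bunif; exact: bunif_cst.
by move=> z _; rewrite indicE; case: (_ \in _); rewrite ?normr1 ?normr0.
Qed.

Lemma approx_setI A B : approx_set A -> approx_set B -> approx_set (A `&` B).
Proof.
move=> [mA aA] [mB aB]; split; first exact: measurableI.
rewrite indicI; apply: (@approxMb _ _ 1) => //.
by move=> z _; rewrite indicE; case: (_ \in _); rewrite ?normr1 ?normr0.
Qed.

Lemma approx_bigcup (F : nat -> set E) : (forall k, approx_set (F k)) -> approx_set (\bigcup_k F k).
Proof.
move=> aF; have mU : measurable (\bigcup_k F k) by apply: bigcup_measurable => k _; exact: (aF k).1.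
split => //.
have aU k : approx_set (\big[setU/set0]_(i < k) F i).
  elim: k => [|k IH].
    rewrite big_ord0 -setCT; apply: approx_setC; exact: approx_setT.
  rewrite big_ord_recr /= -[_ `|` _]setCK setCU; apply: approx_setC.
  by apply: approx_setI; apply: approx_setC.
apply: (@approx_cvg _ (fun k => \1_(\big[setU/set0]_(i < k) F i)) 1).
- by move=> k; exact: (aU k).2.
- move=> z _; apply: cvg_near_cst; rewrite !indicE.
  case: (boolP (z \in \bigcup_k F k)) => [/set_mem[k _ Fk]|zU].
    exists k.+1 => // m /= km; rewrite indicE mem_set//.
    by rewrite -bigcup_mkord; exists k.
  apply: nearW => k; rewrite indicE (_ : (z \in _) = false)//; apply: contraNF zU => /set_mem.
  by rewrite -bigcup_mkord => -[i _ Fi]; apply/mem_set; exists i.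
- by move=> k z _; rewrite indicE; case: (_ \in _); rewrite ?normr1 ?normr0.
- exact: indic_L1.
Qed.

(** The indicator of {c < l} is the limit of the Lipschitz functions obtained by
    truncating k (l - c) to [0, 1]. *)
Lemma approx_half (l : E -> R) (c : R) : measurable_fun setT l ->
  (forall y z : E, `|l y - l z| <= `|y - z|) -> approx_set [set z | c < l z].
Proof.
move=> ml hl; have mA : measurable [set z | c < l z].
  rewrite (_ : [set z | _] = setT `&` l @^-1` `]c, +oo[%classic).
    exact: ml.
  by apply/seteqP; split => z /=; rewrite in_itv/= andbT; [split|case].
split => //.
pose th k (z : E) : R := Num.min 1 (Num.max 0 (k%:R * (l z - c))).
have lip k y z : `|th k y - th k z| <= k%:R * `|y - z|.
  apply: (@le_trans _ _ `|k%:R * (l y - c) - k%:R * (l z - c)|); last first.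
    by rewrite -mulrBr opprB addrA subrK normrM ger0_norm// ler_wpM2l.
  rewrite /th; move: (k%:R * (l y - c)) (k%:R * (l z - c)) => a b.
  wlog ba : a b / b <= a => [H|].
    case/orP: (le_total b a) => ba; first exact: H.
    by rewrite distrC (distrC a); exact: H.
  rewrite (ger0_norm (_ : 0 <= a - b)) ?subr_ge0// ler_norml.
  by case: (lerP 0 a) => a0; case: (lerP 0 b) => b0; (case: (lerP 1 a) => a1 || idtac);
    (case: (lerP 1 b) => b1 || idtac); (case: (lerP 1 0) => c1 || idtac); apply/andP; split; lra.
have th01 k z : 0 <= th k z <= 1.
  by rewrite /th le_min ler01 le_max lexx ge_min lexx.
apply: (@approx_cvg _ th 1).
- move=> k; apply: approx_bunif; split.
    by exists 1 => z; have /andP[h1 h2] := th01 k z; rewrite ger0_norm.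
  move=> e e0; exists (e / k.+1%:R); first by rewrite divr_gt0.
  move=> y z yz; apply: le_trans (lip k y z) _.
  apply: (@le_trans _ _ (k.+1%:R * (e / k.+1%:R))); last by rewrite mulrCA mulfV ?mulr1.
  by apply: ler_pM => //; [rewrite ler_nat|exact: ltW].
- move=> z _; rewrite indicE; case: (boolP (z \in _)) => [/set_mem/= cz|/negP zc].
    have lc : 0 < l z - c by rewrite subr_gt0.
    apply: cvg_near_cst; near=> k.
    rewrite /th max_r; last by rewrite mulr_ge0// ltW.
    rewrite min_l// -ler_pdivrMr// mul1r; near: k; exact: nbhs_infty_ger.
  have zc' : l z <= c by rewrite leNgt; apply/negP => h; apply: zc; exact: mem_set.
  apply: cvg_near_cst; apply: nearW => k; rewrite /th max_l ?min_r//.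
  by rewrite mulr_ge0_le0// subr_le0.
- by move=> k z _; have /andP[h1 h2] := th01 k z; rewrite ger0_norm.
- exact: indic_L1.
Unshelve. all: by end_near. Qed.

Lemma approx_preim (l : E -> R) : measurable_fun setT l ->
  (forall y z : E, `|l y - l z| <= `|y - z|) ->
  forall B, measurable B -> approx_set (l @^-1` B).
Proof.
move=> ml hl B mB.
have {mB} : (@ocitv R).-sigma.-measurable B by exact: mB.
rewrite RGenOInfty.measurableE.
have : <<s @RGenOInfty.G R >> `<=` [set B | approx_set (l @^-1` B)].
  apply: smallest_sub.
    split => [|A|F aF] /=.
    - by rewrite preimage_set0 -setCT; apply: approx_setC; exact: approx_setT.
    - by rewrite setTD preimage_setC; exact: approx_setC.
    - by rewrite preimage_bigcup; exact: approx_bigcup.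
  move=> _ [c ->] /=; have := approx_half c ml hl.
  rewrite (_ : [set z | _] = l @^-1` `]c, +oo[%classic)//.
  by apply/seteqP; split => z /=; rewrite in_itv/= andbT.
exact.
Qed.

(** The sets with this property form a sigma-algebra that contains the half-
    spaces, hence the preimages of Borel sets by the coordinates. *)
Lemma approx_measurable A : measurable A -> approx_set A.
Proof.
have h1 (B : set R) : measurable B -> approx_set (fst @^-1` B).
  apply: approx_preim; first exact: measurable_fst.
  by move=> y z; rewrite [leRHS]prod_normE le_max lexx.
have h2 (B : set 'rV[R]_n) : measurable B -> approx_set (snd @^-1` B).
  have : <<s \big[setU/set0]_(i < n) preimage_set_system setT (fun x : 'rV[R]_n => x ord0 i)
    measurable >> `<=` [set B | approx_set (snd @^-1` B)].
    apply: smallest_sub.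
      split => [|A' |F aF] /=.
      - by rewrite preimage_set0 -setCT; apply: approx_setC; exact: approx_setT.
      - by rewrite setTD preimage_setC; exact: approx_setC.
      - by rewrite preimage_bigcup; exact: approx_bigcup.
    rewrite -bigcup_seq; apply: bigcup_sub => i _ _ [C mC <-] /=.
    rewrite setTI; apply: (@approx_preim (fun z : E => z.2 ord0 i)) => //.
      exact: (measurableT_comp (measurable_coord i) measurable_snd).
    move=> y z; rewrite [leRHS]prod_normE le_max; apply/orP; right.
    rewrite [leRHS]mx_normrE.
    have -> : y.2 ord0 i - z.2 ord0 i = (y - z).2 ord0 i by rewrite !mxE.
    exact: (le_bigmax _ (fun ij => `|(y - z).2 ij.1 ij.2|) (ord0, i)).
  exact.
have : <<s preimage_set_system setT (@fst R 'rV[R]_n) measurable `|`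
    preimage_set_system setT (@snd R 'rV[R]_n) measurable >> `<=` [set B | approx_set B].
  apply: smallest_sub.
    split => [|A' |F aF] /=.
    - by rewrite -setCT; apply: approx_setC; exact: approx_setT.
    - by rewrite setTD; exact: approx_setC.
    - exact: approx_bigcup.
  by move=> _ [[B mB <-]|[B mB <-]]; rewrite setTI; [exact: h1|exact: h2].
exact.
Qed.

Lemma approx_L1 f : L1 f -> approx f.
Proof.
move=> If; apply: approx_lim => // e e0.
have [g [Ig gf gl]] := approximation_sfun_integrable mD If.
have Ig' k : L1 (g k) by exact: Ig.
have {}gl : (fun k => \int[dtx]_(z in D) `|f z - g k z|) @ \oo --> 0.
  have := fine_cvg gl; rewrite /=.
  exact.
have /cvgrPdist_le/(_ _ e0)[k _ hk] := gl.
exists (g k); last first.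
  have := hk k (leqnn k); rewrite sub0r normrN; exact: le_trans (ler_norm _).
have -> : (g k : E -> R) = (fun z => \sum_(y <- finmap.enum_fset (fset_set (range (g k)))) (y * \1_(g k @^-1` [set y]) z)).
  by apply/funext => z; rewrite [LHS]fimfunE fsbig_finite.
elim: (finmap.enum_fset _) => [|y s IH].
  by under eq_fun do rewrite big_nil; apply: approx_bunif; exact: (bunif_cst 0).
under eq_fun do rewrite big_cons; apply: approxD => //.
have aA := approx_measurable (measurable_sfunP (g k) (measurable_set1 y)).
apply: (@approxMb (cst y) _ 1); [by apply: approx_bunif; exact: bunif_cst|exact: aA.2|].
by move=> z _; rewrite indicE; case: (_ \in _); rewrite ?normr1 ?normr0.
Qed.

End density.

Section mollification_limit.
Context {R : realType} (n : nat).
Local Notation dx := (@lebesgue_rV R n).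
Local Notation dtx := (@lebesgue_prod R n dx).
Local Notation E := (R * 'rV[R]_n)%type.
Local Notation L1 f := (dtx.-integrable setT (EFin \o f)).

Lemma restrict_L1 (D : set E) (f : E -> R) : measurable D ->
  dtx.-integrable D (EFin \o f) -> L1 (f \_ D).
Proof.
move=> mD If; rewrite -restrict_EFin.
by have := integrable_mkcond (EFin \o f) mD => <-.
Qed.

Definition moll (k : nat) (f : E -> R) : E -> R := conv (rho k.+1%:R^-1) f.

(** This is clear for bounded uniformly continuous functions, which are dense
    ([approx_L1]), and mollification is a contraction of L^1. *)
Lemma moll_cvg (D K : set E) (f : E -> R) (r : R) : measurable D -> (dtx D < +oo)%E ->
  measurable K -> 0 < r -> (forall z y, K z -> `|y - z| < r -> D y) ->
  dtx.-integrable D (EFin \o f) ->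
  (fun k => \int[dtx]_(z in K) `|moll k (f \_ D) z - f z|) @ \oo --> 0.
Proof.
move=> mD finD mK r0 hr If.
have KD : K `<=` D by move=> z Kz; apply: (hr z) => //; rewrite subrr normr0.
have finK : (dtx K < +oo)%E by apply: le_lt_trans finD; apply: le_measure; rewrite ?inE.
have ek k : 0 < k.+1%:R^-1 :> R by [].
have IfD := restrict_L1 mD If.
apply/cvgrPdist_le => /= e e0.
have e40 : 0 < e / 4 by rewrite divr_gt0.
have [_ /(_ _ e40)[psi up hp]] := approx_L1 mD finD If.
have Ip := bunif_L1 mD finD up; have IpD := restrict_L1 mD Ip.
pose m := fine (dtx K) + 1.
have m0 : 0 < m by rewrite ltr_wpDl// fine_ge0.
have em : 0 < e / 4 / m by rewrite divr_gt0.
have [s s0 hs] := up.2 _ em.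
near=> k.
have kr : k.+1%:R^-1 < Num.min r s :> R by near: k; apply: near_infty_natSinv_lt (PosNum _); rewrite lt_min r0.
move: kr; rewrite lt_min => /andP[kr ks].
have Id : L1 (fun z => (f \_ D) z - (psi \_ D) z) by exact: L1B.
have [Ic hc] := conv_L1 (ek k) Id.
have Icf := (conv_L1 (ek k) IfD).1.
have IK g : L1 g -> dtx.-integrable K (EFin \o g) by exact: integrableS.
have IfK : dtx.-integrable K (EFin \o f) by exact: integrableS If.
have IpK : dtx.-integrable K (EFin \o psi) by exact: integrableS Ip.
rewrite sub0r normrN ger0_norm; last exact: Rintegral_ge0.
have Im : dtx.-integrable K (EFin \o (fun=> e / 4 / m)).
  by apply: bunif_L1 => //; exact: bunif_cst.
have I1 : dtx.-integrable K (EFin \o (fun z => `|conv (rho k.+1%:R^-1) (fun z => (f \_ D) z - (psi \_ D) z) z|)).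
  exact/L1norm/IK.
have I2 : dtx.-integrable K (EFin \o (fun z => `|f z - psi z|)) by exact/L1norm/L1B.
apply: (@le_trans _ _ (\int[dtx]_(z in K) (`|conv (rho k.+1%:R^-1) (fun z => (f \_ D) z - (psi \_ D) z) z| + (e / 4 / m + `|f z - psi z|)))).
  apply: le_Rintegral => //.
  - by apply/L1norm/L1B => //; exact: IK.
  - by apply: L1D => //; exact: L1D.
  - move=> z Kz.
    have hb y : ball z k.+1%:R^-1 y -> D y.
      rewrite -ball_normE /ball_/= => zy; apply: (hr z) => //.
      by rewrite distrC (lt_trans zy).
    have -> : conv (rho k.+1%:R^-1) (fun z => (f \_ D) z - (psi \_ D) z) z = moll k (f \_ D) z - conv (rho k.+1%:R^-1) (psi \_ D) z.
      rewrite /moll /conv -RintegralB//; [|by apply: conv_integrable => //; exact: rho_csmooth..].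
      by apply: eq_Rintegral => y _; rewrite mulrBr.
    have hpsi : `|conv (rho k.+1%:R^-1) (psi \_ D) z - psi z| <= e / 4 / m.
      have [I3 i3] := rho_shift z (ek k).
      have I4 : L1 (fun y => rho k.+1%:R^-1 (z - y) * psi z) by under eq_fun do rewrite mulrC; exact: L1Zl.
      have I5 := conv_integrable z (rho_csmooth n (ek k)) IpD.
      have e1 : \int[dtx]_y (rho k.+1%:R^-1 (z - y) * psi z) = psi z by rewrite RintegralZr// i3 mul1r.
      have e2 : \int[dtx]_y (e / 4 / m * rho k.+1%:R^-1 (z - y)) = e / 4 / m by rewrite RintegralZl// i3 mulr1.
      rewrite -e1 -e2 /conv -RintegralB//; apply: Rintegral_abs_le => //.
      - exact: (L1_measurable (L1B measurableT I5 I4)).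
      - exact: L1Zl.
      - move=> y _; rewrite -mulrBr normrM (ger0_norm (rho_ge0 _ _)) mulrC.
        have [b|nb] := pselect (ball (0 : E) k.+1%:R^-1 (z - y)); last by rewrite (rho_supp (ek k) nb) !mulr0.
        have zy : `|z - y| < k.+1%:R^-1 by move: b; rewrite -ball_normE /ball_/= sub0r normrN.
        rewrite ler_wpM2r ?rho_ge0// patchE mem_set ?hs//; last by apply: hb; rewrite -ball_normE.
        by rewrite distrC (lt_trans zy).
    set a := moll k _ z; set b := conv _ _ z in hpsi *.
    have -> : a - f z = (a - b) + ((b - psi z) + (psi z - f z)) by ring.
    rewrite (le_trans (ler_normD _ _))// lerD2l (le_trans (ler_normD _ _))// [`|psi z - _|]distrC lerD2r.
    exact: hpsi.
rewrite RintegralD//; last exact: L1D.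
rewrite RintegralD// Rintegral_cst//.
have h1 : \int[dtx]_(z in K) `|conv (rho k.+1%:R^-1) (fun z => (f \_ D) z - (psi \_ D) z) z| <= e / 4.
  apply: le_trans (le_trans hc _).
    rewrite Rintegral_mkcond; apply: le_Rintegral => //.
    - by apply: restrict_L1.
    - exact: L1norm.
    - by move=> z _; rewrite patchE; case: ifP => // _; exact: normr_ge0.
  apply: le_trans hp; rewrite [leRHS]Rintegral_mkcond le_eqVlt; apply/orP; left; apply/eqP.
  by apply: eq_Rintegral => z _; rewrite !patchE; case: ifP; rewrite ?subrr ?normr0.
have h2 : \int[dtx]_(z in K) `|f z - psi z| <= e / 4.
  apply: le_trans hp; rewrite /Rintegral fine_le//.
  - by apply: integrable_fin_num.
  - by apply: integrable_fin_num => //; exact/L1norm/L1B.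
  - apply: ge0_subset_integral => //.
    by apply/measurable_EFinP; exact: (L1_measurable (L1norm (L1B mD If Ip))).
have h3 : e / 4 / m * fine (dtx K) <= e / 4.
  by rewrite -mulrA ler_piMr ?(ltW e40)// mulrC ler_pdivrMr// mul1r /m lerDl.
lra.
Unshelve. all: by end_near. Qed.

End mollification_limit.

(** * Integrability by duality with test functions *)

Section duality.
Context {R : realType} (n : nat).
Local Notation dx := (@lebesgue_rV R n).
Local Notation dtx := (@lebesgue_prod R n dx).
Local Notation E := (R * 'rV[R]_n)%type.
Variable D : set E.
Hypotheses (oD : open D) (bD : bounded_set D).
Local Notation L1 f := (dtx.-integrable setT (EFin \o f)).
Local Notation L1D f := (dtx.-integrable D (EFin \o f)).
Implicit Types (f F Psi zeta : E -> R) (K : set E).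

Let mD : measurable D := open_measurable_E oD.
Let finD : (dtx D < +oo)%E := bounded_finite mD bD.

Lemma compact_exhaustion : exists K : nat -> set E,
  [/\ forall j, compact (K j), forall j, K j `<=` D,
      forall i j, (i <= j)%N -> K i `<=` K j &
      forall z, D z -> exists j0, forall j, (j0 <= j)%N -> K j z].
Proof.
exists (fun j => [set z | forall y, `|y - z| < j.+1%:R^-1 -> D y]).
have e0 (j : nat) : 0 < j.+1%:R^-1 :> R by [].
have KD j : [set z | forall y, `|y - z| < j.+1%:R^-1 -> D y] `<=` D.
  by move=> z; apply; rewrite subrr normr0.
have Kmono i j : (i <= j)%N -> [set z | forall y, `|y - z| < i.+1%:R^-1 -> D y] `<=`
    [set z | forall y, `|y - z| < j.+1%:R^-1 -> D y].
  move=> ij z hz y yz; apply: hz; apply: lt_le_trans yz _.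
  by rewrite lef_pV2 ?posrE// ler_nat.
split => // [j|z Dz].
  have [M [_ /(_ (`|M| + 1))]] := bD.
  move=> /(_ _)/= hM; have {}hM : forall z, D z -> `|z| <= `|M| + 1.
    by apply: hM; rewrite (le_lt_trans (ler_norm _))// ltrDl.
  apply: (@subclosed_compact _ _ (cbox (`|M| + 1))); last 2 first.
  - exact: cbox_compact.
  - move=> z /KD /hM hz; split.
      by apply: le_trans hz; rewrite [leRHS]prod_normE le_max lexx.
    move=> i; apply: le_trans hz; rewrite [leRHS]prod_normE le_max; apply/orP; right.
    by rewrite [leRHS]mx_normrE (le_bigmax _ (fun ij => `|z.2 ij.1 ij.2|) (ord0, i)).
  rewrite -[X in closed X]setCK; apply: open_closedC.
  rewrite openE => z /= /existsNP[y /not_implyP[yz nDy]].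
  have d0 : 0 < j.+1%:R^-1 - `|y - z| by rewrite subr_gt0.
  apply: filterS (nbhsx_ballx z _ d0) => x; rewrite -ball_normE /ball_/= => zx.
  apply/existsNP; exists y; apply/not_implyP; split => //.
  by rewrite (le_lt_trans (ler_distD z _ _))// -ltrBrDl.
have /nbhs_ballP[r /= r0 hr] := open_nbhs_nbhs (conj oD Dz).
have [m hm] : exists m, m.+1%:R^-1 < r.
  by have := @ltr_add_invr R 0 r r0; move=> [m]; rewrite add0r => h; exists m.
exists m => j mj y yz; apply: hr; rewrite -ball_normE /ball_/= distrC (lt_le_trans yz)//.
by apply: le_trans (ltW hm); rewrite lef_pV2 ?posrE// ler_nat.
Qed.

Lemma locint_L1 F K : measurable_fun D F ->
  (forall K, compact K -> K `<=` D -> (\int[dtx]_(x in K) `|F x|%:E < +oo)%E) ->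
  compact K -> K `<=` D -> dtx.-integrable K (EFin \o F).
Proof.
move=> mF hF cK KD; apply/integrableP; split; last exact: hF.
apply/measurable_EFinP; apply: measurable_funS mF => //.
Qed.

Lemma test_setT F Psi : supp_in D Psi ->
  \int[dtx]_(z in D) (F z * Psi z) = \int[dtx]_z (F z * Psi z).
Proof.
move=> sPsi; rewrite Rintegral_mkcond; apply: eq_Rintegral => z _.
rewrite patchE; case: ifPn => // /negP zD.
by rewrite sPsi ?mulr0// => /mem_set.
Qed.

Lemma test_supp_in Psi : test_function D Psi -> supp_in D Psi.
Proof.
by move=> /test_elim[K [_ _ KP KD]] z zD; apply: KP => /KD.
Qed.

(** Mollification moves supports by at most the radius of the kernel, which is
    eventually less than the distance from K to the complement of D. *)
Lemma moll_test K : compact K -> K `<=` D ->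
  exists K' k0, [/\ compact K', K `<=` K', K' `<=` D &
  forall zeta, L1 zeta -> supp_in K zeta ->
  forall k, (k0 <= k)%N -> test_function D (moll k zeta) /\ supp_in K' (moll k zeta)].
Proof.
move=> cK KD; have [r r0 hr] := compact_margin cK oD KD.
have [m hm] : exists m, m.+1%:R^-1 < r.
  by have := @ltr_add_invr R 0 r r0; move=> [m]; rewrite add0r => h; exists m.
pose K' := [set z : E | exists2 x, K x & cbox m.+1%:R^-1 (z - x)].
have cK' : compact K' by apply: compact_add => //; exact: cbox_compact.
have e0 (j : nat) : 0 < j.+1%:R^-1 :> R by [].
have K'D : K' `<=` D.
  move=> z [x Kx [b1 b2]]; apply: (hr x) => //.
  rewrite prod_normE gt_max (le_lt_trans b1)//=.
  rewrite [ltLHS]mx_normrE; apply: bigmax_lt => // -[i j] _ /=.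
  by rewrite (ord1 i) (le_lt_trans (b2 j)).
exists K', m; split => //.
  move=> z Kz; exists z => //; rewrite subrr; split; rewrite /ecoord/= ?normr0 ?ltW//.
  by move=> i; rewrite mxE normr0 ltW.
move=> zeta Iz zK k mk; have sk : supp_in K' (moll k zeta).
  move=> z zK'; apply: (conv_supp (e0 k) zK) => -[x Kx [b1 b2]]; apply: zK'; exists x => //.
  have le : k.+1%:R^-1 <= m.+1%:R^-1 :> R by rewrite lef_pV2 ?posrE// ler_nat.
  by split; [exact: le_trans le|move=> i; exact: le_trans (b2 i) le].
split => //; apply: (test_intro _ cK' sk K'D).
by apply: conv_smooth; [exact: rho_csmooth|].
Qed.

Section bounded_multiplier.
Context {F : E -> R} {K : set E} {zeta : E -> R} {c : R}.
Hypotheses (cK : compact K) (KD : K `<=` D)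
  (mz : measurable_fun setT zeta) (zK : supp_in K zeta) (zc : forall z, `|zeta z| <= c).

Lemma mult_L1 : L1 zeta.
Proof.
apply: (supp_in_integrable (K := K) (C := c)) => //; [exact: compact_measurable|exact: compact_finite].
Qed.

Lemma moll_mult_cvg : measurable_fun D F ->
  (forall K, compact K -> K `<=` D -> (\int[dtx]_(x in K) `|F x|%:E < +oo)%E) ->
  (fun k => \int[dtx]_(z in D) (F z * moll k zeta z)) @ \oo --> \int[dtx]_(z in D) (F z * zeta z).
Proof.
move=> mF hF; have Iz := mult_L1; have [K' [k0 [cK' KK' K'D hk']]] := moll_test cK KD.
have hk := hk' _ Iz zK.
have e0 (j : nat) : 0 < j.+1%:R^-1 :> R by [].
have mK' := compact_measurable cK'.
have IF : dtx.-integrable K' (EFin \o F) by exact: locint_L1.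
have c0 : 0 <= c by exact: le_trans (zc 0).
have zD : zeta \_ D = zeta.
  apply/funext => z; rewrite patchE; case: ifPn => // /negP zD; rewrite zK// => /KD zD'.
  by apply: zD; exact: mem_set.
have [r r0 hr] := compact_margin cK' oD K'D.
have IK' g : L1 g -> dtx.-integrable K' (EFin \o g) by exact: integrableS.
have Im k : L1 (moll k zeta) by exact: (conv_L1 (e0 k) Iz).1.
have cv : (fun k => \int[dtx]_(z in K') `|moll k zeta z - zeta z|) @ \oo --> 0.
  have IzD : dtx.-integrable D (EFin \o zeta) by exact: integrableS Iz.
  by have := @moll_cvg R n D K' zeta r mD finD mK' r0 hr IzD; rewrite zD.
have Id k : dtx.-integrable K' (EFin \o (fun z => moll k zeta z - zeta z)).
  by apply: L1B => //; exact: IK'.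
have mc k z : `|moll k zeta z| <= c by exact: conv_le (e0 k) Iz zc.
have C0 := @cvg_int_min _ _ R dtx K' mK' (fun k z => moll k zeta z - zeta z)
  (fun k z => `|moll k zeta z - zeta z|) (c + c) 1 F.
have {}C0 : (fun k => \int[dtx]_(z in K') ((moll k zeta z - zeta z) * F z)) @ \oo --> 0.
  apply: C0 => //.
  - by move=> k; exact: L1_measurable (Id k).
  - by move=> k z _; rewrite (le_trans (ler_normB _ _))// lerD.
  - by move=> k z _; rewrite mul1r.
  - by move=> k; exact: L1norm.
have red g : supp_in K' g -> \int[dtx]_(z in D) (F z * g z) = \int[dtx]_(z in K') (F z * g z).
  move=> sg; rewrite Rintegral_mkcond [RHS]Rintegral_mkcond; apply: eq_Rintegral => z _.
  rewrite !patchE; case: (boolP (z \in K')) => zK'.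
    by rewrite mem_set//; apply: K'D; exact: set_mem.
  case: ifP => // _; rewrite sg ?mulr0// => /mem_set; exact/negP.
have szK' : supp_in K' zeta by move=> z zK'; apply: zK => /KK'.
apply/cvgrPdist_le => /= e e00.
have /cvgrPdist_le/(_ _ e00) := C0; apply: filter_app.
exists k0 => // k /= kk; rewrite sub0r normrN => h.
rewrite red// red; last exact: (hk k kk).2.
have Ib (g : E -> R) (C : R) : measurable_fun setT g -> (forall z, `|g z| <= C) -> dtx.-integrable K' (EFin \o (fun z => F z * g z)).
  move=> mg gC; under eq_fun do rewrite mulrC.
  by apply: (L1M_bounded mK' (c := C)) => //; exact: measurable_funTS.
rewrite -RintegralB//; last 2 first.
- exact: Ib mz zc.
- by apply: Ib (mc k); exact: L1_measurable (Im k).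
apply: le_trans h; rewrite -normrN le_eqVlt; apply/orP; left; apply/eqP; congr `|_|.
rewrite -RintegralN//.
  by apply: eq_Rintegral => z _; ring.
apply: L1B => //; first exact: Ib mz zc.
by apply: Ib (mc k); exact: L1_measurable (Im k).
Qed.

End bounded_multiplier.

(** The bound extends from test functions to bounded functions by mollification,
    which decreases the integral of the q-th power. *)
Lemma dual_bounded F (q C : R) : 1 < q -> measurable_fun D F ->
  (forall K, compact K -> K `<=` D -> (\int[dtx]_(x in K) `|F x|%:E < +oo)%E) ->
  (forall Psi, test_function D Psi ->
    `|\int[dtx]_(z in D) (F z * Psi z)| <= C + \int[dtx]_z (`|Psi z| `^ q)) ->
  forall K zeta c, compact K -> K `<=` D -> measurable_fun setT zeta -> supp_in K zeta ->
  (forall z, `|zeta z| <= c) ->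
  `|\int[dtx]_(z in D) (F z * zeta z)| <= C + \int[dtx]_z (`|zeta z| `^ q).
Proof.
move=> q1 mF hF hC K zeta c cK KD mz zK zc.
have Iz := mult_L1 cK mz zK zc.
have [K' [k0 [cK' KK' K'D hk']]] := moll_test cK KD; have hk := hk' _ Iz zK.
have cv := moll_mult_cvg cK KD mz zK zc mF hF.
have e0 (j : nat) : 0 < j.+1%:R^-1 :> R by [].
have c0 : 0 <= c by exact: le_trans (zc 0).
have q0 : 0 < q by exact: lt_trans q1.
have Izq : L1 (fun z => `|zeta z| `^ q).
  apply: (supp_in_integrable (K := K) (C := c `^ q)).
  - exact: compact_measurable.
  - exact: compact_finite.
  - by apply: measurable_powR_comp; exact: measurableT_comp.
  - by move=> z zz; rewrite zK// normr0 powR0// gt_eqF.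
  - by move=> z; rewrite ger0_norm ?powR_ge0// ge0_ler_powR ?nnegrE// ltW.
have cvn := cvg_norm cv.
apply: (cvgr_to_le (cvn _)); exists k0 => // k /= kk.
apply: le_trans (hC _ (hk k kk).1) _; rewrite lerD2l.
exact: (conv_Lq q1 (e0 k) Iz Izq).2.
Qed.

(** Take zeta = sign(F) |F| ^ (p - 1) / 2, where p = q / (q - 1), and |F| is
    truncated at a level j that tends to infinity: with Y the integral of |F| ^
    p, the hypothesis reads Y / 2 <= C + Y / 2 ^ q. The factor 1/2 makes the
    right-hand side absorbable. *)
Lemma dual_power F (q C : R) K : 1 < q -> measurable_fun D F ->
  compact K -> K `<=` D -> dtx.-integrable K (EFin \o F) ->
  (forall zeta c, measurable_fun setT zeta -> supp_in K zeta -> (forall z, `|zeta z| <= c) ->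
    `|\int[dtx]_(z in D) (F z * zeta z)| <= C + \int[dtx]_z (`|zeta z| `^ q)) ->
  (\int[dtx]_(z in K) (`|F z| `^ (q / (q - 1)))%:E <= (C / (2^-1 - 2^-1 `^ q))%:E)%E.
Proof.
move=> q1 mF cK KD IF hC.
have q0 : 0 < q by exact: lt_trans q1.
have q10 : 0 < q - 1 by rewrite subr_gt0.
pose p := q / (q - 1).
have p0 : 0 < p by rewrite divr_gt0.
have p1 : 1 < p by rewrite ltr_pdivlMr// mul1r gtrBl.
have pq : (p - 1) * q = p by rewrite /p; field; rewrite gt_eqF.
have d0 : 0 < 2^-1 - 2^-1 `^ q :> R.
  rewrite subr_gt0; have := @gt0_ltr_powR R; move=> _.
  rewrite -{2}[2^-1](@powRr1 R)// /powR gt_eqF ?invr_gt0// ltr_expR ltr_nM2r//.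
  by rewrite ln_lt0// invr_gt0 ltr0n invf_lt1 ?ltr1n.
have mK := compact_measurable cK.
have finK := compact_finite cK.
have mFK : measurable_fun K F by apply: measurable_funS mF.
pose F' := F \_ K.
have mF' : measurable_fun setT F' by apply/(measurable_restrictT _ mK).
pose G j z : R := Num.min `|F' z| j%:R.
have G0 j z : 0 <= G j z by rewrite le_min normr_ge0 ler0n.
have Gj j z : G j z <= j%:R by rewrite ge_min lexx orbT.
have GF j z : G j z <= `|F' z| by rewrite ge_min lexx.
have mG j : measurable_fun setT (G j).
  by apply: measurable_minr => //; exact: measurableT_comp.
have mGp j r : measurable_fun setT (fun z => G j z `^ r).
  by exact: measurable_powR_comp.
pose sg z : R := if 0 <= F' z then 1 else -1.
have sgF z : sg z * F' z = `|F' z|.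
  by rewrite /sg; case: ifPn => [h|]; [rewrite mul1r ger0_norm|rewrite -ltNge => h; rewrite mulN1r ltr0_norm].
have sg1 z : `|sg z| = 1 by rewrite /sg; case: ifP; rewrite ?normrN normr1.
pose zt j z := 2^-1 * (sg z * G j z `^ (p - 1)).
have mzt j : measurable_fun setT (zt j).
  apply: measurable_funM => //; apply: measurable_funM => //.
  by apply: measurable_fun_ifT => //; apply: measurable_fun_ler.
have ztK j : supp_in K (zt j).
  move=> z zK; rewrite /zt /G /F' patchE ifF; last by apply/negP => /set_mem.
  by rewrite normr0 min_l// powR0 ?mulr0// gt_eqF// subr_gt0.
have ztc j z : `|zt j z| <= 2^-1 * j%:R `^ (p - 1).
  rewrite normrM ger0_norm ?invr_ge0// ler_wpM2l ?invr_ge0// normrM sg1 mul1r.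
  by rewrite ger0_norm ?powR_ge0// ge0_ler_powR ?nnegrE// subr_ge0 ltW.
have IGp j : dtx.-integrable K (EFin \o (fun z => G j z `^ p)).
  apply: (L1_dom (g := fun z => j%:R `^ p * \1_K z) mK).
  - exact: measurable_funTS (mGp j p).
  - by apply: L1Zl => //; apply: L1_indic.
  - move=> z Kz; rewrite indicE mem_set// mulr1 ger0_norm ?powR_ge0//.
    by rewrite ge0_ler_powR ?nnegrE// ltW.
pose Y j := \int[dtx]_(z in K) (G j z `^ p).
have hY j : Y j <= C / (2^-1 - 2^-1 `^ q).
  rewrite ler_pdivlMr//.
  have := hC (zt j) _ (mzt j) (ztK j) (ztc j).
  have -> : \int[dtx]_z `|zt j z| `^ q = 2^-1 `^ q * Y j.
    rewrite /Y -RintegralZl// [RHS]Rintegral_mkcond; apply: eq_Rintegral => z _.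
    rewrite patchE; case: ifPn => [zK|/negP zK]; last first.
      by rewrite ztK ?normr0 ?powR0 ?gt_eqF// => /mem_set.
    rewrite normrM ger0_norm ?invr_ge0// normrM sg1 mul1r (ger0_norm (powR_ge0 _ _)).
    by rewrite powRM ?invr_ge0 ?powR_ge0// -powRrM pq.
  have h : 2^-1 * Y j <= \int[dtx]_(z in D) (F z * zt j z).
    have -> : \int[dtx]_(z in D) (F z * zt j z) = \int[dtx]_(z in K) (2^-1 * (`|F z| * G j z `^ (p - 1))).
      rewrite Rintegral_mkcond [RHS]Rintegral_mkcond; apply: eq_Rintegral => z _.
      rewrite !patchE; case: (boolP (z \in K)) => zK.
        have FF : F' z = F z by rewrite /F' patchE zK.
        rewrite mem_set; last by apply: KD; exact: set_mem.
        by rewrite /zt -FF -sgF; ring.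
      by case: ifP => // _; rewrite ztK ?mulr0// => /mem_set; exact/negP.
    rewrite /Y -RintegralZl//; apply: le_Rintegral => //.
    - exact: L1Zl.
    - apply: L1Zl => //; under eq_fun do rewrite mulrC.
      apply: (L1M_bounded mK (c := j%:R `^ (p - 1))).
      + exact: measurable_funTS (mGp j _).
      + move=> z _; rewrite ger0_norm ?powR_ge0//.
        by rewrite ge0_ler_powR ?nnegrE// subr_ge0 ltW.
      + exact: L1norm.
    - move=> z Kz; rewrite ler_wpM2l ?invr_ge0//.
      rewrite -(mulr_powRB1 (G0 j z) p0) ler_wpM2r ?powR_ge0//.
      by have := GF j z; rewrite /F' patchE mem_set.
  move=> /(le_trans (ler_norm _))/(le_trans h); rewrite mulrBr; lra.
have cv := @cvg_monotone_convergence _ _ _ dtx K mK (fun j z => (G j z `^ p)%:E).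
have {}cv : (\int[dtx]_(z in K) (G j z `^ p)%:E)%E @[j --> \oo] --> (\int[dtx]_(z in K) (`|F z| `^ p)%:E)%E.
  have -> : (\int[dtx]_(z in K) (`|F z| `^ p)%:E = \int[dtx]_(z in K) limn (fun j => (G j z `^ p)%:E))%E.
    apply: eq_integral => z /set_mem Kz; apply/esym/cvg_lim => //.
    apply: cvg_near_cst; near=> j; rewrite /G /F' patchE mem_set// min_l//.
    by near: j; exact: nbhs_infty_ger.
  apply: cv.
  - by move=> j; apply/measurable_EFinP; exact: measurable_funTS (mGp j p).
  - by move=> j z _; rewrite lee_fin powR_ge0.
  - move=> z _ i j ij; rewrite lee_fin ge0_ler_powR ?nnegrE ?(ltW p0)//.
    by rewrite le_min !ge_min lexx/= ler_nat ij orbT.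
have -> : (q / (q - 1)) = p by [].
apply: (closed_cvg (fun x => x <= (C / (2^-1 - 2^-1 `^ q))%:E)%E _ _ _ cv).
  exact: closed_ereal_ge_ereal.
apply: nearW => j; rewrite -[X in (X <= _)%E]fineK; first by rewrite lee_fin; exact: hY.
by apply: integrable_fin_num => //; exact: IGp.
Unshelve. all: by end_near. Qed.

Lemma dual_Lq F (q C : R) : 1 < q -> measurable_fun D F ->
  (forall K, compact K -> K `<=` D -> (\int[dtx]_(x in K) `|F x|%:E < +oo)%E) ->
  (forall Psi, test_function D Psi ->
    `|\int[dtx]_(z in D) (F z * Psi z)| <= C + \int[dtx]_z (`|Psi z| `^ q)) ->
  (\int[dtx]_(z in D) (`|F z| `^ (q / (q - 1)))%:E <= (C / (2^-1 - 2^-1 `^ q))%:E)%E.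
Proof.
move=> q1 mF hF hC; have [K [cK KD Km Kex]] := compact_exhaustion.
have hK j : (\int[dtx]_(z in K j) (`|F z| `^ (q / (q - 1)))%:E <= (C / (2^-1 - 2^-1 `^ q))%:E)%E.
  apply: dual_power => //; first exact: locint_L1.
  by move=> zeta c mz zK zc; exact: (dual_bounded q1 mF hF hC (cK j) (KD j) mz zK zc).
set p := q / (q - 1) in hK *.
have mFp : measurable_fun D (fun z => `|F z| `^ p).
  by apply: measurable_powR_comp; exact: measurableT_comp.
have DK : D = \bigcup_j K j.
  apply/seteqP; split => [z /Kex[j hj]|z [j _ /KD//]].
  by exists j => //; exact: hj.
have ndK : nondecreasing_seq K by move=> i j ij; apply/subsetPset; exact: Km.
have mKj j : measurable (K j) by exact: compact_measurable.
have := @ge0_nondecreasing_set_cvg_integral _ _ R K (fun z => (`|F z| `^ p)%:E) dtx ndK mKj.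
rewrite -DK => cv.
apply: (closed_cvg (fun x => x <= (C / (2^-1 - 2^-1 `^ q))%:E)%E _ _ _ (cv _ _)).
- exact: closed_ereal_ge_ereal.
- exact: nearW.
- by move=> j; apply/measurable_EFinP; exact: measurable_funS mFp.
- by move=> j z _; rewrite lee_fin powR_ge0.
Qed.

(** The fundamental lemma of the calculus of variations. *)
Lemma dual_zero F : measurable_fun D F ->
  (forall K, compact K -> K `<=` D -> (\int[dtx]_(x in K) `|F x|%:E < +oo)%E) ->
  (forall Psi, test_function D Psi -> \int[dtx]_(z in D) (F z * Psi z) = 0) ->
  {ae dtx, forall z, D z -> F z = 0}.
Proof.
move=> mF hF hC.
have := @dual_Lq F 2 0 _ mF hF; rewrite ltr1n => /(_ isT).
rewrite mul0r (_ : (2 : R) / (2 - 1) = 2); last by field.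
have h0 Psi : test_function D Psi -> `|\int[dtx]_(z in D) (F z * Psi z)| <= 0 + \int[dtx]_z (`|Psi z| `^ 2).
  by move=> tP; rewrite hC// normr0 add0r Rintegral_ge0// => z _; exact: powR_ge0.
move=> /(_ h0) h.
have mF2 : measurable_fun D (fun z => (`|F z| `^ 2)%:E).
  apply/measurable_EFinP; apply: measurable_powR_comp; exact: measurableT_comp.
have i0 : (\int[dtx]_(z in D) `|(`|F z| `^ 2)%:E| = 0)%E.
  apply/eqP; rewrite eq_le integral_ge0// andbT; apply: le_trans h.
  rewrite le_eqVlt; apply/orP; left; apply/eqP; apply: eq_integral => z _.
  by rewrite gee0_abs// lee_fin powR_ge0.
have := (ae_eq_integral_abs dtx mD mF2).1 i0.
apply: filterS => z hz Dz; have := hz Dz; rewrite /= => -[] /eqP.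
by rewrite powR_eq0 normr_eq0 => /andP[/eqP].
Qed.

End duality.

(** * Functions of t with values in functions of x *)

Section slices.
Context {R : realType} (n : nat).
Local Notation dx := (@lebesgue_rV R n).
Local Notation dt := (@lebesgueR R).
Local Notation dtx := (@lebesgue_prod R n dx).
Local Notation E := (R * 'rV[R]_n)%type.
Implicit Types (f Psi : E -> R).

Lemma Ck_affine (V W : normedModType R) (A : V -> W) (L : V -> W) k (f : W -> R) :
  continuous A -> (forall (s : R) v x, A (s *: v + x) = s *: L v + A x) ->
  Ck k f -> Ck k (f \o A).
Proof.
move=> cA hA.
have dA (g : W -> R) x v : (forall y w, derivable g y w) ->
    derivable (g \o A) x v /\ 'D_v (g \o A) x = 'D_(L v) g (A x).
  move=> dg; have e : (fun s : R => (g \o A) (s *: v + x)) = (fun s : R => g (s *: L v + A x)).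
    by apply/funext => s /=; rewrite hA.
  have [h1 h2] := derive_line (g \o A) x v; have [h3 h4] := derive_line g (A x) (L v).
  by rewrite h2 h4 e; split => //; apply/h1; rewrite e; exact/h3.
have cc (g : W -> R) : continuous g -> continuous (g \o A).
  by move=> cg x; apply: continuous_comp; [exact: cA|exact: cg].
elim: k f => [f [cf _]|k IH f /CkSP[cf df Cf]]; first by split => //; exact: cc.
apply/CkSP; split; [exact: cc|by move=> x v; exact: (dA f x v df).1|move=> v].
have -> : 'D_v (f \o A) = 'D_(L v) f \o A by apply/funext => x; rewrite (dA f x v df).2.
exact: IH.
Qed.

Lemma derive_affine (V W : normedModType R) (A : V -> W) (L : V -> W) (f : W -> R) x v :
  (forall (s : R) v x, A (s *: v + x) = s *: L v + A x) ->
  'D_v (f \o A) x = 'D_(L v) f (A x).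
Proof.
move=> hA; rewrite (derive_line (f \o A) x v).2 (derive_line f (A x) (L v)).2.
by congr derive1; apply/funext => s /=; rewrite hA.
Qed.

Lemma slice_affine t (s : R) (v x : 'rV[R]_n) : (t, s *: v + x) = s *: (0, v) + (t, x) :> E.
Proof. by congr pair; rewrite /= scaler0 add0r. Qed.

Lemma pair_continuous (W : normedModType R) (t : R) : continuous (fun x : W => (t, x)).
Proof.
move=> x; apply/(@cvgrPdist_lt _ (R * W)%type) => /= e e0.
apply/nbhs_ballP; exists e => //= y; rewrite -ball_normE /ball_/= => xy.
by rewrite prod_normE /= subrr normr0 gt_max e0.
Qed.

Lemma slice_smooth Psi t : smooth Psi -> smooth (curve Psi t).
Proof.
move=> sP k; apply: (Ck_affine (A := fun x => (t, x)) (L := fun v => (0, v))) => //.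
  exact: pair_continuous.
exact: slice_affine.
Qed.

Lemma slice_derive Psi t x v : 'D_v (curve Psi t) x = 'D_((0, v) : E) Psi (t, x).
Proof. by apply: (derive_affine (A := fun x => (t, x)) (L := fun v => (0, v))); exact: slice_affine. Qed.

Lemma slice_compact (K : set E) : compact K -> compact [set z.2 | z in K].
Proof.
by move=> cK; apply: continuous_compact => //; apply: continuous_subspaceT => z; exact: cvg_snd.
Qed.

Lemma slice_test (Om : set 'rV[R]_n) (I : set R) Psi t : test_function (I `*` Om) Psi -> test_function Om (curve Psi t).
Proof.
move=> /test_elim[K [sP cK KP KD]].
apply: (@test_intro _ _ [set z.2 | z in K]).
- exact: slice_smooth.
- exact: slice_compact.
- by move=> x xK; apply: KP => Kx; apply: xK; exists (t, x).
- by move=> _ [z /KD[_ h] <-].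
Qed.

Lemma test_out (Om : set 'rV[R]_n) T Psi t : test_function (cylinder Om T) Psi ->
  ~ (0 < t < T) -> curve Psi t = cst 0.
Proof.
move=> /test_elim[K [sP cK KP KD]] h; apply/funext => x; apply: KP => /KD[/=].
by rewrite in_itv.
Qed.

Lemma measurable_curve f t : measurable_fun setT f -> measurable_fun setT (curve f t).
Proof. by move=> mf; exact: measurableT_comp mf (pair1_measurable t). Qed.

Local Notation L1 f := (dtx.-integrable setT (EFin \o f)).

Lemma fubini_ae f : L1 f -> {ae dt, forall t, dx.-integrable setT (EFin \o curve f t)}.
Proof. exact: (@ae_integrable1 _ _ _ _ R dt dx (EFin \o f)). Qed.

Lemma fubini_measurable f : L1 f -> measurable_fun setT (fun t => \int[dx]_x f (t, x)).
Proof.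
move=> If; apply: (@measurableT_comp _ _ _ _ _ _ fine); first exact: fine_measurable.
exact: (@measurable_fubini_F _ _ _ _ R dt dx (EFin \o f) If).
Qed.

Lemma fubini_int f : L1 f -> dt.-integrable setT (EFin \o fun t => \int[dx]_x f (t, x)) /\
  \int[dt]_t \int[dx]_x f (t, x) = \int[dtx]_z f z.
Proof.
move=> If; have h := @integral12_prod_meas1 _ _ _ _ R dt dx (EFin \o f) If.
have aef : {ae dt, forall t, setT t -> (\int[dx]_x f (t, x))%:E = (\int[dx]_x (f (t, x))%:E)%E}.
  apply: filterS (fubini_ae If) => t It _.
  by rewrite /Rintegral fineK//; apply: integrable_fin_num.
have IF := @integrable_fubini_F _ _ _ _ R dt dx (EFin \o f) If.
have mF : measurable_fun setT (EFin \o fun t => \int[dx]_x f (t, x)).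
  by apply/measurable_EFinP; exact: fubini_measurable.
have aef' := aef; split; last first.
  rewrite /Rintegral -[X in _ = fine X]h; congr fine; apply: ae_eq_integral => //.
  by case/integrableP : IF.
apply/integrableP; split => //.
have := IF; move=> /integrableP[_]; apply: le_lt_trans.
rewrite le_eqVlt; apply/orP; left; apply/eqP; apply: ae_eq_integral => //.
- exact: measurableT_comp.
- by apply: measurableT_comp => //; case/integrableP : IF.
- by apply: filterS aef => t h0 _; congr (abse _); exact: h0.
Qed.

(** Compare f with the pointwise maximum of f and g, which has the same integral
    as g. *)
Lemma ae_le_lower_integral d (T : measurableType d) (mu : {measure set T -> \bar R}) (D : set T) (f g : T -> \bar R) :
  measurable D -> (forall x, D x -> 0 <= f x)%E -> (forall x, D x -> 0 <= g x)%E ->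
  {ae mu, forall x, D x -> (f x <= g x)%E} ->
  (\int[mu]_(x in D) f x <= \int[mu]_(x in D) g x)%E.
Proof.
move=> mD f0 g0 fg.
have -> : (\int[mu]_(x in D) g x = \int[mu]_(x in D) maxe (f x) (g x))%E.
  apply: integral_ge0_ae_eq => //.
    by move=> x Dx; rewrite le_max f0.
  by apply: filterS fg => x h Dx; rewrite max_r// h.
by apply: le_lower_integral => // x Dx; rewrite le_max lexx.
Qed.

End slices.

Lemma bochner_powE (R : realType) (V : lmodType R) (X : nspace V) (T q : R) (u : R -> V) :
  0 < q -> (forall x, (0 <= nnorm X x)%E) ->
  (bochner_norm X T q%:E u `^ q =
   \int[@lebesgueR R]_(t in [set` `]0, T[%R]) nnorm X (u t) `^ q)%E.
Proof.
move=> q0 N0; rewrite /bochner_norm poweR_Lnorm ?gt_eqF// [RHS]integral_mkcond.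
apply: eq_integral => x _; rewrite !patchE; case: ifP => // _.
  by rewrite gee0_abs.
by rewrite (_ : point = 0%E :> \bar R)// abse0 poweR0r// gt_eqF.
Qed.
Section bochner_bounds.
Context {R : realType} (n : nat).
Local Notation dx := (@lebesgue_rV R n).
Local Notation dt := (@lebesgueR R).
Local Notation dtx := (@lebesgue_prod R n dx).
Local Notation E := (R * 'rV[R]_n)%type.
Variables (Om : set 'rV[R]_n) (T : R).
Hypotheses (oOm : open Om) (bOm : bounded_set Om).
Local Notation Q := (cylinder Om T).
Local Notation I := ([set` `]0, T[%R] : set R).
Local Notation px i := (0 : R, delta_mx ord0 i : 'rV[R]_n).
Implicit Types (u Psi : E -> R).

Lemma open_cylinder : open Q.
Proof.
have -> : Q = fst @^-1` I `&` snd @^-1` Om by apply/seteqP; split => -[].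
apply: openI; apply: open_comp => //.
- by move=> z _; exact: cvg_fst.
- by move=> z _; exact: cvg_snd.
Qed.

Lemma bounded_cylinder : bounded_set Q.
Proof.
have [M [Mr hM]] := bOm; exists (Num.max `|M| `|T|); split; first exact: num_real.
move=> y; rewrite gt_max => /andP[My Ty] [t x] [/=]; rewrite in_itv/= => /andP[t0 tT] Ox.
rewrite /= prod_normE /= ge_max; apply/andP; split.
  by rewrite ger0_norm ?ltW// (lt_trans tT)// (le_lt_trans (ler_norm _)).
by apply: hM Ox; rewrite (le_lt_trans (ler_norm _)).
Qed.

Lemma measurable_cylinder : measurable Q.
Proof. exact: open_measurable_E open_cylinder. Qed.

Lemma finite_cylinder : (dtx Q < +oo)%E.
Proof. exact: bounded_finite measurable_cylinder bounded_cylinder. Qed.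

Let mOm : measurable Om := open_measurable_rV oOm.
Let mQ := measurable_cylinder.

Lemma cylinder_tonelli (f : E -> \bar R) : measurable_fun Q f ->
  (forall z, 0 <= f z)%E ->
  (\int[dtx]_(z in Q) f z = \int[dt]_(t in I) \int[dx]_(x in Om) f (t, x))%E.
Proof.
move=> mf f0; rewrite integral_mkcond integral_lebesgue_prod; last 2 first.
- by apply/(measurable_restrictT _ mQ).
- by move=> z; rewrite patchE; case: ifP.
rewrite [RHS]integral_mkcond; apply: eq_integral => t _.
rewrite patchE; case: ifPn => [/set_mem It|/negP It].
  rewrite [RHS]integral_mkcond; apply: eq_integral => x _; rewrite !patchE.
  case: ifPn => [/set_mem[_ Ox]|/negP h]; first by rewrite mem_set.
  by case: ifPn => // /set_mem Ox; exfalso; apply: h; exact: mem_set.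
rewrite -[RHS](@integral0 _ _ _ dx setT); apply: eq_integral => x _; rewrite patchE.
by case: ifPn => // /set_mem[It' _]; exfalso; apply: It; exact: mem_set.
Qed.

Lemma Lq_normE (q : R) (w : 'rV[R]_n -> R) : 0 < q ->
  (Lq_norm dx Om q%:E w `^ q = \int[dx]_(x in Om) (`|w x| `^ q)%:E)%E.
Proof.
move=> q0; rewrite /Lq_norm poweR_Lnorm ?gt_eqF// [RHS]integral_mkcond.
apply: eq_integral => x _; rewrite !patchE; case: ifP => // _.
rewrite (_ : point = 0%E :> \bar R)// abse0 poweR0r// gt_eqF//.
Qed.

Lemma coord_le_enorm (x : 'rV[R]_n) i : `|x ord0 i| <= enorm x.
Proof.
rewrite -sqrtr_sqr; apply: ler_wsqrtr; rewrite /dotp (bigD1 i)//= expr2 lerDl.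
by apply: sumr_ge0 => j _; rewrite -expr2 sqr_ge0.
Qed.

Lemma abs_fine_le (x : \bar R) : (`|fine x|%:E <= `|x|)%E.
Proof. by case: x => [r| |] //=; rewrite ?normr0 ?lee_fin ?leey. Qed.

Lemma abs_Rintegral_le d (X : measurableType d) (mu : {measure set X -> \bar R}) (D : set X) (f : X -> R) :
  measurable D -> measurable_fun D f ->
  (`|\int[mu]_(x in D) f x|%:E <= \int[mu]_(x in D) `|f x|%:E)%E.
Proof.
move=> mD mf; apply: le_trans (abs_fine_le _) _.
by apply: (le_abse_integral mu mD (f := EFin \o f)); exact/measurable_EFinP.
Qed.

Lemma young (a b q : R) : 1 < q -> 0 <= a -> 0 <= b ->
  a * b <= a `^ q + b `^ (q / (q - 1)).
Proof.
move=> q1 a0 b0; have q0 : 0 < q by lra.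
have p0 : 0 < q / (q - 1) by rewrite divr_gt0// subr_gt0.
have e : 1 / q + 1 / (q / (q - 1)) = 1 by field; rewrite !gt_eqF//; lra.
have := @conjugate_powR _ a b q (q / (q - 1)) a0 b0 q0 p0.
have {}e : q^-1 + (q / (q - 1))^-1 = 1 by rewrite -(div1r q) -(div1r (_ / _)).
move=> /(_ e) h; apply: (le_trans h); apply: lerD.
  by rewrite ler_pdivrMr// ler_peMr ?powR_ge0// ltW.
rewrite ler_pdivrMr// ler_peMr ?powR_ge0// ler_pdivlMr ?subr_gt0// mul1r.
by rewrite lerBlDr lerDl.
Qed.

Lemma le_poweR_mono (x y : \bar R) (q : R) : 0 <= q -> (0 <= x -> x <= y -> x `^ q <= y `^ q)%E.
Proof. by move=> q0 x0 xy; apply: gt0_ler_poweR => //; rewrite in_itv/= ?leey ?andbT// (le_trans x0). Qed.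

Section bound.
Variables (X : nspace ('rV[R]_n -> R)) (q : R).
Hypotheses (q1 : 1 < q) (XW : forall w, X w -> W10 Om q w)
  (XN : forall w, (nnorm (W10 Om q) w <= nnorm X w)%E).
Local Notation q' := (q / (q - 1)).

Let q0 : 0 < q. Proof. exact: lt_trans q1. Qed.

Let N0 w : (0 <= nnorm X w)%E.
Proof. by apply: le_trans (XN w); rewrite /nnorm/= /W1_norm adde_ge0// Lnorm_ge0. Qed.

Lemma bochner_finite u : in_LpX Om T X q%:E u ->
  (\int[dt]_(t in I) nnorm X (curve u t) `^ q < +oo)%E.
Proof. by move=> [_ [_ h]]; rewrite -(bochner_powE T _ q0 N0) poweR_lty. Qed.

Lemma LpX_Lq u : in_LpX Om T X q%:E u ->
  (\int[dtx]_(z in Q) (`|u z| `^ q)%:E < +oo)%E.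
Proof.
move=> hu; apply: le_lt_trans (bochner_finite hu); have [mu _] := hu.
rewrite cylinder_tonelli; last 2 first.
- apply/measurable_EFinP; apply: measurable_powR_comp.
  exact: measurableT_comp.
- by move=> z; rewrite lee_fin powR_ge0.
  apply: le_lower_integral => t It.
    by apply: integral_ge0 => x _; rewrite lee_fin powR_ge0.
  rewrite -(@Lq_normE q (curve u t))//; apply: le_poweR_mono; rewrite ?Lnorm_ge0 ?(ltW q0)//.
  by apply: le_trans (XN _); rewrite /nnorm/= /W1_norm leeDl// Lnorm_ge0.
Qed.

Lemma W1_pairing w psi i : X w -> test_function Om psi ->
  (`|\int[dx]_(x in Om) (w x * 'D_(delta_mx ord0 i) psi x)|%:E <=
   nnorm X w `^ q + \int[dx]_(x in Om) (`|psi x| `^ q')%:E)%E.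
Proof.
move=> Xw tpsi; have [[_ hg _] _] := XW Xw.
have gr : is_grad Om w (grad Om w) by have [F hF] := hg; exact: (xgetPex (fun=> 0) hg).
have [lw lF ipp] := gr; rewrite ipp// normrN.
have [sp _ _] := tpsi; have cp := smooth_continuous sp.
have mpsi : measurable_fun Om psi.
  apply: measurable_funTS => /=.
  have -> : psi = (fun z : E => psi z.2) \o (fun x => (0, x)) by [].
  apply: (@measurableT_comp _ _ _ _ _ _ (fun z : E => psi z.2)); last exact: pair1_measurable.
  apply: continuous_measurable_E => z.
  by apply: continuous_comp; [exact: cvg_snd|exact: cp].
have mF : measurable_fun Om (fun x => grad Om w x ord0 i) by have [] := lF i.
apply: le_trans (abs_Rintegral_le _ mOm _) _; first exact: measurable_funM.
have mpow (h : 'rV[R]_n -> R) r : measurable_fun Om h -> measurable_fun Om (fun x => (`|h x| `^ r)%:E).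
  move=> mh; apply/measurable_EFinP; apply: measurable_powR_comp.
  exact: measurableT_comp.
apply: (@le_trans _ _ (\int[dx]_(x in Om) ((`|grad Om w x ord0 i| `^ q)%:E + (`|psi x| `^ q')%:E)))%E.
  apply: le_lower_integral => x _; rewrite ?lee_fin//.
  by rewrite normrM; apply: young.
have p0 (h : 'rV[R]_n -> R) r x : Om x -> (0 <= (`|h x| `^ r)%:E)%E by move=> _; rewrite lee_fin powR_ge0.
rewrite (ge0_integralD _ mOm (p0 _ _) (mpow _ _ mF) (p0 _ _) (mpow _ _ mpsi)).
apply: leeD => //.
apply: (@le_trans _ _ (Lq_norm dx Om q%:E (fun x => enorm (grad Om w x)) `^ q))%E.
  rewrite Lq_normE//; apply: le_lower_integral => x _; rewrite lee_fin ?powR_ge0//.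
  by rewrite ge0_ler_powR ?nnegrE ?(ltW q0)// (ger0_norm (sqrtr_ge0 _)) coord_le_enorm.
apply: le_poweR_mono; rewrite ?Lnorm_ge0 ?(ltW q0)//.
by apply: le_trans (XN _); rewrite /nnorm/= /W1_norm leeDr// Lnorm_ge0.
Qed.

Lemma Lq_L1 u : measurable_fun Q u -> (\int[dtx]_(z in Q) (`|u z| `^ q)%:E < +oo)%E ->
  dtx.-integrable Q (EFin \o u).
Proof.
move=> mu hu; have mp : measurable_fun Q (fun z => `|u z| `^ q).
  apply: measurable_powR_comp.
  exact: measurableT_comp.
apply: (L1_dom (g := fun z => \1_Q z + `|u z| `^ q) mQ mu).
  apply: L1D => //; first by apply: L1_indic => //; exact: finite_cylinder.
  apply/integrableP; split; first exact/measurable_EFinP.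
  by under eq_integral do rewrite /= ger0_norm ?powR_ge0//.
move=> z Qz; rewrite indicE mem_set// mulr1n.
have [h|h] := lerP `|u z| 1; first by rewrite (le_trans h)// lerDl powR_ge0.
rewrite -[leLHS]powRr1// (le_trans (y := `|u z| `^ q))//; last by rewrite lerDr.
by rewrite ler_powR// ltW.
Qed.

(** For a.e. t, apply [W1_pairing] to u(t). The norm of u(t) need not be a
    measurable function of t, so that its integral on the right is a lower one;
    monotonicity still holds for it. *)
Lemma LpX_pairing u Psi i : in_LpX Om T X q%:E u -> test_function Q Psi ->
  (`|\int[dtx]_(z in Q) (u z * 'D_(px i) Psi z)|%:E <=
   \int[dt]_(t in I) nnorm X (curve u t) `^ q + (\int[dtx]_z (`|Psi z| `^ q'))%:E)%E.
Proof.
move=> hu tPsi; have [mu [[s [_ aeX]] _]] := hu.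
have Iu := Lq_L1 mu (LpX_Lq hu).
have [K [sP cK KP KQ]] := test_elim tPsi.
have q'0 : 0 < q' by rewrite divr_gt0// subr_gt0.
have cP := smooth_continuous sP.
have sD := smooth_derive (px i) sP.
have [B B0 hB] := supp_in_bounded (smooth_continuous sD) cK (supp_in_derive (px i) cK KP).
pose f := (fun z => 'D_(px i) Psi z * u z) \_ Q.
have If : dtx.-integrable setT (EFin \o f).
  apply: restrict_L1 => //; apply: (L1M_bounded mQ (c := B)) => //.
  by exact: smooth_measurable sD.
pose g z := `|Psi z| `^ q'.
have Ig : dtx.-integrable setT (EFin \o g).
  have [B' B'0 hB'] := supp_in_bounded cP cK KP.
  apply: (supp_in_integrable (K := K) (C := B' `^ q')).
  - exact: compact_measurable.
  - exact: compact_finite.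
  - apply: measurable_powR_comp.
    by apply: measurableT_comp => //; exact: continuous_measurable_E.
  - by move=> z /KP; rewrite /g => ->; rewrite normr0 powR0// gt_eqF.
  - by move=> z; rewrite ger0_norm ?powR_ge0// ge0_ler_powR ?nnegrE ?(ltW q'0).
have [Im m_int] := fubini_int If; have [Ip p_int] := fubini_int Ig.
pose m t := \int[dx]_x f (t, x); pose p t := \int[dx]_x g (t, x).
have p0 t : 0 <= p t by apply: Rintegral_ge0 => x _; exact: powR_ge0.
have mm : measurable_fun setT m := fubini_measurable If.
have mp : measurable_fun setT p := fubini_measurable Ig.
pose h t := Num.max (`|m t| - p t) 0.
have h0 t : 0 <= h t by rewrite le_max lexx orbT.
have mh : measurable_fun setT h.
  by apply: measurable_maxr => //; apply: measurable_funB => //; exact: measurableT_comp.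
have mI : measurable I by exact: measurable_itv.
have mE t : I t -> m t = \int[dx]_(x in Om) (u (t, x) * 'D_(delta_mx ord0 i) (curve Psi t) x).
  move=> It; rewrite /m /f [RHS]Rintegral_mkcond; apply: eq_Rintegral => x _.
  rewrite !patchE; case: ifPn => [/set_mem[_ Ox]|/negP nQ].
    by rewrite mem_set// slice_derive mulrC.
  by case: ifPn => // /set_mem Ox; exfalso; apply: nQ; exact: mem_set.
have hN : {ae dt, forall t, I t -> ((h t)%:E <= nnorm X (curve u t) `^ q)%E}.
  apply: filterS2 aeX (fubini_ae Ig) => t ht Igt It.
  have [Xt _] := ht It.
  have := W1_pairing i Xt (slice_test t tPsi); rewrite -mE//.
  have le1 : (\int[dx]_(x in Om) (`|curve Psi t x| `^ q')%:E <= (p t)%:E)%E.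
    rewrite /p /Rintegral fineK; last by apply: integrable_fin_num.
    apply: (@le_trans _ _ (\int[dx]_x (`|curve Psi t x| `^ q')%:E)%E) => //.
    rewrite integral_mkcond; apply: le_lower_integral0 => x; rewrite patchE; case: ifP => _ //;
      by rewrite lee_fin powR_ge0.
  move=> /le_trans -/(_ _ (leeD2l _ le1)) hm.
  rewrite /h EFin_max ge_max poweR_ge0 andbT EFinB leeBlDr//.
have hC : (\int[dt]_(t in I) (h t)%:E <= \int[dt]_(t in I) nnorm X (curve u t) `^ q)%E.
  by apply: ae_le_lower_integral => // t _; [rewrite lee_fin|exact: poweR_ge0].
have -> : \int[dtx]_(z in Q) (u z * 'D_(px i) Psi z) = \int[dt]_(t in I) m t.
  rewrite Rintegral_mkcond [RHS]Rintegral_mkcond; transitivity (\int[dt]_t m t).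
    rewrite m_int; apply: eq_Rintegral => z _; rewrite /f !patchE; case: ifP => // _.
    exact: mulrC.
  apply: eq_Rintegral => t _; rewrite patchE; case: ifPn => // /negP It.
  rewrite /m (_ : \int[dx]_x f (t, x) = \int[dx]_x (cst 0 x : R)).
    by rewrite /Rintegral integral0.
  apply: eq_Rintegral => x _; rewrite /f patchE; case: ifPn => // /set_mem[It' _].
  by exfalso; apply: It; exact: mem_set.
apply: le_trans (abs_Rintegral_le _ mI _) _; first exact: measurable_funTS.
apply: (@le_trans _ _ (\int[dt]_(t in I) ((h t)%:E + (p t)%:E)))%E.
  apply: le_lower_integral => // t _; rewrite ?lee_fin//.
  by rewrite -lerBlDr le_max lexx.
rewrite ge0_integralD//; first last.
- by apply/measurable_EFinP; exact: measurable_funTS.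
- by move=> t _; rewrite lee_fin.
- by apply/measurable_EFinP; exact: measurable_funTS.
- by move=> t _; rewrite lee_fin.
apply: leeD => //.
rewrite -p_int /Rintegral fineK; last by apply: integrable_fin_num.
apply: (@le_trans _ _ (\int[dt]_t (p t)%:E)%E) => //.
rewrite integral_mkcond; apply: le_lower_integral0 => t; rewrite patchE; case: ifP => _.
- by rewrite lee_fin.
- exact: lexx.
- exact: lexx.
- by rewrite lee_fin.
Qed.

(** What is kept of the membership in L^q(0,T;W^{1,q}_0): an additive bound by
    the conjugate power of the test function, which is the form used by
    [dual_Lq]. *)
Lemma LpX_bound u : in_LpX Om T X q%:E u ->
  [/\ measurable_fun Q u, dtx.-integrable Q (EFin \o u),
    dtx.-integrable Q (EFin \o fun z => `|u z| `^ q) &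
    exists C, forall Psi i, test_function Q Psi ->
    `|\int[dtx]_(z in Q) (u z * 'D_(px i) Psi z)| <= C + \int[dtx]_z (`|Psi z| `^ q')].
Proof.
move=> hu; have [mu _] := hu; have h := LpX_Lq hu; split => //; first exact: Lq_L1.
  apply/integrableP; split.
    apply/measurable_EFinP; apply: measurable_powR_comp.
    exact: measurableT_comp.
  by under eq_integral do rewrite /= ger0_norm ?powR_ge0//.
have := bochner_finite hu.
have : (0 <= \int[dt]_(t in I) nnorm X (curve u t) `^ q)%E.
  by apply: integral_ge0 => t _; exact: poweR_ge0.
set J := (X in (0 <= X)%E) => J0 Joo.
exists (fine J) => Psi i tP; rewrite -lee_fin EFinD fineK ?ge0_fin_numE//.
exact: LpX_pairing.
Qed.

End bound.

End bochner_bounds.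

(** * Weak derivatives and mollification *)

Section weak_derivatives.
Context {R : realType} (n : nat).
Local Notation dx := (@lebesgue_rV R n).
Local Notation dtx := (@lebesgue_prod R n dx).
Local Notation E := (R * 'rV[R]_n)%type.
Variable D : set E.
Hypotheses (oD : open D) (bD : bounded_set D).
Local Notation L1 f := (dtx.-integrable setT (EFin \o f)).
Local Notation L1D f := (dtx.-integrable D (EFin \o f)).
Implicit Types (f h v V Psi zeta : E -> R) (K : set E) (e : E).

Let mD : measurable D := open_measurable_E oD.
Let finD : (dtx D < +oo)%E := bounded_finite mD bD.

Lemma conv_adjoint r f zeta : csmooth r -> L1 f -> L1 zeta ->
  \int[dtx]_z (conv r f z * zeta z) = \int[dtx]_y (f y * conv (fun z => r (- z)) zeta y).
Proof.
move=> cr If Iz; have [C C0 hC] := csmooth_bounded cr.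
have sr := cr.1; have mr : measurable_fun setT r.
  by apply: continuous_measurable_E; exact: smooth_continuous.
have mf := L1_measurable If; have mz := L1_measurable Iz.
pose P (p : E * E) : \bar R := (r (p.1 - p.2) * f p.2 * zeta p.1)%:E.
have mP : measurable_fun setT P.
  apply/measurable_EFinP; apply: measurable_funM; last exact: (measurableT_comp mz measurable_fst).
  apply: measurable_funM; last exact: (measurableT_comp mf measurable_snd).
  exact: (measurableT_comp mr (@measurable_sub_E R n)).
pose c := \int[dtx]_y `|f y|.
have cE : (c%:E = \int[dtx]_y `|f y|%:E)%E.
  by rewrite /c /Rintegral fineK//; apply: integrable_fin_num => //; exact: L1norm.
have IP : (dtx \x dtx)%E.-integrable setT P.
  apply/(integrable12ltyP dtx dtx mP).
  apply: (@le_lt_trans _ _ (\int[dtx]_z (C * c * `|zeta z|)%:E)%E).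
    apply: le_lower_integral0 => z; first exact: integral_ge0.
    apply: (@le_trans _ _ (\int[dtx]_y ((C * `|zeta z|)%:E * `|f y|%:E))%E).
      apply: le_lower_integral0 => y; rewrite /P//= lee_fin !normrM -mulrA [`|f y| * _]mulrC mulrA.
      by rewrite ler_wpM2r// ler_wpM2r.
    rewrite ge0_integralZl//; last 2 first.
    - by apply/measurable_EFinP; exact: measurableT_comp.
    - by rewrite lee_fin mulr_ge0.
    by rewrite -cE -EFinM lee_fin mulrAC.
  by have /integrableP[_] := L1Zl measurableT (C * c) (L1norm Iz);
    under eq_integral do rewrite /= ger0_norm ?mulr_ge0// /c ?Rintegral_ge0//.
have F := Fubini IP.
have eL z : (\int[dtx]_y P (z, y) = (conv r f z * zeta z)%:E)%E.
  rewrite /P /=; under eq_integral do rewrite EFinM.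
  have Ic : dtx.-integrable setT (EFin \o (fun y => r (z - y) * f y)) := conv_integrable z cr If.
  rewrite integralZr//; rewrite EFinM; congr (_ * _)%E.
  by rewrite /conv /Rintegral fineK//; apply: integrable_fin_num.
have cr' : csmooth (fun z => r (- z)).
  have [K cK rK] := cr.2; split.
    move=> k; apply: (Ck_affine (A := fun z : E => - z) (L := fun z : E => - z)) => //.
      by move=> z; apply: cvgN; exact: cvg_id.
    by move=> s v x; rewrite opprD scalerN.
  exists [set - z | z in K]; first by apply: continuous_compact => //; apply: continuous_subspaceT => z; apply: cvgN; exact: cvg_id.
  by move=> z zK; apply: rK => Kz; apply: zK; exists (- z); rewrite ?opprK.
have eR y : (\int[dtx]_z P (z, y) = (f y * conv (fun z => r (- z)) zeta y)%:E)%E.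
  have Ic : dtx.-integrable setT (EFin \o (fun z => r (- (y - z)) * zeta z)) := conv_integrable y cr' Iz.
  transitivity (\int[dtx]_z ((f y)%:E * (r (- (y - z)) * zeta z)%:E))%E.
    by apply: eq_integral => z _; rewrite /P /= opprB -EFinM; congr EFin; ring.
  rewrite integralZl//; rewrite EFinM; congr (_ * _)%E.
  by rewrite /conv /Rintegral fineK//; apply: integrable_fin_num.
rewrite /Rintegral; congr fine.
under eq_integral do rewrite -eL.
under [RHS]eq_integral do rewrite -eR.
exact: F.
Qed.

Lemma derive_opp f x e : derivable f x e -> 'D_(- e) f x = - 'D_e f x.
Proof.
move=> df; have [h1 h2] := derive_line f x e; have [_ h3] := derive_line f x (- e).
pose g := fun s : R => f (s *: e + x).
have eg : (fun s : R => f (s *: (- e) + x)) = g \o -%R.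
  by apply/funext => s; rewrite /g/= scaleNr scalerN.
have dN : derivable (-%R : R -> R) 0 1 by exact: derivableN.
have dg : derivable g (- 0) 1 by rewrite oppr0; exact: h1.1 df.
have [_] := @derivable_comp1 _ _ g -%R 0 1 dg dN.
rewrite h3 h2 eg !derive1E oppr0 => ->.
by rewrite deriveN// derive_id mulrN1.
Qed.

Lemma rho_test k K rr z : (forall z y, K z -> `|y - z| < rr -> D y) -> k.+1%:R^-1 < rr -> K z ->
  test_function D (fun y => rho k.+1%:R^-1 (z - y)).
Proof.
move=> hK kr Kz.
have e0 : 0 < k.+1%:R^-1 :> R by [].
apply: (@test_intro _ _ [set y | cbox k.+1%:R^-1 (z - y)]).
- move=> j; apply: (Ck_affine (A := fun y : E => z - y) (L := fun y : E => - y)).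
  + by move=> y; apply: cvgB; [exact: cvg_cst|exact: cvg_id].
  + by move=> s v x; rewrite opprD scalerN addrCA.
  + exact: rho_smooth.
- have -> : [set y | cbox k.+1%:R^-1 (z - y)] = [set z - y | y in cbox k.+1%:R^-1].
    apply/seteqP; split => [y h|_ [y h <-]]; last by rewrite /= opprB addrC subrK.
    by exists (z - y) => //; rewrite opprB addrC subrK.
  apply: continuous_compact; last exact: cbox_compact.
  by apply: continuous_subspaceT => y; apply: cvgB; [exact: cvg_cst|exact: cvg_id].
- by move=> y h; exact: (rho_supp_in e0).
- move=> y [b1 b2]; apply: (hK z) => //; rewrite distrC prod_normE gt_max (le_lt_trans b1)//=.
  rewrite [ltLHS]mx_normrE; apply: bigmax_lt => [|[i j] _] /=; first exact: lt_trans kr.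
  by rewrite (ord1 i) (le_lt_trans (b2 j)).
Qed.

(** Mollification at z is testing against the kernel centred at z. *)
Lemma moll_pairing k f z : moll k (f \_ D) z = \int[dtx]_(y in D) (f y * rho k.+1%:R^-1 (z - y)).
Proof.
rewrite /moll /conv [RHS]Rintegral_mkcond; apply: eq_Rintegral => y _.
by rewrite !patchE; case: ifP => _; rewrite ?mulr0// mulrC.
Qed.

Lemma moll_derive_pairing k f z e : L1D f ->
  'D_e (moll k (f \_ D)) z = - \int[dtx]_(y in D) (f y * 'D_e (fun y => rho k.+1%:R^-1 (z - y)) y).
Proof.
move=> If; have e0 : 0 < k.+1%:R^-1 :> R by [].
rewrite (conv_derive _ _ (rho_csmooth n e0) (restrict_L1 mD If)).2.
rewrite -RintegralN; last 2 first.
- exact: mD.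
- apply: (L1_eq (f := fun y => 'D_(- e) (rho k.+1%:R^-1) (z - y) * f y) mD) => [y _|].
    rewrite mulrC (derive_affine (A := fun y : E => z - y) (L := fun y : E => - y))//.
    by move=> s v x; rewrite opprD scalerN addrCA.
  have cr : csmooth ('D_(- e) (@rho R n k.+1%:R^-1)) by apply: csmooth_derive; exact: rho_csmooth.
  have [C C0 hC] := csmooth_bounded cr.
  apply: (L1M_bounded mD (c := C)) => //; apply: measurable_funTS.
  exact: (@measurable_subl R n _ z (smooth_continuous cr.1)).
rewrite /conv [RHS]Rintegral_mkcond; apply: eq_Rintegral => y _; rewrite !patchE.
case: ifP => _; last by rewrite mulr0.
rewrite (derive_affine (A := fun y : E => z - y) (L := fun y : E => - y)); last first.
  by move=> s v x; rewrite opprD scalerN addrCA.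
rewrite derive_opp; last by apply: smooth_derivable; exact: rho_smooth.
by rewrite mulrN opprK mulrC.
Qed.

(** Away from the boundary of D the translates of the kernel are test functions
    in D, so that the derivative may be moved to h. *)
Lemma moll_derive k f h K rr z e : (forall z y, K z -> `|y - z| < rr -> D y) ->
  k.+1%:R^-1 < rr -> K z -> L1D f ->
  (forall Psi, test_function D Psi ->
    \int[dtx]_(y in D) (f y * 'D_e Psi y) = - \int[dtx]_(y in D) (h y * Psi y)) ->
  'D_e (moll k (f \_ D)) z = moll k (h \_ D) z.
Proof.
move=> hK kr Kz If fh; rewrite moll_derive_pairing// fh ?opprK; last exact: rho_test kr Kz.
by rewrite moll_pairing.
Qed.

End weak_derivatives.

(** The change of the first factor is treated by [cvg_int_min], as it is bounded
    and small in measure; the one of the second factor by its L^1 norm. *)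
Lemma cvg_int_mul d (T : measurableType d) (R : realType) (mu : {measure set T -> \bar R})
    (D : set T) (a r b : nat -> T -> R) (a0 b0 : T -> R) (c C : R) :
  measurable D -> (forall k, measurable_fun D (a k)) -> measurable_fun D a0 ->
  (forall k x, D x -> `|a k x| <= c) -> (forall x, D x -> `|a0 x| <= c) ->
  (forall k x, D x -> `|a k x - a0 x| <= C * r k x) -> 0 <= C ->
  (forall k, mu.-integrable D (EFin \o r k)) ->
  (fun k => \int[mu]_(x in D) r k x) @ \oo --> 0 ->
  (forall k, mu.-integrable D (EFin \o b k)) -> mu.-integrable D (EFin \o b0) ->
  (fun k => \int[mu]_(x in D) `|b k x - b0 x|) @ \oo --> 0 ->
  (fun k => \int[mu]_(x in D) (a k x * b k x)) @ \oo --> \int[mu]_(x in D) (a0 x * b0 x).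
Proof.
move=> mD ma ma0 ac a0c aC C0 Ir r0 Ib Ib0 bb.
have c1 := @cvg_int_min _ _ R mu D mD (fun k x => a k x - a0 x) r (c + c) C b0.
have {}c1 : (fun k => \int[mu]_(x in D) ((a k x - a0 x) * b0 x)) @ \oo --> 0.
  apply: c1 => //; first by move=> k; exact: measurable_funB.
  by move=> k x Dx; rewrite (le_trans (ler_normB _ _))// lerD ?ac ?a0c.
have Ibb k : mu.-integrable D (EFin \o fun x => b k x - b0 x) by exact: L1B.
have I1 k : mu.-integrable D (EFin \o fun x => a k x * (b k x - b0 x)).
  exact: (L1M_bounded mD (ma k) (ac k)).
have I2 k : mu.-integrable D (EFin \o fun x => (a k x - a0 x) * b0 x).
  apply: (L1M_bounded mD (c := c + c)) => //; first exact: measurable_funB.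
  by move=> x Dx; rewrite (le_trans (ler_normB _ _))// lerD ?ac ?a0c.
have I3 : mu.-integrable D (EFin \o fun x => a0 x * b0 x) by exact: (L1M_bounded mD ma0 a0c).
have c2 : (fun k => \int[mu]_(x in D) (a k x * (b k x - b0 x))) @ \oo --> 0.
  apply: norm_cvg0; apply: (@squeeze_cvgr _ _ _ _ (cst 0) (fun k => c * \int[mu]_(x in D) `|b k x - b0 x|)).
  - apply: nearW => k; rewrite normr_ge0/= -RintegralZl//; last exact: L1norm.
    apply: Rintegral_abs_le => //.
    + exact: L1_measurable (I1 k).
    + by apply: L1Zl => //; exact: L1norm.
    + by move=> x Dx; rewrite normrM ler_wpM2r ?ac.
  - exact: cvg_cst.
  - by rewrite -[X in _ --> X](mulr0 c); apply: cvgMr.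
have -> : (fun k => \int[mu]_(x in D) (a k x * b k x)) =
   (fun k => \int[mu]_(x in D) (a k x * (b k x - b0 x)) + (\int[mu]_(x in D) ((a k x - a0 x) * b0 x)
     + \int[mu]_(x in D) (a0 x * b0 x))).
  apply/funext => k; rewrite -RintegralD// -RintegralD//; last exact: L1D.
  by apply: eq_Rintegral => x _; ring.
rewrite -[X in _ --> X]add0r; apply: cvgD => //.
rewrite -[X in _ --> X]add0r; apply: cvgD => //; exact: cvg_cst.
Qed.

Lemma lipschitz_derive (R : realType) (B b : R -> R) (c : R) :
  (forall x, is_derive x (1 : R) B (b x)) -> (forall x, `|b x| <= c) ->
  forall x y, `|B x - B y| <= c * `|x - y|.
Proof.
move=> dB bc x y; wlog xy : x y / y <= x.
  by move=> h; case: (leP y x) => [yx|/ltW xy];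
    [exact: h|rewrite distrC [in leRHS]distrC; exact: h].
have h1 z : z \in `]y, x[ -> is_derive z (1 : R) B (b z) by move=> _; exact: dB.
have h2 : {within `[y, x], continuous B} by apply: derivable_within_continuous => z _.
by have [z _ ->] := MVT_segment xy h1 h2; rewrite normrM ler_wpM2r.
Qed.

Section chain_rule.
Context {R : realType} (n : nat).
Local Notation dx := (@lebesgue_rV R n).
Local Notation dtx := (@lebesgue_prod R n dx).
Local Notation E := (R * 'rV[R]_n)%type.
Variable D : set E.
Hypotheses (oD : open D) (bD : bounded_set D).
Local Notation L1 f := (dtx.-integrable setT (EFin \o f)).
Local Notation L1D f := (dtx.-integrable D (EFin \o f)).
Implicit Types (f h v V Psi zeta : E -> R) (K : set E) (e : E).

Let mD : measurable D := open_measurable_E oD.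
Let finD : (dtx D < +oo)%E := bounded_finite mD bD.
Let e0 (j : nat) : 0 < j.+1%:R^-1 :> R. Proof. by []. Qed.

Lemma inv_lt_near (r : R) : 0 < r -> exists k0, forall k, (k0 <= k)%N -> k.+1%:R^-1 < r.
Proof.
move=> r0; have [m hm] := @ltr_add_invr R 0 r r0; rewrite add0r in hm; exists m => k mk.
by apply: le_lt_trans hm; rewrite lef_pV2 ?posrE// ler_nat.
Qed.

Lemma moll_smooth k f : L1D f -> smooth (moll k (f \_ D)).
Proof. by move=> If; apply: conv_smooth; [exact: rho_csmooth|exact: restrict_L1]. Qed.

Lemma Rintegral_supp K g : K `<=` D -> supp_in K g ->
  \int[dtx]_(z in D) g z = \int[dtx]_(z in K) g z.
Proof.
move=> KD gK; rewrite Rintegral_mkcond [RHS]Rintegral_mkcond; apply: eq_Rintegral => z _.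
rewrite !patchE; case: (boolP (z \in K)) => zK.
  by rewrite mem_set//; apply: KD; exact: set_mem.
by case: ifP => // _; rewrite gK// => /mem_set; exact/negP.
Qed.

Lemma Rintegral_suppT K g : supp_in K g -> \int[dtx]_z g z = \int[dtx]_(z in K) g z.
Proof.
move=> gK; rewrite [RHS]Rintegral_mkcond; apply: eq_Rintegral => z _.
by rewrite patchE; case: ifPn => // zK; rewrite gK// => /mem_set; exact/negP.
Qed.

(** It holds for the mollifications of v, by the classical chain rule and
    integration by parts; then pass to the limit with [cvg_int_mul]. *)
Lemma chain_rule (B b : R -> R) (c : R) v V e :
  (forall x, is_derive x (1 : R) B (b x)) -> (forall x, `|B x| <= c) ->
  (forall x, `|b x| <= c) -> (forall x y, `|b x - b y| <= c * `|x - y|) ->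
  L1D v -> L1D V ->
  (forall Psi, test_function D Psi ->
    \int[dtx]_(z in D) (v z * 'D_e Psi z) = - \int[dtx]_(z in D) (V z * Psi z)) ->
  forall Psi, test_function D Psi ->
    \int[dtx]_(z in D) (B (v z) * 'D_e Psi z) = - \int[dtx]_(z in D) (b (v z) * V z * Psi z).
Proof.
move=> dB Bc bc bL Iv IV hV Psi /test_elim[K [sP cK PK KD]].
have Bl := lipschitz_derive dB bc.
have c0 : 0 <= c by exact: le_trans (bc 0).
have [rr rr0 hr] := compact_margin cK oD KD.
have [k0 hk0] := inv_lt_near rr0.
have mK := compact_measurable cK; have finK := compact_finite cK.
have [C1 C10 hC1] := supp_in_bounded (smooth_continuous sP) cK PK.
have DPK := supp_in_derive e cK PK.
have sDP := smooth_derive e sP.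
have [C2 C20 hC2] := supp_in_bounded (smooth_continuous sDP) cK DPK.
have cB : continuous B by move=> x; apply/differentiable_continuous/derivable1_diffP.
have cb : continuous b.
  move=> x; apply/cvgrPdist_le => /= t t0; apply/nbhs_ballP; exists (t / (c + 1)) => /=.
    by rewrite divr_gt0// ltr_wpDl.
  move=> y; rewrite /ball/= => xy; rewrite (le_trans (bL x y))//.
  rewrite (le_trans (y := (c + 1) * `|x - y|))// ?ler_wpM2r ?lerDl//.
  by rewrite -ler_pdivlMl ?ltr_wpDl// mulrC ltW.
have mB := continuous_measurable_fun cB; have mb := continuous_measurable_fun cb.
pose v_ k := moll k (v \_ D).
have sv k : smooth (v_ k) := moll_smooth k Iv.
have mv_ k : measurable_fun setT (v_ k) by apply: continuous_measurable_E; exact: smooth_continuous (sv k).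
have mv := L1_measurable Iv; have mvK : measurable_fun K v by exact: measurable_funS mv.
have mP : measurable_fun setT Psi by apply: continuous_measurable_E; exact: smooth_continuous.
have mDP : measurable_fun setT ('D_e Psi) by apply: continuous_measurable_E; exact: smooth_continuous.
have IK f : L1D f -> dtx.-integrable K (EFin \o f) by exact: integrableS.
have IKT f : L1 f -> dtx.-integrable K (EFin \o f) by exact: integrableS.
have Im k f : L1D f -> L1 (moll k (f \_ D)).
  by move=> If; exact: (conv_L1 (e0 k) (restrict_L1 mD If)).1.
have cvm f : L1D f -> (fun k => \int[dtx]_(z in K) `|moll k (f \_ D) z - f z|) @ \oo --> 0.
  by move=> If; exact: (@moll_cvg R n D K f rr mD finD mK rr0 hr If).
have ipp k : (k0 <= k)%N -> \int[dtx]_(z in K) (B (v_ k z) * 'D_e Psi z) =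
    - \int[dtx]_(z in K) (Psi z * b (v_ k z) * moll k (V \_ D) z).
  move=> kk; pose F z := B (v_ k z) * Psi z.
  have dBv z : derivable (B \o v_ k) z e /\ 'D_e (B \o v_ k) z = b (v_ k z) * 'D_e (v_ k) z.
    have dBx : derivable B (v_ k z) 1 by [].
    have dvz : derivable (v_ k) z e by exact: smooth_derivable.
    have [h1 h2] := derivable_comp1 dBx dvz; split => //.
    by rewrite h2 derive1E; congr (_ * _); exact: derive_val.
  have dF z : derivable F z e /\ 'D_e F z = B (v_ k z) * 'D_e Psi z + Psi z * (b (v_ k z) * 'D_e (v_ k) z).
    have [h1 h2] := dBv z; have h3 : derivable Psi z e := smooth_derivable sP.
    by split; [exact: derivableM|rewrite -h2; exact: (deriveM h1 h3)].
  have [C3 C30 hC3] := supp_in_bounded (f := fun z => Psi z * 'D_e (v_ k) z) (K := K)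
    (smooth_continuous (smoothM sP (smooth_derive e (sv k)))) cK (fun z zK => etrans (congr1 (fun x => x * _) (PK z zK)) (mul0r _)).
  have Fz : \int[dtx]_z 'D_e F z = 0.
    apply: (Rintegral_derive0_C1 (K := K) (C := c * C2 + c * C3)) => //.
    - by move=> z; apply: cvgM; [apply: continuous_comp; [exact: smooth_continuous|exact: cB]|exact: smooth_continuous].
    - by move=> z; exact: (dF z).1.
    - move=> z; rewrite (dF z).2 (le_trans (ler_normD _ _))// lerD//; first by rewrite normrM ler_pM.
      by rewrite mulrCA normrM ler_pM.
    - by move=> z zK; rewrite /F PK// mulr0.
  have I1 : dtx.-integrable K (EFin \o fun z => B (v_ k z) * 'D_e Psi z).
    apply: (L1M_bounded mK (c := c)) => //; first by apply: measurable_funTS; exact: measurableT_comp.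
    by apply: IKT; apply: (supp_in_integrable_cts cK) => //; exact: smooth_continuous.
  have I2 : dtx.-integrable K (EFin \o fun z => Psi z * b (v_ k z) * moll k (V \_ D) z).
    apply: (L1M_bounded mK (c := C1 * c)) => //; last by apply: IKT; exact: Im.
      by apply: measurable_funTS; apply: measurable_funM => //; exact: measurableT_comp.
    by move=> z _; rewrite normrM ler_pM.
  apply/eqP; rewrite -addr_eq0 -RintegralD// -Fz; apply/eqP.
  rewrite (@Rintegral_suppT K ('D_e F)); last first.
    by move=> z zK; rewrite (dF z).2 DPK// PK// mul0r mulr0 addr0.
  apply: Rintegral_eq => // z Kz; rewrite (dF z).2 -mulrA; congr (_ + _ * (_ * _)).
  by apply/esym; exact: (moll_derive oD hr (hk0 k kk) Kz Iv hV).
have l1 : (fun k => \int[dtx]_(z in K) (B (v_ k z) * 'D_e Psi z)) @ \oo -->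
    \int[dtx]_(z in K) (B (v z) * 'D_e Psi z).
  apply: (@cvg_int_mul _ _ R dtx K _ (fun k z => `|v_ k z - v z|) (fun=> 'D_e Psi) _ _ c c) => //.
  - move=> k; apply: measurable_funTS; exact: measurableT_comp.
  - exact: measurableT_comp.
  - by move=> k; apply: L1norm; apply: L1B => //; [apply: IKT; exact: Im|exact: IK].
  - exact: cvm.
  - by move=> k; apply: IKT; apply: (supp_in_integrable_cts cK) => //; exact: smooth_continuous.
  - by apply: IKT; apply: (supp_in_integrable_cts cK) => //; exact: smooth_continuous.
  - under eq_fun do under eq_Rintegral do rewrite subrr normr0.
    by under eq_fun do rewrite /Rintegral integral0; exact: cvg_cst.
have l2 : (fun k => \int[dtx]_(z in K) (Psi z * b (v_ k z) * moll k (V \_ D) z)) @ \oo -->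
    \int[dtx]_(z in K) (Psi z * b (v z) * V z).
  apply: (@cvg_int_mul _ _ R dtx K _ (fun k z => `|v_ k z - v z|) _ _ _ (C1 * c) (C1 * c)) => //.
  - move=> k; apply: measurable_funTS; apply: measurable_funM => //; exact: measurableT_comp.
  - apply: measurable_funM; [exact: measurable_funTS|exact: measurableT_comp].
  - by move=> k x _; rewrite normrM ler_pM.
  - by move=> x _; rewrite normrM ler_pM.
  - by move=> k x _; rewrite -mulrBr normrM -mulrA ler_pM.
  - exact: mulr_ge0.
  - by move=> k; apply: L1norm; apply: L1B => //; [apply: IKT; exact: Im|exact: IK].
  - exact: cvm.
  - by move=> k; apply: IKT; exact: Im.
  - exact: IK.
  - exact: cvm.
rewrite (Rintegral_supp KD) ?(Rintegral_supp KD (g := fun z => b (v z) * V z * Psi z)).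
- have l3 : (fun k => \int[dtx]_(z in K) (B (v_ k z) * 'D_e Psi z)) @ \oo -->
      - \int[dtx]_(z in K) (Psi z * b (v z) * V z).
    apply: cvg_trans (cvgN l2); apply: near_eq_cvg; exists k0 => // k /= /ipp; first by [].
  rewrite (cvg_unique _ l1 l3)//; congr (- _); apply: eq_Rintegral => z _; ring.
- by move=> z zK; rewrite PK// mulr0.
- by move=> z zK; rewrite DPK// mulr0.
Qed.

(** Mollification is self-adjoint, so that a bound by duality on the weak
    derivative passes to the mollified function. *)
Lemma moll_derive_bound f (q C : R) K e : 1 < q -> L1D f ->
  (forall Psi, test_function D Psi ->
    `|\int[dtx]_(z in D) (f z * 'D_e Psi z)| <= C + \int[dtx]_z (`|Psi z| `^ q)) ->
  compact K -> K `<=` D -> exists k0, forall k, (k0 <= k)%N ->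
  (\int[dtx]_(z in K) (`|'D_e (moll k (f \_ D)) z| `^ (q / (q - 1)))%:E <= (C / (2^-1 - 2^-1 `^ q))%:E)%E.
Proof.
move=> q1 If hf cK KD; have [K' [k0 [cK' KK' K'D hk]]] := moll_test oD cK KD.
have q0 : 0 < q by exact: lt_trans q1.
have If' := restrict_L1 mD If.
exists k0 => k kk; have sD := smooth_derive e (moll_smooth k If).
have mDk : measurable_fun setT ('D_e (moll k (f \_ D))).
  by apply: continuous_measurable_E; exact: smooth_continuous.
have cDk : csmooth ('D_e (@rho R n k.+1%:R^-1)) by apply: csmooth_derive; exact: rho_csmooth.
apply: (dual_power oD) => //.
- exact: measurable_funTS.
- have [C' C'0 hC'] : exists2 C', 0 <= C' & forall z, `|'D_e (moll k (f \_ D)) z| <= C'.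
    have [C1 C10 hC1] := csmooth_bounded cDk.
    exists (C1 * \int[dtx]_y `|(f \_ D) y|).
      by rewrite mulr_ge0// Rintegral_ge0.
    move=> z; rewrite (conv_derive _ _ (rho_csmooth n (e0 k)) If').2 /conv -RintegralZl//; last exact: L1norm.
    apply: Rintegral_abs_le => //.
    + exact: L1_measurable (conv_integrable z cDk If').
    + by apply: L1Zl => //; exact: L1norm.
    + by move=> y _; rewrite normrM ler_wpM2r.
  have mK := compact_measurable cK.
  apply: (L1_dom (g := fun z => C' * \1_K z) mK).
  + exact: measurable_funTS.
  + by apply: (L1Zl mK); apply: (L1_indic mK) => //; exact: compact_finite.
  + by move=> z Kz; rewrite indicE mem_set// mulr1.
move=> zeta c mz zK zc.
have Iz : L1 zeta.
  by apply: (supp_in_integrable (K := K) (C := c)) => //; [exact: compact_measurable|exact: compact_finite].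
have [tm _] := hk zeta Iz zK k kk.
have -> : \int[dtx]_(z in D) ('D_e (moll k (f \_ D)) z * zeta z) =
    - \int[dtx]_(z in D) (f z * 'D_e (moll k zeta) z).
  rewrite -RintegralN//; last first.
    have [K1 [s1 cK1 KP1 _]] := test_elim tm.
    have s2 := smooth_derive e s1.
    have [C1 C10 hC1] := supp_in_bounded (smooth_continuous s2) cK1 (supp_in_derive e cK1 KP1).
    apply: (L1_eq (f := fun z => 'D_e (moll k zeta) z * f z) mD) => [z _|]; first exact: mulrC.
    apply: (L1M_bounded mD (c := C1)) => //; apply: measurable_funTS.
    by apply: continuous_measurable_E; exact: smooth_continuous.
  transitivity (\int[dtx]_z (conv ('D_e (rho k.+1%:R^-1)) (f \_ D) z * zeta z)).
    rewrite Rintegral_mkcond; apply: eq_Rintegral => z _.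
    rewrite patchE; case: ifPn => [_|/negP zD].
      by rewrite (conv_derive _ _ (rho_csmooth n (e0 k)) If').2.
    by rewrite zK ?mulr0// => /KD /mem_set.
  rewrite conv_adjoint// [RHS]Rintegral_mkcond; apply: eq_Rintegral => z _.
  rewrite !patchE; case: ifP => _; last by rewrite mul0r.
  rewrite -mulrN; congr (_ * _).
  rewrite (conv_derive _ _ (rho_csmooth n (e0 k)) Iz).2 /conv.
  have Ic := conv_integrable z cDk Iz; rewrite -RintegralN//.
  apply: eq_Rintegral => y _; rewrite -mulNr; congr (_ * _).
  set x := z - y.
  have hA (s : R) (v0 x0 : E) : - (s *: v0 + x0) = s *: (- v0) - x0 by rewrite opprD scalerN.
  have h := @derive_affine R E E (fun z => - z) (fun z => - z) (rho k.+1%:R^-1) x e hA.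
  have eq1 : rho k.+1%:R^-1 \o (fun z : E => - z) = rho k.+1%:R^-1.
    by apply/funext => w /=; exact: rho_even.
  rewrite eq1 in h.
  have dr : derivable (rho k.+1%:R^-1) (- x) e by apply: smooth_derivable; exact: rho_smooth.
  by apply: oppr_inj; rewrite opprK; apply/esym; exact: etrans h (derive_opp dr).
rewrite normrN; apply: le_trans (hf _ tm) _; rewrite lerD2l.
apply: (conv_Lq q1 (e0 k) Iz _).2.
apply: (supp_in_integrable (K := K) (C := c `^ q)).
- exact: compact_measurable.
- exact: compact_finite.
- apply: measurable_powR_comp; exact: measurableT_comp.
- by move=> z zz; rewrite zK// normr0 powR0// gt_eqF.
- by move=> z; rewrite ger0_norm ?powR_ge0// ge0_ler_powR ?nnegrE ?(ltW q0)// (le_trans _ (zc z)).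
Qed.

End chain_rule.

(** * Weak gradients *)

Section gradients.
Context {R : realType} (n : nat).
Local Notation dx := (@lebesgue_rV R n).
Local Notation dt := (@lebesgueR R).
Local Notation dtx := (@lebesgue_prod R n dx).
Local Notation E := (R * 'rV[R]_n)%type.
Variables (Om : set 'rV[R]_n) (T : R).
Hypotheses (oOm : open Om) (bOm : bounded_set Om).
Local Notation Q := (cylinder Om T).
Local Notation px i := (0 : R, delta_mx ord0 i : 'rV[R]_n).
Local Notation e_ i := (delta_mx ord0 i : 'rV[R]_n).
Local Notation L1 f := (dtx.-integrable setT (EFin \o f)).
Implicit Types (f u v Psi : E -> R) (F G : E -> 'rV[R]_n).

Let oQ : open Q := open_cylinder oOm.
Let bQ : bounded_set Q := bounded_cylinder T bOm.
Let mQ : measurable Q := open_measurable_E oQ.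
Let mOm : measurable Om := open_measurable_rV oOm.

Lemma loc_integrable_test f Psi : loc_integrableQ Om T f -> test_function Q Psi ->
  dtx.-integrable Q (EFin \o fun z => f z * Psi z).
Proof.
move=> [mf hf] /test_elim[K [sP cK PK KQ]].
have mK := compact_measurable cK.
have IK := locint_L1 oQ mf hf cK KQ.
have [C C0 hC] := supp_in_bounded (smooth_continuous sP) cK PK.
have mP : measurable_fun setT Psi by apply: continuous_measurable_E; exact: smooth_continuous.
have I1 : dtx.-integrable K (EFin \o fun z => Psi z * f z).
  by apply: (L1M_bounded mK (c := C)) => //; exact: measurable_funTS.
apply: (integrableS measurableT mQ) => //.
apply: (L1_eq measurableT) (restrict_L1 mK I1) => z _; rewrite patchE.
case: ifPn => [_|/negP zK]; [exact: mulrC|rewrite PK ?mulr0// => Kz].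
by apply: zK; exact: mem_set.
Qed.

Lemma L1_loc f : dtx.-integrable Q (EFin \o f) -> loc_integrableQ Om T f.
Proof.
move=> /[dup] If /integrableP[/measurable_EFinP mf _]; split => // K cK KQ.
have := integrableS mQ (compact_measurable cK) KQ If.
by move=> /integrableP[_]; under eq_integral do rewrite /=.
Qed.

Lemma xgradP u F : is_xgrad Om T u F -> is_xgrad Om T u (xgrad Om T u).
Proof. by move=> h; apply: (xgetPex (fun=> 0)); exists F. Qed.

(** Weak gradients are unique, by the fundamental lemma of the calculus of
    variations. *)
Lemma xgrad_ae u F G : is_xgrad Om T u F -> is_xgrad Om T u G ->
  {ae dtx, forall z, Q z -> F z = G z}.
Proof.
move=> [_ lF hF] [_ lG hG].
have h i : {ae dtx, forall z, Q z -> F z ord0 i - G z ord0 i = 0}.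
  apply: (dual_zero oQ bQ).
  - by apply: measurable_funB; [exact: (lF i).1|exact: (lG i).1].
  - move=> K cK KQ; have mK := compact_measurable cK.
    have IB := L1B mK (locint_L1 oQ (lF i).1 (lF i).2 cK KQ) (locint_L1 oQ (lG i).1 (lG i).2 cK KQ).
    by case/integrableP : IB.
  move=> Psi tP; have IF := loc_integrable_test (lF i) tP; have IG := loc_integrable_test (lG i) tP.
  under eq_Rintegral do rewrite mulrBl; rewrite RintegralB//.
  by have := hF _ tP i; rewrite (hG _ tP i) => /oppr_inj ->; rewrite subrr.
have {}h : {ae dtx, forall z, forall i, Q z -> F z ord0 i - G z ord0 i = 0}.
  exact: filter_forall.
apply: filterS h => z hz Qz; apply/rowP => i; apply/eqP; rewrite -subr_eq0; apply/eqP; exact: hz.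
Qed.

Lemma Rintegral_test (F Psi : E -> R) : test_function Q Psi ->
  \int[dtx]_(z in Q) (F z * Psi z) = \int[dtx]_z (F z * Psi z).
Proof. by move=> tP; apply: test_setT; exact: test_supp_in. Qed.

Lemma test_csmooth (Psi : E -> R) D : test_function D Psi -> csmooth Psi.
Proof. by move=> /test_elim[K [sP cK PK KQ]]; split => //; exists K. Qed.

Lemma test_derive (Psi : E -> R) D (v : E) : test_function D Psi -> test_function D ('D_v Psi).
Proof.
move=> /test_elim[K [sP cK PK KQ]]; apply: (test_intro _ cK _ KQ); first exact: smooth_derive.
exact: supp_in_derive.
Qed.

Lemma xgrad_smooth chi : smooth chi -> is_xgrad Om T chi (fun z => \row_i 'D_(px i) chi z).
Proof.
move=> sc; have loc f : continuous f -> loc_integrableQ Om T f.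
  move=> cf; have mf : measurable_fun setT f by exact: continuous_measurable_E.
  split; first exact: measurable_funTS.
  move=> K cK KQ; have mK := compact_measurable cK.
  have [C [_ hC]] := compact_bounded (continuous_compact (continuous_subspaceT cf) cK).
  have I1 : dtx.-integrable K (EFin \o f).
    apply: (L1_dom (g := fun z => (`|C| + 1) * \1_K z) mK); first exact: measurable_funTS.
      by apply: (L1Zl mK); apply: (L1_indic mK) => //; exact: compact_finite.
    move=> z Kz; rewrite indicE mem_set// mulr1.
    by apply: hC; [rewrite (le_lt_trans (ler_norm _))// ltrDl|exists z].
  by case/integrableP : I1.
split; first by apply: loc; exact: smooth_continuous.
  move=> i; under eq_fun do rewrite mxE; apply: loc; apply: smooth_continuous; exact: smooth_derive.
move=> Psi tP i; rewrite (Rintegral_test _ (test_derive _ tP)).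
rewrite Rintegral_by_parts//; last exact: test_csmooth tP.
congr (- _); under [RHS]eq_Rintegral do rewrite mxE.
rewrite Rintegral_test//; apply: eq_Rintegral => z _; exact: mulrC.
Qed.

End gradients.

Section space_gradients.
Context {R : realType} (n : nat).
Local Notation dx := (@lebesgue_rV R n).
Local Notation dt := (@lebesgueR R).
Local Notation dtx := (@lebesgue_prod R n dx).
Local Notation E := (R * 'rV[R]_n)%type.
Variable Om : set 'rV[R]_n.
Hypotheses (oOm : open Om) (bOm : bounded_set Om).
Local Notation Q := (cylinder Om 1).
Local Notation e_ i := (delta_mx ord0 i : 'rV[R]_n).
Implicit Types (w psi : 'rV[R]_n -> R).

Let oQ : open Q := open_cylinder oOm.
Let bQ : bounded_set Q := bounded_cylinder 1 bOm.
Let mQ : measurable Q := open_measurable_E oQ.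
Let mOm : measurable Om := open_measurable_rV oOm.

Lemma smooth_lift w : smooth w -> smooth (fun z : E => w z.2).
Proof.
move=> sw k; apply: (Ck_affine (A := fun z : E => z.2) (L := fun z : E => z.2)) => //.
by move=> z; exact: cvg_snd.
Qed.

Lemma smooth_lift1 (h : R -> R) : (forall k, Ck k h) -> smooth (fun z : E => h z.1).
Proof.
move=> sw k; apply: (Ck_affine (A := fun z : E => z.1) (L := fun z : E => z.1)) => //.
by move=> z; exact: cvg_fst.
Qed.

Lemma csmooth_lift (h : R -> R) psi (I : set R) (K : set 'rV[R]_n) :
  (forall k, Ck k h) -> smooth psi -> compact I -> compact K -> supp_in I h -> supp_in K psi ->
  smooth (fun z : E => h z.1 * psi z.2) /\ supp_in (I `*` K) (fun z : E => h z.1 * psi z.2).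
Proof.
move=> sh sp cI cK hI hK; split.
  by apply: smoothM; [exact: smooth_lift1|exact: smooth_lift].
move=> z zIK; have [Iz|Iz] := pselect (I z.1); last by rewrite hI// mul0r.
by rewrite hK ?mulr0// => Kz; apply: zIK.
Qed.

Lemma continuous_measurable_rV w : continuous w -> measurable_fun setT w.
Proof.
move=> cw; have -> : w = (fun z : E => w z.2) \o (fun x => (0, x)) by [].
apply: (@measurableT_comp _ _ _ _ _ _ (fun z : E => w z.2)); last exact: pair1_measurable.
apply: continuous_measurable_E => z.
by apply: continuous_comp; [exact: cvg_snd|exact: cw].
Qed.

Lemma compact_measurable_rV (K : set 'rV[R]_n) : compact K -> measurable K.
Proof.
move=> cK; have := compact_closed (@norm_hausdorff _ _) cK => clK.
rewrite -[K]setCK; apply: measurableC; apply: open_measurable_rV; exact: closed_openC.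
Qed.

Lemma bounded_finite_rV (A : set 'rV[R]_n) : measurable A -> bounded_set A -> (dx A < +oo)%E.
Proof.
move=> mA [M [Mr hM]]; pose J : set R := [set t | `|t| < 1].
have mJ : measurable J.
  have -> : J = `]-1, 1[%classic by apply/seteqP; split => t; rewrite /J/= in_itv/= -ltr_norml.
  exact: measurable_itv.
have : (dtx (J `*` A) < +oo)%E.
  apply: bounded_finite; first exact: measurableX.
  exists (Num.max `|M| 1); split; first exact: num_real.
  move=> y; rewrite gt_max => /andP[My y1] [t x] [/= Jt Ax].
  rewrite prod_normE /= ge_max (ltW (lt_trans Jt y1))/=.
  by apply: hM Ax; rewrite (le_lt_trans (ler_norm _)).
rewrite /lebesgue_prod product_measure1E// [X in (X * _)%E](_ : _ = 2%:E)//; last first.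
  by have := @lebesgueR_itv R 1 ltr01; rewrite mulr1.
by case: (dx A) (measure_ge0 dx A) => [r| |]//; rewrite ?ltry// mulry gtr0_sg ?mul1e.
Qed.

Lemma compact_finite_rV (K : set 'rV[R]_n) : compact K -> (dx K < +oo)%E.
Proof.
move=> cK; apply: bounded_finite_rV; first exact: compact_measurable_rV.
exact: compact_bounded.
Qed.

Lemma supp_in_integrable_rV (K : set 'rV[R]_n) psi : compact K -> continuous psi ->
  supp_in K psi -> dx.-integrable setT (EFin \o psi).
Proof.
move=> cK cp hK; have [C C0 hC] := supp_in_bounded cp cK hK.
have mK := compact_measurable_rV cK.
apply: (L1_dom (g := fun x => C * \1_K x) measurableT); first exact: continuous_measurable_rV.
  apply: (L1Zl measurableT); apply: (L1_indic measurableT) => //; exact: compact_finite_rV.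
move=> x _; rewrite indicE; case: (boolP (x \in K)) => [|/negP xK]; first by rewrite mulr1.
by rewrite hK ?normr0 ?mulr0// => /mem_set.
Qed.

Lemma bump_seg : exists I : set R, [/\ compact I, supp_in I bump & measurable I].
Proof.
exists [set` `[-1, 1]%R]; split; [exact: segment_compact| |exact: measurable_itv].
move=> t; rewrite /= in_itv/= => h; apply: bump_out; rewrite leNgt; apply/negP => t1; apply: h.
by rewrite -ler_norml ltW.
Qed.

Lemma bump_int_gt0 : dt.-integrable setT (EFin \o (bump : R -> R)) /\ 0 < \int[dt]_t bump t.
Proof.
have [_ [_ _ _]] := bump_seg; pose J : set R := [set t | `|t| < 1].
have JE : J = `]-1, 1[%classic by apply/seteqP; split => t; rewrite /J/= in_itv/= -ltr_norml.
have mJ : measurable J by rewrite JE; exact: measurable_itv.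
have J2 : dt J = 2%:E by rewrite lebesgueR_itv// mulr1.
have Jf : (lebesgueR J < +oo)%E by rewrite J2 ltry.
have [I0 [cI hI _]] := bump_seg.
have cb := Ck_continuous (@bump_Ck R 0).
have [C C0 hC] := supp_in_bounded cb cI hI.
have mb : measurable_fun setT (bump : R -> R) by exact: continuous_measurable_fun.
have Ib : dt.-integrable setT (EFin \o (bump : R -> R)).
  apply: (L1_dom (g := fun x => C * \1_J x) measurableT) => //.
    by apply: (L1Zl measurableT); apply: (L1_indic measurableT) mJ Jf.
  move=> x _; rewrite indicE; case: (boolP (x \in J)) => [|/negP xK]; first by rewrite mulr1.
  rewrite bump_out ?normr0 ?mulr0//; rewrite leNgt; apply/negP => h; apply: xK; exact: mem_set.
split => //; rewrite lt_neqAle Rintegral_ge0 ?andbT; last by move=> z _; exact: bump_ge0.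
apply/eqP => /esym h.
have h' : (\int[dt]_z `|(EFin \o (bump : R -> R)) z| = 0)%E.
  rewrite -[LHS]fineK.
    congr EFin; rewrite -[RHS]h /Rintegral; congr fine; apply: eq_integral => z _.
    by rewrite /= ger0_norm// bump_ge0.
  by case/integrableP : Ib => _ Ik; rewrite ge0_fin_numE//; exact: integral_ge0.
have mk : measurable_fun setT (EFin \o (bump : R -> R)) by exact/measurable_EFinP.
have [N [mN N0 hN]] := (ae_eq_integral_abs dt measurableT mk).1 h'.
have : (0 < dt J)%E by rewrite J2 lte_fin.
rewrite (@subset_measure0 _ _ _ dt _ N) ?ltxx//.
move=> z zb; apply: hN => /(_ I)/= /eqP; rewrite eqe.
by rewrite gt_eqF// bump_gt0.
Qed.

Lemma integral_derive_rV psi v K : smooth psi -> compact K -> supp_in K psi ->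
  \int[dx]_x 'D_v psi x = 0.
Proof.
move=> sp cK hK; have [I0 [cI hI mI]] := bump_seg.
have [s2 k2] := csmooth_lift (@bump_Ck R) sp cI cK hI hK.
have cIK : compact (I0 `*` K) by exact: compact_setX.
have c2 : csmooth (fun z : E => bump z.1 * psi z.2) by split => //; exists (I0 `*` K).
have h0 := Rintegral_derive0 ((0, v) : E) c2.
have Id := csmooth_integrable (csmooth_derive ((0, v) : E) c2).
have [_ h1] := fubini_int Id; rewrite h0 in h1.
have e1 t x : 'D_((0, v) : E) (fun z : E => bump z.1 * psi z.2) (t, x) = bump t * 'D_v psi x.
  have -> : bump t * 'D_v psi x = 'D_v (bump t *: psi) x.
    by rewrite deriveZ//; exact: smooth_derivable.
  by rewrite -(slice_derive (fun z : E => bump z.1 * psi z.2) t x v).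
have [Ib b0] := bump_int_gt0.
have ID : dx.-integrable setT (EFin \o 'D_v psi).
  by apply: (supp_in_integrable_rV cK); [apply: smooth_continuous; exact: smooth_derive|exact: supp_in_derive].
have h2 : (\int[dx]_x 'D_v psi x) * (\int[dt]_t bump t) = 0.
  rewrite -RintegralZl// -[RHS]h1; apply: eq_Rintegral => t _.
  by under [RHS]eq_Rintegral do rewrite e1; rewrite RintegralZl// mulrC.
by move/eqP: h2; rewrite mulf_eq0 (gt_eqF b0) orbF => /eqP.
Qed.

Lemma loc_integrable_cts w : continuous w -> loc_integrable Om w.
Proof.
move=> cf; have mf : measurable_fun setT w by exact: continuous_measurable_rV.
split; first exact: measurable_funTS.
move=> K cK KQ; have mK := compact_measurable_rV cK.
have [C [_ hC]] := compact_bounded (continuous_compact (continuous_subspaceT cf) cK).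
have I1 : dx.-integrable K (EFin \o w).
  apply: (L1_dom (g := fun z => (`|C| + 1) * \1_K z) mK); first exact: measurable_funTS.
    by apply: (L1Zl mK); apply: (L1_indic mK) => //; exact: compact_finite_rV.
  move=> z Kz; rewrite indicE mem_set// mulr1.
  by apply: hC; [rewrite (le_lt_trans (ler_norm _))// ltrDl|exists z].
by case/integrableP : I1.
Qed.

Lemma Rintegral_test_rV (w psi : 'rV[R]_n -> R) : test_function Om psi ->
  \int[dx]_(z in Om) (w z * psi z) = \int[dx]_z (w z * psi z).
Proof.
move=> /test_elim[K [_ _ hK KO]]; rewrite Rintegral_mkcond; apply: eq_Rintegral => x _.
rewrite patchE; case: ifPn => // /negP xO; rewrite hK ?mulr0// => /KO.
by move=> /mem_set.
Qed.

(** Integration by parts on R^n is deduced from the one on R x R^n, by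
    tensorizing with a bump function of t. *)
Lemma is_grad_smooth psi : smooth psi -> is_grad Om psi (fun x => \row_i 'D_(e_ i) psi x).
Proof.
move=> sp; split; first by apply: loc_integrable_cts; exact: smooth_continuous.
  by move=> i; under eq_fun do rewrite mxE; apply: loc_integrable_cts; apply: smooth_continuous; exact: smooth_derive.
move=> phi tphi i; have [K [sphi cK hK KO]] := test_elim tphi.
have tD := test_intro (smooth_derive (e_ i) sphi) cK (supp_in_derive (e_ i) cK hK) KO.
rewrite Rintegral_test_rV//.
under [X in _ = - X]eq_Rintegral do rewrite mxE.
rewrite Rintegral_test_rV//; apply/eqP; rewrite -addr_eq0 -RintegralD//; last 2 first.
- apply: (supp_in_integrable_rV cK).
    by apply: smooth_continuous; apply: smoothM => //; exact: smooth_derive.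
  by move=> x xK; rewrite (supp_in_derive (e_ i) cK hK)// mulr0.
- apply: (supp_in_integrable_rV cK).
    by apply: smooth_continuous; apply: smoothM => //; exact: smooth_derive.
  by move=> x xK; rewrite hK// mulr0.
have := @integral_derive_rV (fun x => psi x * phi x) (e_ i) K (smoothM sp sphi) cK.
move=> <-; last by move=> x xK; rewrite hK// mulr0.
by apply/eqP; apply: eq_Rintegral => x _; rewrite derive_smoothM// [phi x * _]mulrC.
Qed.

Lemma grad_ae w F G : is_grad Om w F -> is_grad Om w G ->
  {ae dx, forall x, Om x -> F x = G x}.
Proof.
move=> [_ lF hF] [_ lG hG].
pose J : set R := `]0, 1[%classic.
have J1 : dt J = 1%:E.
  transitivity (@lebesgue_measure R J) => //.
  by rewrite lebesgue_measure_itv/= lte_fin ltr01 oppr0 adde0.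
have h i : {ae dx, forall x, Om x -> F x ord0 i = G x ord0 i}.
  pose H x := F x ord0 i - G x ord0 i.
  have mH : measurable_fun Om H by apply: measurable_funB; [exact: (lF i).1|exact: (lG i).1].
  have mH2 : measurable_fun Q (fun z => H z.2).
    have mH' : measurable_fun setT (H \_ Om) by apply/(measurable_restrictT _ mOm).
    apply: (@eq_measurable_fun _ _ _ _ _ ((H \_ Om) \o snd)).
      by move=> z /set_mem[_ Oz]; rewrite /= patchE mem_set.
    by apply: measurable_funTS; exact: measurableT_comp.
  have locI (K : set 'rV[R]_n) : compact K -> K `<=` Om -> dx.-integrable K (EFin \o H).
    move=> cK KO; have mK := compact_measurable_rV cK; apply: (L1B mK).
    - apply/integrableP; split; last exact: (lF i).2.
      by apply/measurable_EFinP; apply: measurable_funS (lF i).1.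
    - apply/integrableP; split; last exact: (lG i).2.
      by apply/measurable_EFinP; apply: measurable_funS (lG i).1.
  have lH : loc_integrableQ Om 1 (fun z => H z.2).
    split => //.
    move=> K cK KQ; pose K2 := [set z.2 | z in K].
      have cK2 : compact K2 by exact: slice_compact.
      have K2O : K2 `<=` Om by move=> _ [z /KQ[_ Oz] <-].
      have mK2 := compact_measurable_rV cK2.
      pose k := (fun x => `|H x|%:E) \_ K2.
      have I2 : (\int[dx]_x k x < +oo)%E.
        by have /integrableP[_] := locI _ cK2 K2O; rewrite integral_mkcond.
      have k0 x : (0 <= k x)%E by rewrite /k patchE; case: ifP => _ //; rewrite lee_fin.
      have mk : measurable_fun setT k.
        apply/(measurable_restrictT _ mK2); apply/measurable_EFinP; apply: measurableT_comp => //.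
        exact: measurable_funS mH.
      have mJ : measurable J by exact: measurable_itv.
      have mJ1 : measurable_fun setT (fun t : R => (\1_J t)%:E : \bar R).
        by apply/measurable_EFinP; exact: measurable_indic.
      pose g (z : E) : \bar R := ((\1_J z.1)%:E * k z.2)%E.
      have mg : measurable_fun setT g.
        apply: emeasurable_funM; last by exact: measurableT_comp mk measurable_snd.
        exact: (measurableT_comp mJ1 measurable_fst).
      have J0 t : (0 <= ((\1_J t)%:E : \bar R))%E by rewrite lee_fin indicE.
      apply: (@le_lt_trans _ _ (\int[dtx]_z g z)%E).
        rewrite integral_mkcond; apply: le_lower_integral0 => z; rewrite !patchE /g.
          by case: ifP.
        case: ifPn => [/set_mem Kz|_]; last by rewrite mule_ge0.
        have [Jz _] := KQ _ Kz; rewrite indicE mem_set// mul1e /k patchE mem_set//.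
        by exists z.
      rewrite integral_lebesgue_prod//; last by move=> z; rewrite mule_ge0.
      under eq_integral do rewrite /g/= ge0_integralZl//.
      rewrite ge0_integralZr//; last exact: integral_ge0.
      rewrite integral_indic// setIT [X in (X * _)%E](_ : _ = 1%:E) ?mul1e//.
  have hz : {ae dtx, forall z, Q z -> H z.2 = 0}.
    apply: (dual_zero oQ bQ); [exact: lH.1|exact: lH.2|].
      move=> Psi tP; have IHP := restrict_L1 mQ (loc_integrable_test oOm lH tP).
      have [_ hf] := fubini_int IHP.
      rewrite Rintegral_mkcond -[LHS]hf.
      transitivity (\int[dt]_t (cst 0 t : R)); last by rewrite /Rintegral integral0.
      apply: eq_Rintegral => t _.
      have [Jt|Jt] := pselect (J t); last first.
        transitivity (\int[dx]_x (cst 0 x : R)); last by rewrite /Rintegral integral0.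
        by apply: eq_Rintegral => x _; rewrite patchE; case: ifPn => // /set_mem[].
      have tpsi := slice_test t tP.
      transitivity (\int[dx]_(x in Om) ((F x ord0 i - G x ord0 i) * curve Psi t x)).
        rewrite [RHS]Rintegral_mkcond; apply: eq_Rintegral => x _; rewrite !patchE.
        case: ifPn => [/set_mem[_ Ox]|/negP h]; first by rewrite mem_set.
        by case: ifPn => // /set_mem Ox; exfalso; apply: h; exact: mem_set.
      have [K [sp cK PK KO]] := test_elim tpsi.
      have mK := compact_measurable_rV cK.
      have [C C0 hC] := supp_in_bounded (smooth_continuous sp) cK PK.
      have Imul (f : 'rV[R]_n -> R) : loc_integrable Om f -> dx.-integrable Om (EFin \o fun x => f x * curve Psi t x).
        move=> [mf lf]; apply: (integrableS measurableT mOm) => //.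
        have IfK : dx.-integrable K (EFin \o f).
          apply/integrableP; split; last exact: lf.
          by apply/measurable_EFinP; apply: measurable_funS mf.
        have I1 : dx.-integrable K (EFin \o fun x => curve Psi t x * f x).
          apply: (L1M_bounded mK (c := C)) => //; apply: measurable_funTS.
          by apply: continuous_measurable_rV; exact: smooth_continuous.
        have := I1; rewrite (integrable_mkcond _ mK); apply: eq_integrable => // x _.
        rewrite patchE; case: ifPn => [_|/negP xK]; first by rewrite /= mulrC.
        by rewrite /= PK ?mulr0// => /mem_set.
      under eq_Rintegral do rewrite mulrBl; rewrite RintegralB//; [|exact: Imul|exact: Imul].
      by have := hF _ tpsi i; rewrite (hG _ tpsi) => /oppr_inj ->; rewrite subrr.
  have [N [mN N0 hN]] := hz.
  pose A := Om `&` H @^-1` [set~ 0].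
  have mA : measurable A by apply: mH => //; apply: measurableC; exact: measurable_set1.
  have JAN : J `*` A `<=` N.
    by move=> [t x] [/= Jt [Ox Hx]]; apply: hN => /(_ (conj Jt Ox)).
  have mJ : measurable J by exact: measurable_itv.
  have JA0 : ((lebesgueR \x dx) (J `*` A) = 0)%E := subset_measure0 (measurableX mJ mA) mN JAN N0.
  have A0 : dx A = 0%E.
    rewrite -JA0 product_measure1E// [X in (X * _)%E](_ : _ = 1%:E) ?mul1e//.
   exists A; split => // x /= /not_implyP[Ox Fx]; split => //.
  by move=> /= /eqP; rewrite subr_eq0 => /eqP.
have {}h : {ae dx, forall z, forall i, Om z -> F z ord0 i = G z ord0 i}.
  exact: filter_forall.
apply: filterS h => z hz Qz; apply/rowP => i; exact: hz.
Qed.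

End space_gradients.

(** * Test functions in the renormalized equation *)

Section step_curves.
Context {R : realType} (V : lmodType R) (X : nspace V) (T q : R).
Hypotheses (T0 : 0 < T) (q0 : 0 < q) (N0 : forall x, (0 <= nnorm X x)%E).
Local Notation dt := (@lebesgueR R).

Definition step_curve (c : R -> V) (k : nat) (t : R) : V :=
  \sum_(i < k.+1) (\1_(`[i%:R * T / k.+1%:R, i.+1%:R * T / k.+1%:R[%classic : set R) t : R) *:
     c (i%:R * T / k.+1%:R).

Lemma step_curve_simple c k : simple_curve X (step_curve c k) \/
  exists i : 'I_k.+1, ~ X (c (i%:R * T / k.+1%:R)).
Proof.
have [[i hi]|h] := pselect (exists i : 'I_k.+1, ~ X (c (i%:R * T / k.+1%:R))).
  by right; exists i.
left; exists k.+1, (fun i : 'I_k.+1 => `[i%:R * T / k.+1%:R, i.+1%:R * T / k.+1%:R[%classic),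
  (fun i : 'I_k.+1 => c (i%:R * T / k.+1%:R)); split => //.
  move=> i; by apply: contrapT => hi; apply: h; exists i.
Qed.

(** The left endpoints of a subdivision of [0, T] into k + 1 intervals are used
    as nodes. *)
Lemma step_curveE c k t : 0 < t < T ->
  exists t', [/\ step_curve c k t = c t', 0 <= t', t' < T & `|t - t'| <= T / k.+1%:R].
Proof.
move=> /andP[t0 tT]; pose x := t * k.+1%:R / T.
have x0 : 0 <= x by rewrite divr_ge0 ?mulr_ge0// ltW.
have /andP[ix xi] := truncn_itv x0; set i := Num.truncn x in ix xi.
have k0 : 0 < k.+1%:R :> R by [].
have xT : x < k.+1%:R by rewrite /x ltr_pdivrMr// mulrC ltr_pM2l.
have ik : (i < k.+1)%N by rewrite -(ltr_nat R) (le_lt_trans ix).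
have tx : t = x * T / k.+1%:R by rewrite /x; field; rewrite !gt_eqF.
have inA (j : nat) : ((t \in (`[j%:R * T / k.+1%:R, j.+1%:R * T / k.+1%:R[%classic : set R)) = (j == i))%B.
  have -> : (t \in (`[j%:R * T / k.+1%:R, j.+1%:R * T / k.+1%:R[%classic : set R)) = (j%:R <= x < j.+1%:R).
    apply/idP/idP => [/set_mem|h]; last apply: mem_set; move=> /=; rewrite in_itv/= {1 2}tx.
      by rewrite ler_pM2r ?invr_gt0// ler_pM2r// ltr_pM2r ?invr_gt0// ltr_pM2r.
    by rewrite ler_pM2r ?invr_gt0// ler_pM2r// ltr_pM2r ?invr_gt0// ltr_pM2r.
  apply/idP/eqP => [/truncn_def <-//|->]; first by rewrite ix.
exists (i%:R * T / k.+1%:R); split.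
- rewrite /step_curve (bigD1 (Ordinal ik))//= indicE inA eqxx scale1r big1 ?addr0// => j ji.
  by rewrite indicE inA (_ : (j : nat) == i = false) ?scale0r//; apply: contraNF ji => /eqP ji; apply/eqP/val_inj.
- by rewrite divr_ge0 ?mulr_ge0// ltW.
- by rewrite (le_lt_trans _ tT)// tx ler_pM2r ?invr_gt0// ler_pM2r.
- have -> : t - i%:R * T / k.+1%:R = (x - i%:R) * (T / k.+1%:R) by rewrite {1}tx; ring.
  rewrite ger0_norm; last by rewrite mulr_ge0 ?subr_ge0// divr_ge0// ltW.
  rewrite -natr1 in xi.
  by rewrite ler_piMl ?divr_ge0 ?(ltW T0)// lerBlDl ltW.
Qed.

Lemma cvge0_le (f : nat -> \bar R) : (forall k, 0 <= f k)%E ->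
  (forall e, 0 < e -> \forall k \near \oo, (f k <= e%:E)%E) -> f @ \oo --> 0%E.
Proof.
move=> f0 h; apply/fine_cvgP; split.
  near=> k; rewrite ge0_fin_numE//; apply: (@le_lt_trans _ _ 1%:E); last exact: ltry.
  by near: k; exact: h.
apply/cvgrPdist_le => e e0; near=> k; rewrite sub0r normrN /=.
have : (f k <= e%:E)%E by near: k; exact: h.
by have := f0 k; case: (f k) => //= r; rewrite !lee_fin => r0 re; rewrite ger0_norm.
Unshelve. all: by end_near. Qed.

(** A continuous curve is the limit of its step curves, uniformly in time. *)
Lemma bochner_continuous (c : R -> V) (M : R) :
  (forall t, 0 <= t < T -> X (c t)) ->
  (forall t, 0 <= t < T -> (nnorm X (c t) <= M%:E)%E) ->
  (forall e, 0 < e -> exists2 r, 0 < r & forall s t, 0 <= s < T -> 0 <= t < T -> `|t - s| < r ->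
     (nnorm X (c t - c s) <= e%:E)%E) ->
  bochner X T q%:E c.
Proof.
move=> Xc cM hc.
have M0 : 0 <= M.
  by rewrite -lee_fin (le_trans (N0 (c 0)))// cM// lexx.
split; last first.
  rewrite /bochner_norm; pose I : set R := `]0, T[%classic.
  have hq : (\int[dt]_(t in I) (nnorm X (c t) `^ q) <= (M `^ q * T)%:E)%E.
    apply: (@le_trans _ _ (\int[dt]_(t in I) (M `^ q)%:E)%E).
      apply: le_lower_integral => [t _|t]; first exact: poweR_ge0.
      rewrite /I/= in_itv/= => /andP[t0 tT].
      by rewrite -poweR_EFin; apply: le_poweR_mono; rewrite ?(ltW q0)// cM// (ltW t0).
    rewrite integral_cst; last exact: measurable_itv.
    rewrite [X in (_ * X)%E](_ : _ = T%:E) -?EFinM//.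
    transitivity (@lebesgue_measure R I) => //.
    by rewrite lebesgue_measure_itv/= lte_fin T0 oppr0 adde0.
  have := bochner_powE T c q0 N0; rewrite /bochner_norm.
  case: ('N[dt]_q%:E[_])%E (@Lnorm_ge0 _ _ R dt q%:E ((fun t => nnorm X (c t)) \_ I)) => [r| |]// _.
    by rewrite ltry.
  by rewrite poweRyr ?gt_eqF// => h; move: hq; rewrite -h leye_eq.
exists (step_curve c); split.
  move=> k; have [//|[i]] := step_curve_simple c k; case; apply: Xc.
  rewrite divr_ge0 ?mulr_ge0 ?(ltW T0)//= ltr_pdivrMr// mulrC ltr_pM2l// ltr_nat.
  exact: ltn_ord.
apply: nearW => t t0T; split; first by apply: Xc; move: t0T => /andP[/ltW -> ->].
apply: cvge0_le => // e e0; have [r r0 hr] := hc e e0.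
have [k0 hk0] := @inv_lt_near R (r / T) (divr_gt0 r0 T0).
exists k0 => // k /= kk; have [t' [-> t'0 t'T tt']] := step_curveE c k t0T.
apply: hr; rewrite ?t'0//; first by move: t0T => /andP[/ltW -> ->].
apply: le_lt_trans tt' _; rewrite mulrC -ltr_pdivlMr//; exact: hk0.
Qed.

End step_curves.

Section smooth_admissible.
Context {R : realType} (n : nat).
Local Notation dx := (@lebesgue_rV R n).
Local Notation dt := (@lebesgueR R).
Local Notation dtx := (@lebesgue_prod R n dx).
Local Notation E := (R * 'rV[R]_n)%type.
Variables (Om : set 'rV[R]_n) (T : R).
Hypotheses (oOm : open Om) (bOm : bounded_set Om) (T0 : 0 < T).
Local Notation Q := (cylinder Om T).
Local Notation I := ([set` `]0, T[%R] : set R).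
Local Notation px i := (0 : R, delta_mx ord0 i : 'rV[R]_n).
Local Notation pt := (1 : R, 0 : 'rV[R]_n).
Local Notation e_ i := (delta_mx ord0 i : 'rV[R]_n).
Implicit Types (w psi : 'rV[R]_n -> R) (chi : E -> R).

Let mOm : measurable Om := open_measurable_rV oOm.
Let mQ : measurable Q := open_measurable_E (open_cylinder oOm).
Let cq (q : R) : R := fine (dx Om) `^ q^-1.
Let cq0 q : 0 <= cq q. Proof. exact: powR_ge0. Qed.

Let fOm : dx Om = (fine (dx Om))%:E.
Proof. by rewrite fineK// ge0_fin_numE//; exact: bounded_finite_rV. Qed.

Let fOm0 : 0 <= fine (dx Om).
Proof. exact: fine_ge0. Qed.

Lemma Lq_norm_bound (q M : R) w : 0 < q -> 0 <= M ->
  {ae dx, forall x, Om x -> `|w x| <= M} -> (Lq_norm dx Om q%:E w <= (M * cq q)%:E)%E.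
Proof.
move=> q0 M0 wM.
have h : (Lq_norm dx Om q%:E w `^ q <= (M `^ q * fine (dx Om))%:E)%E.
  rewrite Lq_normE//; apply: (@le_trans _ _ (\int[dx]_(x in Om) (M `^ q)%:E)%E).
    apply: ae_le_lower_integral => //.
    - by move=> x _; rewrite lee_fin powR_ge0.
    - by apply: filterS wM => x h Ox; rewrite lee_fin ge0_ler_powR ?nnegrE ?(ltW q0)// h.
  by rewrite integral_cst// [X in (_ * X)%E]fOm -EFinM.
have N0 : (0 <= Lq_norm dx Om q%:E w)%E by exact: Lnorm_ge0.
have qK : q * q^-1 = 1 by rewrite mulfV// gt_eqF.
rewrite -[X in (X <= _)%E](poweRe1 N0) -qK poweRrM.
have -> : M * cq q = (M `^ q * fine (dx Om)) `^ q^-1.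
  by rewrite powRM ?powR_ge0// -powRrM qK powRr1.
rewrite -poweR_EFin; apply: le_poweR_mono => //; rewrite ?invr_ge0 ?(ltW q0)//.
exact: poweR_ge0.
Qed.

Lemma W1_norm_bound (q M : R) psi : 0 < q -> 0 <= M -> smooth psi ->
  (forall x, Om x -> `|psi x| <= M) -> (forall x i, Om x -> `|'D_(e_ i) psi x| <= M) ->
  (W1_norm Om q psi <= (M * (cq q + n%:R * cq q))%:E)%E.
Proof.
move=> q0 M0 sp pM dM; rewrite /W1_norm mulrDr EFinD; apply: leeD.
  by apply: Lq_norm_bound => //; apply: nearW.
rewrite mulrA; apply: Lq_norm_bound => //; first by rewrite mulr_ge0.
have gs := is_grad_smooth Om sp; have gp : is_grad Om psi (grad Om psi) by apply: (xgetPex (fun=> 0)); exists (fun x => \row_i 'D_(e_ i) psi x).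
apply: filterS (grad_ae oOm bOm gp gs) => x h Ox; rewrite h// ger0_norm ?sqrtr_ge0//.
rewrite -[leRHS]ger0_norm ?mulr_ge0// -sqrtr_sqr; apply: ler_wsqrtr.
apply: (@le_trans _ _ (\sum_(i < n) M ^+ 2)).
  apply: ler_sum => i _; rewrite mxE -expr2 -[leLHS]ger0_norm ?sqr_ge0//.
  by rewrite normrX lerXn2r ?nnegrE// dM.
rewrite sumr_const card_ord exprMn -[leLHS]mulr_natr ler_wpM2l ?sqr_ge0//.
by rewrite -natrX ler_nat; case: (n) => // m; rewrite expnS leq_pmulr.
Qed.

Lemma Lq_cts (q : R) w M : 0 < q -> measurable_fun Om w -> 0 <= M ->
  {ae dx, forall x, Om x -> `|w x| <= M} -> Lq dx Om q%:E w.
Proof. by move=> q0 mw M0 h; split => //; apply: le_lt_trans (Lq_norm_bound q0 M0 h) (ltry _). Qed.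

Lemma W10_test (q : R) psi : 0 < q -> test_function Om psi -> W10 Om q psi.
Proof.
move=> q0 tp; have [K [sp cK PK KO]] := test_elim tp.
have gs := is_grad_smooth Om sp; have gp : is_grad Om psi (grad Om psi) by apply: (xgetPex (fun=> 0)); exists (fun x => \row_i 'D_(e_ i) psi x).
have [C C0 hC] := supp_in_bounded (smooth_continuous sp) cK PK.
split; last first.
  exists (fun=> psi); split => //.
  have -> : (fun _ : nat => W1_norm Om q (psi - psi)) = cst 0%E; last exact: cvg_cst.
  apply/funext => k /=; apply/eqP; rewrite eq_le; apply/andP; split; last by rewrite adde_ge0// Lnorm_ge0.
  have -> : psi - psi = cst 0 by apply/funext => x; exact: subrr.
  have := @W1_norm_bound q 0 (cst 0) q0 (lexx _) (smooth_cst 0); rewrite mul0r; apply.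
  - by move=> x _; rewrite normr0.
  - by move=> x i _; rewrite derive_cst normr0.
split.
- apply: (Lq_cts (M := C)) => //; first by apply: measurable_funTS; apply: continuous_measurable_rV; exact: smooth_continuous.
  exact: nearW.
- by exists (grad Om psi).
- move=> i; have [C1 C10 hC1] := supp_in_bounded (smooth_continuous (smooth_derive (e_ i) sp)) cK (supp_in_derive (e_ i) cK PK).
  apply: (Lq_cts (M := C1)) => //; first by have [_ /(_ i)[]] := gp.
  by apply: filterS (grad_ae oOm bOm gp gs) => x h Ox; rewrite h// mxE.
Qed.

Lemma curve_unif chi : csmooth chi -> forall e, 0 < e -> exists2 r, 0 < r & forall s t x, `|t - s| < r ->
  `|chi (t, x) - chi (s, x)| <= e.
Proof.
move=> [sc [K cK PK]] e e0; have [r r0 hr] := supp_in_unif (smooth_continuous sc) cK PK e0.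
exists r => // s t x ts; apply: hr; rewrite prod_normE /= subrr normr0 gt_max ts r0//.
Qed.

(** A smooth function with compact support and its derivatives are uniformly
    continuous, and Om has finite measure. *)
Lemma curve_unif_W1 (q : R) chi : 0 < q -> test_function Q chi -> forall e, 0 < e ->
  exists2 r, 0 < r & forall s t, `|t - s| < r -> (W1_norm Om q (curve chi t - curve chi s : 'rV[R]_n -> R)%R <= e%:E)%E.
Proof.
move=> q0 tc e e0; pose c := cq q + n%:R * cq q + 1.
have c0 : 0 < c by rewrite ltr_wpDl// addr_ge0// mulr_ge0.
have ec : 0 < e / c by rewrite divr_gt0.
have sc : smooth chi by case: tc.
have [r r0 hr] := curve_unif (test_csmooth tc) ec.
have hi i : exists r, 0 < r /\ forall s t x, `|t - s| < r -> `|'D_(px i) chi (t, x) - 'D_(px i) chi (s, x)| <= e / c.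
  by have [r1 r10 h1] := curve_unif (test_csmooth (test_derive (px i) tc)) ec; exists r1.
have [ri hri] := choice hi.
exists (\big[Order.min/r]_i ri i).
  by apply: lt_bigmin => // i _; exact: (hri i).1.
move=> s t ts; have sD : smooth (curve chi t - curve chi s).
  have -> : curve chi t - curve chi s = fun x => curve chi t x + (-1) * curve chi s x by apply/funext => x; rewrite mulN1r.
  apply: smoothD; first exact: slice_smooth.
  by apply: smoothM; [exact: smooth_cst|exact: slice_smooth].
apply: (@le_trans _ _ (e / c * (cq q + n%:R * cq q))%:E).
  apply: W1_norm_bound => //; first exact: ltW.
  - move=> x _; apply: hr; apply: lt_le_trans ts _; exact: bigmin_le_id.
  - move=> x i _; rewrite deriveB; [|exact: smooth_derivable (slice_smooth _ _)|exact: smooth_derivable (slice_smooth _ _)].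
    rewrite !slice_derive; apply: (hri i).2; apply: lt_le_trans ts _; exact: bigmin_le_cond.
by rewrite lee_fin -mulrA ler_piMr ?(ltW e0)// mulrC ler_pdivrMr// mul1r /c lerDl.
Qed.

Lemma test_in_LpX (q : R) chi : 0 < q -> test_function Q chi -> in_LpX Om T (W10 Om q) q%:E chi.
Proof.
move=> q0 tc; split.
  apply: measurable_funTS; apply: continuous_measurable_E; apply: smooth_continuous; by case: tc.
have N0 w : (0 <= nnorm (W10 Om q) w)%E by rewrite /nnorm/= /W1_norm adde_ge0// Lnorm_ge0.
have [K [sc cK PK KQ]] := test_elim tc.
have [C C0 hC] := supp_in_bounded (smooth_continuous sc) cK PK.
have hi i : exists C1, forall z, `|'D_(px i) chi z| <= C1.
  by have [C1 _ h1] := supp_in_bounded (smooth_continuous (smooth_derive (px i) sc)) cK (supp_in_derive (px i) cK PK); exists C1.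
have [Ci hCi] := choice hi.
pose M := \big[Order.max/C]_i Ci i.
apply: (@bochner_continuous R _ (W10 Om q) T q T0 q0 N0 _ (M * (cq q + n%:R * cq q))).
- by move=> t _; apply: W10_test => //; exact: slice_test tc.
- move=> t _; apply: W1_norm_bound => //; first by rewrite (le_trans C0)// bigmax_ge_id.
  + exact: slice_smooth.
  + by move=> x _; rewrite (le_trans (hC _))// bigmax_ge_id.
  + by move=> x i _; rewrite slice_derive (le_trans (hCi i _))// le_bigmax.
- move=> e e0; have [r r0 hr] := curve_unif_W1 q0 tc e0; exists r => // s t _ _; exact: hr.
Qed.

Lemma Lq_L1_bound (q : R) w : 1 < q -> measurable_fun Om w ->
  (\int[dx]_(x in Om) `|w x|%:E <= (cq (q / (q - 1)))%:E * Lq_norm dx Om q%:E w)%E.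
Proof.
move=> q1 mw; have q0 : 0 < q by exact: lt_trans q1.
have q10 : 0 < q - 1 by rewrite subr_gt0.
pose w' := w \_ Om; pose j : 'rV[R]_n -> R := (cst (1 : R) : 'rV[R]_n -> R) \_ Om.
have mw' : measurable_fun setT w' by apply/(measurable_restrictT _ mOm).
have mj : measurable_fun setT j by apply/(measurable_restrictT _ mOm).
have qq : q^-1 + (q / (q - 1))^-1 = 1 by field; rewrite !gt_eqF.
have := @hoelder _ _ R dx w' j q (q / (q - 1)) mw' mj q0 (divr_gt0 q0 q10) qq.
rewrite Lnorm1 => h; rewrite muleC.
have e1 : (\int[dx]_(x in Om) `|w x|%:E = \int[dx]_x `|(EFin \o (w' \* j)%R) x|)%E.
  rewrite integral_mkcond; apply: eq_integral => x _; rewrite /w' /j/= !patchE.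
  by case: ifP => _; rewrite ?mulr1// mulr0 normr0.
rewrite e1; apply: (le_trans h).
have -> : @Lnorm _ _ R dx q%:E (EFin \o w') = Lq_norm dx Om q%:E w.
  by rewrite /Lq_norm; apply: eq_Lnorm => x; rewrite /w'/= !patchE; case: ifP.
apply: lee_wpmul2l; first exact: Lnorm_ge0.
have -> : @Lnorm _ _ R dx (q / (q - 1))%:E (EFin \o j) = Lq_norm dx Om (q / (q - 1))%:E (cst 1 : 'rV[R]_n -> R).
  by rewrite /Lq_norm; apply: eq_Lnorm => x; rewrite /j/= !patchE; case: ifP.
have := @Lq_norm_bound (q / (q - 1)) 1 (cst 1); rewrite mul1r; apply; rewrite ?divr_gt0//.
by apply: nearW => x _; rewrite normr1.
Qed.

(** The time derivative of chi, as a functional on functions of x. *)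
Definition time_pairing chi (t : R) w : R := \int[dx]_(x in Om) ('D_pt chi (t, x) * w x).

Section pairing.
Variables (p : R) (p1 : 1 < p).
Local Notation X := (W10 Om p).
Local Notation C := (cq (p / (p - 1))).

Let W10_L1 w : X w -> dx.-integrable Om (EFin \o w) /\
  ((\int[dx]_(x in Om) `|w x|)%:E <= C%:E * nnorm X w)%E.
Proof.
move=> [[[mw fw] _ _] _].
have hb := Lq_L1_bound p1 mw.
have Iw : dx.-integrable Om (EFin \o w).
  apply/integrableP; split; first exact/measurable_EFinP.
  apply: le_lt_trans hb _; rewrite -ge0_fin_numE ?mule_ge0 ?lee_fin ?Lnorm_ge0//.
  by rewrite fin_numM// ge0_fin_numE// Lnorm_ge0.
split => //; rewrite /Rintegral fineK; last by apply: integrable_fin_num => //; exact: L1norm.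
apply: (le_trans hb); apply: lee_wpmul2l; first by rewrite lee_fin.
by rewrite /nnorm/= /W1_norm leeDl// Lnorm_ge0.
Qed.

Let pairing_bound (d : 'rV[R]_n -> R) (M : R) w : measurable_fun Om d ->
  (forall x, Om x -> `|d x| <= M) -> 0 <= M -> X w ->
  dx.-integrable Om (EFin \o fun x => d x * w x) /\
  (`|\int[dx]_(x in Om) (d x * w x)|%:E <= (M * C)%:E * nnorm X w)%E.
Proof.
move=> md dM M0 Xw; have [Iw hw] := W10_L1 Xw.
have Id := L1M_bounded mOm md dM Iw; split => //.
apply: (@le_trans _ _ (M * \int[dx]_(x in Om) `|w x|)%:E).
  rewrite lee_fin -RintegralZl//; last exact: L1norm.
  apply: Rintegral_abs_le => //; first exact: L1_measurable Id.
    by apply: L1Zl => //; exact: L1norm.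
  by move=> x Ox; rewrite normrM ler_wpM2r// dM.
by rewrite !EFinM -muleA; apply: lee_wpmul2l; rewrite ?lee_fin.
Qed.

Let mcurve chi t : smooth chi -> measurable_fun Om (curve chi t).
Proof.
by move=> sc; apply: measurable_funTS; apply: measurable_curve; apply: continuous_measurable_E; exact: smooth_continuous.
Qed.

Lemma time_pairing_dual chi : test_function Q chi ->
  bochner (dual_space X) T (conjugate p)%:E (time_pairing chi).
Proof.
move=> tc; have td := test_derive pt tc.
have [K [sd cK PK KQ]] := test_elim td.
have [M M0 hM] := supp_in_bounded (smooth_continuous sd) cK PK.
have X0 : X (cst 0).
  apply: W10_test; first exact: lt_trans p1.
  apply: (@test_intro _ _ set0) => //; [exact: smooth_cst|exact: compact0].
have N00 : (nnorm X (fun=> 0%R) <= 1)%E.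
  have := @W1_norm_bound p 0 (cst 0) (lt_trans ltr01 p1) (lexx _) (smooth_cst 0); rewrite mul0r => h.
  apply: (@le_trans _ _ 0%E) => //; apply: h.
  - by move=> x _; rewrite normr0.
  - by move=> x i _; rewrite derive_cst normr0.
have pp0 : 0 < conjugate p by rewrite divr_gt0 ?subr_gt0// (lt_trans ltr01 p1).
have N0 (h : ('rV[R]_n -> R) -> R) : (0 <= nnorm (dual_space X) h)%E.
  apply: le_trans (_ : (`|h (cst 0)|%:E <= _)%E); first by rewrite lee_fin.
  by apply: ereal_sup_ubound; exists (cst 0).
have lin (d : 'rV[R]_n -> R) : measurable_fun Om d -> (forall x, Om x -> `|d x| <= M) ->
    forall a x y, X x -> X y -> \int[dx]_(z in Om) (d z * (a *: x + y) z) =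
      a * \int[dx]_(z in Om) (d z * x z) + \int[dx]_(z in Om) (d z * y z).
  move=> md dM a x y Xx Xy; have [I1 _] := pairing_bound md dM M0 Xx; have [I2 _] := pairing_bound md dM M0 Xy.
  rewrite -RintegralZl// -RintegralD//; last exact: L1Zl.
  by apply: eq_Rintegral => z _ /=; rewrite /GRing.scale/= mulrDr mulrCA.
apply: (@bochner_continuous R _ (dual_space X) T (conjugate p) T0 pp0 N0 _ (M * C)).
- move=> t _; split; first exact: (lin _ (mcurve t sd) (fun x _ => hM (t, x))).
  by exists (M * C) => w Xw; exact: (pairing_bound (mcurve t sd) (fun x _ => hM (t, x)) M0 Xw).2.
- move=> t _; apply: ub_ereal_sup => _ [w [Xw Nw] <-].
  apply: le_trans ((pairing_bound (mcurve t sd) (fun x _ => hM (t, x)) M0 Xw).2) _.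
  by rewrite -[leRHS]mule1; apply: lee_wpmul2l => //; rewrite lee_fin mulr_ge0.
- move=> e e0; pose e' := e / (C + 1).
  have e'0 : 0 < e' by rewrite divr_gt0// ltr_wpDl.
  have [r r0 hr] := curve_unif (test_csmooth td) e'0; exists r => // s t _ _ ts.
  apply: ub_ereal_sup => _ [w [Xw Nw] <-].
  have -> : (time_pairing chi t - time_pairing chi s) w = \int[dx]_(x in Om) ((curve ('D_pt chi) t x - curve ('D_pt chi) s x) * w x).
    have [I1 _] := pairing_bound (mcurve t sd) (fun x _ => hM (t, x)) M0 Xw.
    have [I2 _] := pairing_bound (mcurve s sd) (fun x _ => hM (s, x)) M0 Xw.
    rewrite /= -[LHS]/(time_pairing chi t w - time_pairing chi s w) /time_pairing -RintegralB//.
    by apply: eq_Rintegral => x _; rewrite -mulrBl.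
  have md : measurable_fun Om (fun x => curve ('D_pt chi) t x - curve ('D_pt chi) s x).
    by apply: measurable_funB; exact: mcurve.
  apply: le_trans ((pairing_bound md (fun x _ => hr s t x ts) (ltW e'0) Xw).2) _.
  apply: (@le_trans _ _ (e' * C)%:E).
    by rewrite -[leRHS]mule1; apply: lee_wpmul2l => //; rewrite lee_fin mulr_ge0// ltW.
  by rewrite lee_fin /e' mulrAC ler_pdivrMr ?ltr_wpDl// ler_wpM2l ?(ltW e0)// lerDl.
Qed.

(** Fubini's theorem, on the slices of f. *)
Lemma time_pairing_int chi f : test_function Q chi -> dtx.-integrable Q (EFin \o f) ->
  \int[dt]_(t in I) time_pairing chi t (curve f t) = \int[dtx]_(z in Q) (f z * 'D_pt chi z).
Proof.
move=> tc If; have td := test_derive pt tc.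
have [K [sd cK PK KQ]] := test_elim td.
have [M M0 hM] := supp_in_bounded (smooth_continuous sd) cK PK.
have Id : dtx.-integrable Q (EFin \o fun z => 'D_pt chi z * f z).
  apply: (L1M_bounded mQ (c := M)) => //; apply: measurable_funTS.
  by apply: continuous_measurable_E; exact: smooth_continuous.
have [_ h] := fubini_int (restrict_L1 mQ Id).
transitivity (\int[dtx]_z ((fun z => 'D_pt chi z * f z) \_ Q) z); last first.
  rewrite [RHS]Rintegral_mkcond; apply: eq_Rintegral => z _; rewrite !patchE.
  by case: ifP => // _; exact: mulrC.
rewrite -h Rintegral_mkcond; apply: eq_Rintegral => t _; rewrite patchE.
case: ifPn => [/set_mem It|/negP It].
  rewrite /time_pairing Rintegral_mkcond; apply: eq_Rintegral => x _; rewrite !patchE.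
  case: ifPn => [/set_mem Ox|/negP Ox]; first by rewrite mem_set.
  by case: ifPn => // /set_mem[_ Ox']; exfalso; apply: Ox; exact: mem_set.
transitivity (\int[dx]_x (cst 0 x : R)); first by rewrite /Rintegral integral0.
apply: eq_Rintegral => x _; rewrite patchE; case: ifPn => // /set_mem[It' _].
by exfalso; apply: It; exact: mem_set.
Qed.

(** All requirements on the slices in time follow from the uniform continuity of
    chi and of its derivatives. *)
Lemma smooth_renormalized_test chi : test_function Q chi ->
  renormalized_test Om T p chi (time_pairing chi).
Proof.
move=> tc; have p0 : 0 < p by exact: lt_trans p1.
have [K [sc cK PK KQ]] := test_elim tc.
have [M M0 hM] := supp_in_bounded (smooth_continuous sc) cK PK.
have mc : measurable_fun setT chi by apply: continuous_measurable_E; exact: smooth_continuous.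
split.
- exact: test_in_LpX.
- split; first exact: measurable_funTS.
  rewrite /Lq_norm unlock /Lnorm; case: ifP => _; last exact: ltry.
  apply: (@le_lt_trans _ _ M%:E); last exact: ltry.
  apply/ess_sup_inf.ess_supP; apply: nearW => z; rewrite /= patchE; case: ifP => _; first by rewrite /= lee_fin.
  by rewrite (_ : point = 0%E :> \bar R)// abse0 lee_fin.
- exact: time_pairing_dual.
- move=> phi tphi; rewrite time_pairing_int//; last first.
    have h := csmooth_integrable (test_csmooth tphi); exact: integrableS h.
  rewrite (Rintegral_test _ (test_derive pt tphi)).
  rewrite Rintegral_by_parts//; last exact: test_csmooth tphi.
  congr (- _); rewrite Rintegral_test ?mulrC//; last exact: test_derive.
- split=> [t /andP[t0 tT]|].
    split.
      apply: (Lq_cts (M := M)) => //; first exact: mcurve.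
      by apply: nearW => x _; exact: hM.
    apply/fine_cvgP.
    have H e : 0 < e -> exists2 r, 0 < r & forall s, `|s - t| < r ->
        (Lq_norm dx Om 2%:E (curve chi s - curve chi t : 'rV[R]_n -> R)%R <= e%:E)%E.
      move=> e0; pose e' := e / (cq 2 + 1).
      have e'0 : 0 < e' by rewrite divr_gt0// ltr_wpDl.
      have [r r0 hr] := curve_unif (test_csmooth tc) e'0; exists r => // s st.
      apply: (@le_trans _ _ (e' * cq 2)%:E).
        by apply: Lq_norm_bound => //; [exact: ltW|apply: nearW => x _; exact: hr].
      by rewrite lee_fin /e' mulrAC ler_pdivrMr ?ltr_wpDl// ler_wpM2l ?(ltW e0)// lerDl.
    split.
      have [r r0 hr] := H 1 ltr01.
      apply/nbhs_ballP; exists r => // s; rewrite /ball/= distrC => st _.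
      rewrite ge0_fin_numE ?Lnorm_ge0//; apply: le_lt_trans (hr s st) _; exact: ltry.
    apply/cvgrPdist_le => e e0; have [r r0 hr] := H e e0.
    apply/nbhs_ballP; exists r => // s; rewrite /ball/= distrC => st _.
    rewrite sub0r normrN; have := hr s st.
    have : (0 <= Lq_norm dx Om 2%:E (curve chi s - curve chi t : 'rV[R]_n -> R)%R)%E by exact: Lnorm_ge0.
    by case: Lq_norm => //= y; rewrite !lee_fin => y0 ye; rewrite ger0_norm.
  apply: nearW => x _; apply: PK => /KQ[/=]; by rewrite in_itv/= ltxx andbF.
Qed.

End pairing.

End smooth_admissible.

(** * The renormalizing functions *)

Section spline.
Context {R : realType}.
Implicit Types (x y s : R).

Definition posp x : R := Num.max x 0.

Lemma posp_ge0 x : 0 <= posp x.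
Proof. by rewrite /posp le_max lexx orbT. Qed.

Lemma pospE x : (x <= 0 /\ posp x = 0) \/ (0 <= x /\ posp x = x).
Proof. by rewrite /posp; case: (leP x 0) => h; [left|right; rewrite ltW]. Qed.

(** It handles the nodes of the splines below without one-sided limits. *)
Lemma is_derive_quad (f : R -> R) x (d C : R) :
  (forall y, `|f y - f x - d * (y - x)| <= C * (y - x) ^+ 2) -> is_derive x (1 : R) f d.
Proof.
move=> h; have C0 : 0 <= C.
  by have := h (x + 1); rewrite (addrC x) addrK expr1n !mulr1 => h'; exact: le_trans (normr_ge0 _) h'.
have cv : (fun e : R => e^-1 *: (f (e *: 1 + x) - f x)) @ 0^' --> d.
  apply/cvgrPdist_le => e e0; near=> t.
  have t0 : t != 0 by near: t; exact: nbhs_dnbhs_neq.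
  rewrite /GRing.scale/= mulr1 -normrN opprB.
  have -> : t^-1 * (f (t + x) - f x) - d = t^-1 * (f (t + x) - f x - d * t) by field.
  rewrite normrM; have := h (t + x); rewrite addrK => ht.
  apply: (@le_trans _ _ (`|t^-1| * (C * t ^+ 2))); first by rewrite ler_wpM2l.
  have -> : `|t^-1| * (C * t ^+ 2) = C * `|t|.
    rewrite -[t ^+ 2]ger0_norm ?sqr_ge0// normrX normfV; field; rewrite normr_eq0//.
  rewrite (le_trans (y := (C + 1) * `|t|))// ?ler_wpM2r ?lerDl//.
  rewrite -ler_pdivlMl ?ltr_wpDl// mulrC.
  near: t; apply: dnbhs0_le; by rewrite divr_gt0// ltr_wpDl.
have dv : derivable f x 1 by apply/cvg_ex; exists d.
apply: DeriveDef => //; exact: cvg_lim.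
Unshelve. all: by end_near. Qed.

Lemma is_derive_posp2 (c : R) x : is_derive x (1 : R) (fun y => posp (y - c) ^+ 2) (2 * posp (x - c)).
Proof.
apply: (@is_derive_quad _ _ _ 1) => y; rewrite mul1r.
have -> : y - x = (y - c) - (x - c) by ring.
move: (x - c) (y - c) => a b.
have [[ha ->]|[ha ->]] := pospE a; have [[hb ->]|[hb ->]] := pospE b;
  rewrite ?expr0n/= ler_norml; have s1 := sqr_ge0 (b - a); have s2 := sqr_ge0 a; have s3 := sqr_ge0 b;
  rewrite !expr2 in s1 s2 s3 *; apply/andP; split; nra.
Qed.

Lemma is_derive_posp3 (c : R) x : is_derive x (1 : R) (fun y => posp (y - c) ^+ 3) (3 * posp (x - c) ^+ 2).
Proof.
have -> : (fun y => posp (y - c) ^+ 3) = (fun y => y - c) \* (fun y => posp (y - c) ^+ 2).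
  by apply/funext => y /=; rewrite exprS; case: (pospE (y - c)) => -[_ ->] //; rewrite expr0n/= !mulr0.
have h1 : is_derive x (1 : R) (fun y => y - c) 1.
  have -> : (fun y => y - c) = id \- cst c by [].
  by apply: is_derive_eq; rewrite subr0.
have := is_deriveM h1 (is_derive_posp2 c x); set D := (X in is_derive _ _ _ X).
have -> : D = 3 * posp (x - c) ^+ 2 => //.
by rewrite /D /GRing.scale/= mulr1; case: (pospE (x - c)) => -[_ ->]; ring.
Qed.

(** The hat function that is 1 at 3/2 and vanishes outside (1/2, 5/2), as a
    combination of positive parts, for which primitives are explicit. *)
Definition tent x : R := posp (x - 2^-1) - 2 * posp (x - 3 / 2) + posp (x - 5 / 2).
Definition tent_int x : R :=
  2^-1 * (posp (x - 2^-1) ^+ 2 - 2 * posp (x - 3 / 2) ^+ 2 + posp (x - 5 / 2) ^+ 2).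
Definition tent_int2 x : R :=
  6^-1 * (posp (x - 2^-1) ^+ 3 - 2 * posp (x - 3 / 2) ^+ 3 + posp (x - 5 / 2) ^+ 3).

Lemma is_derive_tent_int x : is_derive x (1 : R) tent_int (tent x).
Proof.
have d1 := is_derive_posp2 2^-1 x; have d2 := is_derive_posp2 (3 / 2) x; have d3 := is_derive_posp2 (5 / 2) x.
have := is_deriveZ 2^-1 (is_deriveD (is_deriveB d1 (is_deriveZ 2 d2)) d3).
set D := (X in is_derive _ _ _ X); have -> : D = tent x; last by [].
by rewrite /D /GRing.scale/= /tent; field.
Qed.

Lemma is_derive_tent_int2 x : is_derive x (1 : R) tent_int2 (tent_int x).
Proof.
have d1 := is_derive_posp3 2^-1 x; have d2 := is_derive_posp3 (3 / 2) x; have d3 := is_derive_posp3 (5 / 2) x.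
have := is_deriveZ 6^-1 (is_deriveD (is_deriveB d1 (is_deriveZ 2 d2)) d3).
set D := (X in is_derive _ _ _ X); have -> : D = tent_int x; last by [].
by rewrite /D /GRing.scale/= /tent_int; field.
Qed.

Lemma tent_ge0 x : 0 <= tent x.
Proof.
rewrite /tent; have [[h1 ->]|[h1 ->]] := pospE (x - 2^-1);
have [[h2 ->]|[h2 ->]] := pospE (x - 3 / 2); have [[h3 ->]|[h3 ->]] := pospE (x - 5 / 2); lra.
Qed.

Lemma tent_le1 x : tent x <= 1.
Proof.
rewrite /tent; have [[h1 ->]|[h1 ->]] := pospE (x - 2^-1);
have [[h2 ->]|[h2 ->]] := pospE (x - 3 / 2); have [[h3 ->]|[h3 ->]] := pospE (x - 5 / 2); lra.
Qed.

Lemma tent_out x : ~ (2^-1 < x < 5 / 2) -> tent x = 0.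
Proof.
move=> /negP; rewrite negb_and -!leNgt => /orP h.
rewrite /tent; have [[h1 ->]|[h1 ->]] := pospE (x - 2^-1);
have [[h2 ->]|[h2 ->]] := pospE (x - 3 / 2); have [[h3 ->]|[h3 ->]] := pospE (x - 5 / 2);
  case: h => h; lra.
Qed.

Lemma tent_ge_half x : 1 <= x <= 2 -> 2^-1 <= tent x.
Proof.
move=> /andP[g1 g2].
rewrite /tent; have [[h1 ->]|[h1 ->]] := pospE (x - 2^-1);
have [[h2 ->]|[h2 ->]] := pospE (x - 3 / 2); have [[h3 ->]|[h3 ->]] := pospE (x - 5 / 2); lra.
Qed.

Lemma tent_int_bounds x : 0 <= tent_int x <= 1.
Proof.
rewrite /tent_int; have [[h1 ->]|[h1 ->]] := pospE (x - 2^-1);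
have [[h2 ->]|[h2 ->]] := pospE (x - 3 / 2); have [[h3 ->]|[h3 ->]] := pospE (x - 5 / 2);
  apply/andP; split; nra.
Qed.

Lemma tent_int_left x : x <= 2^-1 -> tent_int x = 0.
Proof.
move=> h; rewrite /tent_int; have [[h1 ->]|[h1 ->]] := pospE (x - 2^-1);
have [[h2 ->]|[h2 ->]] := pospE (x - 3 / 2); have [[h3 ->]|[h3 ->]] := pospE (x - 5 / 2); nra.
Qed.

Lemma tent_int_right x : 5 / 2 <= x -> tent_int x = 1.
Proof.
move=> h; rewrite /tent_int; have [[h1 ->]|[h1 ->]] := pospE (x - 2^-1);
have [[h2 ->]|[h2 ->]] := pospE (x - 3 / 2); have [[h3 ->]|[h3 ->]] := pospE (x - 5 / 2); nra.
Qed.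

Lemma tent_int2_left x : x <= 2^-1 -> tent_int2 x = 0.
Proof.
move=> h; rewrite /tent_int2; have [[h1 ->]|[h1 ->]] := pospE (x - 2^-1);
have [[h2 ->]|[h2 ->]] := pospE (x - 3 / 2); have [[h3 ->]|[h3 ->]] := pospE (x - 5 / 2); nra.
Qed.

Lemma tent_int2_right x : 5 / 2 <= x -> tent_int2 x = x - 3 / 2.
Proof.
move=> h; rewrite /tent_int2; have [[h1 ->]|[h1 ->]] := pospE (x - 2^-1);
have [[h2 ->]|[h2 ->]] := pospE (x - 3 / 2); have [[h3 ->]|[h3 ->]] := pospE (x - 5 / 2); try lra.
have -> : x = 5 / 2 by lra.
by field.
Qed.

Lemma tent_int2_bounds x : 0 <= tent_int2 x <= posp x.
Proof.
have [h|h] := leP x 2^-1; first by rewrite tent_int2_left// lexx posp_ge0.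
have [h3|h3] := leP (5 / 2) x.
  by rewrite tent_int2_right// /posp max_l; lra.
have -> : posp x = x by rewrite /posp max_l; lra.
rewrite /tent_int2 [posp (x - 2^-1)]max_l; last lra.
rewrite [posp (x - 5 / 2)]max_r; last lra.
have [h2|h2] := leP x (3 / 2).
  rewrite [posp (x - 3 / 2)]max_r; last lra.
  rewrite !expr0n/= mulr0 subr0 addr0; set y := x - 2^-1.
  have -> : x = y + 2^-1 by rewrite /y; ring.
  have y0 : 0 <= y by rewrite /y; lra.
  have y1 : y <= 1 by rewrite /y; lra.
  rewrite !exprS expr0 mulr1; apply/andP; split; [by rewrite !mulr_ge0|].
  have : y * (y * y) <= 1 by rewrite !mulr_ile1// mulr_ge0.
  lra.
rewrite [posp (x - 3 / 2)]max_l; last lra.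
set y := x - 3 / 2; have -> : x = y + 3 / 2 by rewrite /y; ring.
have -> : y + 3 / 2 - 2^-1 = y + 1 by field.
have y0 : 0 <= y by rewrite /y; lra.
have y1 : y <= 1 by rewrite /y; lra.
have p3 : y ^+ 3 <= y ^+ 2 by rewrite [y ^+ 3]exprS ler_piMl// sqr_ge0.
have p2 : y ^+ 2 <= y by rewrite expr2 ler_piMl.
have p30 : 0 <= y ^+ 3 by rewrite exprn_ge0.
have p20 : 0 <= y ^+ 2 by rewrite exprn_ge0.
have -> : (y + 1) ^+ 3 = y ^+ 3 + 3 * y ^+ 2 + 3 * y + 1 by ring.
rewrite expr0n/=; apply/andP; split; lra.
Qed.

Lemma continuous_tent : continuous tent.
Proof.
have cp (c : R) : continuous (fun x : R => posp (x - c)).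
  move=> x; have -> : (fun x : R => posp (x - c)) = (fun x => x - c) \max cst 0 by [].
  apply: continuous_max; last exact: cvg_cst.
  by apply: cvgB; [exact: cvg_id|exact: cvg_cst].
by move=> x; apply: cvgD; [apply: cvgB; [exact: cp|apply: cvgM; [exact: cvg_cst|exact: cp]]|exact: cp].
Qed.

End spline.

Section renormalizer.
Context {R : realType}.
Local Notation dt := (@lebesgueR R).
Variables (m L : R).
Hypotheses (m0 : 0 < m) (mL : 5 * m <= L).

(** The two tents have the same integral, so that the first derivative vanishes
    beyond both rings. *)
Definition ren s : R := m * tent_int2 (- s / m) - L * tent_int2 (- s / L).
Definition ren1 s : R := tent_int (- s / L) - tent_int (- s / m).
Definition ren2 s : R := tent (- s / m) / m - tent (- s / L) / L.

Let L0 : 0 < L. Proof. by apply: lt_le_trans mL; rewrite mulr_gt0. Qed.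

Lemma is_derive_scale (B b : R -> R) (a : R) s : (forall x, is_derive x (1 : R) B (b x)) -> 0 < a ->
  is_derive s (1 : R) (fun s => B (- s / a)) (- b (- s / a) / a).
Proof.
move=> dB a0; have dl : is_derive s (1 : R) (fun s => - s / a) (- a^-1).
  have -> : (fun s => - s / a) = (- a^-1) \*: id by apply/funext => t /=; rewrite /GRing.scale/=; ring.
  by apply: is_derive_eq; rewrite /GRing.scale/= mulr1.
have dBx : derivable B (- s / a) 1 by [].
have dls : derivable (fun s : R => - s / a) s 1 by [].
have [h1 h2] := @derivable_comp1 R _ B (fun s : R => - s / a) s 1 dBx dls.
apply: DeriveDef => //; rewrite h2 derive1E !derive_val; ring.
Qed.

Lemma is_derive_ren s : is_derive s (1 : R) ren (ren1 s).
Proof.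
have h1 := is_deriveZ m (is_derive_scale s (@is_derive_tent_int2 R) m0).
have h2 := is_deriveZ L (is_derive_scale s (@is_derive_tent_int2 R) L0).
have := is_deriveB h1 h2; set D := (X in is_derive _ _ _ X); have -> : D = ren1 s; last by [].
by rewrite /D /GRing.scale/= /ren1; field; rewrite !gt_eqF.
Qed.

Lemma is_derive_ren1 s : is_derive s (1 : R) ren1 (ren2 s).
Proof.
have h1 := is_derive_scale s (@is_derive_tent_int R) m0.
have h2 := is_derive_scale s (@is_derive_tent_int R) L0.
have := is_deriveB h2 h1; set D := (X in is_derive _ _ _ X); have -> : D = ren2 s; last by [].
by rewrite /D /ren2; field; rewrite !gt_eqF.
Qed.

Lemma ren1_bound s : `|ren1 s| <= 1.
Proof.
rewrite /ren1; have := tent_int_bounds (- s / L); have := tent_int_bounds (- s / m).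
by move=> /andP[a1 a2] /andP[b1 b2]; rewrite ler_norml; apply/andP; split; lra.
Qed.

Lemma ren2_bound s : `|ren2 s| <= m^-1 + L^-1.
Proof.
rewrite /ren2; apply: le_trans (ler_normB _ _) _; apply: lerD.
- by rewrite ger0_norm ?mulr_ge0 ?tent_ge0 ?invr_ge0 ?(ltW m0)// ler_piMl ?tent_le1// invr_ge0 ltW.
- by rewrite ger0_norm ?mulr_ge0 ?tent_ge0 ?invr_ge0 ?(ltW L0)// ler_piMl ?tent_le1// invr_ge0 ltW.
Qed.

(** The variable is -s: everything happens where the solution is very negative. *)
Definition in_ring (a b s : R) : bool := (a < - s < b).

Lemma in_left s : - s <= m / 2 -> - s / m <= 2^-1 /\ - s / L <= 2^-1.
Proof. by move: m0 mL L0 => h1 h2 h3 h; rewrite !ler_pdivrMr//; split; lra. Qed.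

Lemma in_right s : 5 / 2 * L <= - s -> 5 / 2 <= - s / m /\ 5 / 2 <= - s / L.
Proof. by move: m0 mL L0 => h1 h2 h3 h; rewrite !ler_pdivlMr//; split; lra. Qed.

Lemma ren1_out s : ~~ in_ring (m / 2) (5 / 2 * L) s -> ren1 s = 0.
Proof.
rewrite /in_ring negb_and -!leNgt => /orP[/in_left|/in_right] [h1 h2].
  by rewrite /ren1 !tent_int_left ?subrr.
by rewrite /ren1 !tent_int_right ?subrr.
Qed.

Lemma ren_left s : - s <= m / 2 -> ren s = 0.
Proof.
by move=> /in_left[h1 h2]; rewrite /ren !tent_int2_left ?mulr0 ?subrr.
Qed.

Lemma tent2_out (a s : R) : 0 < a -> ~~ in_ring (a / 2) (5 / 2 * a) s -> tent (- s / a) = 0.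
Proof.
move=> a0 h; apply: tent_out => /andP[h1 h2]; move/negP: h; apply; apply/andP; split.
  by move: h1; rewrite ltr_pdivlMr// mulrC.
by move: h2; rewrite ltr_pdivrMr.
Qed.

Lemma ren_scaled (a s : R) : 0 < a -> 0 <= a * tent_int2 (- s / a) <= posp (- s).
Proof.
move=> a0; have /andP[h1 h2] := tent_int2_bounds (- s / a).
apply/andP; split; first by rewrite mulr_ge0 ?(ltW a0).
apply: (@le_trans _ _ (a * posp (- s / a))); first by rewrite ler_wpM2l ?(ltW a0).
have [[h ->]|[h ->]] := pospE (- s / a); first by rewrite mulr0 posp_ge0.
by rewrite mulrC divfK ?gt_eqF// /posp le_max lexx.
Qed.

(** The two terms lie between 0 and the positive part of -s, and they are
    subtracted. *)
Lemma ren_le s : `|ren s| <= `|s|.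
Proof.
rewrite /ren; have /andP[a1 a2] := ren_scaled s m0; have /andP[b1 b2] := ren_scaled s L0.
apply: (@le_trans _ _ (posp (- s))); first by rewrite ler_norml; apply/andP; split; lra.
have [[h ->]|[h ->]] := pospE (- s) => //; by rewrite -normrN ler_norm.
Qed.

Lemma ren_bound s : `|ren s| <= 5 / 2 * L.
Proof.
have [h|h] := leP (5 / 2 * L) (- s).
  have [h1 h2] := in_right h; rewrite /ren !tent_int2_right//.
  have -> : m * (- s / m - 3 / 2) - L * (- s / L - 3 / 2) = 3 / 2 * (L - m) by field; rewrite !gt_eqF.
  by move: m0 mL L0 => g1 g2 g3; rewrite ger0_norm; lra.
rewrite /ren; have /andP[a1 a2] := ren_scaled s m0; have /andP[b1 b2] := ren_scaled s L0.
have h5 : posp (- s) <= 5 / 2 * L by rewrite /posp ge_max (ltW h)/= mulr_ge0// ltW.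
by rewrite ler_norml; apply/andP; split; lra.
Qed.

Lemma ren0 : ren 0 = 0.
Proof. by apply: ren_left; rewrite oppr0 divr_ge0// ltW. Qed.

Lemma continuous_ren2 : continuous ren2.
Proof.
have cs (a : R) : continuous (fun s : R => tent (- s / a) / a).
  move=> s; apply: cvgM; last exact: cvg_cst.
  apply: (continuous_comp (f := fun s : R => - s / a)); last exact: continuous_tent.
  by apply: cvgM; [apply: cvgN; exact: cvg_id|exact: cvg_cst].
by move=> s; apply: cvgB; exact: cs.
Qed.

End renormalizer.

Section W2oo.
Context {R : realType}.
Local Notation dt := (@lebesgueR R).

Lemma Lqoo_bounded (f : R -> R) (C : R) : continuous f -> (forall x, `|f x| <= C) -> Lq dt setT +oo%E f.
Proof.
move=> cf fC; split; first exact: continuous_measurable_fun.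
rewrite /Lq_norm unlock /Lnorm; case: ifP => _; last exact: ltry.
apply: (@le_lt_trans _ _ C%:E); last exact: ltry.
by apply/ess_sup_inf.ess_supP; apply: nearW => z; rewrite /= patch_setT /= lee_fin.
Qed.

(** Integration by parts on the line, from the vanishing of the integral of a
    derivative. *)
Lemma parts_R (f f1 eta : R -> R) : (forall x, is_derive x (1 : R) f (f1 x)) -> continuous f1 ->
  test_function setT eta -> \int[dt]_x (f x * 'D_1 eta x) = - \int[dt]_x (f1 x * eta x).
Proof.
move=> df c1 /test_elim[K [se cK PK _]].
(* R is identified with R x 'rV_0, where the integral of a derivative vanishes *)
pose E0 := (R * 'rV[R]_0)%type; pose e1 : E0 := (1, 0).
pose F x := f x * eta x; pose F1 x := f x * 'D_1 eta x + f1 x * eta x.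
have cf : continuous f by move=> x; apply/differentiable_continuous/derivable1_diffP.
have ce := smooth_continuous se; have cde := smooth_continuous (smooth_derive (1 : R) se).
have dPK := supp_in_derive (1 : R) cK PK.
have dF x : is_derive x (1 : R) F (F1 x).
  have de : is_derive x (1 : R) eta ('D_1 eta x) by apply: DeriveDef => //; exact: smooth_derivable.
  have := is_deriveM (df x) de; set d := (X in is_derive _ _ _ X); have -> // : d = F1 x.
  by rewrite /d /F1 /GRing.scale/= [f1 x * _]mulrC.
have cI1 : continuous (fun x => f x * 'D_1 eta x) by move=> x; apply: cvgM; [exact: cf|exact: cde].
have cI2 : continuous (fun x => f1 x * eta x) by move=> x; apply: cvgM; [exact: c1|exact: ce].
have cfst : continuous (fun z : E0 => z.1) by move=> z; exact: cvg_fst.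
have lift (h : R -> R) : continuous h -> continuous (fun z : E0 => h z.1).
  by move=> ch z; apply: continuous_comp; [exact: cfst|exact: ch].
have cU : compact [set: 'rV[R]_0].
  have -> : [set: 'rV[R]_0] = [set 0] by apply/seteqP; split => // x _; rewrite /= [x]thinmx0.
  exact: compact_set1.
have cK0 : compact (K `*` [set: 'rV[R]_0]) by exact: compact_setX.
have sK0 (h : R -> R) : supp_in K h -> supp_in (K `*` [set: 'rV[R]_0]) (fun z : E0 => h z.1).
  by move=> hK z zK; apply: hK => Kz; apply: zK.
have pLift (h : R -> R) : continuous h -> supp_in K h ->
    dt.-integrable setT (EFin \o h) /\ \int[dt]_t h t = \int[@lebesgue_prod R 0 (@lebesgue_rV R 0)]_z h z.1.
  move=> ch hK; have Ih := supp_in_integrable_cts cK0 (lift _ ch) (sK0 _ hK).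
  have [h1 h2] := fubini_int Ih; have e t : \int[@lebesgue_rV R 0]_x h t = h t.
    have d1 : (@lebesgue_rV R 0) setT = 1%E.
      rewrite (_ : setT = @cube R 0 1); first by rewrite lebesgue_rV_cube.
      by apply/seteqP; split => // x _ [].
    rewrite (@Rintegral_cst _ _ R (@lebesgue_rV R 0) setT measurableT (h t)).
    by rewrite [X in _ * fine X](_ : _ = 1%E) ?mulr1//; exact: d1.
  split; first by apply: (L1_eq measurableT) h1 => t _; exact: e.
  by rewrite -h2; apply: eq_Rintegral => t _; rewrite -[LHS]e.
have [I1 e1E] := pLift _ cI1 (fun x xK => etrans (congr1 _ (dPK x xK)) (mulr0 _)).
have [I2 e2E] := pLift _ cI2 (fun x xK => etrans (congr1 _ (PK x xK)) (mulr0 _)).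
apply/eqP; rewrite -addr_eq0 -RintegralD//; apply/eqP.
have cF1 : continuous F1 by move=> x; apply: cvgD; [exact: cI1|exact: cI2].
have F1K : supp_in K F1 by move=> x xK; rewrite /F1 PK// dPK// !mulr0 addr0.
have [_ ->] := pLift _ cF1 F1K.
have [C C0 hC] := supp_in_bounded cF1 cK F1K.
have dline z : derivable (fun z : E0 => F z.1) z e1 /\ 'D_e1 (fun z : E0 => F z.1) z = F1 z.1.
  have [h1 h2] := derive_line (fun z : E0 => F z.1) z e1; have [h3 h4] := derive_line F z.1 1.
  have e : (fun s : R => F (s *: e1 + z).1) = (fun s : R => F (s *: 1 + z.1)) by [].
  split; first by apply/h1; rewrite e; apply/h3.
  by rewrite h2 e -h4 derive_val.
rewrite -[RHS](@Rintegral_derive0_C1 R 0 (fun z : E0 => F z.1) e1 (K `*` setT) C)//.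
- by apply: eq_Rintegral => z _; rewrite (dline z).2.
- by apply: lift => x; apply: cvgM; [exact: cf|exact: ce].
- by move=> z; exact: (dline z).1.
- by move=> z; rewrite (dline z).2.
- by apply: sK0 => x xK; rewrite /F PK// mulr0.
Qed.

Lemma in_W2oo_C2 (S S1 S2 : R -> R) (C : R) :
  (forall x, is_derive x (1 : R) S (S1 x)) -> (forall x, is_derive x (1 : R) S1 (S2 x)) ->
  continuous S2 -> (forall x, `|S x| <= C) -> (forall x, `|S1 x| <= C) -> (forall x, `|S2 x| <= C) ->
  in_W2oo S S1 S2.
Proof.
move=> d1 d2 c2 b0 b1 b2.
have c0 : continuous S by move=> x; apply/differentiable_continuous/derivable1_diffP.
have c1 : continuous S1 by move=> x; apply/differentiable_continuous/derivable1_diffP.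
split => //.
- by split; [exact: Lqoo_bounded b0|exact: Lqoo_bounded b1|exact: Lqoo_bounded b2].
- by move=> eta te; exact: parts_R.
- by move=> eta te; exact: parts_R.
Qed.

End W2oo.

Ltac meas := repeat first [ assumption | exact: measurable_cst | apply: measurable_funD
  | apply: measurable_funB | apply: measurable_funM | apply: measurable_sum => ?
  | apply: measurableT_comp => // ].

(** * The energy estimate for smooth cut-offs *)

(** Weight the factors by tau ^ (1 / p), or tau ^ (1 / p'), and its inverse. *)
Lemma young_tau (R : realType) (p tau : R) : 1 < p -> 0 < tau -> exists2 C, 1 <= C &
  forall a b, 0 <= a -> 0 <= b -> a * b <= tau * a `^ p + C * b `^ (p / (p - 1)) /\
    a * b <= tau * a `^ (p / (p - 1)) + C * b `^ p.
Proof.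
move=> p1 t0; have ex (x y : R) : exists C, [/\ 1 <= C, x <= C & y <= C].
  by exists (Num.max 1 (Num.max x y)); rewrite !le_max !lexx !orbT.
have p0 : 0 < p by lra.
have pm : 0 < p - 1 by lra.
set q := p / (p - 1); have q0 : 0 < q by rewrite divr_gt0.
have q1 : 1 < q by rewrite /q ltr_pdivlMr// mul1r; lra.
have qq : q / (q - 1) = p by rewrite /q; field; rewrite !gt_eqF//; lra.
have H r : 1 < r -> forall a b, 0 <= a -> 0 <= b ->
    a * b <= tau * a `^ r + (tau `^ r^-1)^-1 `^ (r / (r - 1)) * b `^ (r / (r - 1)).
  move=> r1 a b a0 b0; have r0 : 0 < r by exact: lt_trans r1.
  have s0 : 0 < tau `^ r^-1 by exact: powR_gt0.
  have := @young R (tau `^ r^-1 * a) ((tau `^ r^-1)^-1 * b) r r1.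
  rewrite !mulr_ge0 ?invr_ge0 ?(ltW s0)// => /(_ isT isT).
  rewrite mulrACA mulfV ?gt_eqF// mul1r powRM ?(ltW s0)// -powRrM mulVf ?gt_eqF// powRr1 ?(ltW t0)//.
  by rewrite powRM ?invr_ge0 ?(ltW s0).
set c1 := (tau `^ p^-1)^-1 `^ q; set c2 := (tau `^ q^-1)^-1 `^ p.
have [C [C1 Cc1 Cc2]] := ex c1 c2.
exists C => //.
move=> a b a0 b0; split.
  apply: (le_trans (H p p1 a b a0 b0)); rewrite lerD2l; exact: ler_wpM2r (powR_ge0 _ _) _ _ Cc1.
have := H q q1 a b a0 b0; rewrite qq => h; apply: (le_trans h); rewrite lerD2l; exact: ler_wpM2r (powR_ge0 _ _) _ _ Cc2.
Qed.

Lemma four_terms (R : realType) (x1 x2 x4 x5 a1 a2 a3 : R) :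
  `|x4| <= a1 -> `|x5| <= a2 -> `|x2| <= a2 -> `|x1| <= a3 ->
  x4 + x5 + x1 - x2 <= a1 + a2 + a3 + a2.
Proof.
by rewrite !ler_norml => /andP[_ h1] /andP[_ h2] /andP[h3 _] /andP[_ h4]; lra.
Qed.

Section core.
Context {R : realType} (n : nat).
Local Notation dx := (@lebesgue_rV R n).
Local Notation dtx := (@lebesgue_prod R n dx).
Local Notation E := (R * 'rV[R]_n)%type.
Local Notation px i := ((0 : R, delta_mx ord0 i : 'rV[R]_n) : E).
Local Notation pt := ((1 : R, 0 : 'rV[R]_n) : E).
Variable D : set E.
Hypotheses (oD : open D) (bD : bounded_set D).
Local Notation LD f := (dtx.-integrable D (EFin \o f)).
Let mD : measurable D := open_measurable_E oD.
Let finD : (dtx D < +oo)%E := bounded_finite mD bD.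

Variables (p : R) (p1 : 1 < p).
Local Notation q := (p / (p - 1)).
Variables (v w f F e kappa : E -> R) (V A G H : 'I_n -> E -> R) (Ce C0 Cw : R).
Hypotheses (Iv : LD v) (Iw : LD w) (If : LD f) (IF : LD F) (Ik : LD kappa)
  (IV : forall i, LD (V i)) (IA : forall i, LD (A i))
  (IG : forall i, LD (G i)) (IH : forall i, LD (H i))
  (IGq : forall i, LD (fun z => `|G i z| `^ q)) (IHq : forall i, LD (fun z => `|H i z| `^ q))
  (me : measurable_fun D e).
Hypotheses (hV : forall i Psi, test_function D Psi ->
    \int[dtx]_(z in D) (v z * 'D_(px i) Psi z) = - \int[dtx]_(z in D) (V i z * Psi z))
  (hw : forall Psi, test_function D Psi ->
    \int[dtx]_(z in D) (w z * 'D_pt Psi z) =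
      - (\int[dtx]_(z in D) (F z * Psi z)) - (\int[dtx]_(z in D) \sum_i H i z * 'D_(px i) Psi z))
  (hwb : forall i Psi, test_function D Psi ->
    `|\int[dtx]_(z in D) (w z * 'D_(px i) Psi z)| <= Cw + \int[dtx]_z (`|Psi z| `^ q)).
Hypotheses (e0 : forall z, D z -> 0 <= e z) (k0 : forall z, D z -> 0 <= kappa z) (Ce0 : 0 < Ce)
  (hA : forall i z, D z -> `|A i z| `^ q <= Ce * e z)
  (hVe : forall i z, D z -> `|V i z| `^ p <= Ce * e z)
  (he : forall z, D z -> e z <= Ce * (\sum_i A i z * V i z + kappa z))
  (C00 : 0 <= C0) (hvw : forall z, D z -> - C0 <= v z + w z).
Hypothesis weq : forall m L chi, 0 < m -> 5 * m <= L -> test_function D chi ->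
  - (\int[dtx]_(z in D) (ren m L (v z) * 'D_pt chi z))
  + (\int[dtx]_(z in D) (ren1 m L (v z) * \sum_i A i z * 'D_(px i) chi z))
  + (\int[dtx]_(z in D) (ren2 m L (v z) * (\sum_i A i z * V i z) * chi z))
  = (\int[dtx]_(z in D) (f z * (ren1 m L (v z) * chi z)))
  + (\int[dtx]_(z in D) \sum_i G i z * (ren2 m L (v z) * V i z * chi z + ren1 m L (v z) * 'D_(px i) chi z)).

Definition dyadic (k : nat) (z : E) : bool := (k%:R <= - v z) && (- v z < (2 * k)%:R).
Variables (n0 : nat) (C1 : R).
Hypotheses (C10 : 0 <= C1)
  (ring_int : forall k, (n0 <= k)%N -> LD (fun z => e z * (dyadic k z)%:R))
  (ring_bound : forall k, (n0 <= k)%N -> \int[dtx]_(z in D) (e z * (dyadic k z)%:R) <= C1 * k%:R).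

Let mv : measurable_fun D v := L1_measurable Iv.

Lemma measurable_in_ring a b : measurable_fun D (fun z => (in_ring a b (v z))%:R : R).
Proof.
apply: measurable_indb => //; rewrite /in_ring; apply: measurable_and.
  by apply: measurable_fun_ltr => //; exact: measurableT_comp.
by apply: measurable_fun_ltr => //; exact: measurableT_comp.
Qed.

Lemma dyadic_cover (k J : nat) z : k%:R <= - v z -> - v z < (2 ^ J * k)%:R ->
  1 <= \sum_(j < J) (dyadic (2 ^ j * k) z)%:R :> R.
Proof.
elim: J => [|J JH] hk hJ; first by move: hJ; rewrite expn0 mul1n ltNge hk.
rewrite big_ord_recr /=; have [h|h] := ltP (- v z) (2 ^ J * k)%:R.
  by rewrite (le_trans (JH hk h))// lerDl.
rewrite /dyadic h mulnA -expnS hJ /= lerDr sumr_ge0//.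
Qed.

(** The ring is covered by J + 3 dyadic rings, and the bounds C1 2 ^ j k add up
    geometrically. *)
Lemma energy_ring k J : (0 < k)%N -> (n0 <= k)%N ->
  let m : R := (2 * k)%:R in let L := 2 ^+ J * m in
  LD (fun z => e z * (in_ring (m / 2) (5 / 2 * L) (v z))%:R) /\
  \int[dtx]_(z in D) (e z * (in_ring (m / 2) (5 / 2 * L) (v z))%:R) <= 4 * C1 * L.
Proof.
move=> k1 nk m L.
pose g z := \sum_(j < J.+3) e z * (dyadic (2 ^ j * k) z)%:R.
have nj (j : nat) : (n0 <= 2 ^ j * k)%N by rewrite (leq_trans nk)// leq_pmull// expn_gt0.
have Ig : LD g by apply: L1_sum => // j; exact: ring_int.
have eg z : D z -> `|e z * (in_ring (m / 2) (5 / 2 * L) (v z))%:R| <= g z.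
  move=> Dz; rewrite ger0_norm ?mulr_ge0 ?e0//.
  rewrite /g -mulr_sumr; have [/andP[h1 h2]|_] := boolP (in_ring _ _ _); last first.
    by rewrite mulr0 mulr_ge0 ?e0// sumr_ge0.
  rewrite ler_wpM2l ?e0//; apply: dyadic_cover.
    by apply: ltW; apply: le_lt_trans h1; have -> : m / 2 = k%:R by rewrite /m natrM; field.
  apply: (lt_le_trans h2); rewrite /L /m (natrM R 2 k) (natrM R _ k) natrX !exprS.
  have : 0 <= 2 ^+ J * k%:R :> R by rewrite mulr_ge0 ?exprn_ge0.
  set X := 2 ^+ J; set Z := k%:R => X0.
  have -> : 5 / 2 * (X * (2 * Z)) = 5 * (X * Z) by field.
  have -> : 2 * (2 * (2 * X)) * Z = 8 * (X * Z) by ring.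
  lra.
have mring := measurable_in_ring (m / 2) (5 / 2 * L).
have mE : measurable_fun D (fun z => e z * (in_ring (m / 2) (5 / 2 * L) (v z))%:R) by apply: measurable_funM.
split; first exact: (L1_dom mD mE Ig eg).
apply: (le_trans (ler_norm _)); apply: le_trans (Rintegral_abs_le mD mE Ig eg) _.
rewrite Rintegral_sum//; last by move=> j; exact: ring_int.
apply: (@le_trans _ _ (\sum_(j < J.+3) C1 * (2 ^ j * k)%:R)).
  by apply: ler_sum => j _; exact: ring_bound.
have -> : 4 * C1 * L = C1 * (2 ^ J.+3 * k)%:R.
  by rewrite /L /m (natrM R 2 k) (natrM R _ k) natrX !exprS; ring.
rewrite -mulr_sumr ler_wpM2l// -natr_sum ler_nat -big_distrl /= leq_mul2r.
apply/orP; right; elim: J.+3 => [|J' JH]; first by rewrite big_ord0.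
by rewrite big_ord_recr /= expnS mul2n -addnn leq_add.
Qed.

Section estimate.
Variables (m L c tau Ct : R) (K : set E) (phi W Fk : E -> R) (Hk : 'I_n -> E -> R).
Hypotheses (m0 : 0 < m) (mL : 5 * m <= L).
Local Notation M := (L / 4).
Local Notation b1 := ('D_1 (bump : R -> R)).
Local Notation b2 := ('D_1 b1).
Hypotheses (cK : compact K) (KD : K `<=` D) (sphi : smooth phi) (phiK : supp_in K phi)
  (sW : smooth W) (sF : smooth Fk) (sH : forall i, smooth (Hk i))
  (hW : forall z, K z -> 'D_pt W z = Fk z - \sum_i 'D_(px i) (Hk i) z).
Hypotheses (c1 : 1 <= c) (phic : forall z, `|phi z| <= c) (phict : forall z, `|'D_pt phi z| <= c)
  (phici : forall i z, `|'D_(px i) phi z| <= c)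
  (bc : forall x, `|bump x| <= c) (b1c : forall x, `|b1 x| <= c) (b2c : forall x, `|b2 x| <= c).
Hypotheses (tau0 : 0 < tau) (Ct1 : 1 <= Ct)
  (hY : forall a b : R, 0 <= a -> 0 <= b -> a * b <= tau * a `^ p + Ct * b `^ q /\
    a * b <= tau * a `^ q + Ct * b `^ p).

Let mK : measurable K := compact_measurable cK.
Let L0 : 0 < L. Proof. by apply: lt_le_trans mL; rewrite mulr_gt0. Qed.
Let M0 : 0 < M. Proof. by rewrite divr_gt0. Qed.
Let c0 : 0 <= c. Proof. exact: le_trans c1. Qed.

Let bW (h : R -> R) z := h (W z / M).
Let chi z := phi z * bW bump z.

Let sWM : smooth (fun z => W z / M). Proof. by apply: smoothM => //; exact: smooth_cst. Qed.
Let sb : forall k, Ck k (bump : R -> R) := @bump_Ck R.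
Let sb1 : forall k, Ck k b1. Proof. by move=> k; apply: smooth_derive. Qed.
Let sb2 : forall k, Ck k b2. Proof. by move=> k; apply: smooth_derive. Qed.
Let sbW h : (forall k, Ck k h) -> smooth (bW h). Proof. by move=> sh; apply: (smooth_comp sh sWM). Qed.

Let dWM (d : E) z : 'D_d (fun z => W z / M) z = 'D_d W z / M.
Proof.
rewrite (derive_smoothM _ _ sW (smooth_cst (V := E) M^-1)) derive_cst mulr0 add0r; exact: mulrC.
Qed.

Let dbW h (d : E) z : (forall k, Ck k h) -> 'D_d (bW h) z = bW ('D_1 h) z * ('D_d W z / M).
Proof. by move=> sh; rewrite /bW (derive_smooth_comp _ _ sh sWM) dWM. Qed.

Let dprod h (d : E) z : (forall k, Ck k h) ->
  'D_d (fun z => phi z * bW h z) z = phi z * (bW ('D_1 h) z * ('D_d W z / M)) + bW h z * 'D_d phi z.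
Proof. by move=> sh; rewrite (derive_smoothM _ _ sphi (sbW sh)) dbW. Qed.

Let test_prod h (g : E -> R) : (forall k, Ck k h) -> smooth g -> test_function D (fun z => phi z * bW h z * g z).
Proof.
move=> sh sg; apply: (test_intro _ cK _ KD).
  by apply: smoothM => //; apply: smoothM => //; exact: sbW.
by move=> z zK; rewrite phiK// !mul0r.
Qed.

Let test_chi : test_function D chi.
Proof.
apply: (test_intro _ cK _ KD); first by apply: smoothM => //; exact: sbW.
by move=> z zK; rewrite /chi phiK// !mul0r.
Qed.

Definition tail (z : E) : R := (m / 2 < - v z)%R%:R.
Definition ring_ (z : E) : R := (in_ring (m / 2) (5 / 2 * L) (v z))%:R.
Definition ring_m (z : E) : R := (in_ring (m / 2) (5 / 2 * m) (v z))%:R.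
Definition firsts z : R := `|v z| + `|f z| + `|Fk z| + \sum_i (`|A i z| + `|G i z| + `|Hk i z|).
Definition powers z : R := \sum_i (`|Hk i z| `^ q + `|G i z| `^ q + `|'D_(px i) W z| `^ p).
(** The common bound, up to a constant, of all the lower order terms: the
    functions without gradients, the energy, and the powers of the remaining
    factors. *)
Definition dominant z : R := firsts z * tail z + tau * (e z * (ring_ z / M + ring_m z / m))
  + Ct * powers z * (M^-1 + m^-1).

Let Z0 z := firsts z * tail z.
Let Z1 z := tau * (e z * (ring_ z / M + ring_m z / m)).
Let Z2 z := Ct * powers z * (M^-1 + m^-1).

Let firsts0 z : 0 <= firsts z.
Proof. by rewrite /firsts !addr_ge0// sumr_ge0// => i _; rewrite !addr_ge0. Qed.
Let powers0 z : 0 <= powers z.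
Proof. by rewrite sumr_ge0// => i _; rewrite !addr_ge0// powR_ge0. Qed.
Let Mm0 : 0 <= M^-1 + m^-1. Proof. by rewrite addr_ge0// invr_ge0 ltW. Qed.
Let Ct0 : 0 <= Ct. Proof. exact: le_trans Ct1. Qed.
Let Z00 z : 0 <= Z0 z. Proof. by rewrite mulr_ge0. Qed.
Let Z10 z : D z -> 0 <= Z1 z.
Proof. by move=> Dz; rewrite mulr_ge0 ?(ltW tau0)// mulr_ge0 ?e0// addr_ge0// divr_ge0// ltW. Qed.
Let Z20 z : 0 <= Z2 z. Proof. by rewrite !mulr_ge0. Qed.

Let ring_tail z : ring_ z <= tail z.
Proof. by rewrite /ring_ /tail /in_ring; case: (_ < _) => //=; rewrite ler_nat; case: (_ < _). Qed.
Let ring_ge0 z : 0 <= ring_ z. Proof. exact: ler0n. Qed.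
Let ring1 z : ring_ z <= 1. Proof. by rewrite /ring_; case: in_ring. Qed.

Let ren1_le z : `|ren1 m L (v z)| <= ring_ z.
Proof.
rewrite /ring_; case: (boolP (in_ring _ _ _)) => [_|h]; first exact: ren1_bound.
by rewrite ren1_out// normr0.
Qed.

Let ren_tail z : `|ren m L (v z)| <= `|v z| * tail z /\ `|ren m L (v z)| <= 10 * M * tail z.
Proof.
rewrite /tail; case: (ltP (m / 2) (- v z)) => h; last by rewrite ren_left// normr0 !mulr0.
rewrite !mulr1; split; first exact: ren_le.
by apply: le_trans (ren_bound m0 mL _) _; rewrite le_eqVlt; apply/orP; left; apply/eqP; field.
Qed.

(** The two tents with their heights, except that 1 / L is replaced by 1 / M,
    the scale of the cut-off. *)
Lemma ren2_le z : `|ren2 m L (v z)| <= ring_ z / M + ring_m z / m.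
Proof.
rewrite /ren2 (le_trans (ler_normB _ _))// addrC; apply: lerD; last first.
  rewrite normrM [`|m^-1|]ger0_norm ?invr_ge0 ?(ltW m0)// ler_wpM2r ?invr_ge0 ?(ltW m0)// /ring_m.
  case: (boolP (in_ring _ _ _)) => [_|h]; first by rewrite ger0_norm ?tent_ge0 ?tent_le1.
  by rewrite tent2_out// normr0.
rewrite normrM [`|L^-1|]ger0_norm ?invr_ge0 ?(ltW L0)//; apply: ler_pM => //; rewrite ?invr_ge0 ?(ltW L0)//.
  rewrite /ring_; case: (boolP (in_ring _ _ _)) => [_|h]; first by rewrite ger0_norm ?tent_ge0 ?tent_le1.
  rewrite tent2_out ?normr0//; apply: contra h => /andP[h1 h2]; apply/andP; split => //.
  by apply: le_lt_trans h1; rewrite ler_pM2r ?invr_gt0//; move: m0 mL => *; lra.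
by rewrite lef_pV2 ?posrE//; move: L0 => *; lra.
Qed.

Let le_Z0 x z : x <= firsts z -> 0 <= x -> x * ring_ z <= Z0 z.
Proof. by move=> h x0; apply: ler_pM => //; exact: ring_tail. Qed.

Let firsts_i i z : [/\ `|A i z| <= firsts z, `|G i z| <= firsts z & `|Hk i z| <= firsts z].
Proof.
have h : `|A i z| + `|G i z| + `|Hk i z| <= firsts z.
  rewrite /firsts (bigD1 i)//= addrCA lerDl !addr_ge0// sumr_ge0// => j _; by rewrite !addr_ge0.
have a0 := normr_ge0 (A i z); have g0 := normr_ge0 (G i z); have h0 := normr_ge0 (Hk i z).
by split; lra.
Qed.

Let powers_i i z : `|Hk i z| `^ q + `|G i z| `^ q + `|'D_(px i) W z| `^ p <= powers z.
Proof.
by rewrite /powers (bigD1 i)//= lerDl sumr_ge0// => j _; rewrite !addr_ge0// powR_ge0.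
Qed.

Let energy_le x z : D z -> 0 <= x -> x <= Ce * e z -> tau * x * (ring_ z / M + ring_m z / m) <= Ce * Z1 z.
Proof.
move=> Dz x0 h; have r0 : 0 <= ring_ z / M + ring_m z / m by rewrite addr_ge0// divr_ge0// ltW.
rewrite /Z1 mulrCA -!mulrA ler_wpM2l ?(ltW tau0)// mulrA ler_wpM2r//.
Qed.

Let ringMm z : ring_ z / M + ring_m z / m <= M^-1 + m^-1.
Proof.
apply: lerD; rewrite ler_piMl ?invr_ge0 ?(ltW M0) ?(ltW m0)//.
by rewrite /ring_m; case: in_ring.
Qed.

Let power_le x z (r : R) : 0 <= x -> x <= powers z -> r <= M^-1 + m^-1 -> 0 <= r -> Ct * x * r <= Z2 z.
Proof. by move=> x0 h hr r0; apply: ler_pM => //; rewrite ?mulr_ge0// ler_wpM2l. Qed.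

Let ringM z : ring_ z / M <= ring_ z / M + ring_m z / m.
Proof. by rewrite lerDl divr_ge0// ltW. Qed.

(** In the products with a gradient, Young's inequality charges the energy with
    the small factor tau, and the other factor, which stays bounded in its
    Lebesgue space, with the large factor Ct. *)
Let yA i z : D z -> `|A i z| * `|'D_(px i) W z| * (ring_ z / M) <= Ce * Z1 z + Z2 z.
Proof.
move=> Dz; have [_ h] := hY (normr_ge0 (A i z)) (normr_ge0 ('D_(px i) W z)).
have r0 : 0 <= ring_ z / M + ring_m z / m by rewrite addr_ge0// divr_ge0// ltW.
apply: (@le_trans _ _ ((tau * `|A i z| `^ q + Ct * `|'D_(px i) W z| `^ p) * (ring_ z / M + ring_m z / m))).
  by apply: ler_pM; [exact: mulr_ge0|rewrite mulr_ge0 ?invr_ge0 ?(ltW M0)|exact: h|exact: ringM].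
rewrite mulrDl; apply: lerD; first by apply: energy_le; rewrite ?powR_ge0// hA.
apply: power_le; [exact: powR_ge0| |exact: ringMm|exact: r0].
by apply: le_trans (powers_i i z); rewrite lerDr addr_ge0// powR_ge0.
Qed.

Let yV i z : D z -> `|V i z| * `|Hk i z| * (ring_ z / M) <= Ce * Z1 z + Z2 z.
Proof.
move=> Dz; have [h _] := hY (normr_ge0 (V i z)) (normr_ge0 (Hk i z)).
have r0 : 0 <= ring_ z / M + ring_m z / m by rewrite addr_ge0// divr_ge0// ltW.
apply: (@le_trans _ _ ((tau * `|V i z| `^ p + Ct * `|Hk i z| `^ q) * (ring_ z / M + ring_m z / m))).
  by apply: ler_pM; [exact: mulr_ge0|rewrite mulr_ge0 ?invr_ge0 ?(ltW M0)|exact: h|exact: ringM].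
rewrite mulrDl; apply: lerD; first by apply: energy_le; rewrite ?powR_ge0// hVe.
apply: power_le; [exact: powR_ge0| |exact: ringMm|exact: r0].
by apply: le_trans (powers_i i z); rewrite -addrA lerDl addr_ge0// powR_ge0.
Qed.

Let yG i z : D z -> `|V i z| * `|G i z| * (ring_ z / M + ring_m z / m) <= Ce * Z1 z + Z2 z.
Proof.
move=> Dz; have [h _] := hY (normr_ge0 (V i z)) (normr_ge0 (G i z)).
have r0 : 0 <= ring_ z / M + ring_m z / m by rewrite addr_ge0// divr_ge0// ltW.
apply: (@le_trans _ _ ((tau * `|V i z| `^ p + Ct * `|G i z| `^ q) * (ring_ z / M + ring_m z / m))).
  by rewrite ler_wpM2r.
rewrite mulrDl; apply: lerD; first by apply: energy_le; rewrite ?powR_ge0// hVe.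
apply: power_le; [exact: powR_ge0| |exact: ringMm|exact: r0].
by apply: le_trans (powers_i i z); rewrite addrAC lerDr addr_ge0// powR_ge0.
Qed.

Let yGW i z : `|G i z| * `|'D_(px i) W z| / M <= Z2 z /\ `|Hk i z| * `|'D_(px i) W z| / M <= Z2 z.
Proof.
have hGW x : 0 <= x -> x `^ q + `|'D_(px i) W z| `^ p <= powers z -> x * `|'D_(px i) W z| / M <= Z2 z.
  move=> x0 hx; have := young p1 (normr_ge0 ('D_(px i) W z)) x0; rewrite mulrC [X in _ <= X]addrC => h.
  apply: (@le_trans _ _ (powers z * M^-1)); first by rewrite ler_wpM2r ?invr_ge0 ?(ltW M0)// (le_trans h).
  apply: (@le_trans _ _ (Ct * powers z * M^-1)).
    by rewrite ler_wpM2r ?invr_ge0 ?(ltW M0)// ler_peMl.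
  by rewrite ler_wpM2l ?mulr_ge0// lerDl invr_ge0 ltW.
split; apply: hGW => //; apply: le_trans (powers_i i z).
- by rewrite lerD2r lerDr powR_ge0.
- by rewrite lerD2r lerDl powR_ge0.
Qed.

Let bWc z : `|bW bump z| <= c. Proof. exact: bc. Qed.
Let bW1c z : `|bW b1 z| <= c. Proof. exact: b1c. Qed.
Let bW2c z : `|bW b2 z| <= c. Proof. exact: b2c. Qed.

Let chi_le z : `|chi z| <= c ^+ 2.
Proof. by rewrite /chi normrM expr2 ler_pM. Qed.

Let dchi_le (d : E) z : `|'D_d phi z| <= c -> `|'D_d chi z| <= c ^+ 2 + c ^+ 2 * (`|'D_d W z| / M).
Proof.
move=> h; rewrite /chi dprod// (le_trans (ler_normD _ _))// addrC; apply: lerD.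
  by rewrite normrM expr2 ler_pM.
rewrite !normrM mulrA; have -> : `|(L / 4)^-1| = M^-1 by rewrite ger0_norm// invr_ge0 ltW.
by rewrite mulrA [leRHS]mulrA ler_wpM2r ?invr_ge0 ?(ltW M0)// ler_wpM2r// expr2 ler_pM.
Qed.

Definition Cb : R := 10 * c ^+ 2 * (Ce + 1).

Let c20 : 0 <= c ^+ 2. Proof. exact: sqr_ge0. Qed.

Let dominant0 z : D z -> 0 <= dominant z.
Proof. by move=> Dz; exact: (addr_ge0 (addr_ge0 (Z00 z) (Z10 Dz)) (Z20 z)). Qed.

Let to_Cb x z : D z -> x <= Z0 z + Ce * Z1 z + Z2 z + Z2 z -> 10 * c ^+ 2 * (x / 5) <= Cb * dominant z.
Proof.
move=> Dz h; rewrite /Cb -[leRHS]mulrA ler_wpM2l ?mulr_ge0//.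
have -> : dominant z = Z0 z + Z1 z + Z2 z by [].
have z0 := Z00 z; have z1 := Z10 Dz; have z2 := Z20 z; have ce := Ce0.
have h1 : 0 <= Ce * Z0 z by rewrite mulr_ge0 ?(ltW ce).
have h2 : 0 <= Ce * Z1 z by rewrite mulr_ge0 ?(ltW ce).
have h3 : 0 <= Ce * Z2 z by rewrite mulr_ge0 ?(ltW ce).
rewrite mulrDl mul1r !mulrDr; lra.
Qed.

Let sum_le (g : 'I_n -> R) X : (forall i, `|g i| <= X) -> `|\sum_i g i| <= n%:R * X.
Proof.
move=> h; apply: le_trans (ler_norm_sum _ _ _) _.
apply: (@le_trans _ _ (\sum_(i < n) X)); first exact: ler_sum.
by rewrite sumr_const card_ord -[leRHS]mulrC mulr_natr.
Qed.

Let term_f z : D z -> `|f z * (ren1 m L (v z) * chi z)| <= Cb * dominant z.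
Proof.
move=> Dz; apply: (@le_trans _ _ (c ^+ 2 * Z0 z)).
  rewrite mulrA normrM mulrC; apply: ler_pM => //; rewrite normrM.
  apply: (@le_trans _ _ (`|f z| * ring_ z)); first by rewrite ler_wpM2l.
  apply: le_Z0 => //; rewrite /firsts -!addrA addrCA lerDl !addr_ge0// sumr_ge0//.
have h : Z0 z <= Z0 z + Ce * Z1 z + Z2 z + Z2 z.
  by rewrite -!addrA lerDl !addr_ge0// mulr_ge0 ?(ltW Ce0)// Z10.
apply: le_trans (to_Cb Dz h); have := Z00 z; have := mulr_ge0 c20 (Z00 z); lra.
Qed.

Let term_A i z : D z -> `|ren1 m L (v z) * (A i z * 'D_(px i) chi z)| <= Cb * dominant z.
Proof.
move=> Dz; have [fA _ _] := firsts_i i z.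
apply: (@le_trans _ _ (c ^+ 2 * (Z0 z + (Ce * Z1 z + Z2 z)))).
  rewrite !normrM; apply: (@le_trans _ _ (ring_ z * (`|A i z| * (c ^+ 2 + c ^+ 2 * (`|'D_(px i) W z| / M))))).
    by apply: ler_pM => //; rewrite ler_wpM2l// dchi_le.
  have -> : ring_ z * (`|A i z| * (c ^+ 2 + c ^+ 2 * (`|'D_(px i) W z| / M))) =
      c ^+ 2 * (`|A i z| * ring_ z + `|A i z| * `|'D_(px i) W z| * (ring_ z / M)) by ring.
  by rewrite ler_wpM2l//; apply: lerD; [exact: le_Z0|exact: yA].
have h : Z0 z + (Ce * Z1 z + Z2 z) <= Z0 z + Ce * Z1 z + Z2 z + Z2 z by rewrite addrA lerDl.
apply: le_trans (to_Cb Dz h); have x0 : 0 <= Z0 z + (Ce * Z1 z + Z2 z).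
  by rewrite !addr_ge0// mulr_ge0 ?(ltW Ce0)// Z10.
have := mulr_ge0 c20 x0; lra.
Qed.

Let term_V i z : D z ->
  `|M^-1 * (ren1 m L (v z) * V i z * (phi z * bW b1 z * Hk i z))| <= Cb * dominant z.
Proof.
move=> Dz; apply: (@le_trans _ _ (c ^+ 2 * (Ce * Z1 z + Z2 z))).
  rewrite !normrM [`|M^-1|]ger0_norm ?invr_ge0 ?(ltW M0)//.
  apply: (@le_trans _ _ (M^-1 * (ring_ z * `|V i z| * (c ^+ 2 * `|Hk i z|)))).
    rewrite ler_wpM2l ?invr_ge0 ?(ltW M0)//; apply: ler_pM; rewrite ?mulr_ge0//; first by rewrite ler_wpM2r.
    by rewrite ler_wpM2r// expr2 ler_pM.
  have -> : M^-1 * (ring_ z * `|V i z| * (c ^+ 2 * `|Hk i z|)) =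
    c ^+ 2 * (`|V i z| * `|Hk i z| * (ring_ z / M)) by ring.
  by rewrite ler_wpM2l// yV.
have h : Ce * Z1 z + Z2 z <= Z0 z + Ce * Z1 z + Z2 z + Z2 z.
  by have := Z00 z; have := Z20 z; lra.
apply: le_trans (to_Cb Dz h); have x0 : 0 <= Ce * Z1 z + Z2 z.
  by rewrite addr_ge0// mulr_ge0 ?(ltW Ce0)// Z10.
have := mulr_ge0 c20 x0; lra.
Qed.

Let term_G i z : D z ->
  `|G i z * (ren2 m L (v z) * V i z * chi z + ren1 m L (v z) * 'D_(px i) chi z)| <= Cb * dominant z.
Proof.
move=> Dz; have [_ fG _] := firsts_i i z; have [gW _] := yGW i z.
apply: (@le_trans _ _ (c ^+ 2 * ((Ce * Z1 z + Z2 z) + (Z0 z + Z2 z)))).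
  rewrite mulrDr (le_trans (ler_normD _ _))// mulrDr; apply: lerD.
    rewrite normrM [X in _ * X]normrM [X in _ * (X * _)]normrM.
    apply: (@le_trans _ _ (`|G i z| * ((ring_ z / M + ring_m z / m) * `|V i z| * c ^+ 2))).
      by rewrite ler_wpM2l// ler_pM ?mulr_ge0// ler_wpM2r// ren2_le.
    have -> : `|G i z| * ((ring_ z / M + ring_m z / m) * `|V i z| * c ^+ 2) =
      c ^+ 2 * (`|V i z| * `|G i z| * (ring_ z / M + ring_m z / m)) by ring.
    by rewrite ler_wpM2l// yG.
  rewrite !normrM; apply: (@le_trans _ _ (`|G i z| * (ring_ z * (c ^+ 2 + c ^+ 2 * (`|'D_(px i) W z| / M))))).
    by rewrite ler_wpM2l//; apply: ler_pM => //; rewrite dchi_le.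
  have -> : `|G i z| * (ring_ z * (c ^+ 2 + c ^+ 2 * (`|'D_(px i) W z| / M))) =
    c ^+ 2 * (`|G i z| * ring_ z + ring_ z * (`|G i z| * `|'D_(px i) W z| / M)) by ring.
  rewrite ler_wpM2l//; apply: lerD; first exact: le_Z0.
  apply: le_trans gW; rewrite ler_piMl// !mulr_ge0// invr_ge0 ltW//.
have h : Ce * Z1 z + Z2 z + (Z0 z + Z2 z) <= Z0 z + Ce * Z1 z + Z2 z + Z2 z by lra.
apply: le_trans (to_Cb Dz h); have x0 : 0 <= Ce * Z1 z + Z2 z + (Z0 z + Z2 z).
  by rewrite !addr_ge0// mulr_ge0 ?(ltW Ce0)// Z10.
have := mulr_ge0 c20 x0; lra.
Qed.

(** What is left of ren(v) D_t chi once the divergence of Hk has been integrated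
    by parts. *)
Let rest z := ren m L (v z) * ('D_pt phi z * bW bump z + phi z * bW b1 z * (Fk z / M)) +
  \sum_i ren m L (v z) * (Hk i z / M) * 'D_(px i) (fun z => phi z * bW b1 z) z.

Let term_rest z : D z -> `|rest z| <= n.+1%:R * Cb * dominant z.
Proof.
move=> Dz; have [s1 s2] := ren_tail z; have t0 : 0 <= tail z by exact: ler0n.
have K1 : `|ren m L (v z)| / M <= 10 * tail z by rewrite ler_pdivrMr// mulrAC.
have i0 : 0 <= M^-1 by rewrite invr_ge0 ltW.
have a1 : `|ren m L (v z) * ('D_pt phi z * bW bump z + phi z * bW b1 z * (Fk z / M))| <=
    10 * c ^+ 2 * (`|v z| * tail z + `|Fk z| * tail z).
  rewrite mulrDr (le_trans (ler_normD _ _))// mulrDr; apply: lerD.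
    apply: (@le_trans _ _ (c ^+ 2 * (`|v z| * tail z))); last first.
      by rewrite ler_wpM2r ?mulr_ge0// ler_peMl// ler1n.
    by rewrite normrM mulrC; apply: ler_pM => //; rewrite normrM expr2 ler_pM.
  rewrite !normrM (ger0_norm i0).
  have -> : `|ren m L (v z)| * (`|phi z| * `|bW b1 z| * (`|Fk z| * M^-1)) =
    `|phi z| * `|bW b1 z| * (`|Fk z| * (`|ren m L (v z)| / M)) by ring.
  have -> : 10 * c ^+ 2 * (`|Fk z| * tail z) = c * c * (`|Fk z| * (10 * tail z)) by ring.
  by apply: ler_pM; rewrite ?mulr_ge0//; [rewrite ler_pM|rewrite ler_wpM2l].
have a2 i : `|ren m L (v z) * (Hk i z / M) * 'D_(px i) (fun z => phi z * bW b1 z) z| <=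
    10 * c ^+ 2 * (`|Hk i z| * tail z + Z2 z).
  have [_ hW2] := yGW i z.
  rewrite dprod// !normrM (ger0_norm i0).
  have -> : `|ren m L (v z)| * (`|Hk i z| * M^-1) = `|Hk i z| * (`|ren m L (v z)| / M) by ring.
  apply: (@le_trans _ _ (`|Hk i z| * (10 * tail z) * (c ^+ 2 * (`|'D_(px i) W z| / M) + c ^+ 2))).
    apply: ler_pM; rewrite ?mulr_ge0//; first by rewrite ler_wpM2l.
    rewrite (le_trans (ler_normD _ _))//; apply: lerD.
      rewrite !normrM (ger0_norm i0) mulrA; apply: ler_pM; rewrite ?mulr_ge0//.
      by rewrite expr2 ler_pM.
    by rewrite normrM expr2 ler_pM.
  have -> : `|Hk i z| * (10 * tail z) * (c ^+ 2 * (`|'D_(px i) W z| / M) + c ^+ 2) =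
    10 * c ^+ 2 * (`|Hk i z| * tail z + tail z * (`|Hk i z| * `|'D_(px i) W z| / M)) by ring.
  rewrite ler_wpM2l ?mulr_ge0// lerD2l; apply: le_trans hW2.
  by rewrite ler_piMl ?mulr_ge0// /tail; case: (_ < _).
apply: (@le_trans _ _ (10 * c ^+ 2 * (`|v z| * tail z + `|Fk z| * tail z + \sum_i (`|Hk i z| * tail z + Z2 z)))).
  rewrite (le_trans (ler_normD _ _))// [leRHS]mulrDr; apply: lerD => //.
  by rewrite mulr_sumr (le_trans (ler_norm_sum _ _ _))// ler_sum.
apply: (@le_trans _ _ (10 * c ^+ 2 * (Z0 z + n%:R * Z2 z))).
  rewrite ler_wpM2l ?mulr_ge0// big_split /= sumr_const card_ord -[Z2 z *+ n]mulr_natl addrA lerD2r.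
  rewrite -mulr_suml -!mulrDl ler_wpM2r// /firsts.
  have : \sum_i `|Hk i z| <= \sum_i (`|A i z| + `|G i z| + `|Hk i z|).
    by apply: ler_sum => i _; rewrite lerDr addr_ge0.
  have := normr_ge0 (f z); lra.
rewrite /Cb; have -> : n.+1%:R * (10 * c ^+ 2 * (Ce + 1)) * dominant z = 10 * c ^+ 2 * (n.+1%:R * ((Ce + 1) * dominant z)) by ring.
rewrite ler_wpM2l ?mulr_ge0//.
have d0 := dominant0 Dz; have -> : n.+1%:R = n%:R + 1 :> R by rewrite natr1.
have h1 : Z0 z + Z2 z <= dominant z by rewrite /dominant -/(Z0 z) -/(Z2 z) lerD2r lerDl Z10.
have h2 : dominant z <= (Ce + 1) * dominant z by rewrite ler_peMl// lerDr ltW.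
have z0 := Z00 z; have z2 := Z20 z.
have h3 : n%:R * Z2 z <= n%:R * dominant z by rewrite ler_wpM2l//; lra.
have h4 : n%:R * dominant z <= n%:R * ((Ce + 1) * dominant z) by rewrite ler_wpM2l.
rewrite mulrDl mul1r; lra.
Qed.

Let mtc (h : E -> R) : continuous h -> measurable_fun K h.
Proof. by move=> ch; apply: measurable_funTS; exact: continuous_measurable_E. Qed.
Let msm (h : E -> R) : smooth h -> measurable_fun K h.
Proof. by move=> sh; apply: mtc; exact: smooth_continuous. Qed.
Let mKD (h : E -> R) : measurable_fun D h -> measurable_fun K h.
Proof. by move=> mh; exact: measurable_funS mh. Qed.
Let mvK : measurable_fun K v. Proof. exact: mKD. Qed.
Let mren (h : R -> R) : continuous h -> measurable_fun K (fun z => h (v z)).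
Proof. by move=> ch; apply: measurableT_comp => //; exact: continuous_measurable_fun. Qed.
Let cren : continuous (ren m L).
Proof.
by move=> x; apply/differentiable_continuous/derivable1_diffP; have := is_derive_ren m0 mL x; case.
Qed.
Let cren1 : continuous (ren1 m L).
Proof.
by move=> x; apply/differentiable_continuous/derivable1_diffP; have := is_derive_ren1 m0 mL x; case.
Qed.
Let mA i : measurable_fun K (A i). Proof. apply: mKD; exact: L1_measurable (IA i). Qed.
Let mV i : measurable_fun K (V i). Proof. apply: mKD; exact: L1_measurable (IV i). Qed.
Let mG i : measurable_fun K (G i). Proof. apply: mKD; exact: L1_measurable (IG i). Qed.
Let mf : measurable_fun K f. Proof. apply: mKD; exact: L1_measurable If. Qed.
Let mren0 := mren cren.
Let mren1 := mren cren1.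
Let mren2 := mren (@continuous_ren2 R m L).
Let schi : smooth chi. Proof. by apply: smoothM => //; exact: sbW. Qed.
Let mchi : measurable_fun K chi. Proof. exact: msm. Qed.
Let mdchi d : measurable_fun K ('D_d chi). Proof. by apply: msm; exact: smooth_derive. Qed.
Let chiK z : ~ K z -> chi z = 0. Proof. by move=> zK; rewrite /chi phiK// mul0r. Qed.
Let dchiK d z : ~ K z -> 'D_d chi z = 0.
Proof. by move=> zK; apply: (supp_in_derive d cK) zK => y; exact: chiK. Qed.

Local Ltac measK := repeat first [ assumption | exact: mA | exact: mV | exact: mG | exact: mdchi
  | exact: measurable_cst | apply: measurable_funD | apply: measurable_funB | apply: measurable_funM
  | apply: measurable_sum => ? ].

(** Each of the terms of the equation other than the one on the left is bounded
    pointwise by a multiple of [dominant]; in the term with D_t chi, this is so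
    after D_t W = Fk - div Hk has been used, the divergence being integrated by
    parts. *)
Lemma renormalized_estimate : dtx.-integrable K (EFin \o dominant) ->
  \int[dtx]_(z in D) (ren2 m L (v z) * (\sum_i A i z * V i z) * chi z) <=
  (4 * n%:R + 2) * Cb * \int[dtx]_(z in K) dominant z.
Proof.
move=> Id; set Bd := \int[dtx]_(z in K) dominant z.
have ren_b := ren_bound m0 mL; have ren1_b := ren1_bound m L.
have bnd (C : R) (g : E -> R) : measurable_fun K g -> (forall z, K z -> `|g z| <= C * dominant z) ->
    dtx.-integrable K (EFin \o g) /\ `|\int[dtx]_(z in K) g z| <= C * Bd.
  move=> mg hg; have IC := L1Zl mK C Id; split; first exact: (L1_dom mK mg IC hg).
  by rewrite /Bd -RintegralZl//; exact: Rintegral_abs_le.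
have Cb0 : 0 <= Cb by rewrite /Cb !mulr_ge0// addr_ge0// ltW.
have Bd0 : 0 <= Bd by apply: Rintegral_ge0 => z Kz; apply: dominant0; exact: KD.
have bf : `|\int[dtx]_(z in D) (f z * (ren1 m L (v z) * chi z))| <= Cb * Bd.
  rewrite (Rintegral_supp KD); last by move=> z zK; rewrite chiK// !mulr0.
  by apply: (bnd _ _ _ _).2; [measK|move=> z /KD; exact: term_f].
have bG : `|\int[dtx]_(z in D) \sum_i G i z * (ren2 m L (v z) * V i z * chi z + ren1 m L (v z) * 'D_(px i) chi z)|
    <= n%:R * Cb * Bd.
  rewrite (Rintegral_supp KD); last first.
    by move=> z zK; rewrite big1// => i _; rewrite chiK// dchiK// !mulr0 addr0 mulr0.
  apply: (bnd _ _ _ _).2; first by measK.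
  by move=> z Kz; rewrite -mulrA; apply: sum_le => i; apply: term_G; exact: KD.
have bA : `|\int[dtx]_(z in D) (ren1 m L (v z) * \sum_i A i z * 'D_(px i) chi z)| <= n%:R * Cb * Bd.
  rewrite (Rintegral_supp KD); last first.
    by move=> z zK; rewrite big1 ?mulr0// => i _; rewrite dchiK// mulr0.
  apply: (bnd _ _ _ _).2; first by measK.
  by move=> z Kz; rewrite mulr_sumr -mulrA; apply: sum_le => i; apply: term_A; exact: KD.
(* D_t chi contains D_t W = Fk - div Hk, and the divergence is integrated by
   parts against the weak gradient of v *)
have bT : `|\int[dtx]_(z in D) (ren m L (v z) * 'D_pt chi z)| <= (n.+1%:R + n%:R) * Cb * Bd.
  rewrite (Rintegral_supp KD); last by move=> z zK; rewrite dchiK// mulr0.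
  pose Psi i z := phi z * bW b1 z * Hk i z.
  have tPsi i : test_function D (Psi i) by exact: test_prod.
  have PsiK i z : ~ K z -> Psi i z = 0 by move=> zK; rewrite /Psi phiK// !mul0r.
  have dPsiK i z : ~ K z -> 'D_(px i) (Psi i) z = 0.
    by move=> zK; apply: (supp_in_derive (px i) cK) zK => y; exact: PsiK.
  have sPsi i : smooth (Psi i) by apply: smoothM => //; apply: smoothM => //; exact: sbW.
  have spb : smooth (fun z => phi z * bW b1 z) by apply: smoothM => //; exact: sbW.
  have chainI i : \int[dtx]_(z in K) (ren m L (v z) * 'D_(px i) (Psi i) z) =
      - \int[dtx]_(z in K) (ren1 m L (v z) * V i z * Psi i z).
    pose cc := 5 / 2 * L + 1 + (m^-1 + L^-1).
    have im : 0 <= m^-1 by rewrite invr_ge0 ltW.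
    have iL : 0 <= L^-1 by rewrite invr_ge0 ltW.
    have h1 x : `|ren m L x| <= cc by apply: le_trans (ren_b x) _; rewrite /cc; lra.
    have LL := L0; have h2 x : `|ren1 m L x| <= cc by apply: le_trans (ren1_b x) _; rewrite /cc; lra.
    have h3 := lipschitz_derive (is_derive_ren1 m0 mL) (ren2_bound m0 mL).
    have h4 x y : `|ren1 m L x - ren1 m L y| <= cc * `|x - y|.
      by apply: le_trans (h3 x y) _; rewrite ler_wpM2r// /cc; lra.
    have := chain_rule oD bD (is_derive_ren m0 mL) h1 h2 h4 Iv (IV i) (hV i) (tPsi i).
    rewrite (Rintegral_supp KD); last by move=> z zK; rewrite dPsiK// mulr0.
    by rewrite (Rintegral_supp KD)// => z zK; rewrite PsiK// mulr0.
  have mrest : measurable_fun K rest.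
    have m1 : measurable_fun K ('D_pt phi) by apply: msm; exact: smooth_derive.
    have m2 := msm (sbW sb); have m3 := msm (sbW sb1); have m4 := msm sphi; have m5 := msm sF.
    have m6 i := msm (sH i); have m7 i := msm (smooth_derive (px i) spb).
    apply: measurable_funD.
      apply: (measurable_funM mren0); apply: measurable_funD; first exact: (measurable_funM m1 m2).
      exact: (measurable_funM (measurable_funM m4 m3) (measurable_funM m5 (measurable_cst _))).
    apply: measurable_sum => i.
    exact: (measurable_funM (measurable_funM mren0 (measurable_funM (m6 i) (measurable_cst _))) (m7 i)).
  have [Ir br] := bnd _ _ mrest (fun z Kz => term_rest (KD Kz)).
  have IDPsi i : dtx.-integrable K (EFin \o 'D_(px i) (Psi i)).
    have cs : csmooth (Psi i) by exact: test_csmooth (tPsi i).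
    exact: integrableS (csmooth_integrable (csmooth_derive (px i) cs)).
  have IU i : dtx.-integrable K (EFin \o fun z => M^-1 * (ren m L (v z) * 'D_(px i) (Psi i) z)).
    by apply: (L1Zl mK); apply: (L1M_bounded mK (c := 5 / 2 * L)).
  have -> : \int[dtx]_(z in K) (ren m L (v z) * 'D_pt chi z) =
      \int[dtx]_(z in K) rest z - \sum_i \int[dtx]_(z in K) (M^-1 * (ren m L (v z) * 'D_(px i) (Psi i) z)).
    rewrite -Rintegral_sum// -RintegralB//; last exact: L1_sum.
    apply: Rintegral_eq => // z Kz; rewrite /rest.
    have -> : 'D_pt chi z = phi z * (bW b1 z * ('D_pt W z / M)) + bW bump z * 'D_pt phi z by exact: dprod.
    rewrite hW//; set X := 'D_pt phi z; set Dpb := fun i => 'D_(px i) (fun z => phi z * bW b1 z) z.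
    have -> : \sum_i M^-1 * (ren m L (v z) * 'D_(px i) (Psi i) z) =
        \sum_i ren m L (v z) * (Hk i z / M) * Dpb i
        + (M^-1 * ren m L (v z) * phi z * bW b1 z) * \sum_i 'D_(px i) (Hk i) z.
      rewrite mulr_sumr -big_split /=; apply: eq_bigr => i _.
      by rewrite (derive_smoothM _ _ spb (sH i)) -/(Dpb i); ring.
    by rewrite -/(Dpb _); set S1 := \sum_i _; set S2 := \sum_i _; ring.
  have bV i : `|\int[dtx]_(z in K) (M^-1 * (ren m L (v z) * 'D_(px i) (Psi i) z))| <= Cb * Bd.
    have mPsi : measurable_fun K (Psi i) by exact: msm.
    have [I1 b1'] : dtx.-integrable K (EFin \o fun z => M^-1 * (ren1 m L (v z) * V i z * Psi i z)) /\
        `|\int[dtx]_(z in K) (M^-1 * (ren1 m L (v z) * V i z * Psi i z))| <= Cb * Bd.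
      by apply: bnd; [measK|move=> z /KD; exact: term_V].
    have I2 : dtx.-integrable K (EFin \o fun z => ren1 m L (v z) * V i z * Psi i z).
      apply: (L1_eq mK) (L1Zl mK M I1) => z _.
      by rewrite mulrA mulfV ?mul1r// gt_eqF.
    rewrite RintegralZl//; last by apply: (L1M_bounded mK (c := 5 / 2 * L)).
    by rewrite chainI mulrN normrN -RintegralZl.
  apply: le_trans (ler_normB _ _) _.
  have -> : (n.+1%:R + n%:R) * Cb * Bd = n.+1%:R * Cb * Bd + n%:R * (Cb * Bd).
    by ring.
  by apply: lerD => //; exact: sum_le.
have := weq m0 mL test_chi.
set X1 := (X in - X + _ + _ = _); set X2 := (X in _ + X + _ = _); set X3 := (X in _ + X = _).
set X4 := (X in _ = X + _); set X5 := (X in _ = _ + X) => e1.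
have e2 : X3 = X4 + X5 + X1 - X2 by rewrite -e1; ring.
have {}bf : `|X4| <= Cb * Bd := bf.
have {}bG : `|X5| <= n%:R * Cb * Bd := bG.
have {}bA : `|X2| <= n%:R * Cb * Bd := bA.
have {}bT : `|X1| <= (n.+1%:R + n%:R) * Cb * Bd := bT.
apply: (@le_trans _ _ X3); first exact: lexx.
have -> : (4 * n%:R + 2) * Cb * Bd = Cb * Bd + n%:R * Cb * Bd + (n.+1%:R + n%:R) * Cb * Bd + n%:R * Cb * Bd.
  by rewrite -(natr1 n); ring.
by rewrite e2; exact: four_terms.
Qed.

End estimate.

(** * The limits of the energy estimate *)

Section limits.
Variables (phi : E -> R) (K : set E) (c tau Ct : R).
Local Notation b1 := ('D_1 (bump : R -> R)).
Local Notation b2 := ('D_1 b1).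
Hypotheses (cK : compact K) (KD : K `<=` D) (sphi : smooth phi) (phiK : supp_in K phi)
  (phi0 : forall z, 0 <= phi z).
Hypotheses (c1 : 1 <= c) (phic : forall z, `|phi z| <= c) (phict : forall z, `|'D_pt phi z| <= c)
  (phici : forall i z, `|'D_(px i) phi z| <= c)
  (bc : forall x, `|bump x| <= c) (b1c : forall x, `|b1 x| <= c) (b2c : forall x, `|b2 x| <= c).
Hypotheses (tau0 : 0 < tau) (Ct1 : 1 <= Ct)
  (hY : forall a b : R, 0 <= a -> 0 <= b -> a * b <= tau * a `^ p + Ct * b `^ q /\
    a * b <= tau * a `^ q + Ct * b `^ p).

Let mK : measurable K := compact_measurable cK.
Let q1 : 1 < q. Proof. by rewrite ltr_pdivlMr ?subr_gt0// mul1r ltrBlDr ltrDl. Qed.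
Let qq : q / (q - 1) = p.
Proof. by have h := p1; have pm : 0 < p - 1 by [rewrite subr_gt0]; field; rewrite gt_eqF//; lra. Qed.
Let e_ (j : nat) : 0 < j.+1%:R^-1 :> R. Proof. by []. Qed.

Definition W_ (k : nat) := moll k (w \_ D).
Definition F_ (k : nat) := moll k (F \_ D).
Definition H_ (k : nat) (i : 'I_n) := moll k (H i \_ D).
Definition AV z := \sum_i A i z * V i z.
Definition limit_firsts z : R := `|v z| + `|f z| + `|F z| + \sum_i (`|A i z| + `|G i z| + `|H i z|).
(** The bound given by [moll_derive_bound] for the mollifications of w. *)
Definition Bw : R := Cw / (2^-1 - 2^-1 `^ q).
Definition Cp : R := \sum_i (\int[dtx]_(z in D) (`|H i z| `^ q) + \int[dtx]_(z in D) (`|G i z| `^ q) + Bw).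

(** The linear equation of w, tested with the kernel centred at z. *)
Lemma moll_time_derivative : exists k0, forall k, (k0 <= k)%N -> forall z, K z ->
  'D_pt (W_ k) z = F_ k z - \sum_i 'D_(px i) (H_ k i) z.
Proof.
have [r r0 hr] := compact_margin cK oD KD.
have [k0' hk0] := inv_lt_near r0; exists k0' => k kk z Kz.
have tr := rho_test hr (hk0 k kk) Kz.
rewrite /W_ (moll_derive_pairing oD k z pt Iw) (hw tr) /F_ moll_pairing opprB addrC opprK; congr (_ + _).
rewrite Rintegral_sum//; last first.
  move=> i; have tri := test_derive (px i) tr; have [K1 [s1 cK1 P1 _]] := test_elim tri.
  have [B B0 hB] := supp_in_bounded (smooth_continuous s1) cK1 P1.
  apply: (L1_eq (f := fun y => 'D_(px i) (fun y => rho k.+1%:R^-1 (z - y)) y * H i y) mD) => [y _|]; first exact: mulrC.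
  apply: (L1M_bounded mD (c := B)) => //; apply: measurable_funTS.
  by apply: continuous_measurable_E; exact: smooth_continuous.
rewrite -sumrN; apply: eq_bigr => i _.
by rewrite /H_ (moll_derive_pairing oD k z (px i) (IH i)) opprK.
Qed.

(** The contraction property in L^q for H, and [moll_derive_bound] for the
    gradient of w, which only has a bound by duality. *)
Lemma powers_bound : exists k0, forall k, (k0 <= k)%N ->
  dtx.-integrable K (EFin \o powers (W_ k) (H_ k)) /\ \int[dtx]_(z in K) powers (W_ k) (H_ k) z <= Cp.
Proof.
have hb i : exists k0, forall k, (k0 <= k)%N ->
    (\int[dtx]_(z in K) (`|'D_(px i) (W_ k) z| `^ p)%:E <= Bw%:E)%E.
  have := moll_derive_bound oD q1 Iw (hwb i) cK KD.
  by rewrite qq.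
have [ki hki] := choice hb; exists (\max_i ki i)%N => k kk.
have kki i : (ki i <= k)%N by rewrite (leq_trans _ kk)//; exact: leq_bigmax.
have IKw i : dtx.-integrable K (EFin \o fun z => `|'D_(px i) (W_ k) z| `^ p) /\
    \int[dtx]_(z in K) (`|'D_(px i) (W_ k) z| `^ p) <= Bw.
  have h := hki i k (kki i).
  have IW : dtx.-integrable K (EFin \o fun z => `|'D_(px i) (W_ k) z| `^ p).
    apply/integrableP; split.
      apply/measurable_EFinP; apply: measurable_powR_comp.
      apply: measurableT_comp => //; apply: measurable_funTS; apply: continuous_measurable_E.
      by apply: smooth_continuous; apply: smooth_derive; exact: moll_smooth.
    under eq_integral do rewrite /= ger0_norm ?powR_ge0//.
    by apply: le_lt_trans h (ltry _).
  split => //; rewrite -lee_fin /Rintegral fineK//; exact: integrable_fin_num.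
have IKH i : dtx.-integrable K (EFin \o fun z => `|H_ k i z| `^ q) /\
    \int[dtx]_(z in K) (`|H_ k i z| `^ q) <= \int[dtx]_(z in D) (`|H i z| `^ q).
  have IH' := restrict_L1 mD (IH i).
  have q0 : 0 < q by exact: lt_trans q1.
  have eH : (fun y => `|(H i \_ D) y| `^ q) = (fun y => `|H i y| `^ q) \_ D.
    by apply/funext => y; rewrite !patchE; case: ifP => // _; rewrite normr0 powR0// gt_eqF.
  have IHq' : dtx.-integrable setT (EFin \o fun y => `|(H i \_ D) y| `^ q).
    by rewrite eH; exact: restrict_L1.
  have [I1 I2] := conv_Lq q1 (e_ k) IH' IHq'; split; first exact: integrableS I1.
  apply: (@le_trans _ _ (\int[dtx]_z (`|H_ k i z| `^ q))).
    rewrite Rintegral_mkcond; apply: le_Rintegral => //.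
      by apply: restrict_L1 => //; exact: integrableS I1.
    by move=> z _; rewrite patchE; case: ifP => _ //; exact: powR_ge0.
  by apply: (le_trans I2); rewrite eH -Rintegral_mkcond.
have IKG i : dtx.-integrable K (EFin \o fun z => `|G i z| `^ q) /\
    \int[dtx]_(z in K) (`|G i z| `^ q) <= \int[dtx]_(z in D) (`|G i z| `^ q).
  have I1 : dtx.-integrable K (EFin \o fun z => `|G i z| `^ q) by exact: integrableS (IGq i).
  by split => //; apply: (Rintegral_le_sub mD mK KD) => // z _; exact: powR_ge0.
have I3 i : dtx.-integrable K (EFin \o fun z => `|H_ k i z| `^ q + `|G i z| `^ q + `|'D_(px i) (W_ k) z| `^ p).
  exact: (L1D mK (L1D mK (IKH i).1 (IKG i).1) (IKw i).1).
split; first exact: L1_sum.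
rewrite /powers Rintegral_sum//; apply: ler_sum => i _.
rewrite RintegralD//; [|exact: (L1D mK (IKH i).1 (IKG i).1)|exact: (IKw i).1].
rewrite RintegralD//; [|exact: (IKH i).1|exact: (IKG i).1].
by apply: lerD; [apply: lerD; [exact: (IKH i).2|exact: (IKG i).2]|exact: (IKw i).2].
Qed.

Let r_ex : exists2 r, 0 < r & forall z y, K z -> `|y - z| < r -> D y := compact_margin cK oD KD.

Lemma moll_K_cvg g : LD g -> (fun k => \int[dtx]_(z in K) `|moll k (g \_ D) z - g z|) @ \oo --> 0.
Proof.
by move=> Ig; have [r r0 hr] := r_ex; exact: (@moll_cvg R n D K g r mD finD mK r0 hr Ig).
Qed.

Let IK g : LD g -> dtx.-integrable K (EFin \o g). Proof. exact: integrableS. Qed.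
Let Imoll k g : LD g -> dtx.-integrable K (EFin \o moll k (g \_ D)).
Proof. by move=> Ig; have [I1 _] := conv_L1 (e_ k) (restrict_L1 mD Ig); exact: integrableS I1. Qed.

Definition moll_error (k : nat) : R := \int[dtx]_(z in K) `|F_ k z - F z| +
  \sum_i \int[dtx]_(z in K) `|H_ k i z - H i z|.

Lemma moll_error_cvg : moll_error @ \oo --> 0.
Proof.
rewrite -[X in _ --> X](addr0 0); apply: cvgD; first exact: moll_K_cvg.
rewrite -[X in _ --> X](@big1 R 0 +%R 'I_n (index_enum _) xpredT (fun=> 0))//.
by apply: cvg_big => [|i _]; [exact: add_continuous|exact: moll_K_cvg].
Qed.

Let mDK (g : E -> R) : measurable_fun D g -> measurable_fun K g.
Proof. by move=> mg; exact: measurable_funS mg. Qed.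

Section fixed.
Variables (m L B1 B2 : R).
Hypotheses (m0 : 0 < m) (mL : 5 * m <= L).
Local Notation M := (L / 4).
Hypotheses (I1 : LD (fun z => e z * ring_ m L z)) (J1 : \int[dtx]_(z in D) (e z * ring_ m L z) <= B1)
  (I2 : LD (fun z => e z * ring_m m z)) (J2 : \int[dtx]_(z in D) (e z * ring_m m z) <= B2).

Let L0 : 0 < L. Proof. by apply: lt_le_trans mL; rewrite mulr_gt0. Qed.
Let M0 : 0 < M. Proof. by rewrite divr_gt0. Qed.
Let iM : 0 <= M^-1. Proof. by rewrite invr_ge0 ltW. Qed.
Let im : 0 <= m^-1. Proof. by rewrite invr_ge0 ltW. Qed.
Let Ct0 : 0 <= Ct. Proof. exact: le_trans Ct1. Qed.

Let mtail : measurable_fun D (tail m).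
Proof. by apply: measurable_indb => //; apply: measurable_fun_ltr => //; exact: measurableT_comp. Qed.
Let tail1 z : `|tail m z| <= 1. Proof. by rewrite /tail; case: (_ < _); rewrite ?normr0 ?normr1. Qed.

Lemma limit_firsts_L1 : LD limit_firsts.
Proof.
apply: (L1D mD); first by apply: (L1D mD); [apply: (L1D mD)|]; exact: L1norm.
by apply: (L1_sum mD) => i; apply: (L1D mD); [apply: (L1D mD)|]; exact: L1norm.
Qed.

Let Itail g : dtx.-integrable K (EFin \o g) -> dtx.-integrable K (EFin \o fun z => g z * tail m z).
Proof.
move=> Ig; apply: (L1_eq (f := fun z => tail m z * g z) mK) => [z _|]; first exact: mulrC.
by apply: (L1M_bounded mK (c := 1)) => //; exact: mDK.
Qed.

Lemma dominant_bound : exists k0, forall k, (k0 <= k)%N ->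
  let d := dominant m L tau Ct (W_ k) (F_ k) (H_ k) in
  dtx.-integrable K (EFin \o d) /\
  \int[dtx]_(z in K) d z <= \int[dtx]_(z in K) (limit_firsts z * tail m z) + moll_error k
    + tau * (B1 / M + B2 / m) + Ct * Cp * (M^-1 + m^-1).
Proof.
have [k0' hk] := powers_bound; exists k0' => k kk d; have [Ip Jp] := hk k kk.
pose f1 z := firsts (F_ k) (H_ k) z * tail m z.
pose f2 z := e z * (ring_ m L z / M + ring_m m z / m).
have If1 : dtx.-integrable K (EFin \o f1).
  apply: Itail; apply: (L1D mK).
    by apply: (L1D mK); [apply: (L1D mK)|]; apply: L1norm; [exact: IK|exact: IK|exact: Imoll].
  by apply: (L1_sum mK) => i; apply: (L1D mK); [apply: (L1D mK)|]; apply: L1norm; [exact: IK|exact: IK|exact: Imoll].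
have If2D : LD f2.
  apply: (L1_eq (f := fun z => M^-1 * (e z * ring_ m L z) + m^-1 * (e z * ring_m m z)) mD) => [z _|].
    by rewrite /f2; ring.
  by apply: (L1D mD); exact: L1Zl.
have If2 := IK If2D.
have Jf2 : \int[dtx]_(z in K) f2 z <= B1 / M + B2 / m.
  apply: (@le_trans _ _ (\int[dtx]_(z in D) f2 z)).
    apply: (Rintegral_le_sub mD mK KD) => // z Dz.
    by rewrite mulr_ge0 ?e0// addr_ge0// mulr_ge0//; exact: ler0n.
  have -> : \int[dtx]_(z in D) f2 z = M^-1 * \int[dtx]_(z in D) (e z * ring_ m L z) + m^-1 * \int[dtx]_(z in D) (e z * ring_m m z).
    rewrite -RintegralZl// -RintegralZl// -RintegralD//; [|exact: L1Zl|exact: L1Zl].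
    by apply: Rintegral_eq => // z _; rewrite /f2; ring.
  by apply: lerD; rewrite mulrC ler_wpM2r.
have Id : dtx.-integrable K (EFin \o d).
  apply: (L1D mK); first by apply: (L1D mK) => //; exact: L1Zl.
  apply: (L1_eq (f := fun z => Ct * (M^-1 + m^-1) * powers (W_ k) (H_ k) z) mK) => [z _|]; first by ring.
  exact: L1Zl.
split => //.
have -> : \int[dtx]_(z in K) d z = \int[dtx]_(z in K) f1 z + tau * \int[dtx]_(z in K) f2 z
    + Ct * (M^-1 + m^-1) * \int[dtx]_(z in K) powers (W_ k) (H_ k) z.
  have I3 : dtx.-integrable K (EFin \o fun z => tau * f2 z) by exact: L1Zl.
  have I4 : dtx.-integrable K (EFin \o fun z => Ct * (M^-1 + m^-1) * powers (W_ k) (H_ k) z) by exact: L1Zl.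
  have -> : tau * \int[dtx]_(z in K) f2 z = \int[dtx]_(z in K) (tau * f2 z) by rewrite RintegralZl.
  have -> : Ct * (M^-1 + m^-1) * \int[dtx]_(z in K) powers (W_ k) (H_ k) z =
    \int[dtx]_(z in K) (Ct * (M^-1 + m^-1) * powers (W_ k) (H_ k) z) by rewrite RintegralZl.
  rewrite -RintegralD// -RintegralD//; last exact: (L1D mK If1 I3).
  by apply: Rintegral_eq => // z _; rewrite /d /dominant /f1 /f2; ring.
apply: lerD; last first.
  have -> : Ct * Cp * (M^-1 + m^-1) = Ct * (M^-1 + m^-1) * Cp by ring.
  by rewrite ler_wpM2l// mulr_ge0// addr_ge0.
apply: lerD; last by rewrite ler_wpM2l// ltW.
have Ilt : dtx.-integrable K (EFin \o fun z => limit_firsts z * tail m z).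
  by apply: Itail; apply: IK; exact: limit_firsts_L1.
have IeF : dtx.-integrable K (EFin \o fun z => `|F_ k z - F z|).
  by apply: L1norm; apply: L1B => //; [exact: Imoll|exact: IK].
have IeH i : dtx.-integrable K (EFin \o fun z => `|H_ k i z - H i z|).
  by apply: L1norm; apply: L1B => //; [exact: Imoll|exact: IK].
have IsH : dtx.-integrable K (EFin \o fun z => \sum_i `|H_ k i z - H i z|) by exact: L1_sum.
have IFH := L1D mK IeF IsH.
rewrite /moll_error -Rintegral_sum// -RintegralD// -RintegralD//.
apply: le_Rintegral => //; first exact: (L1D mK Ilt IFH).
move=> z Kz; rewrite /f1.
have t0 : 0 <= tail m z by exact: ler0n.
have t1 : tail m z <= 1 by have := tail1 z; rewrite ger0_norm.
apply: (@le_trans _ _ ((limit_firsts z + (`|F_ k z - F z| + \sum_i `|H_ k i z - H i z|)) * tail m z)).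
  rewrite ler_wpM2r// /firsts /limit_firsts.
  have hF : `|F_ k z| <= `|F z| + `|F_ k z - F z|.
    by rewrite -{1}(subrK (F z) (F_ k z)) addrC (le_trans (ler_normD _ _)).
  have hH : \sum_i (`|A i z| + `|G i z| + `|H_ k i z|) <= \sum_i (`|A i z| + `|G i z| + `|H i z|) + \sum_i `|H_ k i z - H i z|.
    rewrite -big_split /=; apply: ler_sum => i _; rewrite -!addrA !lerD2l.
    by rewrite -{1}(subrK (H i z) (H_ k i z)) addrC (le_trans (ler_normD _ _)).
  lra.
rewrite mulrDl lerD2l ler_piMr// addr_ge0// sumr_ge0//.
Qed.

Lemma AV_le z : D z -> `|AV z| <= n%:R * (2 * Ce * e z).
Proof.
move=> Dz; apply: le_trans (ler_norm_sum _ _ _) _.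
apply: (@le_trans _ _ (\sum_(i < n) (2 * Ce * e z))); last by rewrite sumr_const card_ord [leRHS]mulr_natl.
apply: ler_sum => i _; rewrite normrM mulrC; apply: (le_trans (young p1 (normr_ge0 _) (normr_ge0 _))).
by have := hA i Dz; have := hVe i Dz; lra.
Qed.

Lemma ren2_AV_L1 : LD (fun z => ren2 m L (v z) * AV z).
Proof.
apply: (L1_dom (g := fun z => n%:R * 2 * Ce * (M^-1 * (e z * ring_ m L z) + m^-1 * (e z * ring_m m z))) mD).
- apply: measurable_funM.
    apply: (@measurableT_comp _ _ _ _ _ _ (ren2 m L)) => //.
    by apply: continuous_measurable_fun; exact: continuous_ren2.
  apply: measurable_sum => i; apply: measurable_funM; apply: L1_measurable; first exact: IA.
  exact: IV.
- by apply: (L1Zl mD); apply: (L1D mD); exact: L1Zl.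
- move=> z Dz; rewrite normrM.
  apply: (le_trans (ler_pM (normr_ge0 _) (normr_ge0 _) (ren2_le m0 mL z) (AV_le Dz))).
  by rewrite le_eqVlt; apply/orP; left; apply/eqP; ring.
Qed.

(** The cut-offs b(w_k / M) are uniformly bounded and converge in measure, while
    the factor in front of them is integrable on the rings. *)
Lemma mollified_limit :
  \int[dtx]_(z in K) (phi z * bump (w z / M) * (ren2 m L (v z) * AV z)) <=
  (4 * n%:R + 2) * Cb c * (\int[dtx]_(z in K) (limit_firsts z * tail m z)
    + tau * (B1 / M + B2 / m) + Ct * Cp * (M^-1 + m^-1)).
Proof.
have Ib := ren2_AV_L1; have IbK := IK Ib.
have sb1 x : is_derive x (1 : R) (bump : R -> R) (b1 x).
  apply: derivableP; have [_ [h _]] := @bump_Ck R 1; exact: h.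
have mb : measurable_fun setT (bump : R -> R).
  by apply: continuous_measurable_fun; exact: (Ck_continuous (@bump_Ck R 0)).
have mphi : measurable_fun K phi.
  by exact: smooth_measurable.
have ma (W : E -> R) : measurable_fun K W -> measurable_fun K (fun z => phi z * bump (W z / M)).
  move=> mW; apply: measurable_funM => //; apply: (measurableT_comp mb).
  by apply: measurable_funM.
have ac (W : E -> R) z : `|phi z * bump (W z / M)| <= c ^+ 2.
  by rewrite normrM expr2 ler_pM.
have mWk k : measurable_fun K (W_ k) by apply: L1_measurable; exact: Imoll.
have h1 : (fun k => \int[dtx]_(z in K) (phi z * bump (W_ k z / M) * (ren2 m L (v z) * AV z))) @ \oo -->
    \int[dtx]_(z in K) (phi z * bump (w z / M) * (ren2 m L (v z) * AV z)).
  apply: (@cvg_int_mul _ _ R dtx K (fun k z => phi z * bump (W_ k z / M)) (fun k z => `|W_ k z - w z|)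
    (fun _ z => ren2 m L (v z) * AV z) _ _ (c ^+ 2) (c * c / M)) => //.
  - by move=> k; exact: ma.
  - by apply: ma; apply: mDK; exact: L1_measurable Iw.
  - move=> k z Kz; rewrite -mulrBr normrM -!mulrA; apply: ler_pM => //.
    apply: (le_trans (lipschitz_derive sb1 b1c _ _)).
    by rewrite -mulrBl normrM [`|M^-1|]ger0_norm// [_ * M^-1]mulrC.
  - by rewrite !mulr_ge0// (le_trans _ c1).
  - by move=> k; apply: L1norm; apply: L1B => //; [exact: Imoll|exact: IK].
  - exact: moll_K_cvg.
  - rewrite (_ : (fun k => _) = fun=> 0); first exact: cvg_cst.
    by apply/funext => k; rewrite /Rintegral integral0_eq// => z _; rewrite subrr normr0.
have [ka hka] := moll_time_derivative; have [kb hkb] := dominant_bound.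
set X := \int[dtx]_(z in K) _; set Y := \int[dtx]_(z in K) _.
set Z := (4 * n%:R + 2) * Cb c.
have Z0 : 0 <= Z.
  rewrite /Z /Cb; apply: mulr_ge0; first by rewrite addr_ge0// mulr_ge0.
  apply: mulr_ge0; first by rewrite mulr_ge0// sqr_ge0.
  by rewrite addr_ge0// ltW.
have h2 : (fun k => Z * (Y + moll_error k + tau * (B1 / M + B2 / m) + Ct * Cp * (M^-1 + m^-1))) @ \oo -->
    Z * (Y + 0 + tau * (B1 / M + B2 / m) + Ct * Cp * (M^-1 + m^-1)).
  apply: cvgM; first exact: cvg_cst.
  apply: cvgD; last exact: cvg_cst.
  apply: cvgD; last exact: cvg_cst.
  by apply: cvgD; [exact: cvg_cst|exact: moll_error_cvg].
rewrite -[Y]addr0; apply: (ler_cvg_to h1 h2).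
exists (maxn ka kb) => // k /= kk.
have kka : (ka <= k)%N by apply: leq_trans kk; rewrite leq_maxl.
have kkb : (kb <= k)%N by apply: leq_trans kk; rewrite leq_maxr.
have [Id Jd] := hkb k kkb.
have sW : smooth (W_ k) by exact: moll_smooth.
have sF : smooth (F_ k) by exact: moll_smooth.
have sH i : smooth (H_ k i) by exact: moll_smooth.
have := @renormalized_estimate m L c tau Ct K phi (W_ k) (F_ k) (H_ k) m0 mL cK KD sphi phiK sW sF sH
  (hka k kka) c1 phic phict phici bc b1c b2c tau0 Ct1 hY Id.
rewrite (@Rintegral_supp R n D K _ KD); [|by move=> z Kz; rewrite phiK// mul0r mulr0].
move=> h; apply: (@le_trans _ _ (Z * \int[dtx]_(z in K) dominant m L tau Ct (W_ k) (F_ k) (H_ k) z)).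
  apply: le_trans h; rewrite le_eqVlt; apply/orP; left; apply/eqP; apply: Rintegral_eq => // z _.
  by rewrite /AV mulrC.
by rewrite ler_wpM2l.
Qed.

End fixed.

Definition Zc : R := (4 * n%:R + 2) * Cb c.

Lemma Zc_ge0 : 0 <= Zc.
Proof.
rewrite /Zc /Cb; apply: mulr_ge0; first by rewrite addr_ge0// mulr_ge0.
apply: mulr_ge0; first by rewrite mulr_ge0// sqr_ge0.
by rewrite addr_ge0// ltW.
Qed.

Lemma AV_measurable : measurable_fun D AV.
Proof.
apply: measurable_sum => i; apply: measurable_funM; apply: L1_measurable; first exact: IA.
exact: IV.
Qed.

Lemma tent_measurable (m : R) : measurable_fun D (fun z => tent (- v z / m)).
Proof.
apply: (@measurableT_comp _ _ _ _ _ _ (tent : R -> R)).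
  apply: continuous_measurable_fun; exact: continuous_tent.
by apply: measurable_funM => //; exact: measurableT_comp.
Qed.

(** On the outer ring w >= L/2 - C0 >= M as soon as L >= 4 C0, so that the cut-
    off vanishes there; then L tends to infinity, and the cut-off tends to b(0)
    = 1. *)
Lemma inner_ring_limit (k : nat) : (0 < k)%N -> (n0 <= k)%N -> let m : R := (2 * k)%:R in
  let g := fun z => phi z * (tent (- v z / m) / m * AV z) in
  dtx.-integrable K (EFin \o g) /\
  \int[dtx]_(z in K) g z <= Zc * (\int[dtx]_(z in K) (limit_firsts z * tail m z)
    + tau * (20 * C1) + Ct * Cp * m^-1).
Proof.
move=> k1 nk m g.
have m0 : 0 < m by rewrite /m ltr0n muln_gt0.
have [I2 J2] := energy_ring 0 k1 nk; rewrite -/m expr0 mul1r in I2 J2.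
have mphi : measurable_fun K phi.
  by exact: smooth_measurable.
have mg : measurable_fun K g.
  apply: measurable_funM => //; apply: mDK; apply: measurable_funM; last exact: AV_measurable.
  by apply: measurable_funM => //; exact: tent_measurable.
have Ig : dtx.-integrable K (EFin \o g).
  apply: (L1_dom (g := fun z => c * (m^-1 * (n%:R * 2 * Ce)) * (e z * ring_m m z)) mK) => //.
    by apply: L1Zl => //; exact: IK.
  move=> z Kz; rewrite /g normrM -!mulrA ler_pM//; rewrite normrM.
  have ht : `|tent (- v z / m)| <= ring_m m z.
    rewrite /ring_m; case: (boolP (in_ring _ _ _)) => h; last by rewrite tent2_out// normr0.
    by rewrite ger0_norm ?tent_ge0// tent_le1.
  apply: (le_trans (ler_pM (normr_ge0 _) (normr_ge0 _) ht (lexx _))).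
  rewrite normrM ger0_norm ?invr_ge0 ?(ltW m0)//.
  apply: (le_trans (ler_wpM2l _ (ler_wpM2l _ (AV_le (KD Kz))))).
  - by rewrite /ring_m ler0n.
  - by rewrite invr_ge0 ltW.
  - by rewrite le_eqVlt; apply/orP; left; apply/eqP; ring.
split => //.
pose Mi J : R := 4 / m * 2^-1 ^+ J.
have MiE J : (2 ^+ J * m / 4)^-1 = Mi J by rewrite /Mi exprVn invf_div invfM; ring.
have Mi0 : Mi @ \oo --> 0.
  by apply: cvg_geometric; rewrite ger0_norm// invf_lt1// ltr1n.
have mb : measurable_fun setT (bump : R -> R).
  by apply: continuous_measurable_fun; exact: (Ck_continuous (@bump_Ck R 0)).
have mw : measurable_fun K w by apply: mDK; exact: L1_measurable Iw.
have h1 : (fun J => \int[dtx]_(z in K) (bump (w z * Mi J) * g z)) @ \oo --> \int[dtx]_(z in K) g z.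
  apply: (DCT_R mK (g := fun z => c * `|g z|)).
  - move=> J; apply: measurable_funM => //; apply: (measurableT_comp mb); exact: measurable_funM.
  - move=> z Kz; rewrite -[X in _ --> X]mul1r; apply: cvgM; last exact: cvg_cst.
    rewrite -(@bump0 R); apply: continuous_cvg; first exact: (Ck_continuous (@bump_Ck R 0)).
    by rewrite -[X in _ --> X](mulr0 (w z)); apply: cvgM; [exact: cvg_cst|exact: Mi0].
  - by apply: (L1Zl mK); exact: L1norm.
  - by move=> J z Kz; rewrite normrM ler_wpM2r.
set Y := \int[dtx]_(z in K) (limit_firsts z * _).
have h2 : (fun J => Zc * (Y + tau * (20 * C1) + Ct * Cp * (Mi J + m^-1))) @ \oo -->
    Zc * (Y + tau * (20 * C1) + Ct * Cp * (0 + m^-1)).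
  apply: cvgM; first exact: cvg_cst.
  apply: cvgD; first exact: cvg_cst.
  apply: cvgM; first exact: cvg_cst.
  by apply: cvgD => //; exact: cvg_cst.
rewrite add0r in h2; apply: (ler_cvg_to h1 h2).
have x0 : 0 <= 4 * C0 / m by rewrite divr_ge0 ?mulr_ge0// ltW.
exists (maxn 3 (Num.bound (4 * C0 / m))) => // J /=; rewrite geq_max => /andP[J3 JC].
set L := 2 ^+ J * m.
have h8 : 8 <= 2 ^+ J :> R.
  apply: (@le_trans _ _ (2 ^+ 3)); first by rewrite !exprS expr0; lra.
  by rewrite ler_weXn2l// ler1n.
have mL : 5 * m <= L by rewrite ler_pM2r//; lra.
have CL : 4 * C0 <= L.
  rewrite -ler_pdivrMr//; apply: ltW; apply: (lt_le_trans (archi_boundP x0)).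
  by rewrite -natrX ler_nat (leq_trans JC)// ltnW// ltn_expl.
have L0 : 0 < L by rewrite mulr_gt0// exprn_gt0.
have [I1 J1] := energy_ring J k1 nk.
have := mollified_limit m0 mL I1 J1 I2 J2; rewrite -/m -/L.
have cancel4 (x y : R) : 0 < x -> 0 < y -> 4 * C1 * x / (x / 4) + 4 * C1 * y / y = 20 * C1.
  by move=> xp yp; field; rewrite !gt_eqF.
rewrite (cancel4 L m)//.
rewrite -/Y -/Zc [(L / 4)^-1]MiE => h; apply: le_trans h.
rewrite le_eqVlt; apply/orP; left; apply/eqP; apply: Rintegral_eq => // z Kz.
have swap (x y r : R) : x * (y * r) = y * x * r by ring.
rewrite /g /ren2.
case: (boolP (in_ring (L / 2) (5 / 2 * L) (v z))) => h; last by rewrite (tent2_out L0 h) mul0r subr0; exact: swap.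
have -> : bump (w z * Mi J) = 0; last by rewrite mulr0 !mul0r.
apply: bump_out; apply: le_trans (ler_norm _).
rewrite -MiE -/L ler_pdivlMr ?divr_gt0// mul1r.
move: h => /andP[h _]; have := hvw (KD Kz); lra.
Qed.

(** The tent is at least 1/2 on the dyadic ring. The energy is nonnegative up to
    the integrable function kappa, which costs the last term. *)
Lemma energy_upper (k : nat) : (0 < k)%N -> (n0 <= k)%N -> let m : R := (2 * k)%:R in
  m^-1 * \int[dtx]_(z in D) (AV z * phi z * (dyadic (2 * k) z)%:R) <=
  2 * (Zc * (\int[dtx]_(z in K) (limit_firsts z * tail m z) + tau * (20 * C1) + Ct * Cp * m^-1))
  + 2 * c * m^-1 * \int[dtx]_(z in D) kappa z.
Proof.
move=> k1 nk; cbv zeta; have [Ig Jg] := inner_ring_limit k1 nk; set m : R := (2 * k)%:R in Ig Jg *.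
have m0 : 0 < m by rewrite /m ltr0n muln_gt0.
have mphi : measurable_fun K phi.
  by exact: smooth_measurable.
set g := (fun z => phi z * _) in Ig; set X := Zc * _ in Jg *.
have IkK := IK Ik.
pose d z : R := (dyadic (2 * k) z)%:R.
have md : measurable_fun D d.
  apply: measurable_indb => //; apply: measurable_and.
    by apply: measurable_fun_ler => //; exact: measurableT_comp.
  by apply: measurable_fun_ltr => //; exact: measurableT_comp.
have Id : LD (fun z => AV z * d z).
  apply: (L1_dom (g := fun z => n%:R * (2 * Ce) * (e z * d z)) mD).
  - by apply: measurable_funM => //; exact: AV_measurable.
  - by apply: (L1Zl mD); apply: ring_int; rewrite (leq_trans nk)// leq_pmull.
  - move=> z Dz; rewrite normrM [`|d z|]ger0_norm ?ler0n//.
    have -> : n%:R * (2 * Ce) * (e z * d z) = n%:R * (2 * Ce * e z) * d z by ring.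
    by rewrite ler_wpM2r ?ler0n// AV_le.
have IdK : dtx.-integrable K (EFin \o fun z => AV z * phi z * d z).
  apply: (L1_eq (f := fun z => phi z * (AV z * d z)) mK) => [z _|]; first by ring.
  by apply: (L1M_bounded mK (c := c)) => //; exact: IK.
rewrite (Rintegral_supp KD); last by move=> z Kz; rewrite phiK// mulr0 mul0r.
have h : \int[dtx]_(z in K) (AV z * phi z * d z) <= \int[dtx]_(z in K) (2 * m * g z + 2 * c * kappa z).
  apply: le_Rintegral => //; first by apply: (L1D mK); exact: L1Zl.
  move=> z Kz; have Dz := KD Kz.
  have ek : 0 <= AV z + kappa z.
    have := le_trans (e0 Dz) (he Dz); rewrite pmulr_rge0//.
  have t0 := tent_ge0 (- v z / m); have t1 := tent_le1 (- v z / m).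
  have -> : 2 * m * g z = 2 * (tent (- v z / m) * AV z * phi z).
    have cancel_m (x y r s : R) : 0 < x -> 2 * x * (s * (y / x * r)) = 2 * (y * r * s).
      by move=> xp; field; rewrite gt_eqF.
    exact: cancel_m.
  have pz := phi0 z; have kz := k0 Dz; have pc : phi z <= c by have := phic z; rewrite ger0_norm.
  have kc : tent (- v z / m) * (kappa z * phi z) <= c * kappa z.
    apply: (@le_trans _ _ (1 * (kappa z * phi z))).
      by rewrite ler_wpM2r// mulr_ge0.
    by rewrite mul1r mulrC ler_wpM2r.
  have h0 : 0 <= tent (- v z / m) * (AV z + kappa z) * phi z by rewrite !mulr_ge0.
  rewrite /d; case: (boolP (dyadic _ _)) => hd; last first.
    by rewrite mulr0; move: h0 kc; rewrite !mulrDr !mulrDl; lra.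
  have t2 : 2^-1 <= tent (- v z / m).
    move: hd => /andP[hd1 hd2]; apply: tent_ge_half.
    rewrite ler_pdivlMr// ler_pdivrMr// mul1r hd1/= ltW//.
    by move: hd2; rewrite (natrM R 2 (2 * k)).
  have h1 : (AV z + kappa z) * phi z <= 2 * (tent (- v z / m) * ((AV z + kappa z) * phi z)).
    have pk : 0 <= (AV z + kappa z) * phi z by rewrite mulr_ge0.
    have := ler_wpM2r pk t2; lra.
  have h2 : 0 <= kappa z * phi z by rewrite mulr_ge0.
  by rewrite mulr1; move: h1 kc h2; rewrite mulrDl mulrDr; lra.
rewrite RintegralD// ?RintegralZl// in h; [|exact: L1Zl|exact: L1Zl].
have hk : \int[dtx]_(z in K) kappa z <= \int[dtx]_(z in D) kappa z.
  exact: (Rintegral_le_sub mD mK KD).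
have hi : 0 <= m^-1 by rewrite invr_ge0 ltW.
apply: (le_trans (ler_wpM2l hi h)).
rewrite mulrDr; apply: lerD.
  have cancel_m (x y : R) : 0 < x -> x^-1 * (2 * x * y) = 2 * y.
    by move=> xp; field; rewrite gt_eqF.
  by rewrite cancel_m// ler_wpM2l.
have c0 : 0 <= c by exact: le_trans c1.
have swap (x y r : R) : x * (y * r) = y * x * r by ring.
by rewrite swap ler_wpM2l// !mulr_ge0.
Qed.

(** Only the term with tau survives as m tends to infinity; here m = 2k, so that
    the tent starts at the integer k and can be covered by dyadic rings. *)
Lemma energy_limit_tau ell :
  (fun k : nat => k%:R^-1 * \int[dtx]_(z in D) (AV z * phi z * (dyadic k z)%:R)) @ \oo --> ell ->
  ell <= 2 * (Zc * (tau * (20 * C1))).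
Proof.
move=> hl.
have h1 : (fun k : nat => (2 * k)%:R^-1 * \int[dtx]_(z in D) (AV z * phi z * (dyadic (2 * k) z)%:R)) @ \oo --> ell.
  have hc : (fun k => 2 * k)%N @ \oo --> \oo by apply: cvg_mulnl.
  exact: (cvg_comp _ _ hc hl).
have hi : (fun k : nat => (2 * k)%:R^-1 : R) @ \oo --> 0.
  apply/cvgrPdist_le => eps eps0; near=> k.
  have ek : eps^-1 <= k%:R by near: k; exact: nbhs_infty_ger.
  have kp : 0 < k%:R :> R by apply: lt_le_trans ek; rewrite invr_gt0.
  rewrite sub0r normrN ger0_norm ?invr_ge0// natrM invfM -[leRHS]invrK.
  rewrite -[leRHS]mul1r ler_pM// ?invr_ge0//; first by rewrite invf_le1// ler1n.
  by rewrite lef_pV2// posrE invr_gt0.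
have ht : (fun k : nat => \int[dtx]_(z in K) (limit_firsts z * tail (2 * k)%:R z)) @ \oo --> 0.
  rewrite (_ : (fun k => _) = fun k : nat => \int[dtx]_(z in K) (`|limit_firsts z| * ((2 * k)%:R / 2 < - v z)%R%:R)).
    apply: L1_tail => //; first by apply: IK; exact: limit_firsts_L1.
      move=> k; apply: measurable_fun_ltr => //; apply: mDK; exact: measurableT_comp.
    move=> z _; near=> k; rewrite -leNgt.
    have -> : (2 * k)%:R / 2 = k%:R :> R by rewrite natrM; field.
    by near: k; exact: nbhs_infty_ger.
  apply/funext => k; apply: Rintegral_eq => // z _; rewrite /tail ger0_norm//.
  by rewrite /limit_firsts !addr_ge0// sumr_ge0// => i _; rewrite !addr_ge0.
have h2 : (fun k : nat => 2 * (Zc * (\int[dtx]_(z in K) (limit_firsts z * tail (2 * k)%:R z)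
    + tau * (20 * C1) + Ct * Cp * (2 * k)%:R^-1)) + 2 * c * (2 * k)%:R^-1 * \int[dtx]_(z in D) kappa z) @ \oo -->
    2 * (Zc * (0 + tau * (20 * C1) + Ct * Cp * 0)) + 2 * c * 0 * \int[dtx]_(z in D) kappa z.
  have cs (x : R) (a : nat -> R) (y : R) : a @ \oo --> y -> (fun k => x * a k) @ \oo --> x * y.
    by move=> ha; apply: cvgM => //; exact: cvg_cst.
  apply: cvgD; last by apply: cvgM; [exact: cs|exact: cvg_cst].
  apply: (cs); apply: (cs); apply: cvgD; last exact: cs.
  by apply: cvgD => //; exact: cvg_cst.
rewrite add0r !mulr0 addr0 mul0r addr0 in h2.
apply: (ler_cvg_to h1 h2).
exists (maxn 1 n0) => // k /=; rewrite geq_max => /andP[k1 nk]; exact: energy_upper.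
Unshelve. all: by end_near. Qed.

End limits.

(** The left-hand side of [energy_limit_tau] is independent of tau. *)
Lemma energy_limit_le0 phi ell : test_function D phi -> (forall z, 0 <= phi z) ->
  (fun k : nat => k%:R^-1 * \int[dtx]_(z in D) ((\sum_i A i z * V i z) * phi z * (dyadic k z)%:R)) @ \oo --> ell ->
  ell <= 0.
Proof.
move=> tphi phi0 hl; have [K [sphi cK phiK KD]] := test_elim tphi.
have [cp cp0 hcp] := supp_in_bounded (smooth_continuous sphi) cK phiK.
have hd (d : E) : exists2 C, 0 <= C & forall z, `|'D_d phi z| <= C.
  exact: (supp_in_bounded (smooth_continuous (smooth_derive d sphi)) cK (supp_in_derive d cK phiK)).
have [ct ct0 hct] := hd pt.
have /choice[ci hci] : forall i : 'I_n, exists C, 0 <= C /\ forall z, `|'D_(px i) phi z| <= C.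
  by move=> i; have [C ? ?] := hd (px i); exists C.
have bK : supp_in (`[-1, 1]%classic : set R) (bump : R -> R).
  move=> x hx; apply: bump_out; rewrite leNgt; apply/negP => h; apply: hx.
  by rewrite /= in_itv /= -ler_norml ltW.
have cI : compact (`[-1, 1]%classic : set R) by exact: segment_compact.
have sb : smooth (bump : R -> R) by exact: bump_Ck.
have [c3 c30 hc3] := supp_in_bounded (smooth_continuous sb) cI bK.
have sb1 := smooth_derive (1 : R) sb; have bK1 := supp_in_derive (1 : R) cI bK.
have [c4 c40 hc4] := supp_in_bounded (smooth_continuous sb1) cI bK1.
have sb2 := smooth_derive (1 : R) sb1; have bK2 := supp_in_derive (1 : R) cI bK1.
have [c5 c50 hc5] := supp_in_bounded (smooth_continuous sb2) cI bK2.
pose c := 1 + cp + ct + \sum_i ci i + c3 + c4 + c5.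
have cs0 : 0 <= \sum_i ci i by apply: sumr_ge0 => i _; exact: (hci i).1.
have cis i : ci i <= \sum_i ci i.
  by rewrite (bigD1 i)//= lerDl sumr_ge0// => j _; exact: (hci j).1.
have le_c (x y : R) : x <= y -> y <= c -> x <= c by exact: le_trans.
have c1 : 1 <= c by rewrite /c; lra.
rewrite leNgt; apply/negP => l0.
pose Z := Zc c; have Z0 : 0 <= Z by exact: Zc_ge0.
pose X := 2 * (Z * (20 * C1)); have X0 : 0 <= X.
  by apply: mulr_ge0 => //; apply: mulr_ge0 => //; exact: mulr_ge0.
pose tau := ell / (2 * (X + 1)).
have tau0 : 0 < tau by rewrite divr_gt0// mulr_gt0// ltr_wpDl.
have [Ct Ct1 hY] := young_tau p1 tau0.
have : ell <= 2 * (Zc c * (tau * (20 * C1))).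
  apply: (@energy_limit_tau phi K c tau Ct) => //.
  - by move=> z; apply: le_c (hcp z) _; rewrite /c; lra.
  - by move=> z; apply: le_c (hct z) _; rewrite /c; lra.
  - move=> i z; apply: le_c ((hci i).2 z) _; apply: (le_trans (cis i)); rewrite /c; lra.
  - by move=> z; apply: le_c (hc3 z) _; rewrite /c; lra.
  - by move=> z; apply: le_c (hc4 z) _; rewrite /c; lra.
  - by move=> z; apply: le_c (hc5 z) _; rewrite /c; lra.
have -> : 2 * (Zc c * (tau * (20 * C1))) = X * tau by rewrite /X /Z; ring.
rewrite leNgt => /negP; apply.
rewrite /tau mulrA ltr_pdivrMr ?mulr_gt0 ?ltr_wpDl// mulrC ltr_pM2l//.
by move: X0; lra.
Qed.

End core.

(** * Inequalities for the energy density *)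

Section pointwise_bounds.
Context {R : realType}.
Implicit Types x y r : R.

Lemma powRD_le r x y : 0 < r -> 0 <= x -> 0 <= y -> (x + y) `^ r <= 2 `^ r * (x `^ r + y `^ r).
Proof.
move=> r0 x0 y0; wlog xy : x y x0 y0 / x <= y.
  move=> h; have [/h|/ltW/h] := leP x y; first by apply.
  by rewrite [x + y]addrC [x `^ r + _]addrC; apply.
apply: (@le_trans _ _ ((2 * y) `^ r)).
  by apply: ge0_ler_powR; [exact: ltW|rewrite nnegrE addr_ge0|rewrite nnegrE mulr_ge0|lra].
by rewrite powRM// ler_wpM2l ?powR_ge0// lerDr powR_ge0.
Qed.

Lemma powR_sum_le n r (x : 'I_n -> R) : 0 < r -> (forall i, 0 <= x i) ->
  (\sum_i x i) `^ r <= n%:R `^ r * \sum_i (x i) `^ r.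
Proof.
move=> r0 x0; case: n x x0 => [|n] x x0.
  by rewrite !big_ord0 mulr0 powR0// gt_eqF.
case: (@Order.TotalTheory.arg_maxP _ _ _ (ord0 : 'I_n.+1) xpredT x isT) => i _ hi.
apply: (@le_trans _ _ ((n.+1%:R * x i) `^ r)).
  apply: ge0_ler_powR; [exact: ltW|by rewrite nnegrE sumr_ge0|by rewrite nnegrE mulr_ge0|].
  apply: (@le_trans _ _ (\sum_(j < n.+1) x i)); first by apply: ler_sum => j _; exact: hi.
  by rewrite sumr_const card_ord [leRHS]mulr_natl.
rewrite powRM// ler_wpM2l ?powR_ge0// (bigD1 i)//= lerDl sumr_ge0// => j _; exact: powR_ge0.
Qed.

Lemma enorm_le_sum n (x : 'rV[R]_n) : enorm x <= \sum_i `|x ord0 i|.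
Proof.
have s0 : 0 <= \sum_i `|x ord0 i| by apply: sumr_ge0.
rewrite -[leRHS]ger0_norm// -sqrtr_sqr /enorm ler_wsqrtr// /dotp expr2 mulr_suml.
apply: ler_sum => i _; rewrite -[leLHS]ger0_norm -?expr2 ?sqr_ge0// expr2 normrM ler_wpM2l//.
by rewrite (bigD1 i)//= lerDl sumr_ge0.
Qed.

Lemma enorm_ge0 n (x : 'rV[R]_n) : 0 <= enorm x. Proof. exact: sqrtr_ge0. Qed.

Lemma tent_lipschitz x y : `|tent x - tent y| <= 4 * `|x - y|.
Proof.
have lp (a b : R) : `|posp a - posp b| <= `|a - b|.
  by have [[? ->]|[? ->]] := pospE a; have [[? ->]|[? ->]] := pospE b; rewrite !ler_norml;
    have := ler_norm (a - b); have := ler_norm (b - a); rewrite (distrC b a); lra.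
have h1 := lp (x - 2^-1) (y - 2^-1); have h2 := lp (x - 3 / 2) (y - 3 / 2); have h3 := lp (x - 5 / 2) (y - 5 / 2).
have e (c : R) : x - c - (y - c) = x - y by ring.
rewrite !e in h1 h2 h3; rewrite /tent; move: h1 h2 h3; rewrite !ler_norml.
by move=> /andP[? ?] /andP[? ?] /andP[? ?]; lra.
Qed.

Lemma ren2_lipschitz (m L : R) : 0 < m -> 0 < L -> exists2 c, 0 <= c &
  forall x y, `|ren2 m L x - ren2 m L y| <= c * `|x - y|.
Proof.
move=> m0 L0; exists (4 / m ^+ 2 + 4 / L ^+ 2); first by rewrite addr_ge0// divr_ge0// sqr_ge0.
move=> x y; rewrite /ren2.
have h (a : R) : 0 < a -> `|tent (- x / a) / a - tent (- y / a) / a| <= 4 / a ^+ 2 * `|x - y|.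
  move=> a0; rewrite -mulrBl normrM [`|a^-1|]ger0_norm ?invr_ge0 ?(ltW a0)//.
  have := tent_lipschitz (- x / a) (- y / a).
  have -> : - x / a - - y / a = (y - x) / a by ring.
  rewrite normrM [`|a^-1|]ger0_norm ?invr_ge0 ?(ltW a0)// [`|y - x|]distrC => h.
  have ai : 0 <= a^-1 by rewrite invr_ge0 ltW.
  apply: (le_trans (ler_wpM2r ai h)); rewrite le_eqVlt; apply/orP; left; apply/eqP.
  by field; rewrite gt_eqF.
have -> : tent (- x / m) / m - tent (- x / L) / L - (tent (- y / m) / m - tent (- y / L) / L) =
  (tent (- x / m) / m - tent (- y / m) / m) - (tent (- x / L) / L - tent (- y / L) / L) by ring.
by rewrite (le_trans (ler_normB _ _))// [leRHS]mulrDl; apply: lerD; exact: h.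
Qed.

End pointwise_bounds.

Section almost_everywhere.
Context d (X : measurableType d) (R : realType) (mu : {measure set X -> \bar R}).

Lemma ae_null_set (P : X -> Prop) : {ae mu, forall z, P z} ->
  exists N, [/\ measurable N, mu N = 0%E & forall z, ~ N z -> P z].
Proof.
move=> [N [mN N0 PN]]; exists N; split => // z Nz; apply: contrapT => Pz; exact/Nz/PN.
Qed.

Lemma Lqoo_ae_bounded (D : set X) (f : X -> R) : Lq mu D +oo%E f ->
  exists2 C, 0 <= C & {ae mu, forall z, D z -> `|f z| <= C}.
Proof.
move=> [_]; rewrite /Lq_norm unlock; case: ifPn => [_ h|m0 _]; last first.
  exists 0 => //; exists setT; split => //.
  by apply/eqP; rewrite eq_le measure_ge0 andbT leNgt.
have := ess_sup_inf.ess_sup_ge mu (abse \o (EFin \o f) \_ D).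
case: (ess_sup_inf.ess_sup _ _) h => [r| |] // _ hM; [exists `|r| => //|exists 0 => //]; apply: filterS hM => z /= h Dz.
  by move: h; rewrite patchE mem_set//= lee_fin => /le_trans; apply; exact: ler_norm.
by have := le_trans (abse_ge0 _) h; rewrite leNgt ltNy0.
Qed.

End almost_everywhere.

(** * Composition with a Caratheodory function *)

Section caratheodory.
Context {R : realType} (n : nat).
Local Notation E := (R * 'rV[R]_n)%type.
Variables (D : set E) (a : E -> 'rV[R]_n -> 'rV[R]_n) (U : E -> 'rV[R]_n).
Hypotheses (mD : measurable D) (ma : forall xi, measurable_fun D (a ^~ xi))
  (mU : forall i, measurable_fun D (fun z => U z ord0 i))
  (ca : forall z, D z -> continuous (a z)).

Let grid (j : nat) (c : 'rV[int]_n) : 'rV[R]_n := \row_i ((c ord0 i)%:~R / 2 ^+ j).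
Let cell (j : nat) z : 'rV[int]_n := \row_i Num.floor (2 ^+ j * U z ord0 i).

Let measurable_cell j c : measurable (D `&` [set z | cell j z = c]).
Proof.
have -> : D `&` [set z | cell j z = c] = D `&` \bigcap_(i in [set: 'I_n])
    (D `&` (fun z => ((c ord0 i)%:~R <= 2 ^+ j * U z ord0 i) && (2 ^+ j * U z ord0 i < (c ord0 i + 1)%:~R)) @^-1` [set true]).
  apply/seteqP; split => z [Dz hz]; split => //.
    by move=> i _; split => //=; have := floor_eq (2 ^+ j * U z ord0 i) (c ord0 i); move: hz => /= <-; rewrite mxE eqxx => <-.
  by apply/rowP => i; rewrite mxE; apply/eqP; have [_ /=] := hz i I; rewrite floor_eq.
apply: measurableI => //; apply: fin_bigcap_measurable => [|i _]; first exact: finite_finset.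
have mu2 : measurable_fun D (fun z => 2 ^+ j * U z ord0 i) by exact: measurable_funM.
by apply: (measurable_and (measurable_fun_ler (measurable_cst _) mu2) (measurable_fun_ltr mu2 (measurable_cst _))) => //.
Qed.

(** U is the limit of the functions U_j that round its coordinates to multiples
    of 2 ^ -j. They take countably many values, so that a(z, U_j(z)) is
    measurable. *)
Lemma caratheodory_measurable i : measurable_fun D (fun z => a z (U z) ord0 i).
Proof.
have cU j z : a z (grid j (cell j z)) ord0 i = (fun z => a z (grid j (cell j z)) ord0 i) z by [].
apply: (measurable_fun_cvg (h := fun j z => a z (grid j (cell j z)) ord0 i)).
  move=> j _ B mB.
  have -> : D `&` (fun z => a z (grid j (cell j z)) ord0 i) @^-1` B =
    \bigcup_c ((D `&` [set z | cell j z = c]) `&` (D `&` (fun z => a z (grid j c) ord0 i) @^-1` B)).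
    apply/seteqP; split => z.
      by move=> [Dz Bz]; exists (cell j z).
    by move=> [c _ [[Dz hc] [_ Bz]]]; split => //; rewrite /= hc.
  apply: countable_bigcupT_measurable => // c; apply: measurableI; first exact: measurable_cell.
  by apply: (measurableT_comp (measurable_coord i) (ma (grid j c))).
move=> z Dz; apply: (cvg_comp (fun j => a z (grid j (cell j z))) (fun x : 'rV[R]_n => x ord0 i)); last exact: coord_continuous_rV.
apply: (cvg_comp (fun j => grid j (cell j z)) (a z)); last exact: ca.
apply/cvg_ballP => eps eps0; near=> j; split => // i0 k; rewrite ord1 /ball /= /grid mxE /cell mxE.
have pj : 0 < 2 ^+ j :> R by rewrite exprn_gt0.
have /andP[h1 h2] := floor_itv (2 ^+ j * U z ord0 k).
set fl := (Num.floor _)%:~R in h1 h2 *.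
have hj : eps^-1 < 2 ^+ j.
  apply: (@lt_le_trans _ _ j%:R); first by near: j; exact: nbhs_infty_gtr.
  by rewrite -natrX ler_nat ltnW// ltn_expl.
rewrite ger0_norm; last by rewrite subr_ge0 ler_pdivrMr// mulrC.
rewrite ltrBlDr -(ltr_pM2l pj) mulrDr mulrCA mulfV ?gt_eqF// mulr1.
apply: (lt_trans h2); rewrite intrD addrC ltrD2r.
by rewrite -ltr_pdivrMr// div1r.
Unshelve. all: by end_near. Qed.

End caratheodory.

Section composed_gradient.
Context {R : realType} (n : nat).
Local Notation dx := (@lebesgue_rV R n).
Local Notation dtx := (@lebesgue_prod R n dx).
Local Notation E := (R * 'rV[R]_n)%type.
Variables (Om : set 'rV[R]_n) (T : R).
Hypotheses (oOm : open Om) (bOm : bounded_set Om).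
Local Notation Q := (cylinder Om T).
Local Notation px i := (0 : R, delta_mx ord0 i : 'rV[R]_n).
Local Notation LQ f := (dtx.-integrable Q (EFin \o f)).
Let oQ : open Q := open_cylinder oOm.
Let bQ : bounded_set Q := bounded_cylinder T bOm.
Let mQ : measurable Q := open_measurable_E oQ.

(** The chain rule for the first derivative of the renormalizing function, and
    the product rule with chi. *)
Lemma xgrad_ren (m L : R) v (V : 'I_n -> E -> R) chi : 0 < m -> 5 * m <= L ->
  LQ v -> (forall i, LQ (V i)) ->
  (forall i Psi, test_function Q Psi ->
    \int[dtx]_(z in Q) (v z * 'D_(px i) Psi z) = - \int[dtx]_(z in Q) (V i z * Psi z)) ->
  test_function Q chi ->
  is_xgrad Om T (fun z => ren1 m L (v z) * chi z)
    (fun z => \row_i (ren2 m L (v z) * V i z * chi z + ren1 m L (v z) * 'D_(px i) chi z)).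
Proof.
move=> m0 mL Iv IV hV tchi.
have L0 : 0 < L by apply: lt_le_trans mL; rewrite mulr_gt0.
have [K [sc cK cKs KQ]] := test_elim tchi.
have [c c0 hc] := supp_in_bounded (smooth_continuous sc) cK cKs.
have mcts (h : R -> R) : continuous h -> measurable_fun Q (fun z => h (v z)).
  by move=> ch; apply: (@measurableT_comp _ _ _ _ _ _ h); [exact: continuous_measurable_fun|exact: L1_measurable Iv].
have c1 : continuous (ren1 m L).
  by move=> x; apply/differentiable_continuous/derivable1_diffP; have [] := is_derive_ren1 (m := m) (L := L) m0 mL x.
have mr1 := mcts _ c1; have mr2 := mcts _ (@continuous_ren2 R m L).
have IT Psi : test_function Q Psi -> LQ Psi.
  by move=> /test_csmooth/csmooth_integrable; exact: integrableS.
have I1 Psi : test_function Q Psi -> LQ (fun z => ren1 m L (v z) * Psi z).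
  by move=> tP; apply: (L1M_bounded mQ (c := 1)) => //; [move=> z _; exact: ren1_bound|exact: IT].
have Ic i : LQ (fun z => chi z * V i z).
  by apply: (L1M_bounded mQ (c := c)) => //; exact: smooth_measurable.
have I2 i : LQ (fun z => ren2 m L (v z) * V i z * chi z).
  apply: (L1_eq (f := fun z => ren2 m L (v z) * (chi z * V i z)) mQ) => [z _|]; first by ring.
  by apply: (L1M_bounded mQ (c := m^-1 + L^-1)) => // z _; exact: ren2_bound.
split.
- exact/(L1_loc oOm)/I1.
- move=> i; apply/(L1_loc oOm); apply: (L1_eq (f := fun z => ren2 m L (v z) * V i z * chi z + ren1 m L (v z) * 'D_(px i) chi z) mQ).
    by move=> z _; rewrite mxE.
  by apply: (L1D mQ) => //; apply: I1; exact: test_derive.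
- move=> Psi tP i; have [K' [sP cK' cKs' KQ']] := test_elim tP.
have [lc lc0 hlc] := ren2_lipschitz m0 L0.
pose cc := 1 + (m^-1 + L^-1) + lc.
have ml0 : 0 <= m^-1 + L^-1 by rewrite addr_ge0// invr_ge0 ltW.
have tcP : test_function Q (fun z => chi z * Psi z).
  by apply: (test_intro _ cK' _ KQ'); [exact: smoothM|move=> z zK; rewrite cKs' ?mulr0].
have := chain_rule oQ bQ (B := ren1 m L) (b := ren2 m L) (c := cc) (e := px i) (is_derive_ren1 m0 mL) _ _ _ Iv (IV i) (hV i) tcP.
have -> : \int[dtx]_(z in Q) (ren1 m L (v z) * 'D_(px i) (fun z => chi z * Psi z) z) =
   \int[dtx]_(z in Q) (ren1 m L (v z) * chi z * 'D_(px i) Psi z) + \int[dtx]_(z in Q) (ren1 m L (v z) * 'D_(px i) chi z * Psi z).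
  have t1 : test_function Q (fun z => chi z * 'D_(px i) Psi z).
    by apply: (test_intro _ cK _ KQ); [apply: smoothM => //; exact: smooth_derive|move=> z zK; rewrite cKs ?mul0r].
  have t2 : test_function Q (fun z => 'D_(px i) chi z * Psi z).
    by apply: (test_intro _ cK' _ KQ'); [apply: smoothM => //; exact: smooth_derive|move=> z zK; rewrite cKs' ?mulr0].
  rewrite -RintegralD//; last 2 first.
  - by apply: (L1_eq mQ) (I1 _ t1) => z _; rewrite mulrA.
  - by apply: (L1_eq mQ) (I1 _ t2) => z _; rewrite mulrA.
  by apply: Rintegral_eq => // z _; rewrite derive_smoothM//; ring.
move=> h.
have h' : \int[dtx]_(z in Q) (ren1 m L (v z) * chi z * 'D_(px i) Psi z) + \int[dtx]_(z in Q) (ren1 m L (v z) * 'D_(px i) chi z * Psi z)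
   = - \int[dtx]_(z in Q) (ren2 m L (v z) * V i z * (chi z * Psi z)).
  apply: h.
  - by move=> x; apply: le_trans (ren1_bound m L x) _; rewrite /cc -addrA lerDl addr_ge0.
  - by move=> x; apply: le_trans (ren2_bound m0 mL x) _; rewrite /cc addrAC lerDr addr_ge0.
  - by move=> x y; apply: le_trans (hlc x y) _; rewrite ler_wpM2r// /cc lerDr addr_ge0.
have t2 : test_function Q (fun z => 'D_(px i) chi z * Psi z).
  by apply: (test_intro _ cK' _ KQ'); [apply: smoothM => //; exact: smooth_derive|move=> z zK; rewrite cKs' ?mulr0].
have [b b0 hb] := supp_in_bounded (smooth_continuous sP) cK' cKs'.
have mP : measurable_fun Q Psi by exact: smooth_measurable.
have -> : \int[dtx]_(z in Q) ((\row_i (ren2 m L (v z) * V i z * chi z + ren1 m L (v z) * 'D_(px i) chi z)) ord0 i * Psi z) =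
   \int[dtx]_(z in Q) (ren2 m L (v z) * V i z * (chi z * Psi z)) + \int[dtx]_(z in Q) (ren1 m L (v z) * 'D_(px i) chi z * Psi z).
  rewrite -RintegralD//; last 2 first.
  - apply: (L1_eq (f := fun z => Psi z * (ren2 m L (v z) * V i z * chi z)) mQ) => [z _|]; first by ring.
    exact: (L1M_bounded mQ (c := b)).
  - by apply: (L1_eq mQ) (I1 _ t2) => z _; rewrite mulrA.
  by apply: Rintegral_eq => // z _; rewrite mxE; ring.
by rewrite opprD -h' addrK.
Qed.

End composed_gradient.

(** Here x = |U| is the length of the gradient of u and U - P is the gradient of
    v. In A.(U - P) the term A.U is coercive, and A.P is absorbed: by the growth
    condition the conjugate power of A is at most a multiple of b ^ p' + x ^ p,
    and Young's inequality puts a small factor in front of it. *)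
Lemma energy_pointwise (R : realType) n (p alpha beta : R) : 1 < p -> 0 < alpha -> 0 < beta ->
  exists Ct Ce, [/\ 0 <= Ct, 0 < Ce & forall (A U P : 'I_n -> R) (x b : R), 0 <= b ->
    0 <= x -> (forall i, `|U i| <= x) ->
    alpha * x `^ p <= \sum_i A i * U i ->
    (forall i, `|A i| <= beta * (b + x `^ (p - 1))) ->
    let k := alpha / 2 * b `^ (p / (p - 1)) + Ct * \sum_i `|P i| `^ p in
    [/\ 0 <= k, forall i, `|A i| `^ (p / (p - 1)) <= Ce * (x `^ p + k),
        forall i, `|U i - P i| `^ p <= Ce * (x `^ p + k)
      & x `^ p + k <= Ce * (\sum_i A i * (U i - P i) + (1 + alpha / 2) * k)]].
Proof.
move=> p1 al0 be0; set q := p / (p - 1).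
have p0 : 0 < p by lra.
have pm : 0 < p - 1 by lra.
have q0 : 0 < q by rewrite divr_gt0.
pose B := beta `^ q * 2 `^ q; have B0 : 0 <= B by rewrite mulr_ge0// powR_ge0.
pose tau := alpha / (2 * (n%:R * B + 1)).
have nB0 : 0 <= n%:R * B by rewrite mulr_ge0.
have tau0 : 0 < tau by rewrite divr_gt0// mulr_gt0// ltr_wpDl.
have tauB : n%:R * (tau * B) <= alpha / 2.
  have -> : n%:R * (tau * B) = (alpha / 2) * ((n%:R * B) / (n%:R * B + 1)).
    by rewrite /tau; field; rewrite gt_eqF// ltr_wpDl.
  have a2 : 0 <= alpha / 2 by rewrite divr_ge0// ltW.
  by rewrite ler_piMr// ler_pdivrMr ?ltr_wpDl// mul1r lerDl.
have [Ct Ct1 hY] := young_tau p1 tau0.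
have Ct0 : 0 <= Ct by exact: le_trans Ct1.
pose Ce := 2 `^ p + B * (1 + 2 / alpha) + 2 / alpha.
have c1 : 0 <= 2 `^ p :> R by exact: powR_ge0.
have c2 : 0 <= B * (1 + 2 / alpha) by rewrite mulr_ge0// addr_ge0// divr_ge0// ltW.
have c3 : 0 < 2 / alpha by rewrite divr_gt0.
exists Ct, Ce; split => //; first by rewrite /Ce; lra.
move=> A U P x b b0 x0 hx hAU hA k.
set Sp := \sum_i `|P i| `^ p in k *.
have Sp0 : 0 <= Sp by apply: sumr_ge0 => i _; exact: powR_ge0.
have bq0 : 0 <= b `^ q by exact: powR_ge0.
have xp0 : 0 <= x `^ p by exact: powR_ge0.
have CS0 : 0 <= Ct * Sp by rewrite mulr_ge0.
have kE : k = alpha / 2 * b `^ q + Ct * Sp by [].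
clearbody k.
have ab0 : 0 <= alpha / 2 * b `^ q by rewrite mulr_ge0// divr_ge0// ltW.
have k0 : 0 <= k by rewrite kE addr_ge0.
have hAq i : `|A i| `^ q <= B * (b `^ q + x `^ p).
  apply: (@le_trans _ _ ((beta * (b + x `^ (p - 1))) `^ q)).
    apply: ge0_ler_powR; [exact: ltW|by rewrite nnegrE| |exact: hA].
    by rewrite nnegrE mulr_ge0 ?(ltW be0)// addr_ge0// powR_ge0.
  rewrite powRM ?(ltW be0)//; last by rewrite addr_ge0// powR_ge0.
  rewrite /B -[leRHS]mulrA ler_wpM2l ?powR_ge0//.
  have := powRD_le q0 b0 (powR_ge0 x (p - 1)).
  by rewrite -powRrM (_ : (p - 1) * q = p)//; rewrite /q; field; rewrite gt_eqF.
have bk : b `^ q <= 2 / alpha * k.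
  have -> : 2 / alpha * k = b `^ q + 2 / alpha * (Ct * Sp) by rewrite kE; field; rewrite gt_eqF.
  by rewrite lerDl mulr_ge0// ltW.
have e0 : 0 <= x `^ p + k by rewrite addr_ge0.
split => //.
- move=> i; apply: (le_trans (hAq i)).
  apply: (@le_trans _ _ (B * ((1 + 2 / alpha) * (x `^ p + k)))).
    rewrite ler_wpM2l//; have : 0 <= 2 / alpha * x `^ p by rewrite mulr_ge0// ltW.
    have -> : (1 + 2 / alpha) * (x `^ p + k) = x `^ p + k + (2 / alpha * x `^ p + 2 / alpha * k) by ring.
    by move: bk k0; lra.
  rewrite mulrA ler_wpM2r// /Ce; lra.
- move=> i; apply: (@le_trans _ _ (2 `^ p * (x `^ p + k))); last by rewrite ler_wpM2r// /Ce; lra.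
  apply: (@le_trans _ _ ((`|U i| + `|P i|) `^ p)).
    apply: ge0_ler_powR; [exact: ltW|by rewrite nnegrE|by rewrite nnegrE addr_ge0|exact: ler_normB].
  apply: (le_trans (powRD_le p0 (normr_ge0 _) (normr_ge0 _))).
  rewrite ler_wpM2l//; apply: lerD.
    by apply: ge0_ler_powR; [exact: ltW|by rewrite nnegrE|by rewrite nnegrE|exact: hx].
  have h1 : `|P i| `^ p <= Sp.
    by rewrite /Sp (bigD1 i)//= lerDl sumr_ge0// => j _; exact: powR_ge0.
  have h2 : Sp <= Ct * Sp by rewrite ler_peMl.
  rewrite kE; lra.
- have hS : \sum_i A i * P i <= alpha / 2 * x `^ p + k.
    apply: (@le_trans _ _ (\sum_i (tau * (B * (b `^ q + x `^ p)) + Ct * `|P i| `^ p))).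
      apply: ler_sum => i _; apply: (le_trans (ler_norm _)); rewrite normrM.
      have [_ h] := hY _ _ (normr_ge0 (A i)) (normr_ge0 (P i)); apply: (le_trans h).
      by rewrite lerD2r ler_wpM2l ?(ltW tau0)// hAq.
    rewrite big_split/=.
    have -> : \sum_(i < n) Ct * `|P i| `^ p = Ct * Sp by rewrite -mulr_sumr.
    have -> : \sum_(i < n) tau * (B * (b `^ q + x `^ p)) = n%:R * (tau * B) * (b `^ q + x `^ p).
      by rewrite sumr_const card_ord -[LHS]mulr_natl; ring.
    have := ler_wpM2r (addr_ge0 bq0 xp0) tauB; rewrite kE [alpha / 2 * (_ + _)]mulrDr; lra.
  have -> : \sum_i A i * (U i - P i) = \sum_i A i * U i - \sum_i A i * P i.
    by rewrite -sumrB; apply: eq_bigr => i _; rewrite mulrBr.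
  set S1 := \sum_i A i * U i in hAU *; set S2 := \sum_i A i * P i in hS *.
  have h : alpha / 2 * (x `^ p + k) <= S1 - S2 + (1 + alpha / 2) * k.
    by rewrite mulrDr mulrDl mul1r; lra.
  have h2 := ler_wpM2l (ltW c3) h.
  have e1 : 2 / alpha * (alpha / 2 * (x `^ p + k)) = x `^ p + k by field; rewrite gt_eqF.
  rewrite e1 in h2; apply: (le_trans h2).
  rewrite ler_wpM2r//; last by rewrite /Ce; lra.
  by apply: le_trans h; rewrite mulr_ge0// divr_ge0// ltW.
Qed.

Section power_integrability.
Context d (X : measurableType d) (R : realType) (mu : {measure set X -> \bar R}) (D : set X).
Hypotheses (mD : measurable D) (fD : (mu D < +oo)%E).
Local Notation LD f := (mu.-integrable D (EFin \o f)).

Lemma Lq_power_L1 (f : X -> R) r : 0 < r -> Lq mu D r%:E f -> LD (fun z => `|f z| `^ r).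
Proof.
move=> r0 [mf hf]; apply/integrableP; split.
  apply/measurable_EFinP; apply: measurable_powR_comp.
  exact: measurableT_comp.
have : (Lq_norm mu D r%:E f `^ r < +oo)%E by apply: poweR_lty.
rewrite /Lq_norm powR_Lnorm ?gt_eqF//; apply: le_lt_trans.
rewrite integral_mkcond; apply: le_lower_integral0 => x; first by rewrite patchE; case: ifP.
by rewrite !patchE; case: ifP => _ /=; [rewrite ger0_norm ?powR_ge0|rewrite lee_fin powR_ge0].
Qed.

Lemma power_L1_mono (f : X -> R) r s : measurable_fun D f -> 0 <= s -> s <= r ->
  LD (fun z => `|f z| `^ r) -> LD (fun z => `|f z| `^ s).
Proof.
move=> mf s0 sr I; apply: (L1_dom (g := fun z => \1_D z + `|f z| `^ r) mD).
- apply: measurable_powR_comp.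
  exact: measurableT_comp.
- by apply: (L1D mD) => //; exact: (L1_indic mD).
move=> z Dz; rewrite ger0_norm ?powR_ge0// indicE mem_set//.
have [h|h] := leP `|f z| 1.
  apply: (@le_trans _ _ 1); last by rewrite lerDl powR_ge0.
  by apply: (@le_trans _ _ (1 `^ s)); [apply: ge0_ler_powR; rewrite ?nnegrE|rewrite powR1].
by apply: (@le_trans _ _ (`|f z| `^ r)); [rewrite ler_powR// ltW|rewrite lerDr].
Qed.

Lemma power_L1_L1 (f : X -> R) r : measurable_fun D f -> 1 <= r ->
  LD (fun z => `|f z| `^ r) -> LD f.
Proof.
move=> mf r1 I; have := power_L1_mono mf ler01 r1 I.
move=> I1; apply: (L1_dom mD mf I1) => z Dz; by rewrite powRr1.
Qed.

Lemma power_L1_D (f g : X -> R) r : 0 < r -> measurable_fun D f -> measurable_fun D g ->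
  LD (fun z => `|f z| `^ r) -> LD (fun z => `|g z| `^ r) -> LD (fun z => `|f z + g z| `^ r).
Proof.
move=> r0 mf mg If Ig; apply: (L1_dom (g := fun z => 2 `^ r * (`|f z| `^ r + `|g z| `^ r)) mD).
- apply: measurable_powR_comp.
  by apply: measurableT_comp => //; exact: measurable_funD.
- by apply: L1Zl => //; exact: L1D.
move=> z Dz; rewrite ger0_norm ?powR_ge0//; apply: le_trans (powRD_le r0 (normr_ge0 _) (normr_ge0 _)).
by apply: ge0_ler_powR; rewrite ?nnegrE ?addr_ge0 ?ler_normD// ltW.
Qed.

(** The integral of a function that is not integrable is 0 if its negative part
    is integrable: it is infinite, and the real value of an infinite integral is
    0. *)
Lemma L1_of_nonzero (h k : X -> R) : measurable_fun D h -> LD k ->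
  (forall z, D z -> - k z <= h z) -> \int[mu]_(z in D) h z != 0 -> LD h.
Proof.
move=> mh Ik hk; have mE : measurable_fun D (EFin \o h) by exact/measurable_EFinP.
have I2 : (\int[mu]_(x in D) ((EFin \o h)^\- x) < +oo)%E.
  have /integrableP[_] := Ik; apply: le_lt_trans; apply: le_lower_integral => // x Dx.
  rewrite funenegE /= -EFin_max lee_fin ge_max normr_ge0 andbT.
  by apply: le_trans (ler_norm _); rewrite lerNl; exact: hk.
rewrite /Rintegral integralE.
have [I1|] := ltP (\int[mu]_(x in D) ((EFin \o h)^\+ x))%E +oo%E.
  move=> _; apply/integrableP; split => //.
  rewrite (_ : (fun x => `|(EFin \o h) x|)%E = (fun x => (EFin \o h)^\+ x + (EFin \o h)^\- x)%E); last first.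
    by have := fune_abse (EFin \o h).
  rewrite ge0_integralD//; [exact: lte_add_pinfty|exact: measurable_funepos|exact: measurable_funeneg].
rewrite leye_eq => /eqP ->.
have : (\int[mu]_(x in D) ((EFin \o h)^\- x) \is a fin_num)%E.
  by rewrite ge0_fin_numE//; apply: integral_ge0 => x _; exact: funeneg_ge0.
by case: (\int[mu]_(x in D) _)%E => //= r _; rewrite eqxx.
Qed.

End power_integrability.

(** * The energy of a renormalized solution *)

Section application.
Context {R : realType} (n : nat).
Local Notation dx := (@lebesgue_rV R n).
Local Notation dt := (@lebesgueR R).
Local Notation dtx := (@lebesgue_prod R n dx).
Local Notation E := (R * 'rV[R]_n)%type.
Variables (Om : set 'rV[R]_n) (T p : R).
Hypotheses (oOm : open Om) (bOm : bounded_set Om) (T0 : 0 < T).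
Local Notation Q := (cylinder Om T).
Local Notation px i := ((0 : R, delta_mx ord0 i : 'rV[R]_n) : E).
Local Notation pt := ((1 : R, 0 : 'rV[R]_n) : E).
Local Notation LQ f := (dtx.-integrable Q (EFin \o f)).
Local Notation p' := (conjugate p).
Let oQ : open Q := open_cylinder oOm.
Let bQ : bounded_set Q := bounded_cylinder T bOm.
Let mQ : measurable Q := open_measurable_E oQ.
Let fQ : (dtx Q < +oo)%E := bounded_finite mQ bQ.

Variables (a : E -> 'rV[R]_n -> 'rV[R]_n) (alpha beta : R) (b : E -> R) (u0 : 'rV[R]_n -> R)
  (mu0 : {charge set E -> \bar R}) (f : E -> R) (G : E -> 'rV[R]_n) (g : E -> R)
  (f' : E -> R) (G' : E -> 'rV[R]_n) (g' : E -> R) (u : E -> R).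
Hypotheses (p_large : (2 * n%:R + 1) / (n%:R + 1) < p) (alpha0 : 0 < alpha) (beta0 : 0 < beta)
  (bLq : Lq dtx Q p'%:E b)
  (hf : Lq dtx Q 1%:E f) (hG : in_Lq_vec Om T p'%:E G) (hg : in_LpX Om T (W10 Om p) p%:E g)
  (hfGg : represents Om T mu0 f G g)
  (mu : measurable_fun Q u) (dec : decomposition Om T p mu0 f' G' g').
Local Notation v := (u - g').
Local Notation U := (xgrad Om T u).
Local Notation V := (xgrad Om T v).
Hypotheses (vLpX : forall r : R, 1 <= r -> r < p - n%:R / (n%:R + 1) -> in_LpX Om T (W10 Om r) r%:E v)
  (hU : is_xgrad Om T u U) (hV : is_xgrad Om T v V).

Let vE z : v z = u z - g' z. Proof. by []. Qed.

Let s1 : n%:R / (n%:R + 1) < 1 :> R.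
Proof. by rewrite ltr_pdivrMr ?ltr_wpDl// mul1r ltrDl. Qed.

Let p_gt : 1 + n%:R / (n%:R + 1) < p.
Proof.
move: p_large; have -> : (2 * n%:R + 1) / (n%:R + 1) = 1 + n%:R / (n%:R + 1) :> R => //.
by field; rewrite gt_eqF// ltr_wpDl.
Qed.

Let p1 : 1 < p.
Proof. by apply: le_lt_trans p_gt; rewrite lerDl divr_ge0// addr_ge0. Qed.
Let p0 : 0 < p. Proof. exact: lt_trans p1. Qed.
Let pm : 0 < p - 1. Proof. by rewrite subr_gt0. Qed.
Let q0 : 0 < p'. Proof. by rewrite divr_gt0. Qed.
Let q1 : 1 < p'. Proof. by rewrite /conjugate ltr_pdivlMr// mul1r ltrBlDr ltrDl. Qed.
Let qq : p' / (p' - 1) = p.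
Proof. by have h := pm; rewrite /conjugate; field; rewrite gt_eqF//; lra. Qed.

(** The range of exponents for the gradient of v reaches above p - 1 because N /
    (N + 1) < 1, which makes a(t,x,grad u) integrable, and above 1 because p >
    (2N + 1) / (N + 1). *)
Lemma admissible_exponent : exists r : R, [/\ 1 < r, p - 1 <= r, r <= p & r < p - n%:R / (n%:R + 1)].
Proof.
have h1 := s1; have h2 := p_gt; have h0 : 0 <= n%:R / (n%:R + 1) :> R by rewrite divr_ge0// addr_ge0.
move: h0 h1 h2; set s := n%:R / _ => h0 h1 h2; have [h|h] := leP 1 (p - 1).
  by exists ((p - 1 + (p - s)) / 2); split; lra.
by exists ((1 + (p - s)) / 2); split; lra.
Qed.

(** The norm of V dominates the one of W^{1,p}_0. *)
Lemma LpX_V_bound w : in_LpX Om T (Vspace Om p) p%:E w ->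
  [/\ measurable_fun Q w, LQ w, LQ (fun z => `|w z| `^ p) &
    exists C, forall Psi i, test_function Q Psi ->
    `|\int[dtx]_(z in Q) (w z * 'D_(px i) Psi z)| <= C + \int[dtx]_z (`|Psi z| `^ p')].
Proof.
apply: LpX_bound => //; first by move=> ? [].
by move=> w'; rewrite /= leeDl// /Lq_norm Lnorm_ge0.
Qed.

Lemma LpX_W_bound r w : 1 < r -> in_LpX Om T (W10 Om r) r%:E w ->
  [/\ measurable_fun Q w, LQ w, LQ (fun z => `|w z| `^ r) &
    exists C, forall Psi i, test_function Q Psi ->
    `|\int[dtx]_(z in Q) (w z * 'D_(px i) Psi z)| <= C + \int[dtx]_z (`|Psi z| `^ (r / (r - 1)))].
Proof. by move=> r1; apply: LpX_bound. Qed.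

Let g'X : in_LpX Om T (Vspace Om p) p%:E g'. Proof. by have [] := dec. Qed.

Let dual_L1 F (r C : R) : 1 < r -> loc_integrableQ Om T F ->
  (forall Psi, test_function Q Psi ->
    `|\int[dtx]_(z in Q) (F z * Psi z)| <= C + \int[dtx]_z (`|Psi z| `^ (r / (r - 1)))) ->
  LQ (fun z => `|F z| `^ r).
Proof.
move=> r1 [mF lF] hF; have rm : 0 < r - 1 by rewrite subr_gt0.
have r'1 : 1 < r / (r - 1) by rewrite ltr_pdivlMr// mul1r ltrBlDr ltrDl.
have := dual_Lq oQ bQ r'1 mF lF hF.
have -> : r / (r - 1) / (r / (r - 1) - 1) = r.
  by move: r1 rm => *; field; rewrite gt_eqF//; lra.
move=> h; apply/integrableP; split.
  apply/measurable_EFinP; apply: measurable_powR_comp.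
  exact: measurableT_comp.
by under eq_integral do rewrite /= ger0_norm ?powR_ge0//; apply: le_lt_trans h (ltry _).
Qed.

(** By [dual_Lq], from the bound of [LpX_bound]. *)
Lemma V_power r i : 1 < r -> r < p - n%:R / (n%:R + 1) -> LQ (fun z => `|V z ord0 i| `^ r).
Proof.
move=> r1 rp; have [_ _ _ [C hC]] := LpX_W_bound r1 (vLpX (ltW r1) rp).
have [lv lV hd] := hV; apply: (dual_L1 r1 (lV i)) => Psi tP.
by rewrite -normrN -hd//; exact: hC.
Qed.

(** The difference of the gradients is the weak gradient of g', which is in
    L^p(0,T;V). *)
Lemma difference_power i : LQ (fun z => `|U z ord0 i - V z ord0 i| `^ p).
Proof.
have [_ _ _ [C hC]] := LpX_V_bound g'X.
have [lu lU hdu] := hU; have [lv lV hdv] := hV.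
have [muU mvV] := ((lU i).1, (lV i).1).
apply: (dual_L1 (C := C) p1).
  split; first exact: measurable_funB.
  move=> K cK KQ; have IU := locint_L1 oQ (lU i).1 (lU i).2 cK KQ; have IV := locint_L1 oQ (lV i).1 (lV i).2 cK KQ.
  by have /integrableP[_] := L1B (compact_measurable cK) IU IV.
move=> Psi tP; have tD := test_derive (px i) tP.
have -> : \int[dtx]_(z in Q) ((U z ord0 i - V z ord0 i) * Psi z) = - \int[dtx]_(z in Q) (g' z * 'D_(px i) Psi z).
  have I1 := loc_integrable_test oOm (lU i) tP; have I2 := loc_integrable_test oOm (lV i) tP.
  have I3 := loc_integrable_test oOm lu tD; have I4 := loc_integrable_test oOm lv tD.
  have -> : \int[dtx]_(z in Q) ((U z ord0 i - V z ord0 i) * Psi z) =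
      \int[dtx]_(z in Q) (U z ord0 i * Psi z) - \int[dtx]_(z in Q) (V z ord0 i * Psi z).
    by rewrite -RintegralB//; apply: Rintegral_eq => // z _; rewrite mulrBl.
  have -> : \int[dtx]_(z in Q) (g' z * 'D_(px i) Psi z) =
      \int[dtx]_(z in Q) (u z * 'D_(px i) Psi z) - \int[dtx]_(z in Q) (v z * 'D_(px i) Psi z).
    rewrite -RintegralB//; apply: Rintegral_eq => // z _.
    by rewrite vE; ring.
  by rewrite hdu// hdv// opprB opprK addrC.
by rewrite normrN; exact: hC.
Qed.

Let v_L1 : LQ v.
Proof.
by have [r [r1 _ _ rp]] := admissible_exponent; have [] := LpX_W_bound r1 (vLpX (ltW r1) rp).
Qed.

Let mUi i : measurable_fun Q (fun z => U z ord0 i). Proof. by have [_ /(_ i)[]] := hU. Qed.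
Let mVi i : measurable_fun Q (fun z => V z ord0 i). Proof. by have [_ /(_ i)[]] := hV. Qed.

Let V_L1 i : LQ (fun z => V z ord0 i).
Proof.
have [r [r1 _ _ rp]] := admissible_exponent.
by apply: (power_L1_L1 mQ fQ (r := r) (mVi i)); [exact: ltW|exact: V_power].
Qed.

Let menormU : measurable_fun Q (fun z => enorm (U z)).
Proof.
apply: (@measurableT_comp _ _ _ _ _ _ (Num.sqrt : R -> R)).
  by apply: continuous_measurable_fun; exact: sqrt_continuous.
by apply: measurable_sum => i; exact: measurable_funM.
Qed.

Lemma enorm_U_power : LQ (fun z => enorm (U z) `^ (p - 1)).
Proof.
have [r [r1 pr rp' rp]] := admissible_exponent; have r0 : 0 < r by exact: lt_trans r1.
have IU i : LQ (fun z => `|U z ord0 i| `^ r).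
  have mUV : measurable_fun Q (fun z => U z ord0 i - V z ord0 i) by exact: measurable_funB.
  have Ip := power_L1_mono mQ fQ mUV (ltW r0) rp' (difference_power i).
  apply: (L1_eq mQ) (power_L1_D mQ r0 mUV (mVi i) Ip (V_power i r1 rp)) => z _; by rewrite subrK.
have Ie : LQ (fun z => `|enorm (U z)| `^ r).
  apply: (L1_dom (g := fun z => n%:R `^ r * \sum_i `|U z ord0 i| `^ r) mQ).
  - apply: measurable_powR_comp.
    exact: measurableT_comp.
  - by apply: (L1Zl mQ); exact: L1_sum.
  - move=> z _; rewrite ger0_norm ?powR_ge0//.
    apply: (@le_trans _ _ ((\sum_i `|U z ord0 i|) `^ r)); last exact: powR_sum_le.
    apply: ge0_ler_powR; rewrite ?nnegrE ?sumr_ge0 ?(ltW r0)//.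
    by rewrite ger0_norm ?enorm_ge0// enorm_le_sum.
have := power_L1_mono mQ fQ menormU (ltW pm) pr Ie.
by apply: (L1_eq mQ) => z _; rewrite ger0_norm ?enorm_ge0.
Qed.

Section cut.
Variables (N : set E) (C0 : R).
Hypotheses (mN : measurable N) (N0 : dtx N = 0%E) (C00 : 0 <= C0)
  (hN : forall z, Q z -> ~ N z -> [/\ continuous (a z), 0 <= b z,
     forall xi, alpha * enorm xi `^ p <= dotp (a z xi) xi,
     forall xi, enorm (a z xi) <= beta * (b z + enorm xi `^ (p - 1)) & - C0 <= u z - g z]).
Hypothesis ma : forall xi, measurable_fun Q (a ^~ xi).
Local Notation D := (Q `\` N).

Let mD : measurable D. Proof. exact: measurableD. Qed.

(** The values on the exceptional null set are replaced by 0, so that all almost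
    everywhere inequalities hold everywhere. *)
Let cut (h : E -> R) : E -> R := h \_ D.

Let cut_in h z : Q z -> ~ N z -> cut h z = h z.
Proof. by move=> Qz Nz; rewrite /cut patchE mem_set. Qed.

Let cut_out h z : ~ D z -> cut h z = 0.
Proof. by move=> Dz; rewrite /cut patchE memNset. Qed.

Let cut_ae (P : E -> Prop) : (forall z, ~ N z -> P z) -> {ae dtx, forall z, P z}.
Proof. by move=> hP; exists N; split => // z /= Pz; apply: contrapT => /hP. Qed.

Let cut_int (h1 h2 : E -> R) : (forall z, Q z -> ~ N z -> h1 z = h2 z) ->
  \int[dtx]_(z in Q) h1 z = \int[dtx]_(z in Q) h2 z.
Proof.
by move=> h; apply: Rintegral_ae_eq; apply: cut_ae => z Nz Qz; exact: h.
Qed.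

Let measurable_cut h : measurable_fun D h -> measurable_fun Q (cut h).
Proof. by move=> mh; apply: measurable_funTS; exact/(measurable_restrictT _ mD). Qed.

Let cut_L1 h : LQ h -> LQ (cut h).
Proof.
move=> Ih; apply: (L1_dom (g := fun z => `|h z|) mQ); last 2 first.
- exact: L1norm.
- by move=> z _; rewrite /cut patchE; case: ifP => _ //; rewrite normr0.
apply: measurable_cut; apply: measurable_funS (L1_measurable Ih) => //; exact: subDsetl.
Qed.

Let A i := cut (fun z => a z (U z) ord0 i).
Let Vc i := cut (fun z => V z ord0 i).
Let vc := cut v.
Let wc := cut (fun z => g' z - g z).

Let mA i : measurable_fun Q (A i).
Proof.
apply: measurable_cut; apply: caratheodory_measurable => //.
- by move=> xi; apply: measurable_funS (ma xi) => //; exact: subDsetl.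
- by move=> j; apply: measurable_funS (mUi j) => //; exact: subDsetl.
- by move=> z [Qz Nz]; have [] := hN Qz Nz.
Qed.

Let b_pow : LQ (fun z => `|b z| `^ p'). Proof. exact: Lq_power_L1. Qed.

Let IA i : LQ (A i).
Proof.
have b_L1 : LQ b by apply: (power_L1_L1 mQ fQ (r := p')); [case: bLq|exact: ltW|].
apply: (L1_dom (g := fun z => beta * (`|b z| + enorm (U z) `^ (p - 1))) mQ) => //.
  by apply: (L1Zl mQ); apply: (L1D mQ); [exact: L1norm|exact: enorm_U_power].
move=> z Qz; have [Nz|Nz] := pselect (N z).
  rewrite /A cut_out; last by move=> [].
  by rewrite normr0 mulr_ge0 ?(ltW beta0)// addr_ge0// powR_ge0.
rewrite /A cut_in//; have [_ bz _ h _] := hN Qz Nz.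
by rewrite (le_trans (coord_le_enorm _ _))// (le_trans (h _))// ger0_norm.
Qed.

Section energy_density.
Variables (Ct Ce : R).
Hypotheses (Ct0 : 0 <= Ct) (Ce0 : 0 < Ce).
Hypothesis hCe : forall (A U P : 'I_n -> R) (x b : R), 0 <= b ->
    0 <= x -> (forall i, `|U i| <= x) ->
    alpha * x `^ p <= \sum_i A i * U i ->
    (forall i, `|A i| <= beta * (b + x `^ (p - 1))) ->
    let k := alpha / 2 * b `^ (p / (p - 1)) + Ct * \sum_i `|P i| `^ p in
    [/\ 0 <= k, forall i, `|A i| `^ (p / (p - 1)) <= Ce * (x `^ p + k),
        forall i, `|U i - P i| `^ p <= Ce * (x `^ p + k)
      & x `^ p + k <= Ce * (\sum_i A i * (U i - P i) + (1 + alpha / 2) * k)].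

Let k0 z := alpha / 2 * `|b z| `^ p' + Ct * \sum_i `|U z ord0 i - V z ord0 i| `^ p.
Let e := cut (fun z => enorm (U z) `^ p + k0 z).
Let kappa z := (1 + alpha / 2) * k0 z.
Let kc := cut kappa.

Let k0_L1 : LQ k0.
Proof.
by apply: (L1D mQ); apply: (L1Zl mQ) => //; apply: (L1_sum mQ) => i; exact: difference_power.
Qed.

Let kappa_L1 : LQ kappa. Proof. exact: L1Zl. Qed.

Let k00 z : 0 <= k0 z.
Proof.
rewrite addr_ge0// mulr_ge0 ?powR_ge0// ?divr_ge0 ?(ltW alpha0)//.
by apply: sumr_ge0 => i _; exact: powR_ge0.
Qed.

Let a20 : 0 <= 1 + alpha / 2. Proof. by rewrite addr_ge0// divr_ge0// ltW. Qed.
Let kappa0 z : 0 <= kappa z. Proof. exact: mulr_ge0. Qed.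

Let me : measurable_fun Q e.
Proof.
have h : measurable_fun Q (fun z => enorm (U z) `^ p + k0 z).
  apply: measurable_funD; last exact: L1_measurable k0_L1.
  by exact: measurable_powR_comp.
by apply: measurable_cut; apply: measurable_funS h => //; exact: subDsetl.
Qed.

Let pointwise z : Q z -> ~ N z ->
  [/\ forall i, `|A i z| `^ p' <= Ce * e z, forall i, `|Vc i z| `^ p <= Ce * e z
    & e z <= Ce * (\sum_i A i z * Vc i z + kc z)].
Proof.
move=> Qz Nz; have [_ bz h1 h2 _] := hN Qz Nz.
have hb : forall i, `|U z ord0 i| <= enorm (U z) by move=> i; exact: coord_le_enorm.
have hA i : `|a z (U z) ord0 i| <= beta * (b z + enorm (U z) `^ (p - 1)).
  exact: le_trans (coord_le_enorm _ _) (h2 _).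
have := @hCe _ _ (fun i => U z ord0 i - V z ord0 i) _ _ bz (enorm_ge0 _) hb (h1 _) hA.
rewrite /e /kc !cut_in// /kappa /k0 [`|b z|]ger0_norm//; set k := _ + _ * \sum_i _.
move=> [_ q2 q3 q4]; split.
- by move=> i; rewrite /A cut_in//; exact: q2.
- by move=> i; rewrite /Vc cut_in//; have := q3 i; rewrite subKr.
- apply: (le_trans q4); rewrite le_eqVlt; apply/orP; left; apply/eqP.
  by congr (_ * (_ + _)); apply: eq_bigr => i _; rewrite /A /Vc !cut_in// subKr.
Qed.

Let F z := f z - f' z.
Let H i z := G z ord0 i - G' z ord0 i.
Let Gc (i : 'I_n) (z : E) : R := G' z ord0 i.

Let If : LQ f.
Proof.
by apply: (power_L1_L1 mQ fQ (r := 1)) => //; [case: hf|exact: Lq_power_L1].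
Qed.

Let If' : LQ f'.
Proof.
have [h _ _ _] := dec.
by apply: (power_L1_L1 mQ fQ (r := 1)) => //; [case: h|exact: Lq_power_L1].
Qed.

Let hG' : in_Lq_vec Om T p'%:E G'. Proof. by have [] := dec. Qed.
Let IGq i : LQ (fun z => `|Gc i z| `^ p'). Proof. exact: (Lq_power_L1 q0 (hG' i)). Qed.
Let IG i : LQ (Gc i).
Proof. by apply: (power_L1_L1 mQ fQ (r := p')); [case: (hG' i)|exact: ltW|exact: IGq]. Qed.

Let mH i : measurable_fun Q (H i).
Proof. by apply: measurable_funB; [case: (hG i)|case: (hG' i)]. Qed.

Let IHq i : LQ (fun z => `|H i z| `^ p').
Proof.
have mG : measurable_fun Q (fun z => G z ord0 i) by case: (hG i).
have mG' : measurable_fun Q (fun z => - G' z ord0 i) by apply: measurableT_comp => //; case: (hG' i).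
apply: (power_L1_D mQ q0 mG mG'); first exact: Lq_power_L1.
by apply: (L1_eq mQ) (IGq i) => z _; rewrite normrN.
Qed.

Let IH i : LQ (H i).
Proof. by apply: (power_L1_L1 mQ fQ (r := p')); [|exact: ltW|]. Qed.

(** By homogeneity: Psi is replaced by s Psi, with s ^ (p' - 1) = 1/2. *)
Let halve w C i : LQ w -> (forall Psi, test_function Q Psi ->
    `|\int[dtx]_(z in Q) (w z * 'D_(px i) Psi z)| <= C + \int[dtx]_z (`|Psi z| `^ p')) ->
  exists C', 0 <= C' /\ forall Psi, test_function Q Psi ->
    `|\int[dtx]_(z in Q) (w z * 'D_(px i) Psi z)| <= C' + 2^-1 * \int[dtx]_z (`|Psi z| `^ p').
Proof.
move=> Iw h; have qm : 0 < p' - 1 by rewrite subr_gt0.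
pose s : R := 2^-1 `^ (p' - 1)^-1.
have s0 : 0 < s by exact: powR_gt0.
have sq : s `^ p' = s * 2^-1.
  rewrite -[in LHS](subrK 1 p') addrC powRD; last by apply/implyP => _; rewrite gt_eqF.
  rewrite powRr1 ?(ltW s0)//; congr (_ * _).
  by rewrite /s -powRrM mulVf ?gt_eqF// powRr1.
exists (`|C| / s); split; first by rewrite divr_ge0// ltW.
move=> Psi tP; have [K [sP cK cKs KQ]] := test_elim tP.
have ts : test_function Q (fun z => s * Psi z).
  apply: (test_intro _ cK _ KQ); first by apply: smoothM => //; exact: (smooth_cst s).
  by move=> z zK; rewrite cKs ?mulr0.
have [c c0 hc] := supp_in_bounded (smooth_continuous sP) cK cKs.
have IP : dtx.-integrable setT (EFin \o fun z => `|Psi z| `^ p').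
  apply: (supp_in_integrable (K := K) (C := c `^ p')).
  - exact: compact_measurable.
  - exact: compact_finite.
  - apply: measurable_powR_comp.
    by apply: measurableT_comp => //; apply: continuous_measurable_E; exact: smooth_continuous.
  - by move=> z zK; rewrite cKs// normr0 powR0// gt_eqF.
  - by move=> z; rewrite ger0_norm ?powR_ge0//; apply: ge0_ler_powR; rewrite ?nnegrE// ltW.
have := h _ ts.
have -> : \int[dtx]_z (`|s * Psi z| `^ p') = s * 2^-1 * \int[dtx]_z (`|Psi z| `^ p').
  rewrite -sq -RintegralZl//; apply: Rintegral_eq => // z _.
  by rewrite normrM powRM// ger0_norm// ltW.
have -> : \int[dtx]_(z in Q) (w z * 'D_(px i) (fun z => s * Psi z) z) =
    \int[dtx]_(z in Q) (s * (w z * 'D_(px i) Psi z)).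
  apply: Rintegral_eq => // z _; rewrite derive_smoothM//; last exact: (smooth_cst s).
  by rewrite derive_cst; ring.
have Iwd := loc_integrable_test oOm (L1_loc oOm Iw) (test_derive (px i) tP).
rewrite RintegralZl// normrM [`|s|]ger0_norm ?(ltW s0)//.
set X := `|_|; set Y := Rintegral _ _ _ => hX.
have -> : `|C| / s + 2^-1 * Y = s^-1 * (`|C| + s * 2^-1 * Y) by field; rewrite gt_eqF.
rewrite -(ler_pM2l s0) mulrA mulfV ?gt_eqF// mul1r; apply: (le_trans hX).
by rewrite lerD2r ler_norm.
Qed.

Let wbound : exists C, forall i Psi, test_function Q Psi ->
  `|\int[dtx]_(z in Q) (wc z * 'D_(px i) Psi z)| <= C + \int[dtx]_z (`|Psi z| `^ p').
Proof.
have [_ I1 _ [C1 hC1]] := LpX_V_bound g'X; have [_ I2 _ [C2 hC2]] := LpX_W_bound p1 hg.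
have /choice[c1 h1] : forall i, exists C', 0 <= C' /\ forall Psi, test_function Q Psi ->
    `|\int[dtx]_(z in Q) (g' z * 'D_(px i) Psi z)| <= C' + 2^-1 * \int[dtx]_z (`|Psi z| `^ p').
  by move=> i; apply: (halve I1) => Psi tP; exact: hC1.
have /choice[c2 h2] : forall i, exists C', 0 <= C' /\ forall Psi, test_function Q Psi ->
    `|\int[dtx]_(z in Q) (g z * 'D_(px i) Psi z)| <= C' + 2^-1 * \int[dtx]_z (`|Psi z| `^ p').
  by move=> i; apply: (halve I2) => Psi tP; exact: hC2.
exists (\sum_i (c1 i + c2 i)) => i Psi tP.
have tD := test_derive (px i) tP.
have -> : \int[dtx]_(z in Q) (wc z * 'D_(px i) Psi z) =
    \int[dtx]_(z in Q) (g' z * 'D_(px i) Psi z) - \int[dtx]_(z in Q) (g z * 'D_(px i) Psi z).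
  rewrite -RintegralB//; last 2 first.
  - by apply: (loc_integrable_test oOm (L1_loc oOm I1) tD).
  - by apply: (loc_integrable_test oOm (L1_loc oOm I2) tD).
  by apply: cut_int => z Qz Nz; rewrite /wc cut_in// mulrBl.
apply: (le_trans (ler_normB _ _)).
apply: (@le_trans _ _ (c1 i + c2 i + \int[dtx]_z (`|Psi z| `^ p'))).
  by have := (h1 i).2 _ tP; have := (h2 i).2 _ tP; lra.
rewrite lerD2r (bigD1 i)//= lerDl sumr_ge0// => j _; by rewrite addr_ge0 ?(h1 j).1 ?(h2 j).1.
Qed.

Let w_L1 : LQ (fun z => g' z - g z).
Proof.
have [_ I1 _ _] := LpX_V_bound g'X; have [_ I2 _ _] := LpX_W_bound p1 hg.
exact: L1B.
Qed.

Let w_eq Psi : test_function Q Psi ->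
  \int[dtx]_(z in Q) (wc z * 'D_pt Psi z) =
    - (\int[dtx]_(z in Q) (F z * Psi z)) - (\int[dtx]_(z in Q) \sum_i H i z * 'D_(px i) Psi z).
Proof.
move=> tP; have [K [sP cK cKs KQ]] := test_elim tP.
have tP' : test_function (setT `*` Om) Psi.
  by apply: (test_intro sP cK cKs) => z /KQ [].
have [_ _ _ hd] := dec; have := hd _ tP'; rewrite (hfGg tP').
have tb Phi : test_function Q Phi -> forall h, LQ h -> LQ (fun z => h z * Phi z).
  move=> tPhi h Ih; have [K' [s' c' P' _]] := test_elim tPhi.
  have [c c0 hc] := supp_in_bounded (smooth_continuous s') c' P'.
  apply: (L1_eq (f := fun z => Phi z * h z) mQ) => [z _|]; first exact: mulrC.
  apply: (L1M_bounded mQ (c := c)) => //; exact: smooth_measurable.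
have tD i := test_derive (px i) tP; have tt := test_derive pt tP.
have [_ I1 _ _] := LpX_V_bound g'X; have [_ I2 _ _] := LpX_W_bound p1 hg.
have IGi i : LQ (fun z => G z ord0 i).
  by apply: (power_L1_L1 mQ fQ (r := p')); [case: (hG i)|exact: ltW|exact: Lq_power_L1].
have dE (X : E -> 'rV[R]_n) : \int[dtx]_(z in Q) dotp (X z) (\row_i 'D_(px i) Psi z) =
    \int[dtx]_(z in Q) \sum_i X z ord0 i * 'D_(px i) Psi z.
  by apply: Rintegral_eq => // z _; apply: eq_bigr => i _; rewrite mxE.
rewrite !dE.
have -> : \int[dtx]_(z in Q) (wc z * 'D_pt Psi z) =
    \int[dtx]_(z in Q) ('D_pt Psi z * g' z) - \int[dtx]_(z in Q) ('D_pt Psi z * g z).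
  rewrite -RintegralB//; last 2 first.
  - by apply: (L1_eq (f := fun z => g' z * 'D_pt Psi z) mQ) => [z _|]; [exact: mulrC|exact: tb].
  - by apply: (L1_eq (f := fun z => g z * 'D_pt Psi z) mQ) => [z _|]; [exact: mulrC|exact: tb].
  by apply: cut_int => z Qz Nz; rewrite /wc cut_in//; ring.
have -> : \int[dtx]_(z in Q) (F z * Psi z) = \int[dtx]_(z in Q) (f z * Psi z) - \int[dtx]_(z in Q) (f' z * Psi z).
  by rewrite -RintegralB//; [apply: Rintegral_eq => // z _; rewrite mulrBl|exact: tb|exact: tb].
have -> : \int[dtx]_(z in Q) (\sum_i H i z * 'D_(px i) Psi z) =
    \int[dtx]_(z in Q) (\sum_i G z ord0 i * 'D_(px i) Psi z) - \int[dtx]_(z in Q) (\sum_i G' z ord0 i * 'D_(px i) Psi z).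
  rewrite -RintegralB//; last 2 first.
  - by apply: (L1_sum mQ) => i; exact: (tb _ (tD i) _ (IGi i)).
  - by apply: (L1_sum mQ) => i; exact: (tb _ (tD i) _ (IG i)).
  by apply: Rintegral_eq => // z _; rewrite -sumrB; apply: eq_bigr => i _; rewrite mulrBl.
lra.
Qed.

Let V_eq i Psi : test_function Q Psi ->
  \int[dtx]_(z in Q) (vc z * 'D_(px i) Psi z) = - \int[dtx]_(z in Q) (Vc i z * Psi z).
Proof.
move=> tP; have [_ _ h] := hV.
rewrite (cut_int (h2 := fun z => v z * 'D_(px i) Psi z)); last by move=> z Qz Nz; rewrite /vc cut_in.
rewrite h//; congr (- _); apply: cut_int => z Qz Nz; by rewrite /Vc cut_in.
Qed.

Hypothesis ren_eq : renormalized_equation Om T p a u0 f' G' u v.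

Let weak_eq m L chi : 0 < m -> 5 * m <= L -> test_function Q chi ->
  - (\int[dtx]_(z in Q) (ren m L (vc z) * 'D_pt chi z))
  + (\int[dtx]_(z in Q) (ren1 m L (vc z) * \sum_i A i z * 'D_(px i) chi z))
  + (\int[dtx]_(z in Q) (ren2 m L (vc z) * (\sum_i A i z * Vc i z) * chi z))
  = (\int[dtx]_(z in Q) (f' z * (ren1 m L (vc z) * chi z)))
  + (\int[dtx]_(z in Q) \sum_i Gc i z * (ren2 m L (vc z) * Vc i z * chi z + ren1 m L (vc z) * 'D_(px i) chi z)).
Proof.
move=> m0 mL tchi; have L0 : 0 < L by apply: lt_le_trans mL; rewrite mulr_gt0.
have W2 : in_W2oo (ren m L) (ren1 m L) (ren2 m L).
  have i0 : 0 <= m^-1 + L^-1 by rewrite addr_ge0// invr_ge0 ltW.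
  have l0 : 0 <= 5 / 2 * L by rewrite mulr_ge0// ltW.
  apply: (in_W2oo_C2 (C := 5 / 2 * L + 1 + (m^-1 + L^-1))).
  - exact: is_derive_ren.
  - exact: is_derive_ren1.
  - exact: continuous_ren2.
  - by move=> x; apply: (le_trans (ren_bound m0 mL x)); lra.
  - by move=> x; apply: (le_trans (ren1_bound m L x)); lra.
  - by move=> x; apply: (le_trans (ren2_bound m0 mL x)); lra.
have cS : compact (closure [set s | ren1 m L s != 0]).
  apply: (subclosed_compact _ (@segment_compact _ (- (5 / 2 * L)) 0)); first exact: closed_closure.
  have cI : closed (`[- (5 / 2 * L), 0]%classic : set R) by exact: interval_closed.
  rewrite [X in _ `<=` X]((closure_id _).1 cI).
  apply: closure_subset => s /= hs; rewrite in_itv /=.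
  have : in_ring (m / 2) (5 / 2 * L) s by apply: contraR hs => /(ren1_out m0 mL) ->; rewrite eqxx.
  by move=> /andP[h1 h2]; apply/andP; split; move: m0 h1 h2; lra.
have := ren_eq W2 cS (ren0 m0 mL) (smooth_renormalized_test oOm bOm T0 p1 tchi).
have -> : \int[dx]_(x in Om) (ren m L (u0 x) * chi (0, x)) = 0.
  have chi0 : curve chi 0 = cst 0 by apply: (test_out tchi); rewrite ltxx.
  rewrite /Rintegral integral0_eq// => x _.
  by have -> : chi (0, x) = curve chi 0 x by []; rewrite chi0 /= mulr0.
have mvc (h : R -> R) : continuous h -> measurable_fun Q (fun z => h (v z)).
  by move=> ch; apply: (@measurableT_comp _ _ _ _ _ _ h); [exact: continuous_measurable_fun|exact: L1_measurable v_L1].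
have Iren : LQ (fun z => ren m L (v z)).
  apply: (L1_dom (g := fun z => 5 / 2 * L * \1_Q z) mQ).
  - apply: mvc => x; apply/differentiable_continuous/derivable1_diffP.
    by have [] := is_derive_ren m0 mL x.
  - by apply: (L1Zl mQ); exact: L1_indic.
  - by move=> z Qz; rewrite indicE mem_set// mulr1 ren_bound.
rewrite (time_pairing_int oOm tchi Iren) oppr0 sub0r.
have [K [sc _ _ _]] := test_elim tchi.
have x1 := xgrad_ae oOm bOm (xgradP (xgrad_smooth Om T sc)) (xgrad_smooth Om T sc).
have xr := xgrad_ren oOm bOm m0 mL v_L1 V_L1 (fun i Psi tP => (let: And3 _ _ h := hV in h) Psi tP i) tchi.
have x2 := xgrad_ae oOm bOm (xgradP xr) xr.
rewrite /hat_int => e1.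
rewrite (cut_int (h2 := fun z => ren m L (v z) * 'D_pt chi z)); last by move=> z Qz Nz; rewrite /vc cut_in.
have -> : \int[dtx]_(z in Q) (ren1 m L (vc z) * \sum_i A i z * 'D_(px i) chi z) =
    \int[dtx]_(z in Q) (ren1 m L (v z) * dotp (a z (U z)) (xgrad Om T chi z)).
  apply: Rintegral_ae_eq; move: x1; apply: filterS2 (cut_ae (P := fun z => ~ N z) (fun _ h => h)) => z Nz h Qz.
  rewrite (h Qz) /vc cut_in//; congr (_ * _); apply: eq_bigr => i _; by rewrite /A cut_in// mxE.
have -> : \int[dtx]_(z in Q) (ren2 m L (vc z) * (\sum_i A i z * Vc i z) * chi z) =
    \int[dtx]_(z in Q) (ren2 m L (v z) * dotp (a z (U z)) (V z) * chi z).
  apply: cut_int => z Qz Nz; rewrite /vc cut_in//; congr (_ * _ * _); apply: eq_bigr => i _; by rewrite /A /Vc !cut_in.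
rewrite e1; congr (_ + _); first by apply: cut_int => z Qz Nz; rewrite /vc cut_in.
apply: Rintegral_ae_eq; move: x2; apply: filterS2 (cut_ae (P := fun z => ~ N z) (fun _ h => h)) => z Nz h Qz.
by rewrite (h Qz); apply: eq_bigr => i _; rewrite mxE /Vc /vc !cut_in.
Qed.

Let energyE psi k : energy_mean Om T a u v psi k `]- (2 * k)%:R, - k%:R] =
  k%:R^-1 * \int[dtx]_(z in Q) ((\sum_i A i z * Vc i z) * psi z * (dyadic vc k z)%:R).
Proof.
rewrite /energy_mean Rintegral_mkcondr; congr (_ * _); apply: cut_int => z Qz Nz.
rewrite patchE; have -> : (z \in v @^-1` `]- (2 * k)%:R, - k%:R]) = dyadic vc k z.
  rewrite /dyadic /vc cut_in//; apply/idP/idP.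
    by move=> /set_mem /=; rewrite in_itv /= => /andP[h1 h2]; rewrite lerNr h2 ltrNl h1.
  by move=> /andP[h1 h2]; apply/mem_set; rewrite /= in_itv /= lerNr h1 ltrNl h2.
case: ifP => _; rewrite ?mulr1 ?mulr0//; congr (_ * _).
by apply: eq_bigr => i _; rewrite /A /Vc !cut_in.
Qed.

Let eN z : Q z -> 0 <= e z.
Proof.
move=> Qz; rewrite /e /cut patchE; case: ifP => // _; by rewrite addr_ge0// powR_ge0.
Qed.

Let kcN z : Q z -> 0 <= kc z.
Proof. by move=> Qz; rewrite /kc /cut patchE; case: ifP. Qed.

Let pointwise_all z : Q z ->
  [/\ forall i, `|A i z| `^ p' <= Ce * e z, forall i, `|Vc i z| `^ p <= Ce * e z,
    e z <= Ce * (\sum_i A i z * Vc i z + kc z) & - C0 <= vc z + wc z].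
Proof.
move=> Qz; have [Nz|Nz] := pselect (N z); last first.
  have [h1 h2 h3] := pointwise Qz Nz; split => //.
  have [_ _ _ _] := hN Qz Nz; rewrite /vc /wc !cut_in// vE; lra.
have Dz : ~ D z by move=> [].
rewrite /e /kc /vc /wc (cut_out _ Dz) (cut_out kappa Dz) (cut_out v Dz) (cut_out (fun z => g' z - g z) Dz).
have hA i : A i z = 0 by exact: cut_out.
have hVc i : Vc i z = 0 by exact: cut_out.
split.
- by move=> i; rewrite hA normr0 powR0 ?gt_eqF// mulr0.
- by move=> i; rewrite hVc normr0 powR0 ?gt_eqF// mulr0.
- by rewrite big1 ?addr0 ?mulr0// => i _; rewrite hA mul0r.
- by rewrite addr0 oppr_le0.
Qed.

Let IVc i : LQ (Vc i). Proof. exact: cut_L1. Qed.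
Let Ivc : LQ vc. Proof. exact: cut_L1. Qed.
Let Ikc : LQ kc. Proof. exact: cut_L1. Qed.
Let mvc : measurable_fun Q vc. Proof. exact: (L1_measurable Ivc). Qed.

Let AVc z := \sum_i A i z * Vc i z.
Let dy (k : nat) (z : E) : R := (dyadic vc k z)%:R.

Let mdy k : measurable_fun Q (dy k).
Proof.
apply: measurable_indb => //; apply: measurable_and.
  by apply: measurable_fun_ler => //; exact: measurableT_comp.
by apply: measurable_fun_ltr => //; exact: measurableT_comp.
Qed.

(** The means converge to a limit M <> 0, hence are eventually nonzero; then the
    energy in the ring is genuinely integrable, by [L1_of_nonzero], and at most
    proportional to k. *)
Lemma ring_energy (M : R) : M != 0 ->
  (fun k => energy_mean Om T a u v (cst 1) k `]- (2 * k)%:R, - k%:R]) @ \oo --> M ->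
  exists n0 C1, [/\ 0 <= C1, forall k, (n0 <= k)%N -> LQ (fun z => e z * dy k z) &
    forall k, (n0 <= k)%N -> \int[dtx]_(z in Q) (e z * dy k z) <= C1 * k%:R].
Proof.
move=> M0 hM; have nM : 0 < `|M| by rewrite normr_gt0.
have mAV : measurable_fun Q AVc.
  by apply: measurable_sum => i; apply: measurable_funM => //; exact: L1_measurable (IVc i).
have Ik0 : 0 <= \int[dtx]_(z in Q) kc z by apply: Rintegral_ge0 => z Qz; exact: kcN.
have /cvgrPdist_lt/(_ _ nM) [k1 _ h1] := hM; have /cvgrPdist_lt/(_ 1 ltr01) [k2 _ h2] := hM.
have hk k : (maxn 1 (maxn k1 k2) <= k)%N -> LQ (fun z => e z * dy k z) /\
    \int[dtx]_(z in Q) (e z * dy k z) <= Ce * (`|M| + 1 + \int[dtx]_(z in Q) kc z) * k%:R.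
  rewrite !geq_max => /and3P[k0' /h1 + /h2]; rewrite /= energyE.
  set X := \int[dtx]_(z in Q) _ => d1 d2.
  have kp : 0 < k%:R :> R by rewrite ltr0n.
  have XE : X = \int[dtx]_(z in Q) (AVc z * dy k z).
    by apply: Rintegral_eq => // z _; rewrite mulr1.
  have X0 : X != 0 by apply: contraTneq d1 => ->; rewrite mulr0 subr0 ltxx.
  have XM : X <= (`|M| + 1) * k%:R.
    rewrite -ler_pdivrMr// mulrC; have := ler_norm M; move: d2; rewrite ltr_norml => /andP[]; lra.
  have dy0 z : 0 <= dy k z by exact: ler0n.
  have dy1 z : dy k z <= 1 by rewrite /dy; case: dyadic.
  have IX : LQ (fun z => AVc z * dy k z).
    apply: (L1_of_nonzero mQ _ Ikc) => //; first exact: measurable_funM.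
    - move=> z Qz; have [_ _ h _] := pointwise_all Qz.
      have h0 : 0 <= AVc z + kc z by have := le_trans (eN Qz) h; rewrite pmulr_rge0.
      have := mulr_ge0 h0 (dy0 z); have := ler_wpM2l (kcN Qz) (dy1 z).
      rewrite mulrDl mulr1; lra.
    - by rewrite -XE.
  have Ikd : LQ (fun z => kc z * dy k z).
    apply: (L1_eq (f := fun z => dy k z * kc z) mQ) => [z _|]; first exact: mulrC.
    by apply: (L1M_bounded mQ (c := 1)) => // z _; rewrite ger0_norm.
  have le_e z : Q z -> e z * dy k z <= Ce * (AVc z * dy k z + kc z * dy k z).
    by move=> Qz; have [_ _ h _] := pointwise_all Qz; rewrite -mulrDl mulrA ler_wpM2r.
  have Ib : LQ (fun z => Ce * (AVc z * dy k z + kc z * dy k z)).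
    by apply: (L1Zl mQ); exact: L1D.
  have Ie : LQ (fun z => e z * dy k z).
    apply: (L1_dom mQ _ Ib) => [|z Qz]; first exact: measurable_funM.
    by rewrite ger0_norm ?mulr_ge0 ?eN// le_e.
  split => //; apply: (@le_trans _ _ (\int[dtx]_(z in Q) (Ce * (AVc z * dy k z + kc z * dy k z)))).
    exact: le_Rintegral.
  rewrite RintegralZl//; last exact: L1D.
  rewrite -mulrA ler_wpM2l ?(ltW Ce0)// RintegralD// -XE mulrDl; apply: lerD => //.
  apply: (@le_trans _ _ (\int[dtx]_(z in Q) kc z)).
    apply: le_Rintegral => // z Qz; rewrite -[leRHS]mulr1; exact: (ler_wpM2l (kcN Qz) (dy1 z)).
  by rewrite ler_peMr// ler1n.
exists (maxn 1 (maxn k1 k2)), (Ce * (`|M| + 1 + \int[dtx]_(z in Q) kc z)); split.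
- by rewrite mulr_ge0 ?(ltW Ce0)// !addr_ge0.
- by move=> k /hk[].
- by move=> k /hk[].
Qed.

Lemma energy_le0 (M : R) phi ell : M != 0 ->
  (fun k => energy_mean Om T a u v (cst 1) k `]- (2 * k)%:R, - k%:R]) @ \oo --> M ->
  test_function Q phi -> (forall z, 0 <= phi z) ->
  (fun k => energy_mean Om T a u v phi k `]- (2 * k)%:R, - k%:R]) @ \oo --> ell -> ell <= 0.
Proof.
move=> M0 hM tphi phi0 hl; have [n0 [C1 [C10 ring_int ring_bound]]] := ring_energy M0 hM.
have [Cw hw] := wbound.
have hl' : (fun k : nat => k%:R^-1 * \int[dtx]_(z in Q) ((\sum_i A i z * Vc i z) * phi z * (dyadic vc k z)%:R)) @ \oo --> ell.
  by move: hl; rewrite (_ : (fun k => _) = (fun k : nat => k%:R^-1 * \int[dtx]_(z in Q) ((\sum_i A i z * Vc i z) * phi z * (dyadic vc k z)%:R))) //; apply/funext => k; exact: energyE.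
apply: (@energy_limit_le0 R n Q oQ bQ p p1 vc wc f' F e kc Vc A Gc H Ce C0 Cw Ivc (cut_L1 w_L1) If'
  (L1B mQ If If') Ikc IVc IA IG IH IGq IHq me V_eq w_eq hw eN kcN Ce0 _ _ _ C00 _ weak_eq n0 C1 C10
  ring_int ring_bound phi ell tphi phi0 hl').
- by move=> i z Qz; have [h _ _ _] := pointwise_all Qz.
- by move=> i z Qz; have [_ h _ _] := pointwise_all Qz.
- by move=> z Qz; have [_ _ h _] := pointwise_all Qz.
- by move=> z Qz; have [_ _ _ h] := pointwise_all Qz.
Qed.

End energy_density.

End cut.

End application.

(** * Nonnegativity of the singular part *)

(** Test the coercivity with xi = - t F(0), and let t tend to 0. *)
Lemma coercive_zero (R : realType) n (p alpha : R) (F : 'rV[R]_n -> 'rV[R]_n) : 0 <= alpha ->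
  continuous F -> (forall xi, alpha * enorm xi `^ p <= dotp (F xi) xi) -> F 0 = 0.
Proof.
move=> al0 cF hF; pose x := F 0; pose t (k : nat) : R := k.+1%:R^-1.
have t0 : t @ \oo --> 0 by exact: cvg_harmonic.
have h k : dotp (F (- t k *: x)) x <= 0.
  have h1 : 0 <= dotp (F (- t k *: x)) (- t k *: x).
    by apply: le_trans (hF _); rewrite mulr_ge0// powR_ge0.
  have e : dotp (F (- t k *: x)) (- t k *: x) = - t k * dotp (F (- t k *: x)) x.
    by rewrite /dotp mulr_sumr; apply: eq_bigr => i _; rewrite mxE mulrCA.
  by move: h1; rewrite e mulNr oppr_ge0 pmulr_rle0// /t.
have hc : (fun k => dotp (F (- t k *: x)) x) @ \oo --> dotp (F 0) x.
  have hy : (fun k => - t k *: x) @ \oo --> (0 : 'rV[R]_n).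
    rewrite -(scale0r x) -[X in X *: x]oppr0; apply: cvgZr_tmp; exact: cvgN.
  have hF0 : (fun k => F (- t k *: x)) @ \oo --> F 0 by apply: (cvg_comp _ _ hy); exact: cF.
  apply: cvg_big => [|i _]; first exact: add_continuous.
  apply: cvgM; last exact: cvg_cst.
  apply: (cvg_comp (fun k => F (- t k *: x)) (fun w : 'rV[R]_n => w ord0 i)); first exact: hF0.
  exact: coord_continuous_rV.
have h0 : dotp x x <= 0 by apply: (cvgr_to_le hc); apply: nearW => k; exact: h.
apply/rowP => i; rewrite mxE -/x; apply/eqP; rewrite -sqrf_eq0; apply/eqP/le_anti.
rewrite sqr_ge0 andbT; apply: le_trans h0.
by rewrite /dotp (bigD1 i)//= expr2 lerDl sumr_ge0// => j _; rewrite -expr2 sqr_ge0.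
Qed.

Lemma neg_part_fin d (E : measurableType d) (R : realType) (nu : {charge set E -> \bar R}) A :
  measurable A -> neg_part nu A \is a fin_num.
Proof. by move=> mA; exact: (fin_num_measure (jordan_neg (hahn_pos_neg nu))). Qed.

Section detection.
Context {R : realType} (n : nat).
Local Notation E := (R * 'rV[R]_n)%type.
Variables (m : {measure set E -> \bar R}) (Q : set E).
Hypotheses (oQ : open Q) (mfin : m Q \is a fin_num).
Let mQ : measurable Q := open_measurable_E oQ.

(** Test with the kernels centred at the points of Q, which are positive on a
    ball. *)
Lemma null_of_test_functions :
  (forall phi, test_function Q phi -> (forall z, 0 <= phi z) -> \int[m]_(z in Q) phi z <= 0) ->
  m Q = 0%E.
Proof.
move=> h; apply: null_cover_E => // y Qy.
have [r r0 hr] := compact_margin (@compact_set1 _ y) oQ (fun z (zy : [set y] z) => ecast w (Q w) (esym zy) Qy).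
have [k hk] := inv_lt_near r0; pose e : R := k.+1%:R^-1.
have e0 : 0 < e by rewrite invr_gt0.
pose phi z := rho e (y - z).
have tphi : test_function Q phi by exact: (rho_test hr (hk k (leqnn k)) (erefl y)).
have phi0 z : 0 <= phi z by exact: rho_ge0.
have [K [sphi cK phiK KQ]] := test_elim tphi.
have [c c0 hc] := supp_in_bounded (smooth_continuous sphi) cK phiK.
have mphi : measurable_fun Q phi by exact: smooth_measurable.
have fin : (m Q < +oo)%E by rewrite ltey_eq mfin.
have Iphi : m.-integrable Q (EFin \o phi).
  apply: (L1_dom (g := fun z => c * \1_Q z) mQ mphi); first by apply: (L1Zl mQ); exact: L1_indic.
  by move=> z Qz; rewrite indicE mem_set// mulr1.
have int0 : (\int[m]_(z in Q) `|(EFin \o phi) z| = 0)%E.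
  have -> : (\int[m]_(z in Q) `|(EFin \o phi) z| = \int[m]_(z in Q) (EFin \o phi) z)%E.
    by apply: eq_integral => z _; rewrite /= ger0_norm.
  have i0 : (0 <= \int[m]_(z in Q) (EFin \o phi) z)%E by apply: integral_ge0 => z _; rewrite lee_fin.
  have fi := integrable_fin_num mQ Iphi.
  apply/eqP; rewrite eq_le i0 andbT -(fineK fi) lee_fin; exact: h.
have mE : measurable_fun Q (EFin \o phi) by exact/measurable_EFinP.
have ae0 := (ae_eq_integral_abs m mQ mE).1 int0.
exists e => //; apply: measure_negligible; first exact: measurable_E_ball.
apply: negligibleS ae0 => z yz /=; have Qz : Q z.
  apply: (hr y) => //; rewrite distrC; apply: lt_trans (hk k (leqnn k)).
  by move: yz; rewrite -ball_normE.
move=> /(_ Qz) /= [] /eqP; rewrite gt_eqF// rho_gt0//.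
by move: yz; rewrite -!ball_normE /ball_ /= sub0r normrN.
Qed.

End detection.

(** In particular the energy vanishes when one of the weak gradients does not
    exist, since it is then 0 by convention. *)
Lemma energy_mean0 (R : realType) n (Om : set 'rV[R]_n) (T : R) (a : R * 'rV[R]_n -> 'rV[R]_n -> 'rV[R]_n)
    (u v psi : R * 'rV[R]_n -> R) k (I : set R) :
  {ae lebesgue_prod (lebesgue_rV n), forall z, cylinder Om T z ->
    dotp (a z (xgrad Om T u z)) (xgrad Om T v z) = 0} ->
  energy_mean Om T a u v psi k I = 0.
Proof.
move=> h; rewrite /energy_mean (Rintegral_ae_eq (g := cst 0)) ?[X in _ * X]/Rintegral ?integral0 ?mulr0//.
by apply: filterS h => z hz [Qz _]; rewrite hz// mul0r.
Qed.
Theorem theorem9p2 (R : realType) (N : nat) (Om : set 'rV[R]_N) (T p : R)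
    (a : R * 'rV[R]_N -> 'rV[R]_N -> 'rV[R]_N)
    (alpha beta : R) (b : R * 'rV[R]_N -> R)
    (u0 : 'rV[R]_N -> R)
    (mu mu0 mus : {charge set (R * 'rV[R]_N)%type -> \bar R})
    (f : R * 'rV[R]_N -> R) (G : R * 'rV[R]_N -> 'rV[R]_N)
    (g u : R * 'rV[R]_N -> R)
    (hN : (2 <= N)%N)
    (hOm_bounded : bounded_set Om) (hOm_open : open Om)
    (hT : 0 < T)
    (hp : (2 * N%:R + 1) / (N%:R + 1) < p)
    (ha : structure_assumptions Om T p a alpha beta b)
    (hu0 : Lq (lebesgue_rV N) Om 1%E u0)
    (hmu : cap_decomposition Om T p mu mu0 mus)
    (hf : Lq (lebesgue_prod (lebesgue_rV N)) (cylinder Om T) 1%E f)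
    (hG : in_Lq_vec Om T (conjugate p)%:E G)
    (hg : in_LpX Om T (W10 Om p) p%:E g)
    (hg_bounded : Lq (lebesgue_prod (lebesgue_rV N)) (cylinder Om T) +oo%E g)
    (hfGg : represents Om T mu0 f G g)
    (hu : renormalized_solution Om T p a u0 mu0 mus u)
    (hu_ge0 : {ae lebesgue_prod (lebesgue_rV N),
      forall z, cylinder Om T z -> 0 <= u z}) :
  forall A : set (R * 'rV[R]_N), measurable A -> (0 <= mus A)%E.
Proof.
have oQ : open (cylinder Om T) := open_cylinder hOm_open.
have mQ : measurable (cylinder Om T) := open_measurable_E oQ.
have [ma ca [alpha0 beta0] bLq astr] := ha.
have [mu_ [f' [G' [g' [dec /= [hv _ ren_eq energies]]]]]] := hu.
have [C0 C00 gC] := Lqoo_ae_bounded hg_bounded.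
have p1 : 1 < p.
  have N1 : 1 < N%:R :> R by rewrite ltr1n.
  have N0 : 0 < N%:R + 1 :> R by lra.
  by apply: lt_trans hp; rewrite ltr_pdivlMr// mul1r; lra.
have good : {ae lebesgue_prod (lebesgue_rV N), forall z, cylinder Om T z ->
    [/\ continuous (a z), 0 <= b z, forall xi, alpha * enorm xi `^ p <= dotp (a z xi) xi,
     forall xi, enorm (a z xi) <= beta * (b z + enorm xi `^ (p - 1)) & - C0 <= u z - g z]}.
  apply: filterS (filterI (filterI ca astr) (filterI gC hu_ge0)) => z h Qz.
  have [[/(_ Qz) q1 /(_ Qz) [q2 q3]] [/(_ Qz) q4 /(_ Qz) q5]] := h.
  have neq (xi : 'rV[R]_N) : xi != xi + const_mx 1.
    apply/eqP => /rowP /(_ (Ordinal (ltnW hN))); rewrite !mxE => /eqP.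
    by rewrite -subr_eq0 opprD addrA subrr sub0r oppr_eq0 oner_eq0.
  split => //.
  - by move=> xi; have [] := q3 _ _ (neq xi).
  - by move=> xi; have [] := q3 _ _ (neq xi).
  - by move: q4; rewrite ler_norml => /andP[]; lra.
have [Z [mZ Z0 hZ]] := ae_null_set good.
set M := Rintegral (neg_part mus) (cylinder Om T) (cst 1).
have lim1 : (fun k => energy_mean Om T a u (u - g') (cst 1) k `]- (2 * k)%:R, - k%:R]) @ \oo --> M.
  by apply: (energies (cst 1) _).2; apply: continuous_subspaceT => x; exact: cvg_cst.
have ME : M = fine (neg_part mus (cylinder Om T)) by rewrite /M Rintegral_cst// mul1r.
have neg_fin := neg_part_fin mus mQ.
(* if the limit M of the energies is 0, there is nothing to prove; otherwise the
   energies are eventually nonzero, which makes them integrals of integrable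
   functions *)
have neg0 : neg_part mus (cylinder Om T) = 0%E.
  have [M0|M0] := eqVneq M 0; first by rewrite -(fineK neg_fin) -ME M0.
  have nonzero : ~ {ae lebesgue_prod (lebesgue_rV N), forall z, cylinder Om T z ->
      dotp (a z (xgrad Om T u z)) (xgrad Om T (u - g') z) = 0}.
    move=> h; move/eqP: M0; apply; apply: (cvg_unique _ lim1); first exact: norm_hausdorff.
    rewrite (_ : (fun k => _) = cst 0); first exact: cvg_cst.
    by apply/funext => k; exact: energy_mean0.
  (* a weak gradient that does not exist is 0 by convention *)
  have grad_exists w : xgrad Om T w <> (fun=> 0) -> is_xgrad Om T w (xgrad Om T w).
    move=> h; have [[F hF]|nF] := pselect (exists F, is_xgrad Om T w F); first exact: xgradP hF.
    by exfalso; apply: h; rewrite /xgrad xgetPN// => F hF; apply: nF; exists F.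
  have hV : is_xgrad Om T (u - g') (xgrad Om T (u - g')).
    apply: grad_exists => V0; apply: nonzero; apply: aeW => z _; rewrite V0 /dotp big1// => i _.
    by rewrite mxE mulr0.
  (* here the coercivity and the continuity of a give a(z, 0) = 0 *)
  have hU : is_xgrad Om T u (xgrad Om T u).
    apply: grad_exists => U0; apply: nonzero; exists Z; split => // z /= hz; apply: contrapT => Nz.
    apply: hz => Qz; have [ac _ h _ _] := hZ z Nz Qz.
    rewrite U0 (coercive_zero (ltW alpha0) ac h) /dotp big1// => i _; by rewrite mxE mul0r.
  have [Ct [Ce [Ct0 Ce0 hCe]]] := energy_pointwise N p1 alpha0 beta0.
  apply: null_of_test_functions => // phi tphi phi0.
  have lim_phi := (energies phi (continuous_subspaceT (smooth_continuous (proj1 (test_csmooth tphi))))).2.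
  apply: (energy_le0 hOm_open hOm_bounded hT hp alpha0 beta0 bLq hf hG hg hfGg dec _ hU hV mZ Z0 C00 _ ma
    Ct0 Ce0 hCe ren_eq M0 lim1 tphi phi0 lim_phi).
  - by move=> r r1 rp; have [] := hv r r1 rp.
  - by move=> z Qz Nz; exact: hZ.
have mus_ge0 B : measurable B -> B `<=` cylinder Om T -> (0 <= mus B)%E.
  move=> mB BQ; have B0 : neg_part mus B = 0%E.
    by apply/eqP; rewrite eq_le measure_ge0 andbT -neg0; apply: le_measure; rewrite ?inE.
  have -> : mus B = (pos_part mus B - neg_part mus B)%E.
    by rewrite (jordan_decomp (hahn_pos_neg mus) mB) /cadd /= cscaleN1.
  by rewrite B0 sube0 measure_ge0.
move=> A mA; have [_ _ [E [mE EQ _ cE]] _] := hmu.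
rewrite (chargeDI mus mA mQ) (cE (A `\` cylinder Om T)) ?add0e; last 2 first.
- exact: measurableD.
- by apply/seteqP; split => // z [[_ nQz] Ez]; case: nQz; exact: EQ.
by apply: mus_ge0; [exact: measurableI|exact: subIsetr].
Qed.
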